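(* Let $X$ be a compact Kähler manifold of dimension $n$ with Kähler form $\omega$, let $V_\omega=\int_X\omega^n$, and let $dV_X$ be a smooth probability measure on $X$. For a smooth function $f>0$ on $X$ with $\int_X f\,dV_X=1$, consider the complex Monge-Ampère equation $$\frac{1}{V_\omega}(\omega+dd^c\varphi)^n=f\,dV_X. \qquad (\ast_f)$$ Fix $p>n$. Assume that for every $K>0$ there is a constant $C(K)$ such that $\mathrm{Osc}_X(\varphi)\le C(K)$ for every smooth $f>0$ with $\int_X f\,dV_X=1$ and $\|f\|_p\le K$, and every smooth solution $\varphi$ of $(\ast_f)$. Then for every weight $w$ satisfying Condition (K) and every $K>0$ there is a constant $C'(K)$ such that $\mathrm{Osc}_X(\varphi)\le C'(K)$ for every smooth $f>0$ with $\int_X f\,dV_X=1$ and $\|f\|_w\le K$, and every smooth solution $\varphi$ of $(\ast_f)$.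
   Context: Manifolds are connected. A smooth probability measure on $X$ is a smooth (positive) volume form of total mass $1$. $d^c$ is the usual real operator, normalized so that $dd^c$ is a fixed positive multiple of $i\partial\bar\partial$. $\mathrm{Osc}_X(\varphi)=\sup_X\varphi-\inf_X\varphi$. $\|f\|_p$ is the $L^p$-norm of $f$ with respect to $dV_X$. Condition (K): a weight $w:\mathbb{R}^+\to\mathbb{R}^+$ satisfies Condition (K) if it is convex increasing and there exists an increasing (positive) function $h$ such that, as $t\to+\infty$, $$w(t)\sim t(\log t)^n\,\big(h(\log\log t)\big)^n\quad\text{and}\quad \int^{+\infty}\frac{dt}{h(t)}<+\infty$$ (here $n=\dim_{\mathbb{C}}X$; the integral is required to converge at $+\infty$). Luxembourg norm of $f$ with respect to $w$: $$\|f\|_w=\inf\Big\{r>0:\ \int_X w\Big(\frac{|f|}{r}\Big)\,dV_X<w(1)\Big\}.$$ *)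

(* Defs.v *)
From HB Require Import structures.
From mathcomp Require Import all_boot all_order all_algebra all_fingroup.
From mathcomp Require Import complex.
From mathcomp Require Import all_classical all_reals all_analysis.

Set Implicit Arguments.
Unset Strict Implicit.
Unset Printing Implicit Defensive.

Import Order.TTheory GRing.Theory Num.Theory numFieldNormedType.Exports.

Local Open Scope classical_set_scope.
Local Open Scope ring_scope.
Local Open Scope complex_scope.

(* The usual topology and norm of C, those of any numFieldType. *)
HB.instance Definition _ (R : realType) := NormedModule.copy R[i] R[i]^o.

Section LocalCalculus.
Variables (R : realType) (n : nat).
Local Notation Cn := 'rV[R[i]]_n.

(* The real directional derivative: t ranges over R, not over R[i]. *)
Definition rderive (f : Cn -> R) (v z : Cn) : R :=
  derive1 (fun t : R => f (z + t%:C *: v)) 0.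

(* Real C^oo regularity on an open set D: all iterated directional derivatives
   exist and are continuous on D. *)
Definition smooth_on (D : set Cn) (f : Cn -> R) : Prop :=
  forall (vs : seq Cn) (z : Cn), D z ->
    let g := foldr (fun v h => rderive h v) f vs in
    continuous_at z g /\
    forall v : Cn, derivable (fun t : R => g (z + t%:C *: v)) 0 1.

(* A field of real bilinear forms on the tangent spaces (all identified with
   Cn): a z v w is the value at z on the real tangent vectors v and w.  The
   complex structure J of the tangent space is multiplication by 'i. *)
Definition form2 := Cn -> Cn -> Cn -> R.

(* d a = 0, where, v1, v2, v3 being constant vector fields,
   (d a)(v1, v2, v3) = v1 a(v2, v3) - v2 a(v1, v3) + v3 a(v1, v2). *)
Definition closed_form_on (D : set Cn) (a : form2) : Prop :=
  forall z, D z -> forall v1 v2 v3 : Cn,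
    rderive (fun x => a x v2 v3) v1 z - rderive (fun x => a x v1 v3) v2 z
    + rderive (fun x => a x v1 v2) v3 z = 0.

(* d^c f = - kappa (d f \o J).  Then dd^c = 2 kappa i \partial \bar\partial, so
   kappa > 0 parametrizes the possible normalizations of d^c. *)
Definition dc (kappa : R) (f : Cn -> R) (z v : Cn) : R :=
  - kappa * rderive f ('i *: v) z.

Definition ddc (kappa : R) (f : Cn -> R) : form2 := fun z v w =>
  rderive (fun x => dc kappa f x w) v z - rderive (fun x => dc kappa f x v) w z.

Definition real_basis (k : 'I_n * bool) : Cn :=
  if k.2 then 'i *: delta_mx 0 k.1 else delta_mx 0 k.1.

(* The coefficient of a^n = a /\ ... /\ a on dx_1 /\ dy_1 /\ ... /\ dx_n /\ dy_n:
   a^n (v_1, ..., v_2n)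
     = 2^-n \sum_s sgn(s) \prod_k a(v_(s (2k-1)), v_(s (2k))),
   evaluated on the basis (e_1, 'i e_1, ..., e_n, 'i e_n), whose members are
   indexed by 'I_n * bool. *)
Definition wedge_top (a : Cn -> Cn -> R) : R :=
  (2 ^+ n)^-1 * \sum_(s : {perm 'I_n * bool})
    (-1) ^+ s * \prod_(k < n)
      a (real_basis (s (k, false))) (real_basis (s (k, true))).

End LocalCalculus.

(* Integral over C^n against dx_1 dy_1 ... dx_n dy_n, as an iterated integral;
   by Tonelli it is the Lebesgue integral for nonnegative Borel functions, the
   only ones it is used for. *)
Fixpoint Cn_integral (R : realType) (n : nat) :
    ('rV[R[i]]_n -> \bar R) -> \bar R :=
  match n with
  | 0 => fun g => g 0
  | m.+1 => fun g =>
      (\int[@lebesgue_measure R]_x \int[@lebesgue_measure R]_y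
         Cn_integral (fun z : 'rV[R[i]]_m =>
           g (row_mx ((x +i* y)%:M : 'rV[R[i]]_1) z)))%E
  end.

(* A connected complex manifold structure of dimension n on X, given by a
   holomorphic atlas.  The chart phi i and its inverse psi i are only meaningful
   on dom i and on phi i @` dom i; `differentiable` is over the field R[i],
   i.e. holomorphy. *)
Record complex_manifold (R : realType) (n : nat) (X : ptopologicalType) :=
  ComplexManifold {
  idx : Type;
  dom : idx -> set X;
  phi : idx -> X -> 'rV[R[i]]_n;
  psi : idx -> 'rV[R[i]]_n -> X;
  mfd_hausdorff : hausdorff_space X;
  mfd_second_countable : @second_countable X;
  mfd_connected : connected [set: X];
  dom_open : forall i, open (dom i);
  dom_cover : forall x, exists i, dom i x;
  img_open : forall i, open (phi i @` dom i);
  phiK : forall i x, dom i x -> psi i (phi i x) = x;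
  phi_continuous : forall i x, dom i x -> continuous_at x (phi i);
  psi_continuous :
    forall i z, (phi i @` dom i) z -> continuous_at z (psi i);
  transition_holomorphic : forall i j z, (phi i @` (dom i `&` dom j)) z ->
    differentiable (phi j \o psi i) z
}.

Section ManifoldNotions.
Variables (R : realType) (n : nat) (X : ptopologicalType).
Variable M : complex_manifold R n X.
Local Notation Cn := 'rV[R[i]]_n.
Local Notation BX := (g_sigma_algebraType (@open X)).

Definition img (i : idx M) : set Cn := phi i @` dom i.

Definition smooth (f : X -> R) : Prop :=
  forall i : idx M, smooth_on (img i) (f \o psi i).

(* The measure m is given in each chart i by
   tau i dx_1 /\ dy_1 /\ ... /\ dx_n /\ dy_n. *)
Definition has_density (m : set BX -> \bar R) (tau : idx M -> Cn -> R) : Prop :=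
  forall (i : idx M) (A : set BX), measurable A -> A `<=` dom i ->
    m A = Cn_integral (fun z => (\1_(phi i @` A) z * tau i z)%:E).

(* The transformation law of the coefficients svm_coef under a change of charts
   follows from svm_density. *)
Record smooth_probability := SmoothProbability {
  svm :> probability BX R;
  svm_coef : idx M -> Cn -> R;
  svm_smooth : forall i, smooth_on (img i) (svm_coef i);
  svm_gt0 : forall i z, img i z -> 0 < svm_coef i z;
  svm_density : has_density svm svm_coef
}.

(* A Kähler form, through its expressions in the charts: a smooth closed real
   2-form which is of type (1,1) (i.e. J-invariant) and positive. *)
Record kahler_form := KahlerForm {
  kf : idx M -> form2 R n;
  kf_linear : forall i z, img i z -> forall (a : R) (u v w : Cn),
    kf i z (a%:C *: u + v) w = a * kf i z u w + kf i z v w;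
  kf_antisym : forall i z, img i z -> forall v w, kf i z v w = - kf i z w v;
  kf_smooth : forall i v w, smooth_on (img i) (fun z => kf i z v w);
  kf_transition : forall i j z, (phi i @` (dom i `&` dom j)) z ->
    forall v w : Cn, let F := phi j \o psi i in
    kf i z v w = kf j (F z) ('d F z v) ('d F z w);
  kf_closed : forall i, closed_form_on (img i) (kf i);
  kf_J : forall i z, img i z ->
    forall v w, kf i z ('i *: v) ('i *: w) = kf i z v w;
  kf_pos : forall i z, img i z -> forall v, v != 0 -> 0 < kf i z v ('i *: v)
}.

(* \int_X omega^n, the total mass of the measure given by the volume form
   omega^n. *)
Definition kahler_volume (omega : kahler_form) : R :=
  fine (xget 0%E [set v | exists2 m : {measure set BX -> \bar R},
    has_density m (fun i z => wedge_top (kf omega i z)) & v = m setT]).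

(* V_omega^-1 (omega + dd^c u)^n = f dV, as an equality of top-degree forms. *)
Definition monge_ampere (kappa : R) (omega : kahler_form)
    (dV : smooth_probability) (f u : X -> R) : Prop :=
  forall (i : idx M) (z : Cn), img i z ->
    (kahler_volume omega)^-1 *
      wedge_top (fun v w => kf omega i z v w + ddc kappa (u \o psi i) z v w)
    = f (psi i z) * svm_coef dV i z.

Definition smooth_positive_density (dV : smooth_probability) (f : X -> R) :
    Prop :=
  [/\ smooth f, (forall x, 0 < f x) & (\int[dV]_x (f x)%:E = 1)%E].

Definition osc (u : X -> R) : R := sup (range u) - inf (range u).

(* The infimum is taken in [0, +oo]; it is +oo if no r is admissible. *)
Definition luxembourg_norm (dV : smooth_probability) (w : R -> R)
    (f : X -> R) : \bar R :=
  ereal_inf [set r%:E | r in [set r : R |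
    0 < r /\ (\int[dV]_x (w (`|f x| / r))%:E < (w 1)%:E)%E]].

End ManifoldNotions.

(* R^+ is [0, +oo[, and functions R^+ -> R^+ are represented by functions R -> R
   whose values outside R^+ are irrelevant; "increasing" is understood in the
   wide sense. *)
Definition conditionK (R : realType) (n : nat) (w : R -> R) : Prop :=
  [/\ forall t, 0 <= t -> 0 <= w t,
      convex_function (`[0, +oo[%classic : set R) w,
      (forall s t, 0 <= s -> s <= t -> w s <= w t)
    & exists h : R -> R,
      [/\ forall t, 0 <= t -> 0 < h t,
          (forall s t, 0 <= s -> s <= t -> h s <= h t),
          w t / (t * ln t ^+ n * h (ln (ln t)) ^+ n) @[t --> +oo%R] --> (1 : R)
        & exists2 a : R, 0 <= a &
          (\int[@lebesgue_measure R]_(t in `[a, +oo[) ((h t)^-1)%:E < +oo)%E]].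

(* Main.v *)
(** Normalize [max u = 0].  At a minimum point of [u] the form [omega + dd^c u]
    is positive, and by the equation its top power vanishes nowhere, so by
    connectedness it is positive everywhere: [u] is quasi-plurisubharmonic.  The
    submean inequality, propagated from chart to chart, then bounds [u] in L^1.

    Near a minimum point [x0], with minimum [m], put [v = u + delta |z - x0|^2],
    [U(s) = {v < m + s}], and let [M(s)] be the mass of [(omega + dd^c u)^n] on
    [U(s)].  Comparing [v] with the poles [lam log(|z - a|^2 + r^2)], in the spirit
    of the Bedford-Taylor comparison principle, shows that
    [M(s) <= al^n] forces [U(s - t)] to have density at most 1/2 at the scale
    [r = exp(-c t / al)] around each of its points.  Since [grad v] is bounded in
    L^1 on the sublevel sets, a translation argument upgrades this to
    [|U(s - 3t)| <= (C / t) exp(-c t / al)], while the bound on the Luxembourg norm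
    gives [M(s) <= C T |U(s)| + C / (log T h(log log T))^n] for all large [T].
    Alternating the two estimates with [al_k ~ exp(-2k)], [log T_k ~ exp(k)] and
    [t_k ~ exp(-k) + 1 / h(k)], which is summable as [1 / h] is integrable, would
    give [M = 0] at a positive level unless [M] is bounded below at the initial
    level.  As [u] is bounded in L^1, that level set has measure [O(1 / |m|)], hence
    small mass when [|m|] is large; so [m] is bounded below. *)

Require Import Defs.
From HB Require Import structures.
From mathcomp Require Import all_boot all_order all_algebra all_fingroup.
From mathcomp Require Import complex.
From mathcomp Require Import all_classical all_reals all_analysis.
From mathcomp Require Import measurable_realfun sesquilinear spectral.
From mathcomp Require Import ring lra.

Set Implicit Arguments.
Unset Strict Implicit.
Unset Printing Implicit Defensive.

Import Order.TTheory GRing.Theory Num.Theory numFieldNormedType.Exports.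

Local Open Scope classical_set_scope.
Local Open Scope ring_scope.
Local Open Scope complex_scope.

(** * Directional calculus *)

Section Coordinates.
Variables (R : realType) (n : nat).
Local Notation Cn := 'rV[R[i]]_n.

(** All estimates are made in charts and on smooth functions; neither local potentials of [omega]
    nor weak Monge-Ampere measures occur. A maximum of potentials is replaced by the addition to [u]
    of a smooth convex function of [v - lam log], and the comparison principle by the fact that the
    top power of a closed form keeps its integral when a compactly supported exact form is added.
    The term [delta |z - x0|^2] confines low sublevel sets to a small box, and the strict positivity
    of [omega] pays for its dd^c.

    The shape of Condition (K) comes from one balance. The volume estimate has exponent [c t / al],
    so [log T] may be half of it; the Orlicz term is then below [al^n], up to constants, once
    [(t / al) h(log log T) >= C / al]. Here [al] cancels, and [t >= C / h(log log T)] remains;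
    [log log T >= k] turns it into [C / h(k)].

    Transition maps are only known to be complex differentiable at each point, so the invariance of
    dd^c cannot come from the chain rule, and the measures of the statement are given by iterated
    integrals: hence the space taken by calculus and by Lebesgue measure. *)

Definition crd (b : 'I_n * bool) (z : Cn) : R :=
  if b.2 then complex.Im (z 0 b.1) else complex.Re (z 0 b.1).

Lemma crdD b (z w : Cn) : crd b (z + w) = crd b z + crd b w.
Proof. by rewrite /crd !mxE; case: b.2; case: (z 0 b.1) => ? ?; case: (w 0 b.1). Qed.

Lemma crdN b (z : Cn) : crd b (- z) = - crd b z.
Proof. by rewrite /crd !mxE; case: b.2; case: (z 0 b.1) => ? ?. Qed.

Lemma crdB b (z w : Cn) : crd b (z - w) = crd b z - crd b w.
Proof. by rewrite crdD crdN. Qed.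

Lemma crd0 b : crd b 0 = 0.
Proof. by rewrite -(subrr 0) crdB subrr. Qed.

Lemma crdZ b (t : R) (z : Cn) : crd b (t%:C *: z) = t * crd b z.
Proof.
rewrite /crd !mxE; case: b.2; case: (z 0 b.1) => x y /=.
  by rewrite mul0r addr0.
by rewrite mul0r subr0.
Qed.

Lemma crd_sum b I r (P : pred I) (F : I -> Cn) :
  crd b (\sum_(i <- r | P i) F i) = \sum_(i <- r | P i) crd b (F i).
Proof. by apply: (big_morph _ (crdD b)); exact: crd0. Qed.

Lemma crd_iF k (z : Cn) : crd (k, false) ('i *: z) = - crd (k, true) z.
Proof. by rewrite /crd /= !mxE; case: (z 0 k) => x y /=; rewrite mul0r mul1r sub0r. Qed.

Lemma crd_iT k (z : Cn) : crd (k, true) ('i *: z) = crd (k, false) z.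
Proof. by rewrite /crd /= !mxE; case: (z 0 k) => x y /=; rewrite mul0r mul1r add0r. Qed.

Lemma crd_ext (z w : Cn) : (forall b, crd b z = crd b w) -> z = w.
Proof.
move=> h; apply/rowP => k.
have := h (k, false); have := h (k, true); rewrite /crd /=.
by case: (z 0 k) => ? ?; case: (w 0 k) => ? ? /= -> ->.
Qed.

Lemma crd_basis b c : crd b (@real_basis R n c) = (b == c)%:R.
Proof.
case: b c => [k [] ] [l [] ]; rewrite /crd /real_basis /= ?mxE /= ?xpair_eqE /=;
case: (k == l) => //=; rewrite ?mul0r ?mul1r ?mulr0 ?mulr1 ?add0r ?addr0 ?subr0 ?oppr0 //.
Qed.

Lemma crd_expand (z : Cn) : z = \sum_b (crd b z)%:C *: real_basis R b.
Proof.
apply: crd_ext => b; rewrite crd_sum (bigD1 b) //= crdZ crd_basis eqxx mulr1.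
rewrite big1 ?addr0 // => c cb; rewrite crdZ crd_basis eq_sym.
by rewrite (negbTE cb) mulr0.
Qed.

Definition nsq (z : Cn) : R := \sum_b crd b z ^+ 2.

Lemma crd_nsq b (z : Cn) : crd b z ^+ 2 <= nsq z.
Proof. by rewrite /nsq (bigD1 b) //= lerDl sumr_ge0 // => c _; exact: sqr_ge0. Qed.

Lemma nsq_ge0 (z : Cn) : 0 <= nsq z.
Proof. by apply: sumr_ge0 => b _; exact: sqr_ge0. Qed.

Lemma nsq_eq0 (z : Cn) : nsq z = 0 -> z = 0.
Proof.
move=> h; apply: crd_ext => b; rewrite crd0; apply/eqP; rewrite -sqrf_eq0.
by rewrite eq_le sqr_ge0 andbT -h crd_nsq.
Qed.

Lemma nsq_gt0 (z : Cn) : z != 0 -> 0 < nsq z.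
Proof. by move=> z0; rewrite lt_def nsq_ge0 andbT; apply: contraNN z0 => /eqP/nsq_eq0 ->. Qed.

Lemma sum_pair_bool (F : 'I_n * bool -> R) :
  \sum_b F b = \sum_k (F (k, false) + F (k, true)).
Proof.
rewrite (eq_bigr (fun b => F (b.1, b.2))); last by case.
rewrite -(pair_big xpredT xpredT (fun k b => F (k, b))) /=.
by apply: eq_bigr => k _; rewrite big_bool /= addrC.
Qed.

Lemma nsq_i (z : Cn) : nsq ('i *: z) = nsq z.
Proof.
rewrite /nsq !sum_pair_bool; apply: eq_bigr => k _.
by rewrite crd_iF crd_iT sqrrN addrC.
Qed.

Lemma nsqZ (t : R) (z : Cn) : nsq (t%:C *: z) = t ^+ 2 * nsq z.
Proof. by rewrite /nsq mulr_sumr; apply: eq_bigr => b _; rewrite crdZ exprMn. Qed.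

(** Cubes in the [2 n] real coordinates rather than balls: being products, they have a Lebesgue
    volume computed one coordinate at a time. *)
Definition box (a : Cn) (r : R) : set Cn :=
  [set z | forall b, `|crd b z - crd b a| < r].

Lemma nbhs_boxP (z : Cn) (A : set Cn) :
  nbhs z A <-> exists2 e : R, 0 < e & box z e `<=` A.
Proof.
split.
  move=> /nbhs_ballP [e /= e0 hA].
  have [e1 e10] : exists2 e1, 0 < e1 & e = e1%:C.
    move: e0; rewrite ltcE /= => /andP[/eqP h1 h2]; exists (complex.Re e) => //.
    by case: e h1 h2 hA => a b /= -> .
  move=> eE; exists (e1 / 2); first by rewrite divr_gt0.
  move=> w hw; apply: hA; split=> // i k; rewrite ord1 /= /ball /= eE.
  have hF := hw (k, false); have hT := hw (k, true).
  rewrite /crd /= in hF hT.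
  rewrite normc_def ltcR; case: (z 0 k) (w 0 k) hF hT => x y [x' y'] /= hF hT.
  rewrite -(@ltr_pXn2r _ 2) // ?nnegrE ?sqrtr_ge0 ?(ltW e10) //.
  rewrite sqr_sqrtr ?addr_ge0 ?sqr_ge0 //.
  rewrite distrC in hF; rewrite distrC in hT.
  have : `|x - x'| ^+ 2 < (e1 / 2) ^+ 2 by rewrite ltr_pXn2r // ?nnegrE // divr_ge0 // ltW.
  have : `|y - y'| ^+ 2 < (e1 / 2) ^+ 2 by rewrite ltr_pXn2r // ?nnegrE // divr_ge0 // ltW.
  rewrite !real_normK ?num_real //; nra.
case=> e e0 hA; apply/nbhs_ballP; exists (e%:C) => /=; first by rewrite ltcR.
move=> w hw; apply: hA => -[k b].
have := hw.2 0 k; rewrite /ball /= normc_def ltcR.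
rewrite /crd /=; case: (z 0 k) (w 0 k) => x y [x' y'] /= h.
case: b => /=; apply: le_lt_trans h; rewrite distrC -sqrtr_sqr ler_wsqrtr //.
  by rewrite lerDr sqr_ge0.
by rewrite lerDl sqr_ge0.
Qed.

Lemma box_center a r : 0 < r -> box a r a.
Proof. by move=> r0 b; rewrite subrr normr0. Qed.

Lemma open_box a r : open (box a r).
Proof.
rewrite openE => z hz; apply/nbhs_boxP.
exists (\big[Order.min/1]_b (r - `|crd b z - crd b a|)).
  by rewrite lt_bigmin ?ltr01 //= => b _; rewrite subr_gt0.
move=> w hw b; have := hw b; rewrite (bigD1 b) //= lt_min => /andP[h _].
have := ler_normD (crd b w - crd b z) (crd b z - crd b a).
rewrite subrKA; lra.
Qed.

Lemma continuous_boxP (f : Cn -> R) z :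
  {for z, continuous f} <->
  forall e : R, 0 < e ->
    exists2 d : R, 0 < d & forall w, box z d w -> `|f w - f z| < e.
Proof.
split=> [h e e0|h].
  by move: h => /cvgrPdistC_lt /(_ e e0) /nbhs_boxP[d d0 hd]; exists d.
move=> A /nbhs_ballP[e /= e0 hA]; apply/nbhs_boxP.
have [d d0 hd] := h e e0; exists d => // w hw; apply: hA.
by rewrite /ball /= distrC; exact: hd.
Qed.

Lemma continuous_crd b : continuous (crd b).
Proof. by move=> z; apply/continuous_boxP => e e0; exists e => // w; apply. Qed.

Lemma continuous_ray (z v : Cn) : continuous (fun t : R => z + t%:C *: v).
Proof.
move=> t A /nbhs_boxP[e e0 hA].
have [M M0 hM] : exists2 M, 0 < M & forall b, `|crd b v| < M.
  exists (1 + \sum_b `|crd b v|); first by rewrite ltr_pwDl // sumr_ge0.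
  move=> b; rewrite (bigD1 b) //= addrCA ltrDl ltr_pwDl // sumr_ge0 //.
apply/nbhs_ballP; exists (e / M); first by rewrite /= divr_gt0.
move=> s /= hs; apply: hA => b; rewrite !crdD !crdZ opprD addrACA subrr add0r -mulrBl normrM.
have : `|s - t| < e / M by rewrite distrC.
rewrite ltr_pdivlMr // => h2; apply: le_lt_trans h2.
by rewrite ler_wpM2l // ltW.
Qed.

End Coordinates.

Section DirectionalCalculus.
Variables (R : realType) (n : nat).
Local Notation Cn := 'rV[R[i]]_n.
Implicit Types (f g : Cn -> R) (D : set Cn) (z v w : Cn).

Definition dir_derivable f v z := derivable (fun t : R => f (z + t%:C *: v)) 0 1.

Lemma eq_rderive f g v z : f =1 g -> rderive f v z = rderive g v z.
Proof. by move/funext ->. Qed.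

Lemma dir_derivableP f v z : dir_derivable f v z ->
  is_derive (0 : R) 1 (fun t : R => f (z + t%:C *: v)) (rderive f v z).
Proof. by move=> h; rewrite /rderive derive1E; exact: (DeriveDef h erefl). Qed.

Lemma is_derive_dir f v z d :
  is_derive (0 : R) 1 (fun t : R => f (z + t%:C *: v)) d ->
  dir_derivable f v z /\ rderive f v z = d.
Proof.
move=> h; split; first exact: (@ex_derive _ _ _ _ _ _ _ h).
by rewrite /rderive derive1E; exact: (@derive_val _ _ _ _ _ _ _ h).
Qed.

Lemma is_derive_ray f v z (t : R) : dir_derivable f v (z + t%:C *: v) ->
  is_derive t 1 (fun t : R => f (z + t%:C *: v)) (rderive f v (z + t%:C *: v)).
Proof.
move=> /dir_derivableP h.
have -> : (fun s : R => f (z + s%:C *: v)) =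
   (fun s : R => f (z + t%:C *: v + s%:C *: v)) \o (fun s => s - t).
  by apply/funext => s /=; rewrite -addrA -scalerDl -rmorphD /= addrCA subrr addr0.
rewrite -[rderive _ _ _]mulr1; apply: is_derive1_comp; first by rewrite subrr.
by rewrite -[X in is_derive _ _ _ X](subr0 (1 : R)); apply: is_deriveB.
Qed.

Lemma near_ray D z v : open D -> D z ->
  \forall t \near (0 : R), D (z + t%:C *: v).
Proof.
move=> oD Dz; have := @continuous_ray R n z v 0.
rewrite /continuous_at (_ : z + 0%:C *: v = z); last by rewrite (_ : 0%:C = 0) // scale0r addr0.
by move=> h; apply: h; move: oD; rewrite openE; exact.
Qed.

Lemma rderive_ext D f g v z : open D -> {in D, f =1 g} -> D z ->
  dir_derivable f v z ->
  dir_derivable g v z /\ rderive g v z = rderive f v z.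
Proof.
move=> oD fg Dz /dir_derivableP h; apply: is_derive_dir.
have nr := near_ray v oD Dz.
move: h; apply: near_eq_is_derive.
by apply: filterS nr => t Dt; rewrite fg ?inE.
Qed.

(** Finite order counterpart of [smooth_on], since the cutoffs and spline compositions used below
    have only two or three derivatives. All directions [v] are allowed at each stage; linearity in
    [v] is a theorem for C^1 functions and not part of the definition. *)
Fixpoint Ck (k : nat) D f : Prop :=
  (forall z, D z -> {for z, continuous f}) /\
  match k with
  | 0%N => True
  | k.+1 => forall v, (forall z, D z -> dir_derivable f v z) /\ Ck k D (rderive f v)
  end.

Lemma Ck_cont k D f : Ck k D f -> forall z, D z -> {for z, continuous f}.
Proof. by case: k => [|k] []. Qed.

Lemma Ck_der k D f v z : Ck k.+1 D f -> D z -> dir_derivable f v z.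
Proof. by case=> _ /(_ v)[h _]; exact: h. Qed.

Lemma Ck_rderive k D f v : Ck k.+1 D f -> Ck k D (rderive f v).
Proof. by case=> _ /(_ v)[_]. Qed.

Lemma Ck_pred k D f : Ck k.+1 D f -> Ck k D f.
Proof.
elim: k f => [|k IH] f [hc hd]; first by split.
by split=> // v; have [h1 h2] := hd v; split=> //; exact: IH.
Qed.

Lemma Ck_le k l D f : (l <= k)%N -> Ck k D f -> Ck l D f.
Proof.
elim: k => [|k IH]; first by rewrite leqn0 => /eqP ->.
rewrite leq_eqVlt => /orP[/eqP -> //|]; rewrite ltnS => lk /Ck_pred; exact: IH.
Qed.

Lemma Ck_sub k D E f : E `<=` D -> Ck k D f -> Ck k E f.
Proof.
move=> ED; elim: k f => [|k IH] f [hc hd]; first by split=> // z /ED; exact: hc.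
split=> [z /ED|v]; first exact: hc.
by have [h1 h2] := hd v; split=> [z /ED|]; [exact: h1|exact: IH].
Qed.

Lemma continuous_ext D f g z : open D -> {in D, f =1 g} -> D z ->
  {for z, continuous f} -> {for z, continuous g}.
Proof.
move=> oD fg Dz /continuous_boxP h; apply/continuous_boxP => e e0.
have : nbhs z D by move: oD; rewrite openE; exact.
move=> /nbhs_boxP[d1 d10 h1]; have [d2 d20 h2] := h e e0.
exists (Num.min d1 d2) => [|w hw]; first by rewrite lt_min d10.
have Dw : D w by apply: h1 => b; apply: lt_le_trans (hw b) _; rewrite ge_min lexx.
rewrite -!fg ?inE //; apply: h2 => b; apply: lt_le_trans (hw b) _.
by rewrite ge_min lexx orbT.
Qed.

Lemma Ck_ext k D f g : open D -> {in D, f =1 g} -> Ck k D f -> Ck k D g.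
Proof.
move=> oD; elim: k f g => [|k IH] f g fg [hc hd].
  by split=> // z Dz; apply: (continuous_ext oD fg Dz); exact: hc.
split=> [z Dz|v]; first by apply: (continuous_ext oD fg Dz); exact: hc.
have [h1 h2] := hd v; split=> [z Dz|].
  by have [] := rderive_ext oD fg Dz (h1 z Dz).
apply: (IH (rderive f v)) => // z; rewrite inE => Dz.
by have [] := rderive_ext oD fg Dz (h1 z Dz).
Qed.

Lemma CkU k D E f : Ck k D f -> Ck k E f -> Ck k (D `|` E) f.
Proof.
elim: k f => [|k IH] f [c1 d1] [c2 d2]; first by split=> // z [/c1|/c2].
split=> [z [/c1|/c2] //|v]; have [a1 b1] := d1 v; have [a2 b2] := d2 v.
by split=> [z [/a1|/a2] //|]; exact: IH.
Qed.

Lemma smooth_on_rderive D f v : smooth_on D f -> smooth_on D (rderive f v).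
Proof.
move=> h vs z Dz; have := h (rcons vs v) z Dz.
by rewrite -cats1 foldr_cat.
Qed.

Lemma smooth_on_Ck k D f : smooth_on D f -> Ck k D f.
Proof.
elim: k f => [|k IH] f h.
  by split=> // z Dz; have [] := h [::] z Dz.
split=> [z Dz|v]; first by have [] := h [::] z Dz.
split=> [z Dz|]; last exact/IH/smooth_on_rderive.
by have [_ /(_ v)] := h [::] z Dz.
Qed.

Lemma rderive_cst (c : R) v z :
  dir_derivable (fun=> c) v z /\ rderive (fun=> c) v z = 0.
Proof. by apply: is_derive_dir; exact: is_derive_cst. Qed.

Lemma rderiveD_def f g v z : dir_derivable f v z -> dir_derivable g v z ->
  dir_derivable (fun x => f x + g x) v z /\
  rderive (fun x => f x + g x) v z = rderive f v z + rderive g v z.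
Proof.
by move=> /dir_derivableP hf /dir_derivableP hg; apply: is_derive_dir; exact: is_deriveD.
Qed.

Lemma rderiveN_def f v z : dir_derivable f v z ->
  dir_derivable (fun x => - f x) v z /\
  rderive (fun x => - f x) v z = - rderive f v z.
Proof. by move=> /dir_derivableP hf; apply: is_derive_dir; exact: is_deriveN. Qed.

Lemma rderiveM_def f g v z : dir_derivable f v z -> dir_derivable g v z ->
  dir_derivable (fun x => f x * g x) v z /\
  rderive (fun x => f x * g x) v z = f z * rderive g v z + rderive f v z * g z.
Proof.
move=> /dir_derivableP hf /dir_derivableP hg; apply: is_derive_dir.
apply: (is_derive_eq (is_deriveM hf hg)).
rewrite (_ : z + 0%:C *: v = z); last by rewrite (_ : 0%:C = 0) // scale0r addr0.
by rewrite /GRing.scale /= [X in _ + X]mulrC.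
Qed.

Lemma rderive_comp_def (h : R -> R) f v z : dir_derivable f v z ->
  derivable h (f z) 1 ->
  dir_derivable (h \o f) v z /\ rderive (h \o f) v z = derive1 h (f z) * rderive f v z.
Proof.
move=> /dir_derivableP hf hh; apply: is_derive_dir.
apply: (is_derive1_comp (f := h)) => //.
rewrite (_ : z + 0%:C *: v = z); last by rewrite (_ : 0%:C = 0) // scale0r addr0.
by rewrite derive1E; exact: (DeriveDef hh erefl).
Qed.

Lemma Ck_cst k D (c : R) : open D -> Ck k D (fun=> c).
Proof.
move=> oD; elim: k c => [|k IH] c; first by split=> // z _; exact: cst_continuous.
split=> [z _|v]; first exact: cst_continuous.
split=> [z _|]; first by have [] := rderive_cst c v z.
apply: (Ck_ext (f := fun=> 0)) => // z _.
by have [_ ->] := rderive_cst c v z.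
Qed.

Lemma CkD k D f g : open D -> Ck k D f -> Ck k D g -> Ck k D (fun z => f z + g z).
Proof.
move=> oD; elim: k f g => [|k IH] f g [cf df] [cg dg].
  by split=> // z Dz; apply: continuousD; [exact: cf|exact: cg].
split=> [z Dz|v]; first by apply: continuousD; [exact: cf|exact: cg].
have [hf1 hf2] := df v; have [hg1 hg2] := dg v; split=> [z Dz|].
  by have [] := rderiveD_def (hf1 z Dz) (hg1 z Dz).
apply: (Ck_ext (f := fun z => rderive f v z + rderive g v z)) => //; last exact: IH.
by move=> z; rewrite inE => Dz; have [_ ->] := rderiveD_def (hf1 z Dz) (hg1 z Dz).
Qed.

Lemma CkM k D f g : open D -> Ck k D f -> Ck k D g -> Ck k D (fun z => f z * g z).
Proof.
move=> oD; elim: k f g => [|k IH] f g [cf df] [cg dg].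
  by split=> // z Dz; apply: continuousM; [exact: cf|exact: cg].
split=> [z Dz|v]; first by apply: continuousM; [exact: cf|exact: cg].
have Kf : Ck k D f by apply: Ck_pred; split.
have Kg : Ck k D g by apply: Ck_pred; split.
have [hf1 hf2] := df v; have [hg1 hg2] := dg v; split=> [z Dz|].
  by have [] := rderiveM_def (hf1 z Dz) (hg1 z Dz).
apply: (Ck_ext (f := fun z => f z * rderive g v z + rderive f v z * g z)) => //.
  by move=> z; rewrite inE => Dz; have [_ ->] := rderiveM_def (hf1 z Dz) (hg1 z Dz).
by apply: CkD => //; exact: IH.
Qed.

Lemma CkN k D f : open D -> Ck k D f -> Ck k D (fun z => - f z).
Proof.
move=> oD hf; apply: (Ck_ext (f := fun z => (-1) * f z)) => //.
  by move=> z _; rewrite mulN1r.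
by apply: CkM => //; exact: Ck_cst.
Qed.

Lemma CkB k D f g : open D -> Ck k D f -> Ck k D g -> Ck k D (fun z => f z - g z).
Proof. by move=> oD hf hg; apply: CkD => //; exact: CkN. Qed.

Lemma Ck_sum k D I (r : seq I) (P : pred I) (F : I -> Cn -> R) : open D ->
  (forall i, P i -> Ck k D (F i)) -> Ck k D (fun z => \sum_(i <- r | P i) F i z).
Proof.
move=> oD h; elim: r => [|i r IH].
  by apply: (Ck_ext (f := fun=> 0)) => //; [move=> z _; rewrite big_nil|exact: Ck_cst].
have [Pi|nPi] := boolP (P i).
  apply: (Ck_ext (f := fun z => F i z + \sum_(j <- r | P j) F j z)) => //.
    by move=> z _; rewrite big_cons Pi.
  by apply: CkD => //; exact: h.
by apply: (Ck_ext _ _ IH) => // z _; rewrite big_cons (negbTE nPi).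
Qed.

Lemma Ck_prod k D I (r : seq I) (P : pred I) (F : I -> Cn -> R) : open D ->
  (forall i, P i -> Ck k D (F i)) -> Ck k D (fun z => \prod_(i <- r | P i) F i z).
Proof.
move=> oD h; elim: r => [|i r IH].
  by apply: (Ck_ext (f := fun=> 1)) => //; [move=> z _; rewrite big_nil|exact: Ck_cst].
have [Pi|nPi] := boolP (P i).
  apply: (Ck_ext (f := fun z => F i z * \prod_(j <- r | P j) F j z)) => //.
    by move=> z _; rewrite big_cons Pi.
  by apply: CkM => //; exact: h.
by apply: (Ck_ext _ _ IH) => // z _; rewrite big_cons (negbTE nPi).
Qed.

Lemma rderive_crd b v z :
  dir_derivable (crd b) v z /\ rderive (crd b) v z = crd b v.
Proof.
apply: is_derive_dir.
have -> : (fun t : R => crd b (z + t%:C *: v)) = (fun t : R => crd b z + t * crd b v).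
  by apply/funext => t; rewrite crdD crdZ.
rewrite -[X in is_derive _ _ _ X]add0r; apply: is_deriveD.
have -> : (fun t : R => t * crd b v) = (crd b v \*: id)%R.
  by apply/funext => t; rewrite /= mulrC.
by apply: (is_derive_eq (is_deriveZ _ _)); rewrite /GRing.scale /= mulr1.
Qed.

Lemma Ck_crd k D b : open D -> Ck k D (crd b).
Proof.
move=> oD; case: k => [|k]; first by split=> // z _; exact: continuous_crd.
split=> [z _|v]; first exact: continuous_crd.
split=> [z _|]; first by have [] := rderive_crd b v z.
apply: (Ck_ext (f := fun=> crd b v)) => //; last exact: Ck_cst.
by move=> z _; have [_ ->] := rderive_crd b v z.
Qed.

Fixpoint Cr (k : nat) (I : set R) (h : R -> R) : Prop :=
  (forall x, I x -> {for x, continuous h}) /\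
  match k with
  | 0%N => True
  | k.+1 => (forall x, I x -> derivable h x 1) /\ Cr k I (derive1 h)
  end.

Lemma Cr_pred k I h : Cr k.+1 I h -> Cr k I h.
Proof.
elim: k h => [|k IH] h [hc hd]; first by split.
by split=> //; have [h1 h2] := hd; split=> //; exact: IH.
Qed.

Lemma Ck_comp k D (I : set R) (h : R -> R) f : open D -> Cr k I h ->
  (forall z, D z -> I (f z)) -> Ck k D f -> Ck k D (h \o f).
Proof.
move=> oD; elim: k h f => [|k IH] h f [ch dh] fI [cf df].
  by split=> // z Dz; apply: continuous_comp; [exact: cf|exact/ch/fI].
split=> [z Dz|v]; first by apply: continuous_comp; [exact: cf|exact/ch/fI].
have Kf : Ck k D f by apply: Ck_pred; split.
have [hf1 hf2] := df v; have [dh1 dh2] := dh; split=> [z Dz|].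
  by have [] := rderive_comp_def (hf1 z Dz) (dh1 _ (fI z Dz)).
apply: (Ck_ext (f := fun z => (derive1 h \o f) z * rderive f v z)) => //.
  by move=> z; rewrite inE => Dz; have [_ ->] := rderive_comp_def (hf1 z Dz) (dh1 _ (fI z Dz)).
by apply: CkM => //; exact: IH.
Qed.

End DirectionalCalculus.
Arguments Ck_der {R n k D f} v [z].
Arguments Ck_rderive {R n k D f} v.

Local Opaque rderive.

(** Little-o form of the derivative at 0, in which quadratic remainders can be bounded by hand. *)
Lemma is_derive0P (R : realType) (h : R -> R) (d : R) :
  is_derive (0 : R) 1 h d <->
  (forall e : R, 0 < e -> exists2 dl : R, 0 < dl &
     forall t : R, `|t| < dl -> `|h t - h 0 - t * d| <= e * `|t|).
Proof.
split=> [[hd hv] e e0|H].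
  have : s^-1 *: ((h \o shift (0:R)) (s *: (1:R)) - h 0) @[s --> (0:R)^'] --> d.
    by rewrite -hv; exact: hd.
  move=> /cvgrPdist_le /(_ e e0) ; move=> /nbhs_ballP[dl /= dl0 hdl].
  exists dl => // t ht; have [->|t0] := eqVneq t 0.
    by rewrite subrr mul0r subr0 normr0 mulr0.
  have := hdl t; rewrite /= /ball /= sub0r normrN => /(_ ht t0).
  rewrite /GRing.scale /= mulr1 addr0 => h1.
  have -> : h t - h 0 - t * d = - (t * (d - t^-1 * (h t - h 0))).
    by rewrite mulrBr mulrA divff // mul1r opprB.
  by rewrite normrN normrM mulrC ler_wpM2r.
have cv : s^-1 *: ((h \o shift (0:R)) (s *: (1:R)) - h 0) @[s --> (0:R)^'] --> d.
  apply/cvgrPdist_le => e e0; have [dl dl0 hdl] := H e e0.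
  apply/nbhs_ballP; exists dl => //= t.
  rewrite /ball /= sub0r normrN => ht t0.
  rewrite /GRing.scale /= mulr1 addr0 -(ler_pM2r (_ : 0 < `|t|)) ?normr_gt0 //.
  rewrite -normrM mulrBl mulrAC mulVf // mul1r distrC [d * t]mulrC; exact: hdl.
by split; [apply/cvg_ex; exists d|exact: cvg_lim cv].
Qed.

Lemma ler_dist_half (R : realFieldType) (e p q r : R) :
  `|p - q| < e / 2 -> `|p - r| < e / 2 -> r <= q + e.
Proof. rewrite !ltr_distl => /andP[? ?] /andP[? ?]; lra. Qed.

Section DirectionalCalculus2.
Variables (R : realType) (n : nat).
Local Notation Cn := 'rV[R[i]]_n.
Implicit Types (f g : Cn -> R) (D : set Cn) (z v w : Cn).

Lemma ray0 z v : z + (0 : R)%:C *: v = z.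
Proof. by rewrite (_ : 0%:C = 0) // scale0r addr0. Qed.

Lemma ray1 z v : z + (1 : R)%:C *: v = z + v.
Proof. by rewrite (_ : 1%:C = 1) // scale1r. Qed.

Lemma ray_MVT f v z (h : R) : 0 < h ->
  (forall s, 0 <= s -> s <= h -> dir_derivable f v (z + s%:C *: v)) ->
  exists2 c, 0 < c < h & f (z + h%:C *: v) - f z = h * rderive f v (z + c%:C *: v).
Proof.
move=> h0 hd.
have [||c cin E] := @MVT R (fun t => f (z + t%:C *: v)) (fun t => rderive f v (z + t%:C *: v)) 0 h h0.
- move=> x; rewrite in_itv /= => /andP[x0 xh].
  by apply: is_derive_ray; apply: hd; exact: ltW.
- apply: derivable_within_continuous => x; rewrite in_itv /= => /andP[x0 xh].
  by have [] := is_derive_ray (hd x x0 xh).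
exists c; first by move: cin; rewrite in_itv.
by rewrite -[in X in _ - X](ray0 z v) E subr0 mulrC.
Qed.

Lemma rderiveZ_dir f v z (s : R) : dir_derivable f v z ->
  dir_derivable f (s%:C *: v) z /\ rderive f (s%:C *: v) z = s * rderive f v z.
Proof.
move=> /dir_derivableP h; apply: is_derive_dir.
have -> : (fun t : R => f (z + t%:C *: (s%:C *: v))) =
    (fun t : R => f (z + t%:C *: v)) \o (fun t => t * s).
  by apply/funext => t /=; rewrite scalerA -rmorphM.
rewrite mulrC; apply: is_derive1_comp; first by rewrite mul0r.
have -> : (fun t : R => t * s) = (s \*: id)%R by apply/funext => t; rewrite /= mulrC.
by apply: (is_derive_eq (is_deriveZ _ _)); rewrite /GRing.scale /= mulr1.
Qed.

Lemma box_ray2 z v w (e : R) : 0 < e -> exists2 d : R, 0 < d &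
  forall s t : R, `|s| < d -> `|t| < d -> box z e (z + s%:C *: v + t%:C *: w).
Proof.
move=> e0.
pose M := 1 + \sum_b (`|crd b v| + `|crd b w|).
have M0 : 0 < M by rewrite ltr_pwDl // sumr_ge0 // => b _; rewrite addr_ge0.
exists (e / M) => [|s t hs ht b]; first by rewrite divr_gt0.
rewrite (_ : _ - _ = s * crd b v + t * crd b w); last by rewrite !crdD !crdZ; ring.
have hM : `|crd b v| + `|crd b w| < M.
  by rewrite /M (bigD1 b) //= addrCA ltrDl ltr_pwDl // sumr_ge0.
apply: (le_lt_trans (ler_normD _ _)); rewrite !normrM.
apply: (@le_lt_trans _ _ (e / M * (`|crd b v| + `|crd b w|))).
  by rewrite mulrDr lerD // ler_wpM2r // ltW.
by rewrite -[ltRHS](@divfK _ M) ?gt_eqF // ltr_pM2l // divr_gt0.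
Qed.

Lemma open_box_sub D z : open D -> D z -> exists2 e : R, 0 < e & box z e `<=` D.
Proof. by move=> oD Dz; apply/nbhs_boxP; move: oD; rewrite openE; exact. Qed.

(** Move along [v], then along [w] from the displaced point: the first increment is controlled by
    differentiability at [z], the second by the mean value theorem and the continuity of
    [rderive f w]. *)
Lemma rderiveD_dir D f v w z : open D -> Ck 1 D f -> D z ->
  rderive f (v + w) z = rderive f v z + rderive f w z.
Proof.
move=> oD kf Dz.
have [e0 e00 he0] := open_box_sub oD Dz.
suff hh : is_derive (0 : R) 1 (fun t : R => f (z + t%:C *: (v + w)))
   (rderive f v z + rderive f w z) by have [] := is_derive_dir hh.
apply/is_derive0P => e e_gt0.
have e2 : 0 < e / 2 by rewrite divr_gt0.
have /is_derive0P /(_ _ e2)[d1 d10 h1] := dir_derivableP (Ck_der v kf Dz).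
have /continuous_boxP /(_ _ e2)[d2 d20 h2] := Ck_cont (Ck_rderive w kf) Dz.
have [|d3 d30 h3] := @box_ray2 z v w (Num.min e0 d2); first by rewrite lt_min e00.
have {}h3 s t : `|s| < d3 -> `|t| < d3 -> D (z + s%:C *: v + t%:C *: w) /\ box z d2 (z + s%:C *: v + t%:C *: w).
  move=> hs ht; have h := h3 s t hs ht; split.
    by apply: he0 => b; apply: lt_le_trans (h b) _; rewrite ge_min lexx.
  by move=> b; apply: lt_le_trans (h b) _; rewrite ge_min lexx orbT.
have inc t : `|t| < d3 -> `|f (z + t%:C *: v + t%:C *: w) - f (z + t%:C *: v) - t * rderive f w z| <= e / 2 * `|t|.
  move=> ht; have [->|t0] := eqVneq t 0.
    by rewrite !ray0 subrr mul0r subr0 normr0 mulr0.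
  have st : 0 < `|t| by rewrite normr_gt0.
  (* The mean value theorem is available for positive steps; the sign of [t] is moved into the
     direction. *)
  pose sg : R := Num.sg t; pose w' : Cn := sg%:C *: w.
  have E (c : R) : c%:C *: w' = (c * sg)%:C *: w by rewrite /w' scalerA -rmorphM.
  have sg1 : `|sg| = 1 by rewrite normr_sg t0.
  have dw c : 0 <= c -> c <= `|t| -> dir_derivable f w (z + t%:C *: v + (c * sg)%:C *: w).
    move=> c0 ct; apply: (Ck_der _ kf).
    by have [] := h3 t (c * sg) ht; rewrite // normrM sg1 mulr1 ger0_norm // (le_lt_trans ct).
  have [|c /andP[c0 ct] Ec] := @ray_MVT f w' (z + t%:C *: v) `|t| st.
    move=> c c0 ct; rewrite E; apply: (rderiveZ_dir sg (dw c c0 ct)).1.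
  move: Ec; rewrite !E (rderiveZ_dir sg (dw c (ltW c0) (ltW ct))).2 mulrA.
  rewrite [`|t| * sg]mulrC -numEsg => ->.
  rewrite -mulrBr normrM mulrC ler_wpM2r // ltW //.
  by apply: h2; have [] := h3 t (c * sg) ht; rewrite // normrM sg1 mulr1 gtr0_norm // (lt_trans ct).
exists (Num.min d1 d3) => [|t]; first by rewrite lt_min d10.
rewrite lt_min => /andP[t1 t3].
have := h1 t t1; have := inc t t3; rewrite !ray0 scalerDr addrA => a1 a2.
have -> : f (z + t%:C *: v + t%:C *: w) - f z - t * (rderive f v z + rderive f w z) =
  (f (z + t%:C *: v + t%:C *: w) - f (z + t%:C *: v) - t * rderive f w z) +
  (f (z + t%:C *: v) - f z - t * rderive f v z) by ring.
apply: (le_trans (ler_normD _ _)); lra.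
Qed.

Lemma rderive_dir_sum D f z I (r : seq I) (F : I -> Cn) : open D -> Ck 1 D f -> D z ->
  rderive f (\sum_(i <- r) F i) z = \sum_(i <- r) rderive f (F i) z.
Proof.
move=> oD kf Dz; elim: r => [|i r IH].
  rewrite !big_nil; have [_] := rderiveZ_dir 0 (Ck_der 0 kf Dz).
  by rewrite mul0r scaler0.
by rewrite !big_cons (rderiveD_dir _ _ oD kf Dz) IH.
Qed.

Lemma rderive_expand D f v z : open D -> Ck 1 D f -> D z ->
  rderive f v z = \sum_b crd b v * rderive f (real_basis R b) z.
Proof.
move=> oD kf Dz; rewrite {1}(crd_expand v) (rderive_dir_sum _ _ oD kf Dz).
by apply: eq_bigr => b _; have [_ ->] := rderiveZ_dir (crd b v) (Ck_der (real_basis R b) kf Dz).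
Qed.

(** Schwarz's argument: the second difference over a small parallelogram is, by two mean value
    theorems, [h^2] times either mixed derivative at a nearby point. One inequality up to [e] is
    enough, the claim being symmetric in [v] and [w]. *)
Lemma rderive2_sym D f v w z : open D -> Ck 2 D f -> D z ->
  rderive (rderive f v) w z = rderive (rderive f w) v z.
Proof.
move=> oD kf Dz.
suff le (v' w' : Cn) : rderive (rderive f v') w' z <= rderive (rderive f w') v' z.
  by apply/le_anti/andP; split; exact: le.
apply/ler_addgt0Pr => e e_gt0.
have e2 : 0 < e / 2 by rewrite divr_gt0.
have /continuous_boxP /(_ _ e2)[d1 d10 h1] := Ck_cont (Ck_rderive w' (Ck_rderive v' kf)) Dz.
have /continuous_boxP /(_ _ e2)[d2 d20 h2] := Ck_cont (Ck_rderive v' (Ck_rderive w' kf)) Dz.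
have [e0 e00 he0] := open_box_sub oD Dz.
have m0 : 0 < Num.min e0 (Num.min d1 d2) by rewrite !lt_min e00 d10.
have [d d0 hd] := box_ray2 z v' w' m0.
have {}hd s t : `|s| < d -> `|t| < d ->
  [/\ D (z + s%:C *: v' + t%:C *: w'), box z d1 (z + s%:C *: v' + t%:C *: w')
   & box z d2 (z + s%:C *: v' + t%:C *: w')].
  move=> hs ht; have h := hd s t hs ht; split.
  - by apply: he0 => b; apply: lt_le_trans (h b) _; rewrite ge_min lexx.
  - by move=> b; apply: lt_le_trans (h b) _; rewrite !ge_min lexx orbT.
  - by move=> b; apply: lt_le_trans (h b) _; rewrite !ge_min lexx !orbT.
pose h := d / 2; have h0 : 0 < h by rewrite divr_gt0.
have hd' c : 0 <= c -> c <= h -> `|c| < d.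
  by move=> c0 ch; rewrite ger0_norm // (le_lt_trans ch) // /h ltr_pdivrMr // ltr_pMr // ltr1n.
have key (a b : Cn) (aD : forall s t, 0 <= s -> s <= h -> 0 <= t -> t <= h -> D (z + s%:C *: a + t%:C *: b)) :
  exists c c', [/\ 0 < c < h, 0 < c' < h &
   f (z + h%:C *: a + h%:C *: b) - f (z + h%:C *: a) - (f (z + h%:C *: b) - f z) =
   h * (h * rderive (rderive f a) b (z + c%:C *: a + c'%:C *: b))].
  pose g (x : Cn) := f (x + h%:C *: b) - f x.
  have dg s : 0 <= s -> s <= h -> dir_derivable g a (z + s%:C *: a) /\
     rderive g a (z + s%:C *: a) = rderive f a (z + s%:C *: a + h%:C *: b) - rderive f a (z + s%:C *: a).
    move=> s0 sh.
    have D1 : D (z + s%:C *: a + h%:C *: b) by apply: aD => //; exact: ltW.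
    have D2 : D (z + s%:C *: a).
      by have := aD s 0 s0 sh (lexx 0) (ltW h0); rewrite ray0.
    have kf1 := Ck_pred kf.
    apply: is_derive_dir; apply: is_deriveB; last exact: (dir_derivableP (Ck_der _ kf D2)).
    have := dir_derivableP (Ck_der a kf D1).
    by under [X in is_derive _ _ X _ -> _]eq_fun do rewrite addrAC.
  have [c /andP[c0 ch] Ec] := @ray_MVT g a z h h0 (fun s s0 sh => (dg s s0 sh).1).
  have Da : forall s, 0 <= s -> s <= h -> dir_derivable (rderive f a) b (z + c%:C *: a + s%:C *: b).
    move=> s s0 sh; apply: (Ck_der _ (Ck_rderive a kf)); apply: aD => //; exact: ltW.
  have [c' c'h Ec'] := @ray_MVT (rderive f a) b (z + c%:C *: a) h h0 Da.
  exists c, c'; split=> //; first by rewrite c0.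
  by rewrite -Ec' -(dg c (ltW c0) (ltW ch)).2 -Ec /g.
have [|c [c' [/andP[c0 ch] /andP[c0' ch'] E1]]] := key v' w'.
  by move=> s t s0 sh t0 th; have [] := hd s t (hd' _ s0 sh) (hd' _ t0 th).
have [|k [k' [/andP[k0 kh] /andP[k0' kh'] E2]]] := key w' v'.
  by move=> s t s0 sh t0 th; rewrite addrAC; have [] := hd t s (hd' _ t0 th) (hd' _ s0 sh).
have : h * (h * rderive (rderive f v') w' (z + c%:C *: v' + c'%:C *: w')) =
   h * (h * rderive (rderive f w') v' (z + k%:C *: w' + k'%:C *: v')).
  have sw (a b x y : R) : a - b - (x - y) = a - x - (b - y) by ring.
  apply: (etrans (esym E1)); apply: (etrans _ E2); apply: (etrans (sw _ _ _ _)).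
  by congr (_ - _ - _); congr f; exact: addrAC.
move=> /(mulfI (lt0r_neq0 h0)) /(mulfI (lt0r_neq0 h0)) E.
have [_ b1 _] := hd c c' (hd' _ (ltW c0) (ltW ch)) (hd' _ (ltW c0') (ltW ch')).
have [_ _ b2] := hd k' k (hd' _ (ltW k0') (ltW kh')) (hd' _ (ltW k0) (ltW kh)).
have := h1 _ b1; have := h2 _ b2; rewrite addrAC -E.
exact: ler_dist_half.
Qed.

Lemma rderive_lin D (c : R) f g v z : open D -> Ck 1 D f -> Ck 1 D g -> D z ->
  rderive (fun x => c * f x + g x) v z = c * rderive f v z + rderive g v z.
Proof.
move=> oD kf kg Dz; have df := Ck_der v kf Dz; have dg := Ck_der v kg Dz.
have [dc ec] := rderive_cst c v z; have [d1 e1] := rderiveM_def dc df.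
by have [_ ->] := rderiveD_def d1 dg; rewrite e1 ec mul0r addr0.
Qed.

Lemma rderive_sum D I (r : seq I) (c : I -> R) (F : I -> Cn -> R) v z : open D ->
  (forall i, Ck 1 D (F i)) -> D z ->
  rderive (fun x => \sum_(i <- r) c i * F i x) v z = \sum_(i <- r) c i * rderive (F i) v z.
Proof.
move=> oD kF Dz; elim: r => [|i r IH].
  rewrite [RHS]big_nil -[RHS](rderive_cst (0 : R) v z).2.
  by apply: eq_rderive => x; rewrite big_nil.
rewrite big_cons -IH -(rderive_lin _ _ oD (kF i) _ Dz); last first.
  apply: Ck_sum => // j _; apply: CkM => //; exact: Ck_cst.
by apply: eq_rderive => x; rewrite big_cons.
Qed.

Lemma rderive2_expand D f v w z : open D -> Ck 2 D f -> D z ->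
  rderive (rderive f v) w z = \sum_b \sum_c
    crd b v * crd c w * rderive (rderive f (real_basis R b)) (real_basis R c) z.
Proof.
move=> oD kf Dz.
have k1 b := Ck_rderive (real_basis R b) kf.
have ks : Ck 1 D (fun x => \sum_b crd b v * rderive f (real_basis R b) x).
  by apply: Ck_sum => // b _; apply: CkM => //; exact: Ck_cst.
have [|_ ->] := rderive_ext (f := fun x => \sum_b crd b v * rderive f (real_basis R b) x)
   (g := rderive f v) (v := w) oD _ Dz (Ck_der w ks Dz).
  by move=> x; rewrite inE => Dx; rewrite -(rderive_expand _ oD (Ck_pred kf) Dx).
rewrite (rderive_sum _ _ _ oD k1 Dz); apply: eq_bigr => b _.
rewrite (rderive_expand w oD (k1 b) Dz) mulr_sumr; apply: eq_bigr => c _.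
by rewrite mulrA.
Qed.

Lemma box0P (z x : Cn) (e : R) : box 0 e x -> box z e (z + x).
Proof. by move=> h b; rewrite crdD addrC addKr; have := h b; rewrite crd0 subr0. Qed.

Lemma box0Z (x : Cn) (e t : R) : box 0 e x -> 0 <= t <= 1 -> box 0 e (t%:C *: x).
Proof.
move=> h /andP[t0 t1] b; rewrite crdZ crd0 subr0 normrM ger0_norm //.
by have := h b; rewrite crd0 subr0; apply: le_lt_trans; rewrite ler_piMl.
Qed.

Lemma crdM_nsq b c (x : Cn) : `|crd b x * crd c x| <= nsq x.
Proof.
rewrite normrM; have := crd_nsq b x; have := crd_nsq c x.
rewrite -[crd b x ^+ 2]real_normK ?num_real // -[crd c x ^+ 2]real_normK ?num_real //.
have := normr_ge0 (crd b x); have := normr_ge0 (crd c x); nra.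
Qed.

Lemma uniform_continuousD D (I : finType) (F : I -> Cn -> R) z : open D -> D z ->
  (forall i, Ck 0 D (F i)) -> forall e : R, 0 < e ->
  exists2 d : R, 0 < d & forall w, box z d w -> D w /\ forall i, `|F i w - F i z| < e.
Proof.
move=> oD Dz kF e e_gt0; have [e0 e00 he0] := open_box_sub oD Dz.
have dd i : {d : R | 0 < d & forall w, box z d w -> `|F i w - F i z| < e}.
  by apply: cid2; have /continuous_boxP := Ck_cont (kF i) Dz; exact.
exists (\big[Order.min/e0]_i (s2val (dd i))).
  by apply: lt_bigmin => [|i _]; [exact: e00|case: (dd i)].
move=> w hw; split.
  by apply: he0 => b; apply: lt_le_trans (hw b) _; exact: bigmin_le_id.
move=> i; apply: (s2valP' (dd i)) => b.
by apply: lt_le_trans (hw b) _; rewrite (bigD1 i) //= ge_min lexx.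
Qed.

(** The remainder is uniform in the direction of [x] because it is controlled by the finitely many
    second derivatives along basis vectors, all continuous at [z]. *)
Lemma Taylor2 D f z : open D -> Ck 2 D f -> D z -> forall e : R, 0 < e ->
  exists2 d : R, 0 < d & forall x, box 0 d x ->
   `|f (z + x) - f z - rderive f x z - rderive (rderive f x) x z / 2| <= e * nsq x.
Proof.
move=> oD kf Dz e e_gt0.
pose I : finType := (('I_n * bool) * ('I_n * bool))%type.
pose N : R := 1 + #|I|%:R.
have N0 : 0 < N by rewrite /N ltr_pwDl.
pose H (p : I) x := rderive (rderive f (real_basis R p.1)) (real_basis R p.2) x.
have kH p : Ck 0 D (H p) by do 2 apply: Ck_rderive.
have eN : 0 < e / N by rewrite divr_gt0.
have [d d0 hd] := uniform_continuousD oD Dz kH eN.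
exists d => // x hx.
have Dt t : 0 <= t <= 1 -> D (z + t%:C *: x).
  by move=> t01; have [] := hd _ (box0P z (box0Z hx t01)).
pose q := rderive (rderive f x) x.
have hq t : 0 <= t <= 1 -> `|q (z + t%:C *: x) - q z| <= e * nsq x.
  move=> t01; rewrite /q !(rderive2_expand _ _ oD kf) //; last exact: Dt.
  rewrite -sumrB.
  under eq_bigr do rewrite -sumrB.
  rewrite pair_big /=; apply: (le_trans (ler_norm_sum _ _ _)).
  apply: (@le_trans _ _ (\sum_(p : I) (e / N) * nsq x)).
    apply: ler_sum => p _; rewrite -mulrBr normrM mulrC.
    apply: ler_pM => //; last exact: crdM_nsq.
    by have [_ /(_ p)/ltW] := hd _ (box0P z (box0Z hx t01)).
  rewrite sumr_const -mulr_natr mulrAC ler_wpM2r ?nsq_ge0 //.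
  rewrite mulrAC ler_pdivrMr // ler_wpM2l ?ltW // /N; lra.
(* The Taylor polynomial is subtracted along the segment; one mean value theorem for [p] and another
   for [rderive f x] leave the variation of [q]. *)
pose p (t : R) := f (z + t%:C *: x) - t * rderive f x z - t ^+ 2 / 2 * q z.
have dp (t : R) : 0 <= t <= 1 ->
    is_derive t (1 : R) p (rderive f x (z + t%:C *: x) - rderive f x z - t * q z).
  move=> t01.
  have h1 := is_derive_ray (Ck_der x kf (Dt t t01)).
  have h2 : is_derive t 1 (fun t : R => t * rderive f x z) (rderive f x z).
    have -> : (fun t : R => t * rderive f x z) = (rderive f x z \*: id)%R.
      by apply/funext => s; rewrite /= mulrC.
    by apply: (is_derive_eq (is_deriveZ _ _)); rewrite /GRing.scale /= mulr1.
  have h3 : is_derive t 1 (fun t : R => t ^+ 2 / 2 * q z) (t * q z).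
    have -> : (fun t : R => t ^+ 2 / 2 * q z) = ((q z / 2) \*: (id ^+ 2))%R.
      by apply/funext => s; rewrite /= /GRing.scale /= mulrC mulrA mulrAC mulrA.
    apply: (is_derive_eq (is_deriveZ _ _)).
    rewrite /GRing.scale /= expr1 mulr1; lra.
  exact: is_deriveB (is_deriveB h1 h2) h3.
have [||c] := @MVT R p (fun t => rderive f x (z + t%:C *: x) - rderive f x z - t * q z) 0 1 ltr01.
- by move=> s; rewrite in_itv /= => /andP[/ltW s0 /ltW s1]; apply: dp; rewrite s0.
- apply: derivable_within_continuous => s; rewrite in_itv /= => s01.
  by have [] := dp s s01.
rewrite in_itv /= => /andP[c0 c1]; rewrite subr0 mulr1 /p ray0 ray1 => E.
have -> : f (z + x) - f z - rderive f x z - rderive (rderive f x) x z / 2 =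
  rderive f x (z + c%:C *: x) - rderive f x z - c * q z by rewrite -E /q; ring.
have [|c' /andP[c'0 c'1] ->] := @ray_MVT (rderive f x) x z c c0.
  move=> s s0 sc; apply: (Ck_der x (Ck_rderive x kf)); apply: Dt.
  by rewrite s0 (le_trans sc) // ltW.
rewrite -mulrBr normrM gtr0_norm //.
apply: (@le_trans _ _ `|q (z + c'%:C *: x) - q z|).
  by rewrite ler_piMl // ltW.
by apply: hq; rewrite (ltW c'0) (le_trans (ltW c'1)) // ltW.
Qed.

Lemma ddcE (kappa : R) D f z v w (iv iw : Cn) : open D -> Ck 2 D f -> D z ->
  iv = 'i *: v -> iw = 'i *: w ->
  ddc kappa f z v w = kappa * (rderive (rderive f iv) w z
                             - rderive (rderive f iw) v z).
Proof.
move=> oD kf Dz Eiv Eiw; rewrite /ddc /dc -Eiv -Eiw {Eiv Eiw}.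
have k0 : Ck 1 D (fun=> 0 : R) by apply: Ck_cst.
have E (a b : Cn) : rderive (fun x => - kappa * rderive f a x) b z =
             - kappa * rderive (rderive f a) b z.
  have := rderive_lin (- kappa) b oD (Ck_rderive a kf) k0 Dz.
  have [_ ->] := rderive_cst (0 : R) b z; rewrite addr0 => <-.
  by apply: eq_rderive => x; rewrite addr0.
rewrite (E iw v) (E iv w).
move: (rderive (rderive f iw) v z) (rderive (rderive f iv) w z) => A B; ring.
Qed.

Lemma iiv v : 'i *: ('i *: v) = - v :> Cn.
Proof. by rewrite scalerA -expr2 sqr_i scaleN1r. Qed.

Lemma rderive2_Nl D f z v w : open D -> Ck 2 D f -> D z ->
  rderive (rderive f (- v)) w z = - rderive (rderive f v) w z.
Proof.
move=> oD kf Dz.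
rewrite (rderive2_expand (- v) w oD kf Dz) (rderive2_expand v w oD kf Dz) -sumrN.
by apply: eq_bigr => b _; rewrite -sumrN; apply: eq_bigr => c _; rewrite crdN !mulNr.
Qed.

Lemma ddc_diag (kappa : R) D f z v (iv : Cn) : open D -> Ck 2 D f -> D z -> iv = 'i *: v ->
  ddc kappa f z v iv =
  kappa * (rderive (rderive f v) v z + rderive (rderive f iv) iv z).
Proof.
move=> oD kf Dz Ei.
have Ei2 : - v = 'i *: iv by rewrite Ei iiv.
rewrite (ddcE kappa oD kf Dz Ei Ei2) (rderive2_Nl v v oD kf Dz).
move: (rderive (rderive f v) v z) (rderive (rderive f iv) iv z) => A B; ring.
Qed.

Lemma ddc_J (kappa : R) D f z v w (iv iw : Cn) : open D -> Ck 2 D f -> D z ->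
  iv = 'i *: v -> iw = 'i *: w ->
  ddc kappa f z iv iw = ddc kappa f z v w.
Proof.
move=> oD kf Dz Ev Ew.
have Ev2 : - v = 'i *: iv by rewrite Ev iiv.
have Ew2 : - w = 'i *: iw by rewrite Ew iiv.
apply: (etrans (ddcE kappa oD kf Dz Ev2 Ew2)); apply: (etrans _ (esym (ddcE kappa oD kf Dz Ev Ew))).
have A1 := etrans (rderive2_Nl v iw oD kf Dz) (congr1 -%R (rderive2_sym v iw oD kf Dz)).
have A2 := etrans (rderive2_Nl w iv oD kf Dz) (congr1 -%R (rderive2_sym w iv oD kf Dz)).
have key (X Y a b : R) : X = - a -> Y = - b -> kappa * (X - Y) = kappa * (b - a).
  by move=> -> ->; ring.
exact: key A1 A2.
Qed.

Lemma ddc_antisym (kappa : R) f z v w : ddc kappa f z v w = - ddc kappa f z w v.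
Proof. by rewrite /ddc opprB. Qed.

Lemma ddc_linear (kappa : R) D f z (a : R) (u v w : Cn) : open D -> Ck 2 D f -> D z ->
  ddc kappa f z (a%:C *: u + v) w = a * ddc kappa f z u w + ddc kappa f z v w.
Proof.
move=> oD kf Dz.
have L (x y b : Cn) : rderive (rderive f b) (a%:C *: x + y) z =
    a * rderive (rderive f b) x z + rderive (rderive f b) y z.
  rewrite (rderiveD_dir _ _ oD (Ck_rderive b kf) Dz).
  by rewrite (rderiveZ_dir a (Ck_der x (Ck_rderive b kf) Dz)).2.
have : a%:C *: ('i *: u) + 'i *: v = 'i *: (a%:C *: u + v) :> Cn.
  by rewrite scalerDr !scalerA [_ * a%:C]mulrC.
have [iu Eu] : exists x : Cn, x = 'i *: u by eexists.
have [iv Ev] : exists x : Cn, x = 'i *: v by eexists.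
have [iw Ew] : exists x : Cn, x = 'i *: w by eexists.
rewrite -Eu -Ev => Es.
rewrite (ddcE kappa oD kf Dz Es Ew) (ddcE kappa oD kf Dz Eu Ew) (ddcE kappa oD kf Dz Ev Ew).
rewrite (rderive2_sym _ w oD kf Dz) (L iu iv w) (L u v iw).
rewrite (rderive2_sym w iu oD kf Dz) (rderive2_sym w iv oD kf Dz).
move: (rderive _ w z) (rderive _ w z) (rderive _ u z) (rderive _ v z) => A B C E.
rewrite !mulrBr !mulrDr !opprD; lra.
Qed.

End DirectionalCalculus2.

(** * Lebesgue measure on C^n *)

Notation BC R n := (g_sigma_algebraType (@open 'rV[R[i]]_n)).

Section BorelCn.
Variables (R : realType) (n : nat).
Local Notation Cn := 'rV[R[i]]_n.

Definition vec_of_crd (c : 'I_n * bool -> R) : Cn :=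
  \row_k (c (k, false) +i* c (k, true)).

Lemma crd_vec_of_crd b c : crd b (vec_of_crd c) = c b.
Proof. by case: b => k []; rewrite /crd /= mxE. Qed.

Definition rational_box (p : {ffun 'I_n * bool -> rat} * nat) : set Cn :=
  box (vec_of_crd (fun b => ratr (p.1 b))) (p.2.+1%:R^-1).

(** A countable base of boxes: it lets the measurability of a map into C^n be tested on its
    coordinates. *)
Lemma open_bigcup_rational_box (O : set Cn) : open O ->
  O = \bigcup_(p in [set p | rational_box p `<=` O]) rational_box p.
Proof.
move=> oO; apply/seteqP; split; last by move=> z [p /= hp]; exact: hp.
move=> z Oz; have [e e0 he] := open_box_sub oO Oz.
(* A box of radius below [e / 2] that contains [z] stays inside [box z e]. *)
have [k hk] : exists k : nat, k.+1%:R^-1 < e / 2.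
  have e2 : 0 < e / 2 by rewrite divr_gt0.
  exists (Num.truncn (e / 2)^-1); rewrite -[ltRHS]invrK ltf_pV2 ?posrE ?invr_gt0 //.
  exact: truncnS_gt.
have k0 : (0 : R) < k.+1%:R^-1 by rewrite invr_gt0.
have q b : {q : rat | `|crd b z - ratr q| < k.+1%:R^-1}.
  apply: cid; have : crd b z - k.+1%:R^-1 < crd b z + k.+1%:R^-1 by move: k0; set x := _^-1 => ?; lra.
  move=> /rat_in_itvoo[r]; rewrite in_itv /= => /andP[h1 h2]; exists r.
  by move: h1 h2 k0; set x := _^-1 => ? ? ?; rewrite ltr_distl; apply/andP; split; lra.
exists ([ffun b => sval (q b)], k) => /=; last first.
  by move=> b; rewrite crd_vec_of_crd ffunE; exact: (svalP (q b)).
move=> w hw; apply: he => b; have := hw b; have := svalP (q b).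
move: hk; rewrite /= crd_vec_of_crd ffunE; set x := _^-1 => ?; rewrite !ltr_distl => /andP[? ?] /andP[? ?].
apply/andP; split; lra.
Qed.

Lemma measurable_openC (O : set Cn) : open O -> measurable (O : set (BC R n)).
Proof. by move=> oO; apply: sub_sigma_algebra. Qed.

Lemma measurable_closedC (O : set Cn) : closed O -> measurable (O : set (BC R n)).
Proof.
move=> cO; rewrite -(setCK O); apply: measurableC; apply: measurable_openC.
exact: closed_openC.
Qed.

Lemma measurable_cont (f : Cn -> R) : continuous f ->
  measurable_fun setT (f : BC R n -> R).
Proof.
move=> cf; apply: (measurability _ (measurable_realfun.RGenOInfty.measurableE R)) => _ [_ [x ->] <-].
rewrite setTI; apply: measurable_openC.
by move/continuousP : cf; apply; exact: rray_open.
Qed.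

Lemma measurable_cont_on (D : set Cn) (f : Cn -> R) : open D ->
  (forall z, D z -> {for z, continuous f}) ->
  measurable_fun (D : set (BC R n)) (f : BC R n -> R).
Proof.
move=> oD cf; apply: (measurability _ (measurable_realfun.RGenOInfty.measurableE R)) => _ [_ [x ->] <-].
apply: measurable_openC; rewrite openE => z [Dz fz].
apply/nbhs_boxP; have [e0 e00 he0] := open_box_sub oD Dz.
have e1 : 0 < f z - x by move: fz; rewrite /= in_itv /= andbT subr_gt0.
have /continuous_boxP/(_ _ e1)[d d0 hd] := cf z Dz.
exists (Num.min e0 d) => [|w hw]; first by rewrite lt_min e00.
split; first by apply: he0 => b; apply: lt_le_trans (hw b) _; rewrite ge_min lexx.
have /hd : box z d w by move=> b; apply: lt_le_trans (hw b) _; rewrite ge_min lexx orbT.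
rewrite /= in_itv /= andbT ltr_distl => /andP[]; lra.
Qed.

Lemma measurable_crd b : measurable_fun setT (crd b : BC R n -> R).
Proof. by apply: measurable_cont; exact: continuous_crd. Qed.

Lemma measurable_of_crd d (T : measurableType d) (f : T -> Cn) :
  (forall b, measurable_fun setT (crd b \o f)) ->
  measurable_fun setT (f : T -> BC R n).
Proof.
move=> mf; apply: (@measurability _ _ _ (BC R n) _ _ (@open 'rV[R[i]]_n) erefl) => // _ [U oU <-].
rewrite setTI (open_bigcup_rational_box oU) preimage_bigcup.
rewrite bigcup_mkcond; apply: countable_bigcupT_measurable; first exact: countableP.
move=> p; case: ifPn => // _.
rewrite (_ : f @^-1` rational_box p = \bigcap_(b in setT)
   ((crd b \o f) @^-1` [set x | `|x - crd b (vec_of_crd (fun b => ratr (p.1 b)))| < p.2.+1%:R^-1])); last first.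
  by apply/seteqP; split => [z hz b _|z hz b]; [exact: hz|exact: (hz b I)].
apply: fin_bigcap_measurable => // b _.
rewrite -[X in measurable X]setTI; apply: mf => //.
set c := crd b _; set e := _^-1.
rewrite (_ : [set x | _] = `]c - e, c + e[%classic) //.
by apply/seteqP; split => x; rewrite /= in_itv /= ltr_distl.
Qed.

End BorelCn.

Section SigmaFiniteProduct.
Local Open Scope ereal_scope.
Context d1 d2 (T1 : measurableType d1) (T2 : measurableType d2) (R : realType).
Variable m1 : {sigma_finite_measure set T1 -> \bar R}.
Variable m2 : {sigma_finite_measure set T2 -> \bar R}.

(** A name for the product measure, so that sigma-finiteness can be attached to it and a further
    product taken. *)
Definition sigma_finite_prod : set (T1 * T2) -> \bar R := m1 \x m2.

HB.instance Definition _ := Measure.copy sigma_finite_prod (m1 \x m2).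

Lemma sigma_finite_prodP : sigma_finite setT sigma_finite_prod.
Proof.
have /sigma_finiteP[F [TF ndF fF]] := sigma_finiteT m1.
have /sigma_finiteP[G [TG ndG fG]] := sigma_finiteT m2.
exists (fun k => F k `*` G k).
  apply/seteqP; split=> // -[x y] _.
  have : [set: T1] x by []. have : [set: T2] y by [].
  rewrite TF TG => -[j _ Gjy] [i _ Fix]; exists (maxn i j) => //; split => /=.
    by move: Fix; exact/subsetPset/ndF/leq_maxl.
  by move: Gjy; exact/subsetPset/ndG/leq_maxr.
move=> k; have [mF lF] := fF k; have [mG lG] := fG k.
split; first exact: measurableX.
by rewrite /sigma_finite_prod product_measure1E // lte_mul_pinfty // ge0_fin_numE.
Qed.

HB.instance Definition _ := @Measure_isSigmaFinite.Build _ _ _ sigma_finite_prod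
  sigma_finite_prodP.

End SigmaFiniteProduct.

Section LebesgueCn.
Variable R : realType.
Local Notation leb := (@lebesgue_measure R).

(** The nesting is that of the integrals in [Cn_integral]. *)
Definition row_cons m (p : measurableTypeR R * (measurableTypeR R * BC R m)) : BC R m.+1 :=
  row_mx ((p.1 +i* p.2.1)%:M : 'rV[R[i]]_1) p.2.2.

Lemma crd_row_cons0 m b p :
  crd (ord0, b) (@row_cons m p : 'rV[R[i]]_m.+1) = if b then p.2.1 else p.1.
Proof.
rewrite /crd /row_cons (_ : ord0 = lshift m (ord0 : 'I_1)) /=; last exact/val_inj.
by rewrite (row_mxEl (p.1 +i* p.2.1)%:M) mxE eqxx mulr1n; case: b.
Qed.

Lemma crd_row_consS m b (k : 'I_m) p :
  crd (lift ord0 k, b) (@row_cons m p : 'rV[R[i]]_m.+1) = crd (k, b) (p.2.2 : 'rV[R[i]]_m).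
Proof.
rewrite /crd /row_cons (_ : lift ord0 k = rshift 1 k) /=; last exact/val_inj.
by rewrite (row_mxEr (p.1 +i* p.2.1)%:M).
Qed.

Lemma measurable_row_cons m : measurable_fun setT (@row_cons m).
Proof.
apply: measurable_of_crd => -[k b]; case: (unliftP ord0 k) => [j ->|->].
  rewrite (_ : _ \o _ = (crd (j, b) : BC R m -> R) \o (snd \o snd)); last first.
    by apply/funext => p; rewrite /= crd_row_consS.
  apply: measurableT_comp; first exact: measurable_crd.
  by apply: measurableT_comp; exact: measurable_snd.
rewrite (_ : _ \o _ = if b then fst \o snd else fst); last first.
  by apply/funext => p; rewrite /= crd_row_cons0; case: b.
case: b; last exact: measurable_fst.
by apply: measurableT_comp; [exact: measurable_fst|exact: measurable_snd].
Qed.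

Lemma row_cons_box m (a : 'rV[R[i]]_m.+1) (r : R) :
  @row_cons m @^-1` (box a r) =
  `]crd (ord0, false) a - r, crd (ord0, false) a + r[%classic `*`
  (`]crd (ord0, true) a - r, crd (ord0, true) a + r[%classic `*`
   box (vec_of_crd (fun b => crd (lift ord0 b.1, b.2) a)) r).
Proof.
apply/seteqP; split => [p hp|p [/= h1 [h2 h3]]].
  split; first by have := hp (ord0, false); rewrite crd_row_cons0 /= in_itv /= ltr_distl.
  split; first by have := hp (ord0, true); rewrite crd_row_cons0 /= in_itv /= ltr_distl.
  by move=> [k b]; rewrite crd_vec_of_crd /= -crd_row_consS; exact: hp.
move=> [k b]; case: (unliftP ord0 k) => [j ->|->].
  by rewrite crd_row_consS; have := h3 (j, b); rewrite crd_vec_of_crd.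
rewrite crd_row_cons0 ltr_distl; move: h1 h2; rewrite !in_itv /=.
by case: b.
Qed.

(** Carried along the recursion that builds Lebesgue measure: the volumes of boxes give the
    sigma-finiteness required to form the next product. *)
Definition box_volume n (m : set (BC R n) -> \bar R) :=
  forall (a : 'rV[R[i]]_n) (r : R), 0 < r -> m (box a r) = (((2 * r) ^+ (2 * n)))%:E.

Lemma box_cover n : \bigcup_k box (0 : 'rV[R[i]]_n) k.+1%:R = setT.
Proof.
apply/seteqP; split=> // z _.
exists (Num.truncn (\sum_b `|crd b z|)) => // b.
rewrite crd0 subr0; apply: (le_lt_trans _ (truncnS_gt _)).
by rewrite (bigD1 b) //= lerDl sumr_ge0.
Qed.

Lemma box_volume_sigma_finite n (m : {measure set (BC R n) -> \bar R}) :
  box_volume m -> sigma_finite setT m.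
Proof.
move=> hm; exists (fun k => box 0 k.+1%:R); first by rewrite box_cover.
move=> k; split; first by apply: measurable_openC; exact: open_box.
by rewrite hm // ltry.
Qed.

Section step.
Variables (m : nat)
  (p : {mu : {sigma_finite_measure set (BC R m) -> \bar R} | box_volume mu}).
Let mu : {sigma_finite_measure set (BC R m) -> \bar R} := proj1_sig p.

Definition leb_prod : {measure set (measurableTypeR R * (measurableTypeR R * BC R m)) -> \bar R} :=
  (leb \x (sigma_finite_prod leb mu))%E.

Definition leb_push : {measure set (BC R m.+1) -> \bar R} :=
  measure_function_pushforward__canonical__measure_function_Measure
     leb_prod (@measurable_row_cons m).

Definition leb_step : set (BC R m.+1) -> \bar R := leb_push.

HB.instance Definition _ := Measure.copy leb_step leb_push.

Lemma leb_itv (c r : R) : 0 < r -> leb `]c - r, c + r[%classic = (2 * r)%:E.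
Proof.
move=> r0; rewrite lebesgue_measure_itv /= lte_fin (_ : c - r < c + r); last by lra.
by rewrite -EFinD; congr (_%:E); ring.
Qed.

Lemma leb_step_box : box_volume leb_step.
Proof.
move=> a r r0; rewrite /leb_step /= /pushforward row_cons_box.
have mb : measurable (box (vec_of_crd (fun b => crd (lift ord0 b.1, b.2) a)) r : set (BC R m)).
  by apply: measurable_openC; exact: open_box.
rewrite /leb_prod.
rewrite (@product_measure1E _ _ _ _ R leb (sigma_finite_prod leb mu)) //; last by apply: measurableX.
have E2 B : measurable B -> sigma_finite_prod leb mu
  (`]crd (ord0, true) a - r, crd (ord0, true) a + r[%classic `*` B) =
  (leb `](crd (ord0, true) a - r)%R, (crd (ord0, true) a + r)%R[%classic * mu B)%E.
  by move=> mB; exact: product_measure1E.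
have hmu := proj2_sig p (vec_of_crd (fun b => crd (lift ord0 b.1, b.2) a)) r r0.
rewrite [X in (_ * X)%E](E2 _ mb).
transitivity ((2 * r)%:E * ((2 * r)%:E * ((2 * r) ^+ (2 * m))%:E))%E.
  congr (_ * (_ * _))%E; [exact: leb_itv|exact: leb_itv|exact: hmu].
by rewrite -!EFinM mulnS exprD expr2 -!mulrA.
Qed.

HB.instance Definition _ := @Measure_isSigmaFinite.Build _ _ _ leb_step
  (@box_volume_sigma_finite _ leb_step leb_step_box).

End step.

Definition leb0 : set (BC R 0) -> \bar R := dirac (0 : BC R 0).
HB.instance Definition _ := Measure.on leb0.

Lemma leb0_box : box_volume leb0.
Proof.
move=> a r r0; rewrite /leb0 diracE mem_set ?muln0 ?expr0 //.
by move=> [[]].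
Qed.

HB.instance Definition _ := @Measure_isSigmaFinite.Build _ _ _ leb0
  (@box_volume_sigma_finite _ leb0 leb0_box).

Fixpoint lebC_sig (n : nat) :
    {m : {sigma_finite_measure set (BC R n) -> \bar R} | box_volume m} :=
  match n with
  | 0%N => exist (fun m : {sigma_finite_measure set (BC R 0) -> \bar R} => box_volume m) leb0 leb0_box
  | m.+1 => exist (fun m0 : {sigma_finite_measure set (BC R m.+1) -> \bar R} => box_volume m0)
      (leb_step (lebC_sig m)) (leb_step_box (lebC_sig m))
  end.

Definition lebC (n : nat) : {sigma_finite_measure set (BC R n) -> \bar R} :=
  proj1_sig (lebC_sig n).

Lemma lebC_box n (a : 'rV[R[i]]_n) (r : R) : 0 < r ->
  lebC n (box a r) = (((2 * r) ^+ (2 * n)))%:E.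
Proof. exact: (proj2_sig (lebC_sig n)). Qed.

Lemma ge0_integral_lebCS n (g : BC R n.+1 -> \bar R) :
  measurable_fun setT (g : BC R n.+1 -> \bar R) -> (forall z, 0 <= g z)%E ->
  (\int[lebC n.+1]_z g z = \int[leb]_x \int[leb]_y \int[lebC n]_z g (row_cons (x, (y, z))))%E.
Proof.
move=> mg g0.
have mgc : measurable_fun setT (g \o @row_cons n).
  by apply: measurableT_comp => //; exact: measurable_row_cons.
transitivity (\int[leb_prod (lebC_sig n)]_p (g \o @row_cons n) p)%E.
  by apply: (ge0_integral_pushforward (@measurable_row_cons n) (leb_prod (lebC_sig n))) => // y _; exact: g0.
rewrite /leb_prod (fubini_tonelli1 (m1 := leb) (m2 := sigma_finite_prod leb _)) //; last by move=> p; exact: g0.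
apply: eq_integral => x _; rewrite /fubini_F.
rewrite -(@fubini_tonelli1 _ _ _ _ _ leb (lebC n) (fun q => (g \o @row_cons n) (x, q))) //.
- by apply: measurableT_comp => //; exact: measurable_pair1.
- by move=> q; exact: g0.
Qed.

Lemma Cn_integralE n (g : BC R n -> \bar R) :
  measurable_fun setT (g : BC R n -> \bar R) -> (forall z, 0 <= g z)%E ->
  Cn_integral g = (\int[lebC n]_z g z)%E.
Proof.
elim: n g => [|n IH] g mg g0.
  rewrite /lebC /= integral_dirac //= diracT mul1e //.
rewrite ge0_integral_lebCS //=; apply: eq_integral => x _; apply: eq_integral => y _.
rewrite IH // .
have mr : measurable_fun setT (fun z : BC R n => row_cons (x, (y, z)) : BC R n.+1).
  apply: (measurableT_comp (@measurable_row_cons n)).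
  apply: (measurableT_comp (f := pair x) (g := pair y)); exact: measurable_pair1.
exact: (measurableT_comp mg mr).
Qed.

End LebesgueCn.

(** * Affine changes of variables and compactly supported integrals *)

Section AffineInvariance.
Variable R : realType.
Local Notation leb := (@lebesgue_measure R).

Section real_line.
Variables (r c : R).
Hypothesis r0 : 0 < r.

Let aff : measurableTypeR R -> measurableTypeR R := fun x => r * x + c.

Lemma measurable_aff : measurable_fun setT aff.
Proof. by apply: measurable_funD => //; apply: measurable_funM. Qed.

Definition leb_aff : {measure set (measurableTypeR R) -> \bar R} :=
  mscale (NngNum (ltW r0)) (measure_function_pushforward__canonical__measure_function_Measure
    (leb : {measure set (measurableTypeR R) -> \bar R}) measurable_aff).

Lemma leb_affE A : measurable A -> leb A = leb_aff A.
Proof.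
apply: lebesgue_measure_unique => _ [[a b] /= _ <-].
rewrite /leb_aff /mscale /= /pushforward.
rewrite (_ : aff @^-1` `]a, b] = `](a - c) / r, (b - c) / r]%classic); last first.
  apply/seteqP; split => x; rewrite /aff /= !in_itv /= ltr_pdivrMr // ler_pdivlMr //.
    by rewrite ltrBlDr lerBrDr mulrC.
  by rewrite ltrBlDr lerBrDr mulrC.
rewrite !lebesgue_measure_itv /= !lte_fin ltr_pM2r ?invr_gt0 // ltrD2r.
case: ifPn => _; last by rewrite mule0.
rewrite -!EFinB -EFinM; congr (_%:E); field; exact: lt0r_neq0.
Qed.

Lemma ge0_integral_aff (f : R -> \bar R) :
  measurable_fun setT (f : measurableTypeR R -> \bar R) -> (forall x, 0 <= f x)%E ->
  (\int[leb]_x f (r * x + c)%R = (r^-1)%:E * \int[leb]_x f x)%E.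
Proof.
move=> mf f0.
rewrite [in RHS](eq_measure_integral leb_aff); last by move=> A mA _; exact: leb_affE.
rewrite /leb_aff ge0_integral_mscale //=.
rewrite muleA -EFinM mulVf ?mul1e; last exact: lt0r_neq0.
rewrite (ge0_integral_pushforward measurable_aff (leb : {measure set (measurableTypeR R) -> \bar R})) //.
Qed.

Lemma ge0_integral_affZ (k : R) (f : R -> \bar R) : 0 <= k ->
  measurable_fun setT (f : measurableTypeR R -> \bar R) -> (forall x, 0 <= f x)%E ->
  (\int[leb]_x (k%:E * f (r * x + c)%R) = k%:E * ((r^-1)%:E * \int[leb]_x f x))%E.
Proof.
move=> k0 mf f0; rewrite -ge0_integral_aff // ge0_integralZl_EFin //.
by apply: (measurableT_comp mf); exact: measurable_aff.
Qed.

End real_line.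

(** Induction on the dimension, with one affine change of variable on the line for each of the two
    real coordinates split off. *)
Lemma ge0_integral_affC n (r : R) (v : 'rV[R[i]]_n) (g : BC R n -> \bar R) : 0 < r ->
  measurable_fun setT (g : BC R n -> \bar R) -> (forall z, 0 <= g z)%E ->
  (\int[lebC R n]_z g (r%:C *: (z : 'rV[R[i]]_n) + v)%R = ((r ^+ (2 * n))^-1)%:E * \int[lebC R n]_z g z)%E.
Proof.
move=> r0; elim: n v g => [|n IH] v g mg g0.
  rewrite muln0 expr0 invr1 mul1e; apply: eq_integral => z _; congr (g _).
  by apply/rowP; case.
have mr : measurable_fun setT (fun z : BC R n.+1 => (r%:C *: (z : 'rV[R[i]]_n.+1) + v)%R : BC R n.+1).
  apply: measurable_of_crd => b.
  rewrite (_ : _ \o _ = (fun x => r * x + crd b v) \o (crd b : BC R n.+1 -> R)); last first.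
    by apply/funext => z; rewrite /= crdD crdZ.
  by apply: measurableT_comp; [exact: measurable_aff|exact: measurable_crd].
have mgr : measurable_fun setT (fun z : BC R n.+1 => g (r%:C *: (z : 'rV[R[i]]_n.+1) + v)%R).
  exact: (measurableT_comp mg mr).
rewrite !ge0_integral_lebCS //.
pose a := crd (ord0, false) v; pose b := crd (ord0, true) v.
pose v' := vec_of_crd (fun b => crd (lift ord0 b.1, b.2) v).
have E x y z : r%:C *: (row_cons (x, (y, z)) : 'rV[R[i]]_n.+1) + v =
   row_cons (r * x + a, (r * y + b, r%:C *: (z : 'rV[R[i]]_n) + v')).
  apply: crd_ext => -[k c]; rewrite crdD crdZ; case: (unliftP ord0 k) => [j ->|->].
    by rewrite !crd_row_consS /= crdD crdZ crd_vec_of_crd.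
  by rewrite !crd_row_cons0 /= /a /b; case: c.
have mgc : measurable_fun setT (g \o @row_cons R n).
  by apply: measurableT_comp => //; exact: measurable_row_cons.
have mg1 x : measurable_fun setT (fun q => (g \o @row_cons R n) (x, q)).
  by apply: measurableT_comp => //; exact: measurable_pair1.
have mg2 x y : measurable_fun setT (fun z => (g \o @row_cons R n) (x, (y, z))).
  exact: (measurableT_comp (mg1 x) (measurable_pair1 y)).
pose G1 x y := (\int[lebC R n]_z g (row_cons (x, (y, z))))%E.
have mG1 x : measurable_fun setT (G1 x : measurableTypeR R -> \bar R).
  exact: (@measurable_fun_fubini_tonelli_F _ _ _ _ R (lebC R n) (fun q => (g \o @row_cons R n) (x, q)) (mg1 x) (fun q => g0 _)).
have G10 x y : (0 <= G1 x y)%E by apply: integral_ge0.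
pose G2 x := (\int[leb]_y G1 x y)%E.
have mG2 : measurable_fun setT (G2 : measurableTypeR R -> \bar R).
  have := @measurable_fun_fubini_tonelli_F _ _ _ _ R (sigma_finite_prod leb (lebC R n)) _ mgc (fun q => g0 _).
  apply: eq_measurable_fun => x _.
  exact: (@fubini_tonelli1 _ _ _ _ _ leb (lebC R n) (fun q => (g \o @row_cons R n) (x, q)) (mg1 x) (fun q => g0 _)).
have G20 x : (0 <= G2 x)%E by apply: integral_ge0.
transitivity (\int[leb]_x \int[leb]_y (((r ^+ (2 * n))^-1)%:E * G1 (r * x + a)%R (r * y + b)%R))%E.
  apply: eq_integral => x _; apply: eq_integral => y _.
  rewrite /G1 -(IH v' _ (mg2 (r * x + a) (r * y + b)) (fun z => g0 _)).
  by apply: eq_integral => z _; rewrite E.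
have ri0 : (0 <= (r ^+ (2 * n))^-1)%R by rewrite invr_ge0 exprn_ge0 // ltW.
transitivity (\int[leb]_x (((r ^+ (2 * n))^-1)%:E * ((r^-1)%:E * G2 (r * x + a)%R)))%E.
  apply: eq_integral => x _; rewrite ge0_integralZl_EFin //; last first.
    by apply: (measurableT_comp (mG1 _)); exact: measurable_aff.
  by congr (_ * _)%E; rewrite ge0_integral_aff.
rewrite ge0_integralZl_EFin //; last 2 first.
- by move=> x _; rewrite mule_ge0 // lee_fin invr_ge0 ltW.
- by apply: measurable_funeM; apply: (measurableT_comp mG2); exact: measurable_aff.
transitivity (((r ^+ (2 * n))^-1)%:E * ((r^-1)%:E * ((r^-1)%:E * \int[leb]_x G2 x)))%E.
  congr (_ * _)%E; apply: (ge0_integral_affZ a r0 _ mG2 G20).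
  by rewrite invr_ge0 ltW.
rewrite !muleA -!EFinM; congr (_%:E * _)%E.
rewrite -!invfM; congr (_^-1); rewrite mulnS exprD expr2; ring.
Qed.

End AffineInvariance.

Section CompactSupport.
Variables (R : realType) (n : nat).
Local Notation Cn := 'rV[R[i]]_n.
Implicit Types (F G : Cn -> R).

(** Bounded measurable functions of bounded support, a single constant bounding both the values and
    the support. On this class [Int] is linear and monotone without separate integrability
    conditions. *)
Definition bcs F := measurable_fun setT (F : BC R n -> R) /\
  exists2 M : R, 0 < M & forall z, `|F z| <= M * \1_(box 0 M) z.

Definition Int F : R := \int[lebC R n]_z (F z).

Lemma integral_box_cst (a : Cn) (r M : R) : 0 < r -> 0 <= M ->
  (\int[lebC R n]_z (M * \1_(box a r) z)%:E = (M * (2 * r) ^+ (2 * n))%:E)%E.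
Proof.
move=> r0 M0; have mb : measurable (box a r : set (BC R n)) by apply: measurable_openC; exact: open_box.
under eq_integral do rewrite EFinM.
rewrite ge0_integralZl_EFin //; last exact: measurableT_comp.
by rewrite EFinM; congr (_ * _)%E; rewrite integral_indic // setIT; exact: lebC_box.
Qed.

Lemma bcs_integrable F : bcs F -> (lebC R n).-integrable setT (EFin \o F).
Proof.
case=> mF [M M0 hM]; apply/integrableP; split; first exact/measurable_EFinP.
have mb : measurable (box 0 M : set (BC R n)) by apply: measurable_openC; exact: open_box.
apply: (@le_lt_trans _ _ (\int[lebC R n]_z (M * \1_(box 0 M) z)%:E)%E); last first.
  by rewrite integral_box_cst ?ltry // ltW.
apply: ge0_le_integral => //.
- by apply: measurableT_comp => //; exact/measurable_EFinP.
- by apply/measurable_EFinP; apply: measurable_funM.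
- by move=> z _ /=; rewrite lee_fin.
Qed.

Lemma bcs_le F (M C : R) : measurable_fun setT (F : BC R n -> R) ->
  (forall z, `|F z| <= C) -> (forall z, ~ box 0 M z -> F z = 0) -> bcs F.
Proof.
move=> mF hC hM; split=> //; exists (1 + `|M| + `|C|).
  by rewrite -addrA ltr_pwDl // addr_ge0.
move=> z; have [zb|zb] := pselect (box 0 M z).
  rewrite indicE mem_set ?mulr1; last first.
    move=> k; apply: lt_le_trans (zb k) _; apply: (le_trans (ler_norm M)).
    by rewrite -addrA addrCA lerDl addr_ge0.
  by apply: (le_trans (hC z)); apply: (le_trans (ler_norm C)); rewrite lerDr addr_ge0.
by rewrite hM // normr0 mulr_ge0 // ?indicE // addr_ge0 // addr_ge0.
Qed.

Lemma bcsP F : bcs F -> exists M : R, [/\ 0 < M, forall z, `|F z| <= M &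
  forall z, ~ box 0 M z -> F z = 0].
Proof.
case=> mF [M M0 hM]; exists M; split=> // z.
  apply: (le_trans (hM z)); rewrite ger_pMr // indicE; by case: (_ \in _).
move=> zb; have := hM z; rewrite indicE memNset // mulr0 normr_le0.
by move/eqP.
Qed.

Lemma bcsD F G : bcs F -> bcs G -> bcs (fun z => F z + G z).
Proof.
move=> bF bG; have [M [M0 h1 h2]] := bcsP bF; have [N [N0 k1 k2]] := bcsP bG.
apply: (@bcs_le _ (M + N) (M + N)).
- by apply: measurable_funD => //; [exact: bF.1|exact: bG.1].
- by move=> z; apply: (le_trans (ler_normD _ _)); rewrite lerD.
- move=> z zb; rewrite h2 ?k2 ?addr0 // => hb; apply: zb => b;
  apply: lt_le_trans (hb b) _; rewrite ?lerDl ?lerDr ltW //.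
Qed.

Lemma bcsZ (c : R) F : bcs F -> bcs (fun z => c * F z).
Proof.
move=> bF; have [M [M0 h1 h2]] := bcsP bF; apply: (@bcs_le _ M (`|c| * M)).
- by apply: measurable_funM => //; exact: bF.1.
- by move=> z; rewrite normrM ler_wpM2l.
- by move=> z /h2 ->; rewrite mulr0.
Qed.

Lemma bcsN F : bcs F -> bcs (fun z => - F z).
Proof.
by move=> /(bcsZ (-1)); rewrite (_ : (fun z => -1 * F z) = (fun z => - F z)) //;
  apply/funext => z; rewrite mulN1r.
Qed.

Lemma bcs0 : bcs (fun=> 0).
Proof. by apply: (@bcs_le _ 1 0) => // z; rewrite normr0. Qed.

Lemma bcs_abs F : bcs F -> bcs (fun z => `|F z|).
Proof.
move=> bF; have [M [M0 h1 h2]] := bcsP bF; apply: (@bcs_le _ M M).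
- by apply: measurableT_comp => //; exact: bF.1.
- by move=> z; rewrite normr_id.
- by move=> z /h2 ->; rewrite normr0.
Qed.

Lemma bcs_indic_box (a : Cn) (r : R) : bcs (\1_(box a r)).
Proof.
have mb : measurable (box a r : set (BC R n)) by apply: measurable_openC; exact: open_box.
apply: (@bcs_le _ (r + \sum_b `|crd b a|) 1) => //.
  by move=> z; rewrite indicE; case: (_ \in _); rewrite ?normr1 ?normr0.
move=> z zb; rewrite indicE memNset // => h; apply: zb => b; rewrite crd0 subr0.
have := ler_normD (crd b z - crd b a) (crd b a); rewrite subrK => /le_lt_trans; apply.
by rewrite ltr_leD // (bigD1 b) //= lerDl sumr_ge0.
Qed.

Lemma IntD F G : bcs F -> bcs G -> Int (fun z => F z + G z) = Int F + Int G.
Proof. by move=> /bcs_integrable iF /bcs_integrable iG; exact: RintegralD. Qed.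

Lemma IntZ (c : R) F : bcs F -> Int (fun z => c * F z) = c * Int F.
Proof. by move=> /bcs_integrable iF; exact: RintegralZl. Qed.

Lemma IntN F : bcs F -> Int (fun z => - F z) = - Int F.
Proof.
move=> bF; rewrite -mulN1r -IntZ //; congr Int.
by apply/funext => z; rewrite mulN1r.
Qed.

Lemma IntB F G : bcs F -> bcs G -> Int (fun z => F z - G z) = Int F - Int G.
Proof. by move=> bF bG; rewrite IntD ?IntN //; exact: bcsN. Qed.

Lemma Int0 : Int (fun=> 0) = 0.
Proof. by rewrite -(mul0r (0 : R)) IntZ ?mul0r //; exact: bcs0. Qed.

Lemma bcs_sum I (s : seq I) (P : pred I) (F : I -> Cn -> R) :
  (forall i, P i -> bcs (F i)) -> bcs (fun z => \sum_(i <- s | P i) F i z).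
Proof.
move=> h; elim: s => [|i s IH].
  by under eq_fun do rewrite big_nil; exact: bcs0.
case Pi: (P i).
  by under eq_fun do rewrite big_cons Pi; apply: bcsD => //; exact: h.
by under eq_fun do rewrite big_cons Pi.
Qed.

Lemma Int_sum I (s : seq I) (P : pred I) (F : I -> Cn -> R) :
  (forall i, P i -> bcs (F i)) ->
  Int (fun z => \sum_(i <- s | P i) F i z) = \sum_(i <- s | P i) Int (F i).
Proof.
move=> h; elim: s => [|i s IH].
  by rewrite big_nil -[RHS]Int0; congr Int; apply/funext => z; rewrite big_nil.
rewrite big_cons; case Pi: (P i).
  rewrite -IH -IntD //; [|exact: h|exact: bcs_sum].
  by congr Int; apply/funext => z; rewrite big_cons Pi.
by rewrite -IH; congr Int; apply/funext => z; rewrite big_cons Pi.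
Qed.

Lemma Int_ge0 F : (forall z, 0 <= F z) -> 0 <= Int F.
Proof. by move=> F0; apply: Rintegral_ge0. Qed.

Lemma Int_le F G : bcs F -> bcs G -> (forall z, F z <= G z) -> Int F <= Int G.
Proof. by move=> /bcs_integrable iF /bcs_integrable iG h; apply: le_Rintegral. Qed.

Lemma Int_indic_box (a : Cn) (r : R) : 0 < r -> Int (\1_(box a r)) = (2 * r) ^+ (2 * n).
Proof.
move=> r0; have mb : measurable (box a r : set (BC R n)) by apply: measurable_openC; exact: open_box.
rewrite /Int /Rintegral (_ : integral _ _ _ = ((2 * r) ^+ (2 * n))%:E) //.
by apply: etrans (lebC_box a r0); rewrite integral_indic // setIT.
Qed.

Lemma measurable_affC (r : R) (v : Cn) :
  measurable_fun setT (fun z : BC R n => (r%:C *: (z : Cn) + v) : BC R n).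
Proof.
apply: measurable_of_crd => b.
rewrite (_ : _ \o _ = (fun x => r * x + crd b v) \o (crd b : BC R n -> R)); last first.
  by apply/funext => z; rewrite /= crdD crdZ.
by apply: measurableT_comp; [exact: measurable_aff|exact: measurable_crd].
Qed.

Lemma Int_aff (r : R) (v : Cn) F : 0 < r -> bcs F ->
  Int (fun z => F (r%:C *: z + v)) = (r ^+ (2 * n))^-1 * Int F.
Proof.
move=> r0 bF; have mF := bF.1.
have iF := bcs_integrable bF.
rewrite /Int /Rintegral [in LHS]integralE [in RHS]integralE.
have mE : measurable_fun setT (EFin \o (F : BC R n -> R)) by exact/measurable_EFinP.
have E1 : (\int[lebC R n]_z (fun z => (F (r%:C *: (z : Cn) + v))%:E)^\+ z =
   ((r ^+ (2 * n))^-1)%:E * \int[lebC R n]_z ((EFin \o F)^\+ z))%E.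
  rewrite (_ : (fun z => _)^\+%E = (EFin \o F)^\+%E \o (fun z : Cn => r%:C *: z + v)); last by rewrite -funepos_comp.
  exact: (ge0_integral_affC v r0 (measurable_funepos mE)).
have E2 : (\int[lebC R n]_z (fun z => (F (r%:C *: (z : Cn) + v))%:E)^\- z =
   ((r ^+ (2 * n))^-1)%:E * \int[lebC R n]_z ((EFin \o F)^\- z))%E.
  rewrite (_ : (fun z => _)^\-%E = (EFin \o F)^\-%E \o (fun z : Cn => r%:C *: z + v)); last by rewrite -funeneg_comp.
  exact: (ge0_integral_affC v r0 (measurable_funeneg mE)).
rewrite E1 E2.
have f1 := integrable_pos_fin_num measurableT iF.
have f2 := integrable_neg_fin_num measurableT iF.
rewrite -(fineK f1) -(fineK f2) -!EFinM -!EFinB /= mulrBr //.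
Qed.

Lemma Int_translate (v : Cn) F : bcs F -> Int (fun z => F (z + v)) = Int F.
Proof.
move=> bF; have := Int_aff v ltr01 bF; rewrite expr1n invr1 mul1r => <-.
by congr Int; apply/funext => z; rewrite (_ : 1%:C = 1) // scale1r.
Qed.

End CompactSupport.

(** * Compact boxes and integration by parts *)

Section CompactBoxes.
Variables (R : realType) (n : nat).
Local Notation Cn := 'rV[R[i]]_n.
Implicit Types (F G : Cn -> R).

Definition cbox (a : Cn) (r : R) : set Cn :=
  [set z | forall b, `|crd b z - crd b a| <= r].

Lemma closed_cbox a r : closed (cbox a r).
Proof.
rewrite -(setCK (cbox a r)); apply: open_closedC; rewrite openE => z /= zb.
have [b hb] : exists b, r < `|crd b z - crd b a|.
  apply: contrapT => h; apply: zb => b; rewrite leNgt; apply/negP => h'.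
  by apply: h; exists b.
apply/nbhs_boxP; exists (`|crd b z - crd b a| - r); first by rewrite subr_gt0.
move=> w hw wb; have h1 := hw b; have h2 := wb b.
have := ler_normD (crd b z - crd b w) (crd b w - crd b a).
rewrite subrKA [`|crd b z - crd b w|]distrC => h3.
have : `|crd b w - crd b z| + `|crd b w - crd b a| < `|crd b z - crd b a| - r + r by rewrite ltr_leD.
by rewrite subrK ltNge h3.
Qed.

Lemma box_sub_cbox a r : box a r `<=` cbox a r.
Proof. by move=> z h b; exact: ltW. Qed.

Lemma cbox_sub_box a (r s : R) : r < s -> cbox a r `<=` box a s.
Proof. by move=> rs z h b; exact: le_lt_trans (h b) rs. Qed.

Lemma compact_cbox a r : compact (cbox a r).
Proof.
pose S (k : 'I_n) : set R[i] :=
  (fun p : R * R => p.1 +i* p.2) @` (`[crd (k, false) a - r, crd (k, false) a + r] `*`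
     `[crd (k, true) a - r, crd (k, true) a + r]).
have cS k : compact (S k).
  apply: continuous_compact; last by apply: compact_setX; exact: segment_compact.
  apply: continuous_subspaceT => p A /nbhs_ballP[e /= e0 hA].
  have [e1 [e10 eE]] : exists e1 : R, 0 < e1 /\ e = e1%:C.
    move: e0; rewrite ltcE /= => /andP[/eqP h1 h2]; exists (complex.Re e); split=> //.
    by case: e h1 h2 hA => x y /= -> .
  apply/nbhs_ballP; exists (e1 / 2); first by rewrite /= divr_gt0.
  move=> q [/= h1 h2]; apply: hA; rewrite /ball /= eE normc_def ltcR /=.
  rewrite -(@ltr_pXn2r _ 2) // ?nnegrE ?sqrtr_ge0 ?(ltW e10) //.
  rewrite sqr_sqrtr ?addr_ge0 ?sqr_ge0 //.
  have : `|p.1 - q.1| ^+ 2 < (e1 / 2) ^+ 2 by rewrite ltr_pXn2r // ?nnegrE // divr_ge0 // ltW.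
  have : `|p.2 - q.2| ^+ 2 < (e1 / 2) ^+ 2 by rewrite ltr_pXn2r // ?nnegrE // divr_ge0 // ltW.
  rewrite !real_normK ?num_real //; nra.
rewrite (_ : cbox a r = [set v | forall k, S k (v ord0 k)]); first exact: rV_compact.
apply/seteqP; split => [z hz k|z hz [k b]].
  have h1 := hz (k, false); have h2 := hz (k, true).
  exists (crd (k, false) z, crd (k, true) z).
    by rewrite /= !in_itv /= -!ler_distl; split.
  by rewrite /crd /=; case: (z 0 k).
have [p [h1 h2] E] := hz k; move: h1 h2; rewrite /= !in_itv /= -!ler_distl => h1 h2.
by rewrite {1}/crd /= -E /=; case: b.
Qed.

Lemma bounded_cbox F a r : (forall z, cbox a r z -> {for z, continuous F}) ->
  exists2 C : R, 0 < C & forall z, cbox a r z -> `|F z| <= C.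
Proof.
move=> cF.
have cw : {within cbox a r, continuous F}.
  by apply: continuous_in_subspaceT => z; rewrite inE; exact: cF.
have /compact_bounded [M [_ hM]] := continuous_compact cw (@compact_cbox a r).
exists (`|M| + 1) => [|z hz]; first by rewrite ltr_wpDl.
by apply: (hM (`|M| + 1)); [rewrite (le_lt_trans (ler_norm M)) // ltrDl|exists z].
Qed.

Lemma bcs_cont F (M : R) : (forall z, {for z, continuous F}) ->
  (forall z, ~ cbox 0 M z -> F z = 0) -> bcs F.
Proof.
move=> cF sF; have [C C0 hC] := @bounded_cbox F 0 M (fun z _ => cF z).
apply: (@bcs_le _ _ _ (M + 1) C).
- by apply: measurable_cont => z; exact: cF.
- move=> z; have [h|h] := pselect (cbox 0 M z); first exact: hC.
  by rewrite sF // normr0 ltW.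
- move=> z h; apply: sF => h'; apply: h; apply: cbox_sub_box h'; by rewrite ltrDl.
Qed.

Lemma Int_cvg (f_ : nat -> Cn -> R) F (M : R) : 0 < M ->
  (forall k, measurable_fun setT (f_ k : BC R n -> R)) ->
  (forall k z, `|f_ k z| <= M * \1_(box 0 M) z) ->
  (forall z, f_ k z @[k --> \oo] --> F z) ->
  bcs F /\ Int (f_ k) @[k --> \oo] --> Int F.
Proof.
move=> M0 mf hf cf.
have bf k : bcs (f_ k) by split=> //; exists M.
have mF : measurable_fun setT (F : BC R n -> R).
  by apply: (@measurable_fun_cvg _ _ _ _ (fun k => f_ k : BC R n -> R)) => // z _; exact: cf.
have bF : bcs F.
  split=> //; exists M => // z; have cn : `|f_ k z| @[k --> \oo] --> `|F z| by apply: cvg_norm; exact: cf.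
  rewrite -(cvg_lim _ cn) //; apply: limr_le; first exact: (cvgP _ cn).
  by apply: nearW => k; exact: hf.
split=> //.
have bM : bcs (fun z : Cn => M * \1_(box 0 M) z) by apply: bcsZ; exact: bcs_indic_box.
have cvgE z : (f_ k z)%:E @[k --> \oo] --> (F z)%:E by apply: cvg_EFin; [exact: nearW|exact: cf].
have [_ _ h] := @dominated_convergence _ _ _ (lebC R n) setT measurableT
  (fun k z => (f_ k z)%:E) (EFin \o F) (fun z => (M * \1_(box 0 M) z)%:E)
  (fun k => (measurable_EFinP _ _).2 (mf k)) ((measurable_EFinP _ _).2 mF)
  (aeW _ (fun (z : BC R n) _ => cvgE z)) (bcs_integrable bM)
  (aeW _ (fun (z : BC R n) k _ => hf k z)).
by apply: fine_cvg; rewrite fineK //; apply: integrable_fin_num => //; exact: bcs_integrable.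
Qed.

Definition dquot F (v : Cn) (k : nat) (z : Cn) : R :=
  k.+1%:R * (F (z + (k.+1%:R^-1 : R)%:C *: v) - F z).

Lemma dquot_cvg F v z : dir_derivable F v z ->
  dquot F v k z @[k --> \oo] --> rderive F v z.
Proof.
move=> /dir_derivableP /is_derive0P h; apply/cvgrPdist_le => e e0.
have [d d0 hd] := h e e0.
exists (Num.truncn d^-1) => // k /= hk.
have k0 : (0 : R) < k.+1%:R by [].
have kd : `|k.+1%:R^-1| < d.
  rewrite ger0_norm ?invr_ge0 // -[ltRHS]invrK ltf_pV2 ?posrE ?invr_gt0 //.
  by apply: (lt_le_trans (truncnS_gt _)); rewrite ler_nat ltnS.
have := hd _ kd; rewrite ray0 => h1.
rewrite distrC /dquot.
have xr : `|k.+1%:R^-1 : R| = k.+1%:R^-1 by rewrite ger0_norm // invr_ge0.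
move: h1; rewrite xr; move: (F _) k0; set x : R := k.+1%:R => A k0 h1.
have -> : x * (A - F z) - rderive F v z = x * (A - F z - x^-1 * rderive F v z).
  by rewrite [RHS]mulrBr mulrA divff ?mul1r // gt_eqF.
by rewrite normrM gtr0_norm // mulrC -ler_pdivlMr.
Qed.

Lemma bcs_shift F v : bcs F -> bcs (fun z => F (z + v)).
Proof.
move=> bF; have [M [M0 h1 h2]] := bcsP bF.
apply: (@bcs_le _ _ _ (M + \sum_b `|crd b v|) M) => //.
- have := @measurable_affC R n 1 v.
  under eq_fun do rewrite (_ : 1%:C = 1) // scale1r.
  by move=> /(measurableT_comp bF.1).
move=> z zb; apply: h2 => h; apply: zb => b; rewrite crd0 subr0.
have := h b; rewrite crd0 subr0 crdD => h'.
have := ler_normD (crd b z + crd b v) (- crd b v); rewrite addrK normrN => /le_lt_trans; apply.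
by rewrite ltr_leD // (bigD1 b) //= lerDl sumr_ge0.
Qed.

Lemma dquot_bcs F v : bcs F -> (forall z, dir_derivable F v z) ->
  (exists C, forall z, `|rderive F v z| <= C) ->
  exists2 M : R, 0 < M & forall k, measurable_fun setT (dquot F v k : BC R n -> R) /\
    forall z, `|dquot F v k z| <= M * \1_(box 0 M) z.
Proof.
move=> bF dF [C hC]; have [M [M0 h1 h2]] := bcsP bF.
pose V := \sum_b `|crd b v|.
have V0 : 0 <= V by apply: sumr_ge0.
exists (M + V + `|C|) => [|k].
  by rewrite -addrA ltr_pwDl // addr_ge0.
have k0 : (0 : R) < k.+1%:R^-1 by rewrite invr_gt0.
split.
  apply: measurable_funM => //; apply: measurable_funB; last exact: bF.1.
  exact: (bcs_shift _ bF).1.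
move=> z; have [zb|zb] := pselect (box 0 (M + V + `|C|) z); last first.
  rewrite indicE memNset // mulr0 /dquot !h2 ?subrr ?mulr0 ?normr0 //.
    move=> h; apply: zb => b; apply: lt_le_trans (h b) _.
    by rewrite -addrA lerDl addr_ge0.
  move=> h; apply: zb => b; have := h b; rewrite !crd0 !subr0 crdD crdZ => h'.
  have := ler_normD (crd b z + k.+1%:R^-1 * crd b v) (- (k.+1%:R^-1 * crd b v)).
  rewrite addrK normrN => /le_lt_trans; apply; rewrite -addrA ltr_leD //.
  apply: (@le_trans _ _ V); last by rewrite lerDl.
  apply: (@le_trans _ _ `|crd b v|); last by rewrite /V (bigD1 b) //= lerDl sumr_ge0.
  rewrite normrM gtr0_norm // ler_piMl // invf_le1 // ler1n //.
rewrite indicE mem_set // mulr1 /dquot.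
have [c _ ->] := ray_MVT k0 (fun s _ _ => dF (z + s%:C *: v)).
rewrite mulrA divff ?gt_eqF // mul1r.
by apply: (le_trans (hC _)); apply: (le_trans (ler_norm C)); rewrite lerDr addr_ge0 // ltW.
Qed.

(** Translation invariance makes the integral of every difference quotient vanish, and the mean
    value theorem dominates the quotients. Boundedness of the derivative replaces its continuity, in
    view of components of holomorphic maps, which are only known to be differentiable. *)
Lemma Int_rderive_bnd F v : bcs F -> (forall z, dir_derivable F v z) ->
  (exists C, forall z, `|rderive F v z| <= C) ->
  bcs (rderive F v) /\ Int (rderive F v) = 0.
Proof.
move=> bF dF hC; have [M M0 hM] := dquot_bcs bF dF hC.
have [|bd cd] := Int_cvg M0 (fun k => (hM k).1) (fun k => (hM k).2) (F := rderive F v).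
  by move=> z; apply: dquot_cvg.
split=> //; apply: (cvg_unique _ cd) => //.
rewrite (_ : (fun k => _) = fun=> 0); first exact: cvg_cst.
apply/funext => k; rewrite /dquot IntZ; last by apply: bcsD; [exact: bcs_shift|exact: bcsN].
by rewrite IntB // ?Int_translate ?subrr ?mulr0 //; exact: bcs_shift.
Qed.

Definition csupp (M : R) F := forall z, ~ cbox 0 M z -> F z = 0.

Lemma csupp_rderive M F v : csupp M F -> csupp M (rderive F v).
Proof.
move=> sF z zb; have oC : open (~` cbox (0 : Cn) M) by apply: closed_openC; exact: closed_cbox.
have [|_ ->] := rderive_ext (f := fun=> 0) (g := F) (v := v) oC _ zb (rderive_cst 0 v z).1.
  by move=> w; rewrite inE => /sF ->.
by have [_ ->] := rderive_cst (0 : R) v z.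
Qed.

Lemma bcs_Ck k M F : Ck k setT F -> csupp M F -> bcs F.
Proof. by move=> kF; apply: bcs_cont => z; exact: (Ck_cont kF). Qed.

Lemma bcs_rderive k M F v : Ck k.+1 setT F -> csupp M F -> bcs (rderive F v).
Proof. by move=> kF /(csupp_rderive v); apply: bcs_Ck; exact: (Ck_rderive v kF). Qed.

Lemma Int_rderive k M F v : Ck k.+1 setT F -> csupp M F -> Int (rderive F v) = 0.
Proof.
move=> kF sF; have [|_ //] := Int_rderive_bnd (bcs_Ck kF sF) (fun z => Ck_der v kF (I : setT z)).
by have [C [_ h _]] := bcsP (bcs_rderive v kF sF); exists C.
Qed.

(** A translation by [y] consists of [k + 1] translations by [y / (k + 1)], each of the same cost by
    invariance; the total is the L^1 norm of a difference quotient, and [k] tends to infinity. *)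
Lemma Int_translate_diff M F y : Ck 1 setT F -> csupp M F ->
  Int (fun z => `|F (z + y) - F z|) <= Int (fun z => `|rderive F y z|).
Proof.
move=> kF sF; have bF := bcs_Ck kF sF.
have dF z := Ck_der y kF (I : setT z).
have hB : exists C, forall z, `|rderive F y z| <= C.
  by have [C [_ h _]] := bcsP (bcs_rderive y kF sF); exists C.
have [N N0 hN] := dquot_bcs bF dF hB.
have [k|k z|z|bd cd] := @Int_cvg (fun k z => `|dquot F y k z|) (fun z => `|rderive F y z|) N N0.
- by apply: measurableT_comp => //; exact: (hN k).1.
- by rewrite normr_id; exact: (hN k).2.
- by apply: cvg_norm; exact: dquot_cvg.
have bdf w : bcs (fun z => `|F (z + w) - F z|).
  by apply: bcs_abs; apply: bcsD; [exact: bcs_shift|exact: bcsN].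
have step (w : Cn) (m : nat) : Int (fun z => `|F (z + m%:R%:C *: w) - F z|) <= m%:R * Int (fun z => `|F (z + w) - F z|).
  elim: m => [|m IH].
    rewrite mul0r (_ : (fun z => _) = fun=> 0) ?Int0 //.
    by apply/funext => z; rewrite ray0 subrr normr0.
  rewrite -natr1 mulrDl mul1r -[X in _ <= _ + X](Int_translate (m%:R%:C *: w) (bdf w)).
  apply: (@le_trans _ _ (Int (fun z => `|F (z + m%:R%:C *: w) - F z| + `|F (z + m%:R%:C *: w + w) - F (z + m%:R%:C *: w)|))).
    apply: Int_le; [exact: bdf|apply: bcsD; first exact: bdf|].
      exact: (bcs_shift (m%:R%:C *: w) (bdf w)).
    move=> z; rewrite rmorphD /= scalerDl (_ : 1%:C = 1) // scale1r addrA.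
    have tri (a b c : R) : `|b - c| <= `|a - c| + `|b - a|.
      by rewrite [leRHS]addrC; exact: ler_distD.
    exact: tri.
  rewrite IntD; [by rewrite lerD2r|exact: bdf|].
  exact: (bcs_shift (m%:R%:C *: w) (bdf w)).
rewrite -(cvg_lim _ cd) //; apply: limr_ge; first exact: (cvgP _ cd).
apply: nearW => k; pose w : Cn := (k.+1%:R^-1 : R)%:C *: y.
have Ey : (k.+1%:R : R)%:C *: w = y.
  by rewrite /w scalerA -rmorphM /= divff // scale1r.
have := step w k.+1; rewrite Ey => /le_trans; apply.
rewrite -IntZ; last exact: bdf.
apply: Int_le; [by apply: bcsZ; exact: bdf|split; last by exists N => // z; rewrite normr_id; exact: (hN k).2|].
  by apply: measurableT_comp => //; exact: (hN k).1.
by move=> z; rewrite /dquot normrM ger0_norm.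
Qed.

Definition zext (D : set Cn) F (z : Cn) : R := if `[< D z >] then F z else 0.

Lemma zextT D F z : D z -> zext D F z = F z.
Proof. by move=> Dz; rewrite /zext asboolT. Qed.

Lemma zextF D F z : ~ D z -> zext D F z = 0.
Proof. by move=> Dz; rewrite /zext asboolF. Qed.

(** The whole space is covered by the open sets [D] and the complement of [K], and the extension is
    regular on each of them. *)
Lemma Ck_zext k D K F : open D -> closed K -> K `<=` D ->
  (forall z, D z -> ~ K z -> F z = 0) -> Ck k D F -> Ck k setT (zext D F).
Proof.
move=> oD cK KD F0 kF; have oK : open (~` K) by apply: closed_openC.
have -> : setT = D `|` ~` K.
  by apply/esym/seteqP; split=> // z _; have [/KD|] := pselect (K z); [left|right].
apply: CkU.
  by apply: Ck_ext kF => // z; rewrite inE => Dz; rewrite zextT.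
apply: (Ck_ext (f := fun=> 0)) => //; last exact: Ck_cst.
move=> z; rewrite inE => nK; have [Dz|nD] := pselect (D z).
  by rewrite zextT ?F0.
by rewrite zextF.
Qed.

Lemma rderive_zext D F v z : open D -> D z -> dir_derivable F v z ->
  rderive (zext D F) v z = rderive F v z.
Proof.
move=> oD Dz dF; have [|_ ->] // := rderive_ext (f := F) (g := zext D F) (v := v) oD _ Dz dF.
by move=> w; rewrite inE => Dw; rewrite zextT.
Qed.

End CompactBoxes.

(** * Pfaffians and (1,1)-forms *)

Section Pfaffian.
Variables (R : realFieldType) (n : nat).
Local Notation I := ('I_n * bool)%type.

(** For antisymmetric [A] this is [2^n n!] times the usual Pfaffian. *)
Definition pf (A : I -> I -> R) : R :=
  \sum_(s : {perm I}) (-1) ^+ s * \prod_(k < n) A (s (k, false)) (s (k, true)).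

Definition detI (P : I -> I -> R) : R :=
  \sum_(s : {perm I}) (-1) ^+ s * \prod_x P (s x) x.

Lemma prod_pair_bool (F : I -> R) :
  \prod_b F b = \prod_k (F (k, false) * F (k, true)).
Proof.
rewrite (eq_bigr (fun b => F (b.1, b.2))); last by case.
rewrite -(pair_big xpredT xpredT (fun k b => F (k, b))) /=.
by apply: eq_bigr => k _; rewrite big_bool /= mulrC.
Qed.

(** If [g] repeats a value, exchanging the two positions changes the sign of the sum and nothing
    else, so the sum is 0; otherwise [g] merely permutes the columns. *)
Lemma detI_col (P : I -> I -> R) (g : I -> I) :
  \sum_(s : {perm I}) (-1) ^+ s * \prod_x P (s x) (g x) =
  if [pick t : {perm I} | [forall x, t x == g x]] is Some t then (-1) ^+ t * detI P else 0.
Proof.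
case: pickP => [t /forallP ht|ht].
  rewrite /detI mulr_sumr (reindex_inj (mulgI t)) /=; apply: eq_bigr => s _.
  rewrite odd_permM signr_addb -mulrA; congr (_ * (_ * _)).
  rewrite [RHS](reindex_inj (@perm_inj _ t)) /=; apply: eq_bigr => x _.
  by rewrite permM (eqP (ht x)).
have [x [y [xy gxy]]] : exists x y, x != y /\ g x = g y.
  apply: contrapT => h; have gi : injective g.
    by move=> x y gxy; apply/eqP; apply: contrapT => /negP xy; apply: h; exists x, y.
  by have := ht (perm gi); move/negP; apply; apply/forallP => x; rewrite permE.
apply/eqP; rewrite -[_ == 0](mulrn_eq0 _ 2) mulr2n; apply/eqP.
rewrite [X in X + _](reindex_inj (mulgI (tperm x y))) /= -big_split /=.
apply: big1 => s _; rewrite odd_permM signr_addb odd_tperm xy expr1 -mulrA mulN1r.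
rewrite (_ : \prod_x0 P ((tperm x y * s)%g x0) (g x0) = \prod_x P (s x) (g x)).
  by rewrite addNr.
rewrite (reindex_inj (@perm_inj _ (tperm x y))) /=; apply: eq_bigr => z _.
rewrite permM tpermK; congr P.
by case: tpermP => [->|->|].
Qed.

(** This is [Pf(P A P^T) = det P Pf A]. After expansion the terms are indexed by arbitrary choices
    of columns, and [detI_col] keeps the bijective ones only. *)
Lemma pf_change (P A : I -> I -> R) :
  pf (fun i j => \sum_x \sum_y P i x * P j y * A x y) = detI P * pf A.
Proof.
rewrite /pf.
pose toI (g : {ffun 'I_n -> I * I}) (x : I) : I := if x.2 then (g x.1).2 else (g x.1).1.
transitivity (\sum_(g : {ffun 'I_n -> I * I}) (\prod_k A (g k).1 (g k).2) *
   \sum_(s : {perm I}) (-1) ^+ s * \prod_x P (s x) (toI g x)).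
  under eq_bigr => s _.
    under eq_bigr => k _ do rewrite pair_big /=.
    rewrite bigA_distr_bigA /= mulr_sumr; over.
  rewrite exchange_big /=; apply: eq_bigr => g _; rewrite mulr_sumr.
  apply: eq_bigr => s _; rewrite mulrCA; congr (_ * _).
  by rewrite prod_pair_bool -big_split /=; apply: eq_bigr => k _; rewrite mulrC.
under eq_bigr do rewrite detI_col.
rewrite mulr_sumr.
rewrite (bigID (fun g : {ffun 'I_n -> I * I} => [exists t : {perm I}, [forall x, t x == toI g x]])) /=.
rewrite [X in _ + X]big1 ?addr0; last first.
  move=> g /negP hg; case: pickP => [t ht|_]; last by rewrite mulr0.
  by case: hg; apply/existsP; exists t.
pose ofP (t : {perm I}) : {ffun 'I_n -> I * I} := [ffun k => (t (k, false), t (k, true))].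
pose toP (g : {ffun 'I_n -> I * I}) : {perm I} :=
  if [pick t : {perm I} | [forall x, t x == toI g x]] is Some t then t else 1%g.
have toPK t : toP (ofP t) = t.
  rewrite /toP; case: pickP => [t' /forallP ht|/(_ t)/negP[]].
    apply/permP => -[k b]; rewrite (eqP (ht (k, b))) /toI /ofP ffunE /=.
    by case: b.
  by apply/forallP => -[k b]; rewrite /toI /ofP ffunE /=; case: b.
have toIof t x : toI (ofP t) x = t x by case: x => k b; rewrite /toI /ofP ffunE /=; case: b.
rewrite (reindex_onto ofP toP) /=; last first.
  move=> g /existsP[t ht]; rewrite /toP; case: pickP => [t' /forallP ht'|/(_ t)]; last by rewrite ht.
  apply/ffunP => k; rewrite /ofP ffunE (eqP (ht' (k, false))) (eqP (ht' (k, true))).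
  by rewrite /toI /=; case: (g k).
apply: eq_big => [t|t _].
  rewrite toPK eqxx andbT; apply/existsP; exists t; apply/forallP => x.
  by rewrite toIof.
case: pickP => [t' /forallP ht|/(_ t)/negP[]]; last first.
  by apply/forallP => x; rewrite toIof.
have -> : t' = t by apply/permP => x; rewrite (eqP (ht x)) toIof.
rewrite mulrC [_ * detI P]mulrC -mulrA; congr (_ * (_ * _)).
by apply: eq_bigr => k _; rewrite /ofP ffunE.
Qed.

(** Matrix of [sum_k dx_k /\ dy_k] in the real basis. *)
Definition std_form (u w : I) : R := (u.1 == w.1)%:R * (w.2%:R - u.2%:R).

(** A permutation contributes only if it sends each pair [(k, false)], [(k, true)] to the two
    indices of one coordinate; then each [d k] occurs exactly once. *)
Lemma pf_diag (d : 'I_n -> R) :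
  pf (fun u w => d u.1 * std_form u w) = (\prod_k d k) * pf std_form.
Proof.
rewrite /pf mulr_sumr; apply: eq_bigr => s _.
rewrite big_split /= mulrCA.
have [/forallP h|/forallPn[k hk]] := boolP [forall k : 'I_n, (s (k, false)).1 == (s (k, true)).1].
  congr (_ * _); have fi : injective (fun k : 'I_n => (s (k, false)).1).
    move=> k l /= E; apply/eqP; apply: contraT => kl.
    have Ek := eqP (h k); have El := eqP (h l).
    have inj x y : s x = s y -> x = y := @perm_inj _ s x y.
    case: (s (k, false)) (s (k, true)) (s (l, false)) (s (l, true)) Ek El E
      (inj (k, false) (k, true)) (inj (k, false) (l, false)) (inj (k, false) (l, true))
      (inj (k, true) (l, false)) (inj (k, true) (l, true)) (inj (l, false) (l, true))
      => [m b] [? b1] [? b2] [? b3] /= <- <- <- i1 i2 i3 i4 i5 i6.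
    move: kl; case: b b1 b2 b3 i1 i2 i3 i4 i5 i6 => [] [] [] [] i1 i2 i3 i4 i5 i6;
    try (by have [] := i1 erefl); try (by have [->] := i2 erefl; rewrite eqxx);
    try (by have [->] := i3 erefl; rewrite eqxx); try (by have [->] := i4 erefl; rewrite eqxx);
    try (by have [->] := i5 erefl; rewrite eqxx); by have [] := i6 erefl.
  by rewrite [RHS](reindex_inj fi).
have -> : \prod_k0 std_form (s (k0, false)) (s (k0, true)) = 0.
  by rewrite (bigD1 k) //= /std_form (negbTE hk) !mul0r.
by rewrite !mulr0.
Qed.

End Pfaffian.

Section Jform.
Variables (R : realType) (n : nat).
Local Notation Cn := 'rV[R[i]]_n.
Implicit Types a : Cn -> Cn -> R.

(** Real forms of type (1,1) at one point. *)
Definition Jform a := [/\ forall (t : R) (u v w : Cn), a (t%:C *: u + v) w = t * a u w + a v w,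
  forall v w : Cn, a v w = - a w v & forall v w : Cn, a ('i *: v) ('i *: w) = a v w].

Lemma Jform_nonneg_lin a b (s t : R) : Jform a -> Jform b -> Jform (fun v w => s * a v w + t * b v w).
Proof.
move=> [a1 a2 a3] [b1 b2 b3]; split=> [x u v w|v w|v w]; rewrite ?a1 ?b1 ?a3 ?b3 //; last first.
  by rewrite a2 b2; ring.
by ring.
Qed.

Section One.
Variable a : Cn -> Cn -> R.
Hypothesis ja : Jform a.

(** The Hermitian form attached to a real (1,1)-form, conjugate linear in its first argument. *)
Definition herm (v w : Cn) : R[i] := a v ('i *: w) +i* a v w.

Lemma Jform0 v : a 0 v = 0.
Proof.
have [a1 _ _] := ja; have := a1 0 0 0 v; rewrite mul0r add0r => h.
by have := a1 1 0 0 v; rewrite scaler0 addr0 mul1r => /eqP; rewrite -subr_eq0 opprD addrA subrr add0r oppr_eq0 => /eqP.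
Qed.

Lemma Jform_i (v w : Cn) : a ('i *: v) w = - a v ('i *: w).
Proof.
have [a1 a2 a3] := ja; rewrite -a3 iiv -[- v]addr0.
rewrite (_ : - v + 0 = (-1 : R)%:C *: v + 0); last by rewrite rmorphN1 scaleN1r.
by rewrite a1 Jform0 addr0 mulN1r.
Qed.

Lemma herm_sym (v w : Cn) : herm v w = Num.conj (herm w v).
Proof.
have [a1 a2 a3] := ja; rewrite /herm (a2 w v) (a2 w) Jform_i opprK.
by apply/eqP; rewrite eq_complex /= opprK !eqxx.
Qed.

Lemma hermZr (z : R[i]) (v w : Cn) : herm (z *: v) w = Num.conj z * herm v w.
Proof.
have [a1 a2 a3] := ja; case: z => x y.
have -> : (x +i* y) *: v = x%:C *: v + (y%:C *: ('i *: v) + 0).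
  rewrite addr0 scalerA -scalerDl; congr (_ *: v).
  by apply/eqP; rewrite eq_complex /=; apply/andP; split; apply/eqP; ring.
rewrite /herm !a1 !Jform0 a3 Jform_i.
by apply/eqP; rewrite eq_complex /=; apply/andP; split; apply/eqP; ring.
Qed.

Lemma hermD (u v w : Cn) : herm (u + v) w = herm u w + herm v w.
Proof.
have [a1 a2 a3] := ja; have aD x : a (u + v) x = a u x + a v x.
  by have := a1 1 u v x; rewrite mul1r scale1r.
by rewrite /herm !aD.
Qed.

Lemma herm0 w : herm 0 w = 0.
Proof. by rewrite /herm !Jform0. Qed.

Lemma herm_expand (v w : Cn) : herm v w =
  \sum_k \sum_l Num.conj (v 0 k) * w 0 l * herm (delta_mx 0 k) (delta_mx 0 l).
Proof.
have suml (I : Type) (r : seq I) (F : I -> Cn) x : herm (\sum_(i <- r) F i) x = \sum_(i <- r) herm (F i) x.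
  by apply: (big_morph (fun v => herm v x) (fun u v => hermD u v x)); exact: herm0.
rewrite {1}(row_sum_delta v) suml; apply: eq_bigr => k _.
rewrite hermZr herm_sym {1}(row_sum_delta w) suml rmorph_sum mulr_sumr /=; apply: eq_bigr => l _.
by rewrite hermZr rmorphM /= conjCK mulrA; congr (_ * _); apply/esym/herm_sym.
Qed.

End One.

Definition std_J (v w : Cn) : R := \sum_x \sum_y crd x v * crd y w * std_form R x y.

(** The top power of the standard form [std_J], by which products of eigenvalues are converted into
    top powers. *)
Definition cn : R := (2 ^+ n)^-1 * pf (@std_form R n).

Lemma wedge_topE a : wedge_top a = (2 ^+ n)^-1 * pf (fun i j => a (real_basis R i) (real_basis R j)).
Proof. by []. Qed.

Lemma sum_std_form (D : 'I_n -> R) (v w : Cn) :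
  \sum_x \sum_y crd x v * crd y w * (D x.1 * std_form R x y) =
  \sum_m D m * complex.Im (Num.conj (v 0 m) * w 0 m).
Proof.
rewrite sum_pair_bool; apply: eq_bigr => m _; rewrite !sum_pair_bool -big_split /= (bigD1 m) //= big1.
  rewrite /std_form /crd /= eqxx !mul1r addr0.
  case: (v 0 m) (w 0 m) => x y [x' y'] /=; ring.
by move=> l lm; rewrite /std_form /= eq_sym (negbTE lm) !mul0r !mulr0 !addr0.
Qed.

(** Unitary diagonalization of the Hermitian matrix of [a]: [D] are its eigenvalues, [f] unit
    eigenvectors, and [T] gives the coordinates in that basis. *)
Lemma Jform_spectral a : Jform a -> exists (D : 'I_n -> R) (T : Cn -> Cn) (f : 'I_n -> Cn),
  [/\ wedge_top a = cn * \prod_m D m,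
      forall v, nsq (T v) = nsq v,
      forall v, a v ('i *: v) = \sum_m D m * (crd (m, false) (T v) ^+ 2 + crd (m, true) (T v) ^+ 2),
      forall m, nsq (f m) = 1 & forall m, D m = a (f m) ('i *: f m)].
Proof.
move=> ja; have [a1 a2 a3] := ja.
pose H : 'M[R[i]]_n := \matrix_(k, l) herm a (delta_mx 0 k) (delta_mx 0 l).
have hH : H \is hermsymmx.
  apply/is_hermitianmxP; rewrite expr0 scale1r; apply/matrixP => k l.
  by rewrite !mxE (herm_sym ja).
have /orthomx_spectralP HE := hermitian_normalmx hH.
pose U := spectralmx H; pose d := spectral_diag H.
have uU : U \is unitarymx := spectral_unitarymx H.
have UU : U *m map_mx Num.conj U^T = 1%:M by apply/unitarymxP.
have UU' : map_mx Num.conj U^T *m U = 1%:M by apply: mulmx1C.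
pose T (v : Cn) : Cn := v *m U^T.
have TE v m : T v 0 m = \sum_j v 0 j * U m j.
  by rewrite /T mxE; apply: eq_bigr => j _; rewrite mxE.
have sumT (v w : Cn) : \sum_m Num.conj (T v 0 m) * T w 0 m = \sum_m Num.conj (v 0 m) * w 0 m.
  transitivity (\sum_k \sum_l Num.conj (v 0 k) * w 0 l * (map_mx Num.conj U^T *m U) k l).
    under eq_bigr => m _.
      rewrite !TE rmorph_sum mulr_suml; under eq_bigr do rewrite mulr_sumr; over.
    rewrite exchange_big; apply: eq_bigr => k _; rewrite exchange_big; apply: eq_bigr => l _.
    rewrite mxE mulr_sumr; apply: eq_bigr => m _; rewrite rmorphM !mxE /=.
    by rewrite mulrACA [Num.conj (U m k) * _]mulrC; ring.
  apply: eq_bigr => k _; rewrite UU' (bigD1 k) //= mxE eqxx mulr1 big1 ?addr0 // => l lk.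
  by rewrite mxE eq_sym (negbTE lk) mulr0.
have hE (v w : Cn) : herm a v w = \sum_m d 0 m * (Num.conj (T v 0 m) * T w 0 m).
  rewrite herm_expand //.
  transitivity (\sum_k \sum_l Num.conj (v 0 k) * w 0 l * H k l).
    by apply: eq_bigr => k _; apply: eq_bigr => l _; rewrite mxE.
  under [RHS]eq_bigr => m _.
    rewrite !TE rmorph_sum mulr_suml mulr_sumr; under eq_bigr do rewrite !mulr_sumr; over.
  rewrite [RHS]exchange_big; apply: eq_bigr => k _; rewrite [RHS]exchange_big; apply: eq_bigr => l _.
  rewrite HE -/U -/d invmx_unitary // mxE mulr_sumr; apply: eq_bigr => m _.
  rewrite mul_mx_diag !mxE rmorphM /=; ring.
pose f m : Cn := row m (map_mx Num.conj U).
have Tf m j : T (f m) 0 j = (j == m)%:R.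
  have := UU => /matrixP /(_ j m); rewrite [X in X = _]mxE [X in _ = X]mxE => <-.
  by rewrite TE; apply: eq_bigr => l _; rewrite !mxE mulrC.
pose D m := a (f m) ('i *: f m).
have dE m : d 0 m = (D m)%:C.
  have := hE (f m) (f m); rewrite (bigD1 m) //= big1 ?addr0; last first.
    by move=> j jm; rewrite Tf (negbTE jm) !mulr0.
  rewrite !Tf eqxx rmorph1 !mulr1 => <-; rewrite /herm -/(D m).
  have aff : a (f m) (f m) = 0 by have := a2 (f m) (f m); lra.
  by rewrite aff.
have hnsq (v : Cn) : (nsq v)%:C = \sum_m Num.conj (v 0 m) * v 0 m.
  rewrite /nsq sum_pair_bool rmorph_sum; apply: eq_bigr => m _; rewrite /crd /=.
  by case: (v 0 m) => x y; apply/eqP; rewrite eq_complex /=; apply/andP; split; apply/eqP; ring.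
have aE (v w : Cn) : a v w = \sum_x \sum_y crd x (T v) * crd y (T w) * (D x.1 * std_form R x y).
  rewrite sum_std_form -[LHS]/(complex.Im (herm a v w)) hE raddf_sum; apply: eq_bigr => m _.
  rewrite dE; case: (Num.conj _ * _) => x y /=; ring.
have aE1 (v w : Cn) : std_J v w = \sum_x \sum_y crd x (T v) * crd y (T w) * (1 * std_form R x y).
  rewrite (sum_std_form (fun=> 1)) /std_J.
  under eq_bigr do under eq_bigr do rewrite -[std_form _ _ _]mul1r.
  rewrite (sum_std_form (fun=> 1)).
  under eq_bigr do rewrite mul1r; under [RHS]eq_bigr do rewrite mul1r.
  by rewrite -!raddf_sum sumT.
exists D, T, f; split.
- rewrite wedge_topE.
  have E1 : pf (fun i j => a (real_basis R i) (real_basis R j)) =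
      detI (fun i x => crd x (T (real_basis R i))) * ((\prod_m D m) * pf (@std_form R n)).
    by rewrite -pf_diag -pf_change; congr pf; apply/funext => i; apply/funext => j; rewrite aE.
  (* The real determinant of [T] is not evaluated: as [T] preserves the standard form, this
     determinant times the Pfaffian of the form is that Pfaffian again, which suffices. *)
  have E2 : pf (@std_form R n) = detI (fun i x => crd x (T (real_basis R i))) * pf (@std_form R n).
    have E3 : @std_form R n = fun i j => std_J (real_basis R i) (real_basis R j).
      apply/funext => i; apply/funext => j; rewrite /std_J (bigD1 i) //= [X in _ + X]big1 ?addr0.
        rewrite (bigD1 j) //= [X in _ + X]big1 ?addr0; first by rewrite !crd_basis !eqxx !mul1r.
        by move=> l lj; rewrite (@crd_basis R n l j) (negbTE lj) mulr0 mul0r.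
      move=> l li; apply: big1 => x _; by rewrite (@crd_basis R n l i) (negbTE li) !mul0r.
    rewrite -pf_change {1}E3; congr pf; apply/funext => i; apply/funext => j; rewrite aE1.
    by apply: eq_bigr => x _; apply: eq_bigr => y _; rewrite mul1r.
  rewrite E1 /cn [in RHS]E2; move: (pf _) (detI _) (\prod__ _) => A B C; ring.
- by move=> v; apply: (@complexI R); rewrite /= !hnsq sumT.
- move=> v; rewrite -[LHS]/(complex.Re (herm a v v)) hE raddf_sum; apply: eq_bigr => m _.
  rewrite dE /crd; case: (T v 0 m) => x y /=; ring.
- move=> m; apply: (@complexI R); rewrite /= hnsq -sumT (bigD1 m) //= big1 ?addr0.
    by rewrite Tf eqxx rmorph1 mulr1.
  by move=> j jm; rewrite Tf (negbTE jm) mulr0.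
- by [].
Qed.

Lemma Jform_lower a c : Jform a -> (forall v, c * nsq v <= a v ('i *: v)) ->
  0 <= c -> 0 <= cn -> cn * c ^+ n <= wedge_top a.
Proof.
move=> ja h c0 cn0; have [D [T [f [-> _ _ hf hD]]]] := Jform_spectral ja.
apply: ler_wpM2l => //; rewrite -[X in _ ^+ X]card_ord -prodr_const.
by apply: ler_prod => m _; rewrite c0 /= hD -[leLHS]mulr1 -(hf m).
Qed.

(** Eigenvectors take the place of the compactness of the sphere: a lower bound on [n] unit vectors
    holds in all directions. *)
Lemma Jform_diag_lower a : Jform a -> exists f : 'I_n -> Cn, (forall m, nsq (f m) = 1) /\
  forall c, (forall m, c <= a (f m) ('i *: f m)) -> forall v, c * nsq v <= a v ('i *: v).
Proof.
move=> ja; have [D [T [f [_ hT hv hf hD]]]] := Jform_spectral ja.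
exists f; split=> // c hc v; rewrite hv -hT /nsq sum_pair_bool mulr_sumr; apply: ler_sum => m _.
by apply: ler_wpM2r; [rewrite addr_ge0 ?sqr_ge0|rewrite hD].
Qed.

Lemma nsq1_neq0 (v : Cn) : nsq v = 1 -> v != 0.
Proof.
move=> h; apply/eqP => v0; move: h; rewrite v0 /nsq big1 => [/eqP|b _]; last by rewrite crd0 expr0n.
by rewrite eq_sym oner_eq0.
Qed.

Lemma finmin_gt0 m (F : 'I_m -> R) : (forall i, 0 < F i) -> exists2 c, 0 < c & forall i, c <= F i.
Proof.
move=> h; exists (\big[Order.min/1]_i F i); first by apply: lt_bigmin => //.
by move=> i; apply: bigmin_le_cond.
Qed.

Lemma Jform_coercive a : Jform a -> (forall v, v != 0 -> 0 < a v ('i *: v)) ->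
  exists2 c, 0 < c & forall v, c * nsq v <= a v ('i *: v).
Proof.
move=> ja h; have [f [hf hc]] := Jform_diag_lower ja.
have [c c0 cf] := finmin_gt0 (fun m => h _ (nsq1_neq0 (hf m))).
by exists c => //; exact: hc.
Qed.

(** No eigenvalue can vanish. Where the equation holds this upgrades nonnegativity to definiteness,
    so that positivity becomes a closed condition. *)
Lemma Jform_nondeg a : Jform a -> (forall v, 0 <= a v ('i *: v)) -> wedge_top a != 0 ->
  exists2 c, 0 < c & forall v, c * nsq v <= a v ('i *: v).
Proof.
move=> ja h0; have [D [T [f [-> hT hv hf hD]]]] := Jform_spectral ja.
rewrite mulf_eq0 negb_or => /andP[_ /prodf_neq0 hn].
have [c c0 cD] : exists2 c, 0 < c & forall m, c <= D m.
  by apply: finmin_gt0 => m; rewrite lt_def hn //= hD.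
exists c => // v; rewrite hv -hT /nsq sum_pair_bool mulr_sumr; apply: ler_sum => m _.
by apply: ler_wpM2r; rewrite ?addr_ge0 ?sqr_ge0.
Qed.

(* That the standard volume [cn] is positive is not computed: it is read off
   from any positive form with positive top power, such as the one provided by
   the equation at a minimum point. *)
Lemma cn_gt0 a : Jform a -> (forall v, 0 <= a v ('i *: v)) -> 0 < wedge_top a -> 0 < cn.
Proof.
move=> ja h; have [D [T [f [-> hT hv hf hD]]]] := Jform_spectral ja.
have p0 : 0 <= \prod_m D m by apply: prodr_ge0 => m _; rewrite hD.
move=> h1; rewrite ltNge; apply/negP => c0.
by have := mulr_le0_ge0 c0 p0; rewrite leNgt h1.
Qed.

End Jform.

(** * Stokes' theorem for top powers of closed forms *)

Section NullLagrangian.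
Variables (R : realType) (n : nat).
Local Notation Cn := 'rV[R[i]]_n.
Local Notation I := ('I_n * bool)%type.
Local Notation "'rb' b" := (@real_basis R n b) (at level 10).

Lemma rderive_prod (J : eqType) D (r : seq J) (P : pred J) (F : J -> Cn -> R) (v z : Cn) :
  open D -> uniq r -> (forall k, Ck 1 D (F k)) -> D z ->
  rderive (fun x => \prod_(k <- r | P k) F k x) v z =
  \sum_(l <- r | P l) rderive (F l) v z * \prod_(k <- r | P k && (k != l)) F k z.
Proof.
move=> oD + kF Dz; elim: r => [|j r IH] /=.
  move=> _; rewrite big_nil -[RHS](rderive_cst (1 : R) v z).2.
  by apply: eq_rderive => x; rewrite big_nil.
move=> /andP[jr ur]; rewrite big_cons.
have tail l : l \in r -> \prod_(k <- j :: r | P k && (k != l)) F k z =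
    (if P j then F j z else 1) * \prod_(k <- r | P k && (k != l)) F k z.
  move=> lr; rewrite big_cons (_ : j != l) ?andbT; last by apply: contraNneq jr => ->.
  by case: (P j); rewrite ?mul1r.
have S : \sum_(l <- r | P l) rderive (F l) v z * \prod_(k <- j :: r | P k && (k != l)) F k z =
    (if P j then F j z else 1) * rderive (fun x => \prod_(k <- r | P k) F k x) v z.
  rewrite IH // mulr_sumr [LHS]big_seq_cond [RHS]big_seq_cond; apply: eq_bigr => l /andP[lr _].
  by rewrite tail // mulrCA.
rewrite S; case: ifP => Pj; last first.
  by rewrite Pj mul1r; apply: eq_rderive => x; rewrite big_cons Pj.
have kP : Ck 1 D (fun x => \prod_(k <- r | P k) F k x) by apply: Ck_prod.
have [_ E] := rderiveM_def (Ck_der v (kF j) Dz) (Ck_der v kP Dz).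
rewrite (_ : (fun x => \prod_(k <- j :: r | P k) F k x) =
  (fun x => F j x * \prod_(k <- r | P k) F k x)); last by apply/funext => x; rewrite big_cons Pj.
rewrite Pj E addrC; congr (_ * _ + _).
rewrite big_cons Pj eqxx /= big_seq_cond [RHS]big_seq_cond; apply: eq_bigl => k.
case kr: (k \in r) => //=; rewrite (_ : k != j) ?andbT //.
by apply: contraNneq jr => <-.
Qed.

Lemma sum3_zero (J : finType) (S : R) (f g h : J -> R) : S = \sum_j f j ->
  S = \sum_j g j -> S = \sum_j h j -> (forall j, f j + g j + h j = 0) -> S = 0.
Proof.
move=> Sf Sg Sh H; have : S + S + S = 0.
  transitivity (\sum_j (f j + g j + h j)); last by rewrite big1.
  by rewrite !big_split /= -Sf -Sg -Sh.
by move=> h0; lra.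
Qed.

Definition cycle3 (x y z : I) : {perm I} := (tperm x y * tperm y z)%g.

Section Term.
Variables (D : set Cn) (C : 'I_n -> I -> I -> Cn -> R) (zeta : I -> Cn -> R) (m : 'I_n).
Hypothesis oD : open D.
Hypothesis kC : forall k i j, Ck 1 D (C k i j).
Hypothesis kz : forall i, Ck 1 D (zeta i).
Hypothesis closedC : forall k z, D z -> forall i j l,
  rderive (C k j l) (rb i) z + rderive (C k l i) (rb j) z + rderive (C k i j) (rb l) z = 0.

(** The 3-cycles on [(m, false)], [(l, false)], [(l, true)] are even and fix the indices of the
    other factors, so the sum keeps its value when these three are rotated. Adding the three
    versions produces the cyclic sum of derivatives, which vanishes by [closedC]. *)
Lemma pf_closed_zero z (l : 'I_n) : D z -> l != m ->
  \sum_(s : {perm I}) (-1) ^+ s * (zeta (s (m, true)) z *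
    (rderive (C l (s (l, false)) (s (l, true))) (rb (s (m, false))) z *
     \prod_(k | (k != m) && (k != l)) C k (s (k, false)) (s (k, true)) z)) = 0.
Proof.
move=> Dz lm; set S := \sum_s _.
pose T (s : {perm I}) (i j k : I) := (-1) ^+ s * (zeta (s (m, true)) z *
    (rderive (C l (s j) (s k)) (rb (s i)) z *
     \prod_(k | (k != m) && (k != l)) C k (s (k, false)) (s (k, true)) z)).
have cyc (x y w : I) : x != y -> y != w -> x != w ->
    [set x; y; w] `<=` [set (m, false); (l, false); (l, true)] ->
    \sum_s T s x y w = \sum_s T s y w x.
  move=> xy yw xw sub; have [hx hy hw] : [/\ (x = (m,false) \/ x = (l,false)) \/ x = (l,true),
     (y = (m,false) \/ y = (l,false)) \/ y = (l,true) & (w = (m,false) \/ w = (l,false)) \/ w = (l,true)].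
    by split; apply: sub; [left; left|left; right|right].
  have fixed u : u != x -> u != y -> u != w -> cycle3 x y w u = u.
    by move=> ux uy uw; rewrite /cycle3 permM !tpermD // eq_sym.
  have [c Ec] : exists c, c = cycle3 w y x by exists (cycle3 w y x).
  have cx : c x = y.
    rewrite Ec /cycle3 permM (_ : tperm w y x = x) ?tpermR //.
    by rewrite tpermD // eq_sym.
  have cy : c y = w by rewrite Ec /cycle3 permM tpermR tpermD // eq_sym.
  have cw : c w = x by rewrite Ec /cycle3 permM tpermL tpermL.
  have oc : odd_perm c = false.
    by rewrite Ec /cycle3 odd_permM !odd_tperm (eq_sym w y) yw (eq_sym y x) xy.
  rewrite [LHS](reindex_inj (mulgI c)); apply: eq_bigr => s _.
  rewrite /T odd_permM oc addFb !permM cx cy cw.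
  have out u : u.1 != m -> u.1 != l -> c u = u.
    move=> um ul; have ne v : (v = (m,false) \/ v = (l,false)) \/ v = (l,true) -> u != v.
      by case=> [[->|->]|->]; apply: contraNneq um => E; rewrite E // in ul *; rewrite eqxx in ul.
    by rewrite Ec /cycle3 permM !tpermD // eq_sym ne.
  have cmT : c (m, true) = (m, true).
    have ne v : (v = (m,false) \/ v = (l,false)) \/ v = (l,true) -> (m, true) != v.
      by case=> [[->|->]|->]; rewrite xpair_eqE ?andbF //= eq_sym (negbTE lm).
    by rewrite Ec /cycle3 permM !tpermD // eq_sym ne.
  rewrite cmT; congr (_ * (_ * (_ * _))); apply: eq_bigr => k /andP[km kl].
  by rewrite !permM !out.
have e1 : (m, false) != (l, false) by rewrite xpair_eqE andbT eq_sym.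
have e2 : (l, false) != (l, true) by rewrite xpair_eqE andbF.
have e3 : (m, false) != (l, true) by rewrite xpair_eqE andbF.
have S1 : S = \sum_s T s (m, false) (l, false) (l, true) by [].
have S2 : S = \sum_s T s (l, false) (l, true) (m, false).
  by rewrite S1; apply: cyc => // u /=; tauto.
have S3 : S = \sum_s T s (l, true) (m, false) (l, false).
  have e4 : (l, true) != (m, false) by rewrite eq_sym.
  have e5 : (l, false) != (m, false) by rewrite eq_sym.
  by rewrite S2; apply: (cyc _ _ _ e2 e4 e5) => u /=; tauto.
apply: (sum3_zero S1 S2 S3) => s.
have hlp (e y a b c p : R) : a + b + c = 0 ->
    e * (y * (a * p)) + e * (y * (b * p)) + e * (y * (c * p)) = 0.
  by move=> h; rewrite -!mulrDr -!mulrDl h mul0r !mulr0.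
exact: hlp (closedC l Dz (s (m, false)) (s (l, false)) (s (l, true))).
Qed.

(** The Leibniz rule adds only terms in which a coefficient of a closed form is differentiated, and
    [pf_closed_zero] removes these. The right-hand side is a divergence. *)
Lemma pf_exact_term z : D z ->
  \sum_(s : {perm I}) (-1) ^+ s * (rderive (zeta (s (m, true))) (rb (s (m, false))) z *
    \prod_(k | k != m) C k (s (k, false)) (s (k, true)) z) =
  \sum_(s : {perm I}) (-1) ^+ s * rderive (fun x => zeta (s (m, true)) x *
    \prod_(k | k != m) C k (s (k, false)) (s (k, true)) x) (rb (s (m, false))) z.
Proof.
move=> Dz; apply/esym.
have E (s : {perm I}) : rderive (fun x => zeta (s (m, true)) x *
    \prod_(k | k != m) C k (s (k, false)) (s (k, true)) x) (rb (s (m, false))) z =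
    zeta (s (m, true)) z * (\sum_(l | l != m) rderive (C l (s (l, false)) (s (l, true))) (rb (s (m, false))) z *
      \prod_(k | (k != m) && (k != l)) C k (s (k, false)) (s (k, true)) z) +
    rderive (zeta (s (m, true))) (rb (s (m, false))) z * \prod_(k | k != m) C k (s (k, false)) (s (k, true)) z.
  have kP : Ck 1 D (fun x => \prod_(k | k != m) C k (s (k, false)) (s (k, true)) x) by apply: Ck_prod.
  have [_ ->] := rderiveM_def (Ck_der (rb (s (m, false))) (kz (s (m, true))) Dz) (Ck_der (rb (s (m, false))) kP Dz).
  rewrite (@rderive_prod _ D _ _ _ _ _ oD (index_enum_uniq _)) //.
under eq_bigr do rewrite E mulrDr mulr_sumr mulr_sumr.
rewrite big_split /= exchange_big /= big1 ?add0r // => l lm.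
exact: pf_closed_zero.
Qed.

End Term.

(** The factors are changed one at a time, those before [m] being already changed, so that all
    factors other than [b m] are again coefficients of closed forms. *)
Lemma prodD_telescope (a b : 'I_n -> R) :
  \prod_k (a k + b k) - \prod_k a k =
  \sum_(m < n) b m * \prod_(k | k != m) (if (k < m)%N then a k + b k else a k).
Proof.
pose T (m : nat) := \prod_(k < n) (if (k < m)%N then a k + b k else a k).
have -> : \prod_k (a k + b k) = T n by apply: eq_bigr => k _; rewrite ltn_ord.
have -> : \prod_k a k = T 0%N by [].
rewrite -telescope_sumr // big_mkord; apply: eq_bigr => m _.
rewrite /T (bigD1 m) //= ltnSn (bigD1 (P := xpredT) m) //= ltnn.
rewrite (eq_bigr (fun k : 'I_n => if (k < m)%N then a k + b k else a k)); first by ring.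
by move=> k km; rewrite ltnS leq_eqVlt; move: km; rewrite -val_eqE /= => /negbTE ->.
Qed.

(* Pf is a null Lagrangian: expanding the difference, each term is a divergence
   up to sums which cancel over 3-cycles of indices since A is closed. *)
Lemma Int_pf_exact (D K : set Cn) (M : R) (A : I -> I -> Cn -> R) (zeta : I -> Cn -> R) :
  open D -> closed K -> K `<=` D -> K `<=` cbox 0 M ->
  (forall i j, Ck 1 D (A i j)) ->
  (forall z, D z -> forall i j l,
    rderive (A j l) (rb i) z + rderive (A l i) (rb j) z + rderive (A i j) (rb l) z = 0) ->
  (forall i, Ck 2 D (zeta i)) -> (forall i z, D z -> ~ K z -> zeta i z = 0) ->
  let B i j z := rderive (zeta j) (rb i) z - rderive (zeta i) (rb j) z in
  let F z := pf (fun i j => A i j z + B i j z) - pf (fun i j => A i j z) in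
  bcs (zext D F) /\ Int (zext D F) = 0.
Proof.
move=> oD cK KD KM kA clA kz z0 B F.
have kz1 i : Ck 1 D (zeta i) by apply: Ck_pred.
have kB i j : Ck 1 D (B i j) by apply: CkB => //; apply: Ck_rderive.
(* The factors of the telescoped product: coefficients of [A + B] before [m] and of [A] after it,
   closed in both cases. *)
pose C (m k : 'I_n) i j z := if (k < m)%N then A i j z + B i j z else A i j z.
have kC m k i j : Ck 1 D (C m k i j).
  by rewrite /C; case: ltnP => _ //; apply: CkD.
have clC m k z : D z -> forall i j l,
  rderive (C m k j l) (rb i) z + rderive (C m k l i) (rb j) z + rderive (C m k i j) (rb l) z = 0.
  move=> Dz i j l; rewrite /C; case: ltnP => _; last exact: clA.
  have AB i' j' v : rderive (fun z => A i' j' z + B i' j' z) v z =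
      rderive (A i' j') v z + (rderive (rderive (zeta j') (rb i')) v z - rderive (rderive (zeta i') (rb j')) v z).
    have d1 := Ck_der v (Ck_rderive (rb i') (kz j')) Dz.
    have d2 := Ck_der v (Ck_rderive (rb j') (kz i')) Dz.
    have [d3 e3] := rderiveN_def d2.
    have [d4 e4] := rderiveD_def d1 d3.
    have [d5 ->] := rderiveD_def (Ck_der v (kA i' j') Dz) d4.
    by rewrite e4 e3.
  rewrite !AB.
  rewrite (rderive2_sym (rb j) (rb i) oD (kz l) Dz) (rderive2_sym (rb l) (rb j) oD (kz i) Dz).
  rewrite (rderive2_sym (rb i) (rb l) oD (kz j) Dz).
  have := clA z Dz i j l.
  move: (rderive _ _ _) (rderive _ _ _) (rderive _ _ _) => x1 x2 x3.
  move: (rderive _ _ _) (rderive _ _ _) (rderive _ _ _) => x4 x5 x6 h.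
  lra.
pose W (m : 'I_n) (s : {perm I}) (x : Cn) := zeta (s (m, true)) x * \prod_(k | k != m) C m k (s (k, false)) (s (k, true)) x.
have kW m s : Ck 1 D (W m s) by apply: CkM => //; apply: Ck_prod.
have W0 m s z : D z -> ~ K z -> W m s z = 0 by move=> Dz Kz; rewrite /W z0 // mul0r.
have kzW m s : Ck 1 setT (zext D (W m s)) := Ck_zext oD cK KD (W0 m s) (kW m s).
have oK : open (~` K) by apply: closed_openC.
have zW0 m s z : ~ K z -> zext D (W m s) z = 0.
  by move=> Kz; rewrite /zext; case: asboolP => // Dz; exact: W0.
have sW m s : csupp M (zext D (W m s)) by move=> z Mz; apply: zW0 => /KM.
have FE : zext D F = fun z => \sum_(m < n) \sum_(s : {perm I})
    (2 * (-1) ^+ s) * rderive (zext D (W m s)) (rb (s (m, false))) z.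
  apply/funext => z; rewrite /zext; case: asboolP => [Dz|nD]; last first.
    apply/esym/big1 => m _; apply: big1 => s _.
    have Kz : (~` K) z by move=> /KD.
    have [|_ ->] := rderive_ext (f := fun=> 0) (g := zext D (W m s)) (v := rb (s (m, false))) oK _ Kz (rderive_cst 0 _ z).1.
      by move=> x; rewrite inE => Kx; rewrite zW0.
    by rewrite (rderive_cst 0 _ z).2 mulr0.
  rewrite /F /pf -sumrB.
  under eq_bigr do rewrite -mulrBr prodD_telescope mulr_sumr.
  rewrite exchange_big; apply: eq_bigr => m _.
  (* The two halves of [B] contribute equally: they are exchanged by the transposition of
     [(m, false)] and [(m, true)], whose sign makes up for the minus sign in [B]. *)
  transitivity (2 * \sum_(s : {perm I}) (-1) ^+ s * (rderive (zeta (s (m, true))) (rb (s (m, false))) z *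
    \prod_(k | k != m) C m k (s (k, false)) (s (k, true)) z)).
    rewrite mulr_natl mulr2n.
    rewrite [X in _ = _ + X](reindex_inj (mulgI (tperm (m, false) (m, true)))) -big_split; apply: eq_bigr => s _.
    rewrite odd_permM signr_addb odd_tperm xpair_eqE eqxx /= expr1 !permM tpermL tpermR.
    have -> : \prod_(k < n | k != m) C m k ((tperm (m, false) (m, true) * s)%g (k, false))
        ((tperm (m, false) (m, true) * s)%g (k, true)) z =
      \prod_(k < n | k != m) C m k (s (k, false)) (s (k, true)) z.
      apply: eq_bigr => k km; rewrite !permM !tpermD // ?xpair_eqE eq_sym (negbTE km) //.
    rewrite /B /C; move: (rderive _ _ _) (rderive _ _ _) (\prod_(_ | _) _) => x y p.
    by move: ((-1) ^+ s) => e; ring.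
  rewrite (@pf_exact_term D (C m) zeta m oD (kC m) kz1 (clC m) z Dz).
  rewrite mulr_sumr; apply: eq_bigr => s _; rewrite mulrA; congr (_ * _).
  by rewrite rderive_zext //; exact: Ck_der.
have bW (m : 'I_n) (s : {perm I}) : bcs (fun z => (2 * (-1) ^+ s) * rderive (zext D (W m s)) (rb (s (m, false))) z).
  by apply: bcsZ; exact: bcs_rderive (kzW m s) (sW m s).
rewrite FE; split; first by apply: bcs_sum => m _; apply: bcs_sum => s _; exact: bW.
rewrite Int_sum; last by move=> m _; apply: bcs_sum => s _; exact: bW.
apply: big1 => m _; rewrite Int_sum //; apply: big1 => s _.
by rewrite IntZ ?(Int_rderive _ (kzW m s) (sW m s)) ?mulr0 //; exact: bcs_rderive (kzW m s) (sW m s).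
Qed.

End NullLagrangian.

(** * Truncated powers and spline cutoffs *)

Section TruncatedPowers.
Variable R : realType.
Implicit Types (x t : R).

Lemma Cr_is_derive k (I : set R) (h g : R -> R) : open I ->
  (forall x, I x -> is_derive x 1 h (g x)) -> Cr k I g -> Cr k.+1 I h.
Proof.
move=> oI hd.
have ext j (h1 h2 : R -> R) : {in I, h1 =1 h2} -> Cr j I h1 -> Cr j I h2.
  elim: j h1 h2 => [|j IH] h1 h2 E [c1 d1].
    split=> // x Ix; rewrite /prop_for /continuous_at -(E x (mem_set Ix)).
    apply: cvg_trans (c1 x Ix); apply: near_eq_cvg.
    by near=> y; rewrite E // inE; near: y; exact: (@open_nbhs_nbhs _ x I (conj oI Ix)).
  have nE x : I x -> \forall y \near x, h1 y = h2 y.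
    by move=> Ix; near=> y; rewrite E // inE; near: y; exact: (@open_nbhs_nbhs _ x I (conj oI Ix)).
  split=> [x Ix|].
    rewrite /prop_for /continuous_at -(E x (mem_set Ix)).
    by apply: cvg_trans (c1 x Ix); apply: near_eq_cvg; apply: filterS (nE x Ix).
  have [d1' cr] := d1; split=> [x Ix|].
    by apply: near_eq_derivable (d1' x Ix) => //; exact: nE.
  apply: IH cr => x; rewrite inE => Ix; rewrite !derive1E.
  by apply: near_eq_derive => //; exact: nE.
move=> cg; split=> [x Ix|].
  by apply/differentiable_continuous/derivable1_diffP; have [] := hd x Ix.
split=> [x Ix|]; first by have [] := hd x Ix.
by apply: ext cg => x; rewrite inE => Ix; rewrite derive1E; have [_ ->] := hd x Ix.
Unshelve. all: end_near. Qed.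

Definition tp (k : nat) (x : R) : R := Num.max x 0 ^+ k.

Lemma tp_ge0 k x : 0 <= tp k x.
Proof. by apply: exprn_ge0; rewrite le_max lexx orbT. Qed.

Lemma tpP k x : 0 <= x -> tp k x = x ^+ k.
Proof. by move=> x0; rewrite /tp max_l. Qed.

Lemma tpN k x : x <= 0 -> tp k.+1 x = 0.
Proof. by move=> x0; rewrite /tp max_r // expr0n. Qed.

Lemma tpS k x : tp k.+2 x = x * tp k.+1 x.
Proof.
have [x0|/ltW x0] := leP 0 x; first by rewrite !tpP // exprS.
by rewrite !tpN // mulr0.
Qed.

Lemma is_derive_shift (f : R -> R) (x d : R) :
  is_derive (0 : R) 1 (fun t => f (x + t)) d -> is_derive x 1 f d.
Proof.
move=> h; have -> : f = (fun t => f (x + t)) \o (fun y => y - x).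
  by apply/funext => y /=; rewrite addrC subrK.
have h1 : is_derive ((fun y => y - x) x) 1 (fun t => f (x + t)) d by rewrite /= subrr.
have h2 : is_derive x 1 (fun y => y - x) 1 by apply: is_derive_eq; rewrite ?subr0 ?addr0.
by rewrite -[d]mulr1; exact: (@is_derive1_comp R _ _ x d 1 h1 h2).
Qed.

Lemma is_derive_tp k x : is_derive x 1 (tp k.+2) (k.+2%:R * tp k.+1 x).
Proof.
elim: k => [|k IH]; last first.
  have -> : tp k.+3 = (fun y => y) * tp k.+2 :> (R -> R) by apply/funext => y; rewrite tpS.
  have E : k.+3%:R * tp k.+2 x = x * (k.+2%:R * tp k.+1 x) + tp k.+2 x * 1.
    by rewrite tpS -[k.+3%:R]natr1; ring.
  rewrite E; exact: is_deriveM.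
apply: is_derive_shift; apply/is_derive0P => e e0; exists e => // t te.
rewrite addr0; apply: (@le_trans _ _ (`|t| * `|t|)); last by rewrite ler_wpM2r // ltW.
rewrite -normrM [leRHS]ger0_norm -?expr2 ?sqr_ge0 // ler_norml.
apply/andP; split; rewrite /tp; have [h1|h1] := leP (x + t) 0; have [h2|h2] := leP x 0; nra.
Qed.

Lemma continuous_tp1 : continuous (tp 1).
Proof.
move=> x; have -> : tp 1 = (fun y : R => Num.max y 0) by apply/funext => y; rewrite /tp expr1.
by apply: continuous_max => //; exact: cst_continuous.
Qed.

(* Third difference of [x_+ ^ k], hence a C^(k-1) smoothing of a multiple of
   [x_+ ^ (k-3)]: [bsp 3 / 6] is a smooth step and [bsp 4] a smooth positive part. *)
Definition bsp (k : nat) (x : R) : R := tp k x - 3 * tp k (x - 1) + 3 * tp k (x - 2) - tp k (x - 3).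

Lemma is_derive_bsp k x : is_derive x 1 (bsp k.+2) (k.+2%:R * bsp k.+1 x).
Proof.
have D (a : R) : is_derive x 1 (fun y => tp k.+2 (y - a)) (k.+2%:R * tp k.+1 (x - a)).
  rewrite -[X in is_derive _ _ _ X]mulr1.
  have -> : (fun y => tp k.+2 (y - a)) = tp k.+2 \o (fun y => y - a) by [].
  have h2 : is_derive x 1 (fun y => y - a) 1 by apply: is_derive_eq; rewrite ?subr0 ?addr0.
  exact: (@is_derive1_comp R _ _ x _ 1 (is_derive_tp k (x - a)) h2).
have D0 := is_derive_tp k x; have D1 := D 1; have D2 := D 2; have D3 := D 3.
rewrite /bsp; apply: is_derive_eq; rewrite /GRing.scale /=; ring.
Qed.

Lemma continuous_bsp1 : continuous (bsp 1).
Proof.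
move=> x; have C (a : R) : {for x, continuous (fun y => tp 1 (y - a))}.
  apply: continuous_comp; last exact: continuous_tp1.
  by apply: continuousB; [|exact: cst_continuous].
have C3 (a : R) : {for x, continuous (fun y => 3 * tp 1 (y - a))}.
  by apply: continuousM; [exact: cst_continuous|exact: C].
exact: (continuousB (continuousD (continuousB (@continuous_tp1 x) (C3 1)) (C3 2)) (C 3)).
Qed.

Lemma Cr_tp k c : Cr k setT (fun x => c * tp k.+1 x).
Proof.
elim: k c => [|k IH] c.
  by split=> // x _; apply: continuousM; [exact: cst_continuous|exact: continuous_tp1].
apply: (@Cr_is_derive _ _ _ (fun x => (c * k.+2%:R) * tp k.+1 x)); [exact: openT| |exact: IH].
move=> x _; have D := is_derive_tp k x; apply: is_derive_eq; rewrite /GRing.scale /=; ring.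
Qed.

Lemma Cr_bsp k c : Cr k setT (fun x => c * bsp k.+1 x).
Proof.
elim: k c => [|k IH] c.
  by split=> // x _; apply: continuousM; [exact: cst_continuous|exact: continuous_bsp1].
apply: (@Cr_is_derive _ _ _ (fun x => (c * k.+2%:R) * bsp k.+1 x)); [exact: openT| |exact: IH].
move=> x _; have D := is_derive_bsp k x; apply: is_derive_eq; rewrite /GRing.scale /=; ring.
Qed.

Lemma bsp_le0 k x : x <= 0 -> bsp k.+1 x = 0.
Proof. by move=> x0; rewrite /bsp !tpN; [ring|lra..]. Qed.

Lemma bsp2_ge0 x : 0 <= bsp 2 x.
Proof.
rewrite /bsp /tp.
have [h1|h1] := leP x 0; have [h2|h2] := leP (x - 1) 0; have [h3|h3] := leP (x - 2) 0; have [h4|h4] := leP (x - 3) 0; nra.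
Qed.

Lemma bsp2_le x : bsp 2 x <= 2.
Proof.
rewrite /bsp /tp.
have [h1|h1] := leP x 0; have [h2|h2] := leP (x - 1) 0; have [h3|h3] := leP (x - 2) 0; have [h4|h4] := leP (x - 3) 0; nra.
Qed.

Lemma bsp3_ge3 x : 3 <= x -> bsp 3 x = 6.
Proof. by move=> x3; rewrite /bsp !tpP; [ring|lra..]. Qed.

Lemma bsp4_ge3 x : 3 <= x -> bsp 4 x = 24 * x - 36.
Proof. by move=> x3; rewrite /bsp !tpP; [ring|lra..]. Qed.

(** The derivative is a multiple of [bsp 2], hence nonnegative, and the values are 0 up to 0 and 6
    from 3 on. *)
Lemma bsp3_bounds x : 0 <= bsp 3 x <= 6.
Proof.
have nd (y z : R) : y <= z -> bsp 3 y <= bsp 3 z.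
  rewrite le_eqVlt => /predU1P[->//|yz].
  apply: (@ger0_derive1_le_cc R (bsp 3) y z); rewrite ?in_itv /= ?lexx ?(ltW yz) //.
  - by move=> u _; have [] := is_derive_bsp 1 u.
  - move=> u _; rewrite derive1E; have [_ ->] := is_derive_bsp 1 u.
    by apply: mulr_ge0 => //; exact: bsp2_ge0.
  - apply: continuous_subspaceT => u; apply/differentiable_continuous/derivable1_diffP.
    by have [] := is_derive_bsp 1 u.
have [x0|x0] := leP x 0.
  by rewrite bsp_le0 // lexx /=.
have [x3|x3] := leP 3 x; first by rewrite bsp3_ge3 // lexx andbT.
apply/andP; split; first by have := nd _ _ (ltW x0); rewrite bsp_le0.
by have := nd _ _ (ltW x3); rewrite [X in _ <= X -> _]bsp3_ge3.
Qed.

Lemma is_derive_inv (x : R) (m : nat) (c : R) : 0 < x ->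
  is_derive x 1 (fun y => c * y^-1 ^+ m) (- (c * m%:R) * x^-1 ^+ m.+1).
Proof.
move=> x0; have D : is_derive x 1 (fun y : R => y^-1) (- x^-1 ^+ 2).
  have xn : x != 0 by rewrite gt_eqF.
  have := @is_deriveV R id x 1 1 xn (is_derive_id _ _).
  by rewrite exprVn /GRing.scale /= mulr1.
case: m => [|m].
  rewrite mulr0 oppr0 mul0r (_ : (fun y => _) = cst c); last by apply/funext => y; rewrite expr0 mulr1.
  exact: is_derive_cst.
have D2 : is_derive (x^-1) 1 (fun y : R => c * y ^+ m.+1) (c * m.+1%:R * x^-1 ^+ m).
  have D3 := @is_deriveX R R id m.+1 (x^-1) 1 1 (is_derive_id _ _).
  have D4 := @is_deriveZ R R R (id ^+ m.+1) c (x^-1) 1 _ D3.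
  move: D4; rewrite /GRing.scale /= mulr1 mulrA.
  by congr (is_derive _ _ _ _); apply/funext => y; rewrite /= fctE.
rewrite (_ : - (c * m.+1%:R) * _ = c * m.+1%:R * x^-1 ^+ m * - x^-1 ^+ 2).
  exact: (@is_derive1_comp R _ _ x _ _ D2 D).
by rewrite !exprS expr0; ring.
Qed.

Lemma Cr_inv k m (c : R) : Cr k [set x | 0 < x] (fun y => c * y^-1 ^+ m).
Proof.
have oI : open [set x : R | 0 < x] by exact: open_gt.
elim: k m c => [|k IH] m c.
  split=> // x /= x0; have [d _] := is_derive_inv m c x0.
  exact/differentiable_continuous/derivable1_diffP.
apply: (@Cr_is_derive _ _ _ (fun x => (- (c * m%:R)) * x^-1 ^+ m.+1)) => //.
by move=> x x0; exact: is_derive_inv.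
Qed.

Lemma Cr_ln k : Cr k.+1 [set x : R | 0 < x] (@ln R).
Proof.
apply: (@Cr_is_derive _ _ _ (fun x => 1 * x^-1 ^+ 1)); [exact: open_gt| |exact: Cr_inv].
by move=> x /= x0; rewrite expr1 mul1r; exact: is_derive1_ln.
Qed.

End TruncatedPowers.

(** * Composition with functions of one variable and logarithmic potentials *)

Section Composition.
Variables (R : realType) (n : nat).
Local Notation Cn := 'rV[R[i]]_n.

Lemma rderive_comp (D : set Cn) (h g : R -> R) (f : Cn -> R) v z : Ck 1 D f -> D z ->
  is_derive (f z) 1 h (g (f z)) -> rderive (h \o f) v z = g (f z) * rderive f v z.
Proof.
move=> kf Dz hd; have [|_ ->] := rderive_comp_def (h := h) (Ck_der v kf Dz); first by have [] := hd.
by rewrite derive1E; have [_ ->] := hd.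
Qed.

Lemma rderive2_comp (D : set Cn) (I : set R) (h g k : R -> R) (f : Cn -> R) v w z : open D -> Ck 2 D f -> D z ->
  (forall x, D x -> I (f x)) ->
  (forall x, I x -> is_derive x 1 h (g x)) -> (forall x, I x -> is_derive x 1 g (k x)) ->
  rderive (rderive (h \o f) v) w z =
  k (f z) * (rderive f v z * rderive f w z) + g (f z) * rderive (rderive f v) w z.
Proof.
move=> oD kf Dz fI hd gd; have kf1 := Ck_pred kf.
have dg : dir_derivable (g \o f) w z.
  have [|d _] := rderive_comp_def (h := g) (Ck_der w kf1 Dz); last exact: d.
  by have [] := gd _ (fI _ Dz).
have dv := Ck_der w (Ck_rderive v kf) Dz.
have [d1 e1] := rderiveM_def dg dv.
have [|_ ->] := rderive_ext (g := rderive (h \o f) v) oD _ Dz d1.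
  by move=> x; rewrite inE => Dx; rewrite (rderive_comp v kf1 Dx (hd _ (fI _ Dx))).
rewrite e1 (rderive_comp w kf1 Dz (gd _ (fI _ Dz))) /=.
move: (rderive _ _ _) (rderive _ _ _) (rderive _ _ _) => A B C; ring.
Qed.

Lemma ddc_comp (kappa : R) (D : set Cn) (I : set R) (h g k : R -> R) (f : Cn -> R) (v iv : Cn) z :
  open D -> Ck 2 D f -> D z -> (forall x, D x -> I (f x)) -> open I -> Cr 2 I h ->
  (forall x, I x -> is_derive x 1 h (g x)) -> (forall x, I x -> is_derive x 1 g (k x)) ->
  iv = 'i *: v ->
  ddc kappa (h \o f) z v iv = g (f z) * ddc kappa f z v iv +
   kappa * k (f z) * (rderive f v z ^+ 2 + rderive f iv z ^+ 2).
Proof.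
move=> oD kf Dz fI oI Ch hd gd Ei.
rewrite (ddc_diag kappa oD kf Dz Ei) (ddc_diag kappa oD (Ck_comp oD Ch fI kf) Dz Ei).
rewrite !(rderive2_comp _ _ oD kf Dz fI hd gd).
move: (rderive _ _ _) (rderive _ _ _) (rderive _ _ _) (rderive _ _ _) => A B C E; ring.
Qed.

Definition dot (v w : Cn) : R := \sum_b crd b v * crd b w.

Lemma nsq_dot v : nsq v = dot v v.
Proof. by apply: eq_bigr => b _; rewrite expr2. Qed.

Lemma rderive_quad (a : Cn) (c : R) v z :
  dir_derivable (fun z => nsq (z - a) + c) v z /\
  rderive (fun z => nsq (z - a) + c) v z = 2 * dot (z - a) v.
Proof.
apply: is_derive_dir; apply/is_derive0P => e e0.
exists (e / (1 + nsq v)); first by rewrite divr_gt0 // ltr_pwDl // nsq_ge0.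
move=> t te; rewrite ray0.
have -> : nsq (z + t%:C *: v - a) + c - (nsq (z - a) + c) - t * (2 * dot (z - a) v) = t ^+ 2 * nsq v.
  have -> : nsq (z + t%:C *: v - a) = nsq (z - a) + t * (2 * dot (z - a) v) + t ^+ 2 * nsq v.
    rewrite /nsq /dot !mulr_sumr -!big_split; apply: eq_bigr => b _ /=.
    rewrite !crdB crdD crdZ; ring.
  ring.
rewrite normrM [`|nsq v|]ger0_norm ?nsq_ge0 // normrX expr2 -mulrA [leRHS]mulrC ler_wpM2l //.
apply: (@le_trans _ _ (`|t| * (1 + nsq v))); first by rewrite ler_wpM2l // lerDr.
by rewrite -ler_pdivlMr ?ltW // ltr_pwDl // nsq_ge0.
Qed.

Lemma rderive_dot (a v w : Cn) z :
  dir_derivable (fun z => 2 * dot (z - a) v) w z /\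
  rderive (fun z => 2 * dot (z - a) v) w z = 2 * dot v w.
Proof.
apply: is_derive_dir; apply/is_derive0P => e e0; exists 1 => // t _; rewrite ray0.
rewrite (_ : dot (z + t%:C *: w - a) v = dot (z - a) v + t * dot v w).
  move: (dot _ _) (dot _ _) => B A; have -> : 2 * (A + t * B) - 2 * A - t * (2 * B) = 0 by ring.
  by rewrite normr0 mulr_ge0 // ltW.
rewrite /dot mulr_sumr -big_split; apply: eq_bigr => b _ /=.
rewrite !crdB crdD crdZ; ring.
Qed.

Lemma Ck_quad k D (a : Cn) (c : R) : open D -> Ck k D (fun z => nsq (z - a) + c).
Proof.
move=> oD; apply: CkD => //; last exact: Ck_cst.
apply: (Ck_ext (f := fun z => \sum_b (crd b z - crd b a) * (crd b z - crd b a))) => //.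
  by move=> z _; apply: eq_bigr => b _; rewrite crdB expr2.
by apply: Ck_sum => // b _; apply: CkM => //; (apply: CkB => //; [exact: Ck_crd|exact: Ck_cst]).
Qed.

Lemma rderive2_quad D (a : Cn) (c : R) v w z : open D -> D z ->
  rderive (rderive (fun z => nsq (z - a) + c) v) w z = 2 * dot v w.
Proof.
move=> oD Dz; have [d e] := rderive_dot a v w z.
have [|_ ->] := rderive_ext (g := rderive (fun z => nsq (z - a) + c) v) oD _ Dz d; last exact: e.
by move=> x _; have [_ ->] := rderive_quad a c v x.
Qed.

Lemma ddc_quad (kappa : R) (a : Cn) (c : R) (v iv : Cn) z : iv = 'i *: v ->
  ddc kappa (fun z => nsq (z - a) + c) z v iv = 4 * kappa * nsq v.
Proof.
move=> Ei; rewrite (ddc_diag kappa openT (Ck_quad 2 a c openT) I Ei).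
rewrite !(rderive2_quad a c _ _ openT I) -!nsq_dot Ei nsq_i.
by move: (nsq v) => A; ring.
Qed.

Lemma dot_i (v iv : Cn) : iv = 'i *: v -> dot v iv = 0.
Proof.
move=> ->; rewrite /dot sum_pair_bool; apply: big1 => k _; rewrite crd_iF crd_iT; ring.
Qed.

Lemma nsq_comb3 (N al be : R) (w v u : Cn) :
  \sum_b (N * crd b w - al * crd b v - be * crd b u) ^+ 2 =
    N ^+ 2 * nsq w + al ^+ 2 * nsq v + be ^+ 2 * nsq u - 2 * N * al * dot w v
    - 2 * N * be * dot w u + 2 * al * be * dot v u.
Proof.
rewrite /nsq /dot !mulr_sumr -!sumrN -!big_split /=; apply: eq_bigr => b _ /=.
move: (crd _ _) (crd _ _) (crd _ _) => x y w'.
ring.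
Qed.

(** Bessel's inequality for [v] and [iv], which are orthogonal and of equal length. Its sharp
    constant is what keeps the logarithm plurisubharmonic in [ddc_logq]. *)
Lemma dot_CS (w v iv : Cn) : iv = 'i *: v -> dot w v ^+ 2 + dot w iv ^+ 2 <= nsq w * nsq v.
Proof.
move=> Ei; have [v0|v0] := eqVneq (nsq v) 0.
  have d0 (u : Cn) : u = 0 -> dot w u = 0.
    by move=> ->; rewrite /dot big1 // => b _; rewrite crd0 mulr0.
  by rewrite v0 mulr0 Ei (nsq_eq0 v0) scaler0 d0 // expr0n addr0.
have N0 : 0 < nsq v by rewrite lt_def v0 nsq_ge0.
set N := nsq v in N0 *; set al := dot w v; set be := dot w iv.
have : 0 <= \sum_b (N * crd b w - al * crd b v - be * crd b iv) ^+ 2.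
  by apply: sumr_ge0 => b _; exact: sqr_ge0.
rewrite nsq_comb3 (dot_i Ei) Ei nsq_i -Ei -/al -/be -/N.
move: (nsq w) => W h; rewrite -(ler_pM2l N0).
have : N * (al ^+ 2 + be ^+ 2) <= N * (W * N) + 0.
  rewrite -subr_ge0; apply: le_trans h _; rewrite le_eqVlt; apply/orP; left; apply/eqP; ring.
by rewrite addr0.
Qed.

(** [log |z - a|] smoothed at the scale [sqrt c]. *)
Definition logq (a : Cn) (c : R) (z : Cn) : R := 2^-1 * ln (nsq (z - a) + c).

Lemma Ck_logq k D (a : Cn) (c : R) : 0 < c -> open D -> Ck k.+1 D (logq a c).
Proof.
move=> c0 oD; apply: CkM => //; first exact: Ck_cst.
apply: (@Ck_comp _ _ _ _ _ _ (fun z => nsq (z - a) + c) oD (Cr_ln R k)); last exact: Ck_quad.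
by move=> z _ /=; rewrite ltr_wpDl // nsq_ge0.
Qed.

(** By [dot_CS] the negative term due to the concavity of [ln] is absorbed, and exactly the share of
    [c] is left over. Where [nsq (z - a)] is of order [c], the bound is of order [1 / c]. *)
Lemma ddc_logq (kappa : R) (a : Cn) (c : R) (v : Cn) z : 0 < c -> 0 < kappa ->
  2 * kappa * c / (nsq (z - a) + c) ^+ 2 * nsq v <= ddc kappa (logq a c) z v ('i *: v).
Proof.
move=> c0 k0; have [iv Ei] : exists iv : Cn, iv = 'i *: v by exists ('i *: v).
rewrite -Ei; pose I := [set x : R | 0 < x].
pose h (x : R) := 2^-1 * ln x; pose g (x : R) := 2^-1 * x^-1 ^+ 1.
pose k (x : R) := - (2^-1 * 1%:R) * x^-1 ^+ 2.
have oI : open I by exact: open_gt.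
have hd x : I x -> is_derive x 1 h (g x).
  move=> Ix; have := is_derive1_ln Ix => D; rewrite /h /g expr1.
  apply: is_derive_eq; rewrite /GRing.scale /=; ring.
have gd x : I x -> is_derive x 1 g (k x) by move=> Ix; exact: is_derive_inv.
have Ch : Cr 2 I h by apply: (Cr_is_derive oI hd); exact: Cr_inv.
have fI x : (setT : set Cn) x -> I (nsq (x - a) + c) by move=> _; rewrite /I /= ltr_wpDl // nsq_ge0.
have -> : logq a c = h \o (fun z => nsq (z - a) + c) by [].
rewrite (ddc_comp kappa openT (Ck_quad 2 a c openT) Logic.I fI oI Ch hd gd Ei).
rewrite (ddc_quad _ _ _ _ Ei); have [_ ->] := rderive_quad a c v z; have [_ ->] := rderive_quad a c iv z.
have := dot_CS (z - a) Ei; have := fI z Logic.I; rewrite /I /g /k /= expr1.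
have := nsq_ge0 (z - a); have := nsq_ge0 v.
move: (nsq (z - a)) (nsq v) (dot _ v) (dot _ iv) => W N al be N0 W0 q0 CS.
set q := W + c in q0 *.
have -> : 2^-1 * q^-1 * (4 * kappa * N) + kappa * (- (2^-1 * 1%:R) * q^-1 ^+ 2) * ((2 * al) ^+ 2 + (2 * be) ^+ 2)
  = 2 * kappa / q ^+ 2 * (q * N - (al ^+ 2 + be ^+ 2)) by field; rewrite gt_eqF.
have -> : 2 * kappa * c / q ^+ 2 * N = 2 * kappa / q ^+ 2 * (c * N) by ring.
apply: ler_wpM2l; first by rewrite divr_ge0 ?mulr_ge0 ?exprn_ge0 ?ltW.
rewrite /q; lra.
Qed.

End Composition.

(** * Zero extensions, closed forms and linearity of dd^c *)

Section ZextMeasure.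
Variables (R : realType) (n : nat).
Local Notation Cn := 'rV[R[i]]_n.
Implicit Types (F G : Cn -> R) (E : set Cn).

Lemma measurable_zext E F : measurable (E : set (BC R n)) ->
  measurable_fun (E : set (BC R n)) (F : BC R n -> R) -> measurable_fun setT (zext E F : BC R n -> R).
Proof.
move=> mE mF; have -> : zext E F = (F : BC R n -> R) \_ E.
  by apply/funext => z; rewrite patchE /zext; congr (if _ then _ else _).
by apply/(measurable_restrictT _ _).1.
Qed.

Lemma bcs_zext E F (a : Cn) (M C : R) : measurable (E : set (BC R n)) ->
  measurable_fun (E : set (BC R n)) (F : BC R n -> R) -> E `<=` cbox a M ->
  (forall z, E z -> `|F z| <= C) -> bcs (zext E F).
Proof.
move=> mE mF EM FC; apply: (@bcs_le _ _ _ (1 + `|M| + \sum_b `|crd b a|) `|C|).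
- exact: measurable_zext.
- move=> z; rewrite /zext; case: asboolP => [/FC h|_]; last by rewrite normr0.
  exact: le_trans h (ler_norm _).
- move=> z nz; apply: zextF => /EM h; apply: nz => b; rewrite crd0 subr0.
  apply: (@le_lt_trans _ _ (`|crd b z - crd b a| + `|crd b a|)).
    by rewrite -{1}[crd b z](subrK (crd b a)) ler_normD.
  apply: (@le_lt_trans _ _ (`|M| + \sum_b `|crd b a|)).
    by rewrite lerD ?(le_trans (h b) (ler_norm _)) // (bigD1 b) //= lerDl sumr_ge0.
  by rewrite ltrD2r ltrDr.
Qed.

Lemma bcs_zext_cont (D E : set Cn) F (a : Cn) (M : R) : open D -> cbox a M `<=` D ->
  (forall z, D z -> {for z, continuous F}) -> measurable (E : set (BC R n)) -> E `<=` cbox a M ->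
  bcs (zext E F).
Proof.
move=> oD MD cF mE EM.
have [C C0 hC] : exists2 C : R, 0 < C & forall z, cbox a M z -> `|F z| <= C.
  by apply: bounded_cbox => z /MD; exact: cF.
apply: (bcs_zext mE _ EM (fun z Ez => hC z (EM z Ez))).
apply: (@measurable_funS _ _ (BC R n) _ D); [exact: measurable_openC| |exact: measurable_cont_on].
by move=> z /EM /MD.
Qed.

Definition vol E : R := Int (zext E (fun=> 1)).

Lemma bcs_vol E (a : Cn) (M : R) : measurable (E : set (BC R n)) -> E `<=` cbox a M -> bcs (zext E (fun=> 1)).
Proof.
move=> mE EM; apply: (@bcs_zext _ _ a M 1) => // z _; by rewrite normr1.
Qed.

Lemma zext_subset E E' F : E `<=` E' -> (forall z, E' z -> 0 <= F z) -> forall z, zext E F z <= zext E' F z.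
Proof.
move=> EE F0 z; rewrite /zext; case: asboolP => [/EE h|_]; first by rewrite asboolT.
by case: asboolP => // /F0.
Qed.

Lemma zext_ge0 E F : (forall z, E z -> 0 <= F z) -> forall z, 0 <= zext E F z.
Proof. by move=> h z; rewrite /zext; case: asboolP => // /h. Qed.

End ZextMeasure.

Section Closedness.
Variables (R : realType) (n : nat).
Local Notation Cn := 'rV[R[i]]_n.
Local Notation I := ('I_n * bool)%type.
Local Notation "'rb' b" := (@real_basis R n b) (at level 10).

Definition closed_coef (D : set Cn) (A : I -> I -> Cn -> R) := forall z, D z -> forall i j l,
    rderive (A j l) (rb i) z + rderive (A l i) (rb j) z + rderive (A i j) (rb l) z = 0.

Lemma closed_coef_exact D (zeta : I -> Cn -> R) : open D -> (forall i, Ck 2 D (zeta i)) ->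
  closed_coef D (fun i j z => rderive (zeta j) (rb i) z - rderive (zeta i) (rb j) z).
Proof.
move=> oD kz z Dz i j l.
have E i' j' v : rderive (fun z => rderive (zeta j') (rb i') z - rderive (zeta i') (rb j') z) v z =
    rderive (rderive (zeta j') (rb i')) v z - rderive (rderive (zeta i') (rb j')) v z.
  have d1 := Ck_der v (Ck_rderive (rb i') (kz j')) Dz.
  have [d3 e3] := rderiveN_def (Ck_der v (Ck_rderive (rb j') (kz i')) Dz).
  by have [_ ->] := rderiveD_def d1 d3; rewrite e3.
rewrite !E.
rewrite (rderive2_sym (rb j) (rb i) oD (kz l) Dz) (rderive2_sym (rb l) (rb j) oD (kz i) Dz).
rewrite (rderive2_sym (rb i) (rb l) oD (kz j) Dz).
move: (rderive _ _ _) (rderive _ _ _) (rderive _ _ _) => x1 x2 x3; ring.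
Qed.

Lemma closed_coef_add D (A B : I -> I -> Cn -> R) : (forall i j, Ck 1 D (A i j)) -> (forall i j, Ck 1 D (B i j)) ->
  closed_coef D A -> closed_coef D B -> closed_coef D (fun i j z => A i j z + B i j z).
Proof.
move=> kA kB cA cB z Dz i j l.
have E i' j' v : rderive (fun z => A i' j' z + B i' j' z) v z = rderive (A i' j') v z + rderive (B i' j') v z.
  by have [_ ->] := rderiveD_def (Ck_der v (kA i' j') Dz) (Ck_der v (kB i' j') Dz).
rewrite !E; have := cA z Dz i j l; have := cB z Dz i j l.
move: (rderive _ _ _) (rderive _ _ _) (rderive _ _ _) => x1 x2 x3.
move: (rderive _ _ _) (rderive _ _ _) (rderive _ _ _) => x4 x5 x6 h1 h2; lra.
Qed.

Lemma closed_coef_form D (A : form2 R n) : open D -> (forall v w, Ck 1 D (fun z => A z v w)) ->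
  (forall z, D z -> forall v w, A z v w = - A z w v) -> closed_form_on D A ->
  closed_coef D (fun i j z => A z (rb i) (rb j)).
Proof.
move=> oD kA aA cA z Dz i j l; have := cA z Dz (rb i) (rb j) (rb l).
have [dn en] := rderiveN_def (Ck_der (rb j) (kA (rb i) (rb l)) Dz).
have [|_ ->] := rderive_ext (g := fun x => A x (rb l) (rb i)) oD _ Dz dn.
  by move=> x; rewrite inE => Dx; rewrite (aA _ Dx (rb l)).
by rewrite en.
Qed.

Lemma ddc_Jform (kappa : R) D (f : Cn -> R) z : open D -> Ck 2 D f -> D z -> Jform (ddc kappa f z).
Proof.
move=> oD kf Dz; split=> [t u v w|v w|v w]; first exact: (ddc_linear kappa t u v w oD kf Dz).
  exact: ddc_antisym.
exact: (ddc_J kappa oD kf Dz erefl erefl).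
Qed.

Lemma Ck_dc (kappa : R) k D (f : Cn -> R) w : open D -> Ck k.+1 D f -> Ck k D (fun z => dc kappa f z w).
Proof.
by move=> oD kf; apply: CkM => //; [exact: Ck_cst|exact: Ck_rderive].
Qed.

Lemma Ck_ddc (kappa : R) k D (f : Cn -> R) v w : open D -> Ck k.+2 D f -> Ck k D (fun z => ddc kappa f z v w).
Proof.
by move=> oD kf; apply: CkB => //; apply: Ck_rderive; exact: Ck_dc.
Qed.

Lemma wedge_top_cont (A : form2 R n) z : (forall v w, {for z, continuous (fun x => A x v w)}) ->
  {for z, continuous (fun x => wedge_top (A x))}.
Proof.
move=> cA; have sumc (J : Type) (r : seq J) (P : pred J) (F : J -> Cn -> R) :
    (forall j, {for z, continuous (F j)}) -> {for z, continuous (fun x => \sum_(j <- r | P j) F j x)}.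
  move=> cF; elim: r => [|j r IH].
    by rewrite (_ : (fun x => _) = cst 0); [exact: cst_continuous|apply/funext => x; rewrite big_nil].
  case Pj: (P j); last by rewrite (_ : (fun x => _) = (fun x => \sum_(j <- r | P j) F j x)) //;
    apply/funext => x; rewrite big_cons Pj.
  rewrite (_ : (fun x => _) = (fun x => F j x + \sum_(j <- r | P j) F j x)); first exact: continuousD.
  by apply/funext => x; rewrite big_cons Pj.
have prodc (J : Type) (r : seq J) (F : J -> Cn -> R) :
    (forall j, {for z, continuous (F j)}) -> {for z, continuous (fun x => \prod_(j <- r) F j x)}.
  move=> cF; elim: r => [|j r IH].
    by rewrite (_ : (fun x => _) = cst 1); [exact: cst_continuous|apply/funext => x; rewrite big_nil].
  rewrite (_ : (fun x => _) = (fun x => F j x * \prod_(j <- r) F j x)); first exact: continuousM.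
  by apply/funext => x; rewrite big_cons.
rewrite /wedge_top; apply: continuousM; first exact: cst_continuous.
apply: sumc => s; apply: continuousM; first exact: cst_continuous.
by apply: prodc.
Qed.

End Closedness.

Local Opaque rderive Ck Cr.

Section DdcLinear.
Variables (R : realType) (n : nat).
Local Notation Cn := 'rV[R[i]]_n.
Implicit Types (D E : set Cn) (f g : Cn -> R) (v w z iv : Cn).

Lemma bcsB f g : bcs f -> bcs g -> bcs (fun z => f z - g z).
Proof. by move=> bf bg; apply: bcsD => //; exact: bcsN. Qed.

Lemma CkZ k D (c : R) f : open D -> Ck k D f -> Ck k D (fun z => c * f z).
Proof. by move=> oD kf; exact: (CkM oD (Ck_cst k c oD) kf). Qed.

Lemma Ck_lin k D (c : R) f g : open D -> Ck k D f -> Ck k D g -> Ck k D (fun z => c * f z + g z).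
Proof. by move=> oD kf kg; exact: (CkD oD (CkZ c oD kf) kg). Qed.

Lemma rderive2_lin D (c : R) (f g : Cn -> R) v w z : open D -> Ck 2 D f -> Ck 2 D g -> D z ->
  rderive (rderive (fun x => c * f x + g x) v) w z = c * rderive (rderive f v) w z + rderive (rderive g v) w z.
Proof.
move=> oD kf kg Dz; have kf1 := Ck_rderive v kf; have kg1 := Ck_rderive v kg.
rewrite -(rderive_lin c w oD kf1 kg1 Dz).
have kl := Ck_lin c oD kf1 kg1.
have [|_ ->] // := rderive_ext (g := rderive (fun x => c * f x + g x) v) oD _ Dz (Ck_der w kl Dz).
by move=> x; rewrite inE => Dx; rewrite (rderive_lin c v oD (Ck_pred kf) (Ck_pred kg) Dx).
Qed.

Lemma ddc_lin (kappa : R) D (c : R) (f g : Cn -> R) v iv z : open D -> Ck 2 D f -> Ck 2 D g -> D z ->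
  iv = 'i *: v ->
  ddc kappa (fun x => c * f x + g x) z v iv = c * ddc kappa f z v iv + ddc kappa g z v iv.
Proof.
move=> oD kf kg Dz Ei.
have kl := Ck_lin c oD kf kg.
rewrite (ddc_diag kappa oD kl Dz Ei) (ddc_diag kappa oD kf Dz Ei) (ddc_diag kappa oD kg Dz Ei).
have E1 := rderive2_lin c v v oD kf kg Dz; have E2 := rderive2_lin c iv iv oD kf kg Dz.
rewrite E1 E2; move: (rderive _ _ _) (rderive _ _ _) (rderive _ _ _) (rderive _ _ _) => a b x y; ring.
Qed.

Lemma ddc_cst (kappa c : R) (v w z : Cn) : ddc kappa (fun=> c) z v w = 0.
Proof.
have E x : rderive (fun=> c : R) x = (fun=> 0) :> (Cn -> R).
  by apply/funext => y; exact: (rderive_cst c x y).2.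
rewrite /ddc /dc !E.
have -> : (fun x : Cn => - kappa * 0) = (fun=> 0) by apply/funext => x; rewrite mulr0.
by rewrite !(rderive_cst 0 _ z).2 subrr.
Qed.

Lemma rderive_local0 E (f : Cn -> R) v z : open E -> (forall x, E x -> f x = 0) -> E z -> rderive f v z = 0.
Proof.
move=> oE f0 Ez; have [|_ ->] := rderive_ext (f := fun=> 0) (g := f) (v := v) oE _ Ez (rderive_cst 0 v z).1.
  by move=> x; rewrite inE => /f0 ->.
exact: (rderive_cst 0 v z).2.
Qed.

Lemma ddc_local0 (kappa : R) E (f : Cn -> R) v w z : open E -> (forall x, E x -> f x = 0) -> E z ->
  ddc kappa f z v w = 0.
Proof.
move=> oE f0 Ez; have d0 u x : E x -> dc kappa f x u = 0.
  by move=> Ex; rewrite /dc (rderive_local0 _ oE f0 Ex) mulr0.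
have E1 := rderive_local0 v oE (d0 w) Ez; have E2 := rderive_local0 w oE (d0 v) Ez.
exact: (etrans (congr2 (fun a b : R => a - b) E1 E2) (subrr _)).
Qed.

Lemma open_cont_gt (D : set Cn) (f : Cn -> R) (c : R) : open D -> (forall z, D z -> {for z, continuous f}) ->
  open [set z | D z /\ c < f z].
Proof.
move=> oD cf; rewrite openE => z [Dz fz].
have : nbhs z (D `&` f @^-1` [set y | c < y]).
  apply: filterI; first exact: open_nbhs_nbhs.
  by apply: cf => //; apply: open_nbhs_nbhs; split=> //; exact: open_gt.
by apply: filterS => x [].
Qed.

Lemma JformD (a b : Cn -> Cn -> R) : Jform a -> Jform b -> Jform (fun v w => a v w + b v w).
Proof.
move=> ja jb; have := Jform_nonneg_lin 1 1 ja jb.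
by congr Jform; apply/funext => v; apply/funext => w; rewrite !mul1r.
Qed.

Lemma nsq_box (a z : Cn) (r : R) : box a r z -> nsq (z - a) <= (2 * n)%:R * r ^+ 2.
Proof.
move=> h; apply: (@le_trans _ _ (\sum_(b : 'I_n * bool) r ^+ 2)).
  apply: ler_sum => b _; rewrite crdB -[leLHS]real_normK ?num_real // ler_sqr ?nnegrE //.
    exact: ltW.
  by apply: le_trans (ltW (h b)).
by rewrite sumr_const card_prod card_ord card_bool mulnC mulr_natl.
Qed.

Lemma nsq_out_box (a z : Cn) (r : R) : 0 < r -> ~ box a r z -> r ^+ 2 <= nsq (z - a).
Proof.
move=> r0 /existsNP[b /negP]; rewrite -leNgt => h.
apply: le_trans (crd_nsq b _); rewrite crdB -[leRHS]real_normK ?num_real //.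
by rewrite ler_sqr ?nnegrE // ltW.
Qed.

End DdcLinear.

Lemma capacity_num1 (R : realType) (m s e u L : R) :
  m + (s + 3 * e) <= u -> u < m + (s - L) -> 0 < e -> 0 < L -> False.
Proof. by move=> *; lra. Qed.

Lemma capacity_num2 (R : realType) (m s u lam lr lD lq : R) : lr <= lq ->
  u < m + (s - lam * (lD - lr)) -> 0 < lam -> u - m - s - lam * (lq - lD) <= 0.
Proof. by move=> *; nra. Qed.

(** * Comparison with logarithmic poles *)

Section Capacity.
Variables (R : realType) (n : nat) (kappa rho delta m : R).
Local Notation Cn := 'rV[R[i]]_n.
Variables (x0 : Cn) (A : form2 R n) (f : Cn -> R).
Local Notation Dd := (box x0 (2 * rho)).
Hypotheses (kappa0 : 0 < kappa) (rho0 : 0 < rho) (delta0 : 0 < delta) (cn0 : 0 < cn R n).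
Hypothesis jA : forall z, Dd z -> Jform (A z).
Hypothesis sA : forall v w, Ck 1 Dd (fun z => A z v w).
Hypothesis clA : closed_form_on Dd A.
Hypothesis Apos : forall z, Dd z -> forall v, 4 * kappa * delta * nsq v <= A z v ('i *: v).
Hypothesis kf : Ck 3 Dd f.
Hypothesis f_ge : forall z, Dd z -> m <= f z.

Definition Om (z v w : Cn) : R := A z v w + ddc kappa f z v w.
Hypothesis Opos : forall z, Dd z -> forall v, 0 <= Om z v ('i *: v).

(** The added term lifts [f] by at least [delta rho^2] outside [box x0 rho], so that low sublevel
    sets stay inside this box; [Apos] compensates for its dd^c. *)
Definition uu (z : Cn) : R := f z + delta * nsq (z - x0).
Definition US (s : R) : set Cn := [set z | Dd z /\ uu z < m + s].
Definition MM (s : R) : R := Int (zext (US s) (fun z => wedge_top (Om z))).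

Let oD : open Dd. Proof. exact: open_box. Qed.
Local Opaque box ddc wedge_top.
Let kf2 : Ck 2 Dd f. Proof. exact: Ck_pred. Qed.

Lemma JOm z : Dd z -> Jform (Om z).
Proof. by move=> Dz; exact: (JformD (jA Dz) (ddc_Jform kappa oD kf2 Dz)). Qed.

Lemma Ck_Om v w : Ck 1 Dd (fun z => Om z v w).
Proof. exact: (CkD oD (sA v w) (Ck_ddc kappa v w oD kf)). Qed.

Lemma wOm_cont z : Dd z -> {for z, continuous (fun z => wedge_top (Om z))}.
Proof. by move=> Dz; apply: wedge_top_cont => v w; exact: (Ck_cont (Ck_Om v w)). Qed.

Lemma wOm_ge0 z : Dd z -> 0 <= wedge_top (Om z).
Proof.
move=> Dz; apply: le_trans (Jform_lower (JOm Dz) _ (lexx 0) (ltW cn0)).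
  by rewrite mulr_ge0 ?exprn_ge0 // ltW.
by move=> v; rewrite mul0r; exact: Opos.
Qed.

Lemma Ck_uu : Ck 3 Dd uu.
Proof.
have k1 : Ck 3 Dd (fun z => nsq (z - x0)).
  by apply: (Ck_ext oD _ (Ck_quad 3 x0 0 oD)) => z _; rewrite addr0.
exact: (CkD oD kf (CkZ delta oD k1)).
Qed.

Lemma uu_cont z : Dd z -> {for z, continuous uu}.
Proof. by move=> Dz; exact: (Ck_cont Ck_uu Dz). Qed.

Lemma uu_out z : Dd z -> ~ box x0 rho z -> m + delta * rho ^+ 2 <= uu z.
Proof.
move=> Dz /(nsq_out_box rho0) h; apply: lerD; first exact: f_ge.
by rewrite ler_pM2l.
Qed.

Lemma US_sub s : s <= delta * rho ^+ 2 -> US s `<=` box x0 rho.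
Proof.
move=> hs z [Dz uz]; apply: contrapT => /(uu_out Dz); lra.
Qed.

Lemma US_mono s t : s <= t -> US s `<=` US t.
Proof. by move=> st z [Dz uz]; split=> //; lra. Qed.

Lemma box_rho_Dd : cbox x0 rho `<=` Dd.
Proof. by apply: cbox_sub_box; rewrite ltr_pMl // ltr1n. Qed.

Lemma measurable_US s : measurable (US s : set (BC R n)).
Proof.
apply: measurable_openC.
have -> : US s = [set z | Dd z /\ - (m + s) < - uu z].
  by apply/seteqP; split=> z [Dz] /= h; split=> //; move: h; rewrite ltrN2.
apply: (@open_cont_gt _ _ Dd (fun z => - uu z) _ oD) => z Dz.
by apply: continuousN; exact: uu_cont.
Qed.

Lemma bcs_MM s : s <= delta * rho ^+ 2 -> bcs (zext (US s) (fun z => wedge_top (Om z))).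
Proof.
move=> hs; apply: (bcs_zext_cont oD box_rho_Dd wOm_cont (measurable_US s)).
by apply: subset_trans (US_sub hs) _; exact: box_sub_cbox.
Qed.

Section Comparison.
Variables (a : Cn) (r lam s eps : R).
Hypotheses (Da : Dd a) (r0 : 0 < r) (r_rho : r <= rho) (lam0 : 0 < lam) (eps0 : 0 < eps).
Hypothesis hs : s + 3 * eps <= delta * rho ^+ 2.

(** An upper bound for [exp logq] on the whole box: two of its points differ by less than [4 rho] in
    each real coordinate, so that [nsq (z - a) + r^2 <= (32 n + 1) rho^2], which is less than
    [Dc^2]. *)
Definition Dc : R := rho * (8 * n%:R + 2).

Let e1 : R := eps^-1.
Let pp (z : Cn) : R := e1 * f z + ((e1 * delta) * (nsq (z - x0) + 0) +
  ((- (lam * e1)) * logq a (r ^+ 2) z + e1 * (lam * ln Dc - m - s))).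

Let ppE z : pp z = e1 * (uu z - m - s - lam * (logq a (r ^+ 2) z - ln Dc)).
Proof. rewrite /pp /uu; ring. Qed.

Let k_l : Ck 3 Dd (logq a (r ^+ 2)).
Proof. by apply: Ck_logq => //; rewrite exprn_gt0. Qed.

Let k_p1 : Ck 3 Dd (fun z => (- (lam * e1)) * logq a (r ^+ 2) z + e1 * (lam * ln Dc - m - s)).
Proof. exact: (Ck_lin _ oD k_l (Ck_cst _ _ oD)). Qed.

Let k_p2 : Ck 3 Dd (fun z => (e1 * delta) * (nsq (z - x0) + 0) +
  ((- (lam * e1)) * logq a (r ^+ 2) z + e1 * (lam * ln Dc - m - s))).
Proof. exact: (Ck_lin _ oD (Ck_quad 3 x0 0 oD) k_p1). Qed.

Let k_p : Ck 3 Dd pp.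
Proof. exact: (Ck_lin _ oD kf k_p2). Qed.

Let ddc_pp z v (iv : Cn) : Dd z -> iv = 'i *: v -> ddc kappa pp z v iv =
  e1 * (ddc kappa f z v iv + delta * (4 * kappa * nsq v) - lam * ddc kappa (logq a (r ^+ 2)) z v iv).
Proof.
move=> Dz Ei; have kq := Ck_quad 2 x0 0 oD.
rewrite (ddc_lin kappa e1 oD kf2 (Ck_pred k_p2) Dz Ei).
rewrite (ddc_lin kappa (e1 * delta) oD kq (Ck_pred k_p1) Dz Ei).
rewrite (ddc_lin kappa (- (lam * e1)) oD (Ck_pred k_l) (Ck_cst _ _ oD) Dz Ei).
rewrite (ddc_quad _ _ _ _ Ei) ddc_cst.
move: (ddc _ _ _ _ _) (ddc _ _ _ _ _) => X Y; ring.
Qed.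

(** A smooth convex form of [eps * max (3/2 - x, 0)]: its slope is [-eps] for [x <= 0] and it
    vanishes for [x >= 3]. Thus [uu + eta] is a regularized maximum of [uu] and of the pole
    [m + s + lam (logq - ln Dc)] raised by [3 eps / 2]. *)
Let hh (x : R) : R := eps * 24^-1 * bsp 4 x + eps * (3 / 2 - x).
Let gg (x : R) : R := eps * 6^-1 * bsp 3 x - eps.
Let kk (x : R) : R := eps * 2^-1 * bsp 2 x.

Let hhd (x : R) : is_derive x (1 : R) hh (gg x).
Proof.
have D := is_derive_bsp 2 x; have D2 : is_derive x 1 (fun y : R => eps * (3 / 2 - y)) (- eps).
  by apply: is_derive_eq; rewrite /GRing.scale /=; ring.
rewrite /hh /gg; apply: is_derive_eq; rewrite /GRing.scale /=; field => //.
Qed.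

Let ggd (x : R) : is_derive x (1 : R) gg (kk x).
Proof.
have D := is_derive_bsp 1 x; rewrite /kk /gg; apply: is_derive_eq; rewrite /GRing.scale /=; field => //.
Qed.

Let Chh : Cr 3 setT hh.
Proof.
apply: (@Cr_is_derive _ _ _ _ gg openT (fun x _ => hhd x)).
apply: (@Cr_is_derive _ _ _ _ kk openT (fun x _ => ggd x)).
exact: Cr_bsp.
Qed.

Let eta : Cn -> R := hh \o pp.

Let k_eta : Ck 3 Dd eta.
Proof. exact: (Ck_comp oD Chh (fun z _ => Logic.I) k_p). Qed.

Let eta0 z : 3 <= pp z -> eta z = 0.
Proof. by move=> h; rewrite /eta /hh /= (bsp4_ge3 h); field. Qed.

Lemma Dc_gt0 : 0 < Dc.
Proof. by rewrite mulr_gt0 // ltr_wpDl // mulr_ge0. Qed.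

Lemma ln_Dc_gt0 : 0 < ln (Dc / r).
Proof.
apply: ln_gt0; rewrite ltr_pdivlMr // mul1r; apply: (le_lt_trans r_rho).
rewrite /Dc; have := ler0n R n; have := rho0; move: rho (n%:R) => x y; nra.
Qed.

Lemma ln_pow2 (x : R) : 0 < x -> ln x = 2^-1 * ln (x ^+ 2).
Proof. by move=> xp; rewrite lnXn // -mulr_natl; field. Qed.

Lemma logq_lt z : Dd z -> logq a (r ^+ 2) z < ln Dc.
Proof.
move=> Dz; rewrite (ln_pow2 Dc_gt0) /logq ltr_pM2l // ltr_ln ?posrE ?exprn_gt0 ?Dc_gt0 //; last first.
  by rewrite ltr_wpDl ?nsq_ge0 ?exprn_gt0.
have bz : box a (4 * rho) z.
  move=> b; have -> : crd b z - crd b a = (crd b z - crd b x0) - (crd b a - crd b x0) by ring.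
  apply: le_lt_trans (ler_normB _ _) _; have := Dz b; have := Da b; lra.
have := nsq_box bz; rewrite natrM /Dc; have := ler0n R n; move: (nsq _) (n%:R) => N k k0 h.
have : r ^+ 2 <= rho ^+ 2 by rewrite ler_sqr ?nnegrE // ltW.
have : 0 < rho ^+ 2 by rewrite exprn_gt0.
rewrite !exprMn in h *; move: (rho ^+ 2) (r ^+ 2) h => P Q h; nra.
Qed.

Let pp_gt3 z : Dd z -> m + (s + 3 * eps) <= uu z -> 3 < pp z.
Proof.
move=> Dz h; rewrite ppE /e1 mulrC ltr_pdivlMr //.
have : lam * (logq a (r ^+ 2) z - ln Dc) < 0 by rewrite pmulr_rlt0 // subr_lt0 logq_lt.
lra.
Qed.

Let B z v w := Om z v w + ddc kappa eta z v w.

Let JB z : Dd z -> Jform (B z).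
Proof.
by move=> Dz; apply: JformD; [exact: JOm|exact: (ddc_Jform kappa oD (Ck_pred k_eta) Dz)].
Qed.

(** With [b = bsp 3 (pp z)], the form [B] is the combination of [Om] and of [A - delta dd^c |z -
    x0|^2 + lam dd^c logq] with weights [b / 6] and [1 - b / 6], plus the gradient term of
    [ddc_comp]. All parts are nonnegative, and only the [logq] part is kept. *)
Let B_ge z v : Dd z -> (1 - bsp 3 (pp z) / 6) * lam * (2 * kappa * r ^+ 2 / (nsq (z - a) + r ^+ 2) ^+ 2 * nsq v)
   <= B z v ('i *: v).
Proof.
move=> Dz; have [iv Ei] : exists iv : Cn, iv = 'i *: v by exists ('i *: v).
have r20 : 0 < r ^+ 2 by rewrite exprn_gt0.
have := @ddc_logq R n kappa a (r ^+ 2) v z r20 kappa0.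
rewrite /B -Ei (ddc_comp kappa oD (Ck_pred k_p) Dz (I := setT) (fun _ _ => Logic.I) openT (Cr_pred Chh) (fun x _ => hhd x) (fun x _ => ggd x) Ei).
rewrite (ddc_pp Dz Ei); have := Apos Dz v; have := Opos Dz v; rewrite -Ei /Om.
have : 0 <= kk (pp z) by rewrite /kk mulr_ge0 ?bsp2_ge0 // mulr_ge0 // ltW.
rewrite /gg; have := bsp3_bounds (pp z).
move: (bsp 3 _) (kk _) => b3 K /andP[b0 b6] K0.
have : 0 <= rderive pp v z ^+ 2 + rderive pp iv z ^+ 2 by rewrite addr_ge0 ?sqr_ge0.
move: (rderive pp v z ^+ 2 + _) => S S0.
move: (ddc _ _ _ _ _) (ddc _ _ _ _ _) (A z v iv) (nsq v) => Y X a1 N.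
move: (2 * kappa * r ^+ 2 / _) => Q h1 h2 h3.
have KS : 0 <= kappa * K * S by rewrite !mulr_ge0 // ltW.
have -> : (eps * 6^-1 * b3 - eps) * (e1 * (X + delta * (4 * kappa * N) - lam * Y)) =
   (b3 / 6 - 1) * (X + delta * (4 * kappa * N) - lam * Y).
  by rewrite /e1; field; rewrite gt_eqF.
have t0 : 0 <= 1 - b3 / 6 by lra.
have t1 : 0 <= b3 / 6 by lra.
have : (1 - b3 / 6) * lam * (Q * N) <= (1 - b3 / 6) * lam * Y by rewrite ler_wpM2l // mulr_ge0 // ltW.
have : 0 <= (b3 / 6) * (a1 + X) by rewrite mulr_ge0.
have : 0 <= (1 - b3 / 6) * (a1 - 4 * kappa * delta * N) by rewrite mulr_ge0 // subr_ge0.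
move: (b3 / 6) => c; lra.
Qed.

Let B_ge0 z : Dd z -> 0 <= wedge_top (B z).
Proof.
move=> Dz; apply: le_trans (Jform_lower (JB Dz) _ (lexx 0) (ltW cn0)).
  by rewrite mulr_ge0 ?exprn_ge0 // ltW.
move=> v; rewrite mul0r; apply: le_trans (B_ge v Dz).
have h6 : 0 <= 1 - bsp 3 (pp z) / 6.
  by have /andP[_] := bsp3_bounds (pp z); rewrite subr_ge0 ler_pdivrMr // mul1r.
apply: mulr_ge0; first by rewrite mulr_ge0 // ltW.
by apply: mulr_ge0; [rewrite divr_ge0 ?sqr_ge0 // !mulr_ge0 ?sqr_ge0 // ltW|exact: nsq_ge0].
Qed.

(** On [box a r] one has [nsq (z - a) + r^2 <= (2 n + 1) r^2], so [ckap / r^2] bounds dd^c of [logq]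
    from below there. *)
Definition ckap : R := 2 * kappa / (2 * n%:R + 1) ^+ 2.

Let B_ge2 z : Dd z -> box a r z -> pp z <= 0 -> cn R n * (lam * ckap / r ^+ 2) ^+ n <= wedge_top (B z).
Proof.
move=> Dz bz pz; have r20 : 0 < r ^+ 2 by rewrite exprn_gt0.
have N0 : 0 < 2 * n%:R + 1 :> R by rewrite ltr_wpDl // mulr_ge0.
apply: Jform_lower (JB Dz) _ _ (ltW cn0); last first.
  by rewrite divr_ge0 ?mulr_ge0 ?invr_ge0 ?sqr_ge0 // ltW.
move=> v; apply: le_trans (B_ge v Dz); rewrite bsp_le0 // mul0r subr0 mul1r [leRHS]mulrA.
apply: ler_wpM2r; first exact: nsq_ge0.
have h := nsq_box bz; set q := nsq (z - a) + r ^+ 2.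
rewrite -[leLHS]mulrA ler_pM2l //.
have -> : ckap / r ^+ 2 = 2 * kappa * (((2 * n%:R + 1) ^+ 2)^-1 * (r ^+ 2)^-1).
  by rewrite /ckap; ring.
have -> : 2 * kappa * r ^+ 2 / q ^+ 2 = 2 * kappa * (r ^+ 2 / q ^+ 2) by ring.
rewrite ler_pM2l ?mulr_gt0 //.
have q0 : 0 < q by rewrite /q ltr_wpDl ?nsq_ge0.
have q1 : q <= (2 * n%:R + 1) * r ^+ 2 by rewrite /q mulrDl mul1r -natrM lerD2r.
have -> : ((2 * n%:R + 1) ^+ 2)^-1 * (r ^+ 2)^-1 = r ^+ 2 / ((2 * n%:R + 1) * r ^+ 2) ^+ 2.
  by field; rewrite !gt_eqF.
rewrite ler_pM2l // lef_pV2 ?posrE ?exprn_gt0 // ?mulr_gt0 //.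
have q2 : 0 < (2 * n%:R + 1) * r ^+ 2 by rewrite mulr_gt0.
by rewrite ler_sqr ?nnegrE //; exact: ltW.
Qed.

Let B_out z : Dd z -> m + (s + 3 * eps) <= uu z -> wedge_top (B z) = wedge_top (Om z).
Proof.
move=> Dz h; have oE : open [set x | Dd x /\ 3 < pp x].
  by apply: (@open_cont_gt _ _ Dd pp _ oD) => x Dx; exact: (Ck_cont k_p Dx).
have e0 x : Dd x /\ 3 < pp x -> eta x = 0 by case=> _ /ltW; exact: eta0.
apply: (congr1 (@wedge_top R n)); apply/funext => v; apply/funext => w.
have E0 := ddc_local0 kappa v w oE e0 (conj Dz (pp_gt3 Dz h)).
exact: (etrans (congr1 (fun y => Om z v w + y) E0) (addr0 _)).
Qed.

Let zeta (j : 'I_n * bool) (z : Cn) := dc kappa eta z (real_basis R j).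

(** [B] differs from [Om] by the exact form with primitive [zeta], which vanishes outside
    [cbox x0 rho] because [pp] exceeds 3 there. *)
Let Int_B : bcs (zext Dd (fun z => wedge_top (B z) - wedge_top (Om z))) /\
  Int (zext Dd (fun z => wedge_top (B z) - wedge_top (Om z))) = 0.
Proof.
have cK : closed (cbox x0 rho) := @closed_cbox R n x0 rho.
have KM : cbox x0 rho `<=` cbox 0 (rho + \sum_b `|crd b x0|).
  move=> z h b; rewrite crd0 subr0 -{1}[crd b z](subrK (crd b x0)).
  apply: le_trans (ler_normD _ _) _; apply: lerD => //.
  by rewrite (bigD1 b) //= lerDl sumr_ge0.
have kO i j : Ck 1 Dd (fun z => Om z (real_basis R i) (real_basis R j)) by exact: Ck_Om.
have kz i : Ck 2 Dd (zeta i) by exact: (Ck_dc kappa _ oD k_eta).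
have z0 i z : Dd z -> ~ cbox x0 rho z -> zeta i z = 0.
  move=> Dz Kz; rewrite /zeta /dc (@rderive_local0 _ _ (Dd `&` ~` cbox x0 rho)) ?mulr0 //.
    by apply: openI; [exact: oD|exact: closed_openC].
  move=> x [Dx Kx]; apply: eta0; apply/ltW/pp_gt3 => //.
  apply: le_trans (uu_out Dx _); first by rewrite lerD2l.
  by move=> /box_sub_cbox.
have cO : closed_coef Dd (fun (i j : 'I_n * bool) z => Om z (real_basis R i) (real_basis R j)).
  apply: closed_coef_add; [by move=> i j; exact: sA|by move=> i j; exact: (Ck_ddc kappa _ _ oD kf)| |].
    by apply: (closed_coef_form oD sA _ clA) => z Dz; have [] := jA Dz.
  by apply: (closed_coef_exact (zeta := fun j z => dc kappa f z (real_basis R j)) oD) => i; exact: (Ck_dc kappa _ oD kf).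
have [b0 I0] := Int_pf_exact oD cK box_rho_Dd KM kO cO kz z0.
have -> : zext Dd (fun z => wedge_top (B z) - wedge_top (Om z)) =
  fun z => (2 ^+ n)^-1 * zext Dd (fun z =>
    pf (fun i j => Om z (real_basis R i) (real_basis R j) +
       (rderive (zeta j) (real_basis R i) z - rderive (zeta i) (real_basis R j) z)) -
    pf (fun i j => Om z (real_basis R i) (real_basis R j))) z.
  apply/funext => z; rewrite /zext; case: asboolP => _; last by rewrite mulr0.
  by rewrite mulrBr.
by split; [exact: bcsZ|rewrite IntZ // I0 mulr0].
Qed.

(* The form [B] is the difference of [Om] and a [dd^c]-exact form supported in the
   sublevel set, so its top power has the same integral; it dominates
   [lam dd^c log] where [v - lam log] is low, and is nonnegative elsewhere. *)
Lemma comparison : cn R n * (lam * ckap / r ^+ 2) ^+ n *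
  vol (US (s - lam * ln (Dc / r)) `&` box a r) <= MM (s + 3 * eps).
Proof.
set c := cn R n * _; set E := _ `&` _.
have c0 : 0 <= c.
  apply: mulr_ge0; first exact: ltW.
  apply/exprn_ge0/divr_ge0; last exact: sqr_ge0.
  by rewrite mulr_ge0 ?ltW // divr_gt0 ?mulr_gt0 // exprn_gt0 // ltr_wpDl // mulr_ge0.
have mE : measurable (E : set (BC R n)).
  by apply: measurableI; [exact: measurable_US|apply: measurable_openC; exact: open_box].
have EM : E `<=` cbox a r by move=> z [_ /box_sub_cbox].
have bE := bcs_vol mE EM; have bM := bcs_MM hs.
have [bB IB] := Int_B.
(* By [Int_B] a pointwise comparison with [wedge_top (B z) - wedge_top (Om z)] suffices. Off the
   sublevel set of level [s + 3 * eps] both sides are 0; inside it [B] has nonnegative top power, at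
   least [c] on [E]. *)
have : Int (fun z => c * zext E (fun=> 1) z - zext (US (s + 3 * eps)) (fun z => wedge_top (Om z)) z) <= 0.
  rewrite -IB; apply: Int_le => //; first by apply: bcsB; [exact: bcsZ|].
  move=> z; rewrite {3}/zext; case: asboolP => Dz; last first.
    by rewrite !zextF ?mulr0 ?subrr //; [case|case=> -[]].
  have [Uz|Uz] := pselect (US (s + 3 * eps) z); last first.
    have uz : m + (s + 3 * eps) <= uu z by rewrite leNgt; apply/negP => h; apply: Uz.
    have EB := B_out Dz uz; have E2 := zextF (fun z0 => wedge_top (Om z0)) Uz.
    have hlp (x y wB wO : R) : x = 0 -> y = 0 -> wB = wO -> c * x - y <= wB - wO.
      by move=> -> -> ->; rewrite mulr0 !subrr.
    suff E1 : ~ E z by exact: hlp (zextF (fun=> 1) E1) E2 EB.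
    case=> -[_ h] bz; have := ln_Dc_gt0.
    move=> L0; exact: (capacity_num1 uz h eps0 (mulr_gt0 lam0 L0)).
  have E2 := zextT (fun z0 => wedge_top (Om z0)) Uz; rewrite E2 lerD2r.
  have [Ez|Ez] := pselect (E z); last by rewrite (zextF (fun=> 1) Ez) mulr0 B_ge0.
  rewrite (zextT (fun=> 1) Ez) mulr1; have [[_ uz] bz] := Ez.
  apply: B_ge2 => //; rewrite ppE /e1 mulrC pmulr_lle0 ?invr_gt0 //.
  have : ln r <= logq a (r ^+ 2) z.
    rewrite (ln_pow2 r0) /logq ler_pM2l // ler_ln ?posrE ?exprn_gt0 //.
      by rewrite lerDr nsq_ge0.
    by rewrite ltr_wpDl ?nsq_ge0 ?exprn_gt0.
  move: uz; rewrite ln_div ?posrE ?Dc_gt0 //.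
  by move=> h1 h2; exact: (capacity_num2 h2 h1 lam0).
rewrite IntB ?IntZ //; last exact: bcsZ.
by rewrite subr_le0.
Qed.

End Comparison.
End Capacity.

Lemma rderive_shift (R : realType) (n : nat) (f : 'rV[R[i]]_n -> R) (a v z : 'rV[R[i]]_n) :
  rderive (fun x => f (x - a)) v z = rderive f v (z - a).
Proof.
have E : (fun t : R => f (z + t%:C *: v - a)) = (fun t : R => f (z - a + t%:C *: v)).
  by apply/funext => t; congr f; exact: addrAC.
exact: (congr1 (fun h => derive1 h 0) E).
Qed.

Lemma Ck_shift (R : realType) (n k : nat) (f : 'rV[R[i]]_n -> R) (a : 'rV[R[i]]_n) :
  Ck k setT f -> Ck k setT (fun x => f (x - a)).
Proof.
have cs (g : 'rV[R[i]]_n -> R) (z : 'rV[R[i]]_n) : {for z - a, continuous g} ->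
    {for z, continuous (fun x : 'rV[R[i]]_n => g (x - a))}.
  move=> /continuous_boxP h; apply/continuous_boxP => e /h[d d0 hd]; exists d => // w hw.
  apply: hd => b; have := hw b; rewrite !crdB.
  by move: (crd _ _) (crd _ _) (crd _ _) => x y u; congr (`|_| < _); ring.
have dE (g : 'rV[R[i]]_n -> R) v z : (fun t : R => g (z + t%:C *: v - a)) = (fun t : R => g (z - a + t%:C *: v)).
  by apply/funext => t; congr g; exact: addrAC.
elim: k f => [|k IH] f [c d]; first by split=> // z _; apply: cs; exact: c.
split=> [z _|v]; first by apply: cs; exact: c.
have [d1 d2] := d v; split=> [z _|].
  by rewrite /dir_derivable dE; exact: d1.
have -> : rderive (fun x => f (x - a)) v = fun z => rderive f v (z - a).
  by apply/funext => z; exact: rderive_shift.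
exact: IH.
Qed.

(** * Green's formula and the gradient estimate *)

Section Laplacian.
Variables (R : realType) (n : nat).
Local Notation Cn := 'rV[R[i]]_n.
Local Notation "'rb' b" := (@real_basis R n b) (at level 10).
Implicit Types (D K : set Cn) (f g psi : Cn -> R) (v z : Cn).

Definition lap f z : R := \sum_b rderive (rderive f (rb b)) (rb b) z.

Lemma lap_shift f (a : Cn) z : lap (fun x => f (x - a)) z = lap f (z - a).
Proof.
apply: eq_bigr => b _; have -> : rderive (fun x => f (x - a)) (rb b) = fun x => rderive f (rb b) (x - a).
  by apply/funext => x; exact: rderive_shift.
exact: (rderive_shift (rderive f (rb b))).
Qed.

Lemma lap_cont D f z : open D -> Ck 2 D f -> D z -> {for z, continuous (lap f)}.
Proof.
move=> oD kf Dz; have k0 : Ck 0 D (lap f).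
  by apply: Ck_sum => // b _; exact: (Ck_rderive (rb b) (Ck_rderive (rb b) kf)).
exact: (Ck_cont k0 Dz).
Qed.

Lemma vol_box (a : Cn) (r : R) : 0 < r -> vol (box a r) = (2 * r) ^+ (2 * n).
Proof.
move=> r0; rewrite -(Int_indic_box a r0); congr Int; apply/funext => z.
by rewrite indicE /zext; case: asboolP => h; rewrite ?(mem_set h) ?(memNset h).
Qed.

Lemma cbox0_sub (a : Cn) (r : R) : cbox a r `<=` cbox 0 (r + \sum_b `|crd b a|).
Proof.
move=> z h b; rewrite crd0 subr0 -{1}[crd b z](subrK (crd b a)).
apply: le_trans (ler_normD _ _) _; apply: lerD => //.
by rewrite (bigD1 b) //= lerDl sumr_ge0.
Qed.

(** The integrand is the divergence of [psi grad g - g grad psi], a field that extends by zero. *)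
Lemma Green D K (a : Cn) (r : R) g psi : open D -> closed K -> K `<=` D -> K `<=` cbox a r ->
  Ck 2 D g -> Ck 2 D psi -> (forall z, D z -> ~ K z -> psi z = 0) ->
  bcs (zext D (fun z => psi z * lap g z - g z * lap psi z)) /\
  Int (zext D (fun z => psi z * lap g z - g z * lap psi z)) = 0.
Proof.
move=> oD cK KD Kr kg kp p0; have KM : K `<=` cbox 0 (r + \sum_b `|crd b a|) by move=> z /Kr /cbox0_sub.
have oK : open (~` K) by exact: closed_openC.
pose F b z := psi z * rderive g (rb b) z - g z * rderive psi (rb b) z.
have kF b : Ck 1 D (F b).
  exact: (CkB oD (CkM oD (Ck_pred kp) (Ck_rderive (rb b) kg)) (CkM oD (Ck_pred kg) (Ck_rderive (rb b) kp))).
have F0 b z : D z -> ~ K z -> F b z = 0.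
  move=> Dz Kz; have oDK : open (D `&` ~` K) by exact: openI.
  have p0' x : (D `&` ~` K) x -> psi x = 0 by case; exact: p0.
  by rewrite /F p0 // (rderive_local0 (rb b) oDK p0' (conj Dz Kz)) mul0r mulr0 subrr.
have kz b := Ck_zext oD cK KD (F0 b) (kF b).
have sz b : csupp (r + \sum_b `|crd b a|) (zext D (F b)).
  move=> z nz; rewrite /zext; case: asboolP => // Dz; apply: F0 => // /KM //.
have E : zext D (fun z => psi z * lap g z - g z * lap psi z) = fun z => \sum_b rderive (zext D (F b)) (rb b) z.
  apply/funext => z; rewrite {1}/zext; case: asboolP => [Dz|nD]; last first.
    apply/esym/big1 => b _; apply: (rderive_local0 (rb b) oK) => [x Kx|/KD //].
    by rewrite /zext; case: asboolP => // Dx; exact: F0.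
  rewrite /lap !mulr_sumr -sumrB; apply: eq_bigr => b _.
  rewrite (rderive_zext oD Dz (Ck_der (rb b) (kF b) Dz)).
  have dp := Ck_der (rb b) (Ck_pred kp) Dz; have dg := Ck_der (rb b) (Ck_pred kg) Dz.
  have dp' := Ck_der (rb b) (Ck_rderive (rb b) kp) Dz; have dg' := Ck_der (rb b) (Ck_rderive (rb b) kg) Dz.
  have [d1 e1] := rderiveM_def dp dg'; have [d2 e2] := rderiveM_def dg dp'.
  have [d3 e3] := rderiveN_def d2; have [_ e4] := rderiveD_def d1 d3.
  rewrite [RHS]e4 e3 e1 e2.
  move: (rderive _ _ _) (rderive _ _ _) (rderive _ _ _) (rderive _ _ _) => x y u w; ring.
rewrite E; split; first by apply: bcs_sum => b _; exact: (bcs_rderive (rb b) (kz b) (sz b)).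
rewrite Int_sum; last by move=> b _; exact: (bcs_rderive (rb b) (kz b) (sz b)).
by apply: big1 => b _; exact: (Int_rderive (rb b) (kz b) (sz b)).
Qed.

Lemma Int_lap D K (a : Cn) (r : R) psi : open D -> closed K -> K `<=` D -> K `<=` cbox a r ->
  Ck 2 D psi -> (forall z, D z -> ~ K z -> psi z = 0) ->
  bcs (zext D (lap psi)) /\ Int (zext D (lap psi)) = 0.
Proof.
move=> oD cK KD Kr kp p0; have [b1 i1] := Green oD cK KD Kr (Ck_cst 2 (-1) oD) kp p0.
have E : zext D (fun z => psi z * lap (fun=> -1) z - (-1) * lap psi z) = zext D (lap psi).
  apply/funext => z; rewrite /zext; case: asboolP => // _.
  rewrite mulN1r opprK (_ : lap (fun=> -1) z = 0) ?mulr0 ?add0r //.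
  apply: big1 => b _; have -> : rderive (fun=> -1 : R) (rb b) = (fun=> 0).
    by apply/funext => y; exact: (rderive_cst (-1) _ y).2.
  exact: (rderive_cst 0 _ z).2.
by rewrite -E.
Qed.

(** A product over the coordinates of [(1 - (q x)^2)_+^3], of class C^2. It is not constant on the
    inner box but bounded below there, which is enough to test nonnegative functions. *)
Lemma cutoff (rho : R) : 0 < rho -> exists (chi : Cn -> R) (c C : R),
  [/\ 0 < c, Ck 2 setT chi, csupp (3 / 2 * rho) chi, forall z, box 0 rho z -> c <= chi z &
      forall z, [/\ 0 <= chi z, chi z <= C & `|lap chi z| <= C]].
Proof.
move=> rho0; pose q : R := (3 / 2 * rho)^-1.
have q0 : 0 < 3 / 2 * rho by rewrite mulr_gt0 // divr_gt0.
pose chi z := \prod_b tp 3 (1 - (q * crd b z) * (q * crd b z)).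
have kc : Ck 2 setT chi.
  rewrite /chi; apply: Ck_prod; [exact: openT|move=> b _].
  have k1 : Ck 2 setT (fun z : Cn => 1 - (q * crd b z) * (q * crd b z)).
    have k2 := CkZ q openT (Ck_crd 2 b (@openT Cn)).
    exact: (CkB openT (Ck_cst 2 1 openT) (CkM openT k2 k2)).
  have := Ck_comp openT (Cr_tp 2 1) (fun z _ => Logic.I) k1.
  apply: (Ck_ext openT) => z _ /=; by rewrite mul1r.
have sc : csupp (3 / 2 * rho) chi.
  move=> z /existsNP[b /negP]; rewrite -ltNge crd0 subr0 => hb.
  rewrite /chi (bigD1 b) //= tpN ?mul0r // subr_le0 -expr2 -[leRHS]real_normK ?num_real //.
  rewrite exprn_ege1 // normrM gtr0_norm ?invr_gt0 // /q mulrC ler_pdivlMr // mul1r ltW //.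
have bC := bcs_Ck kc sc; have [C1 [_ h1 _]] := bcsP bC.
have bl : bcs (lap chi).
  by apply: bcs_sum => b _; apply: (@bcs_rderive _ _ 0 (3/2*rho) _ _ _ (csupp_rderive _ sc)); exact: (Ck_rderive _ kc).
have [C2 [_ h2 _]] := bcsP bl.
(* On the inner box [|q x| <= 2 / 3], so each factor is at least [(1 - 4 / 9)^3]. *)
exists chi, (\prod_(b : 'I_n * bool) (5 / 9) ^+ 3), (Num.max C1 C2); split=> //.
- by apply: prodr_gt0 => b _; rewrite exprn_gt0 // divr_gt0.
- move=> z hz; apply: ler_prod => b _; rewrite exprn_ge0 ?divr_ge0 //=.
  have hb : `|q * crd b z| <= 2 / 3.
    have := hz b; rewrite crd0 subr0 normrM gtr0_norm ?invr_gt0 // /q => hb.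
    rewrite mulrC ler_pdivrMr //; have -> : 2 / 3 * (3 / 2 * rho) = rho by field.
    exact: ltW.
  have : (q * crd b z) * (q * crd b z) <= 4 / 9.
    rewrite -expr2 -[leLHS]real_normK ?num_real // (_ : 4 / 9 = (2 / 3) ^+ 2); last by field.
    by rewrite ler_sqr ?nnegrE // divr_ge0.
  move: (_ * _) => y hy; rewrite tpP; last by lra.
  by rewrite lerXn2r ?nnegrE; lra.
- move=> z; split.
  + by apply: prodr_ge0 => b _; exact: tp_ge0.
  + by rewrite le_max; apply/orP; left; exact: le_trans (ler_norm _) (h1 z).
  + by rewrite le_max; apply/orP; right.
Qed.

End Laplacian.

Lemma grad_num1 (R : realType) (m b u : R) : u < m + b / 2 -> 0 < b ->
  0 <= m + b - u /\ 3 * b <= 6 * (m + b - u).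
Proof. by move=> *; split; lra. Qed.

Lemma grad_num4 (R : realType) (x1 x2 p g q : R) : x1 <= p -> - g * q <= x2 -> x1 - x2 <= p + g * q.
Proof. by move=> *; lra. Qed.

Lemma grad_num5 (R : realType) (x p L C f l K M : R) : x <= p * (L + C) -> f * l <= K -> C * p <= M ->
  x - (p * L - f * l) <= K + M.
Proof. by move=> *; lra. Qed.

Lemma grad_num3 (R : realType) (x g : R) : x ^+ 2 <= g -> x <= 1 + g.
Proof. by move=> *; nra. Qed.

Section GradientBound.
Variables (R : realType) (n : nat) (kappa rho delta m Ca C1 : R).
Local Notation Cn := 'rV[R[i]]_n.
Local Notation "'rb' b" := (@real_basis R n b) (at level 10).
Variables (x0 : Cn) (A : form2 R n) (f : Cn -> R).
Local Notation Dd := (box x0 (2 * rho)).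
Hypotheses (kappa0 : 0 < kappa) (rho0 : 0 < rho) (delta0 : 0 < delta).
Hypothesis kf : Ck 3 Dd f.
Hypothesis f_ge : forall z, Dd z -> m <= f z.
Hypothesis Opos : forall z, Dd z -> forall v, 0 <= Om kappa A f z v ('i *: v).
Hypothesis A_le : forall z, Dd z -> \sum_k A z (rb (k, false)) (rb (k, true)) <= Ca.
Hypothesis f_L1 : Int (zext (cbox x0 (3 / 2 * rho)) (fun z => `|f z|)) <= C1.
Variables (chi : Cn -> R) (cchi Cchi : R).
Hypotheses (cchi0 : 0 < cchi) (kchi : Ck 2 setT chi) (schi : csupp (3 / 2 * rho) chi).
Hypothesis chi_ge : forall z, box 0 rho z -> cchi <= chi z.
Hypothesis chi_le : forall z, [/\ 0 <= chi z, chi z <= Cchi & `|lap chi z| <= Cchi].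

Local Notation u := (uu delta x0 f).
Local Notation US := (US rho delta m x0 f).
Let oD : open Dd. Proof. exact: open_box. Qed.
Local Opaque box ddc wedge_top.
Let kf2 : Ck 2 Dd f. Proof. exact: Ck_pred. Qed.
Let ku : Ck 3 Dd u. Proof. exact: Ck_uu. Qed.

(** By the trace of [Om] the first term already makes [lap f] nonnegative; the second is the
    Laplacian of [delta |z - x0|^2], so that [lap f + C0l] dominates [lap u] as well. *)
Definition C0l : R := `|Ca| / kappa + 4 * delta * n%:R.

Lemma C0l_ge0 : 0 <= C0l.
Proof. by rewrite /C0l addr_ge0 // ?mulr_ge0 ?invr_ge0 // ltW. Qed.

Lemma lap_ge z : Dd z -> 0 <= lap f z + C0l - 4 * delta * n%:R.
Proof.
move=> Dz; have h k : 0 <= A z (rb (k, false)) (rb (k, true)) +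
   kappa * (rderive (rderive f (rb (k, false))) (rb (k, false)) z + rderive (rderive f (rb (k, true))) (rb (k, true)) z).
  have := Opos Dz (rb (k, false)); rewrite /Om.
  by rewrite (ddc_diag kappa oD kf2 Dz (erefl : rb (k, true) = 'i *: rb (k, false))).
have : 0 <= Ca + kappa * lap f z.
  apply: (@le_trans _ _ (\sum_k A z (rb (k, false)) (rb (k, true)) + kappa * lap f z)).
    rewrite /lap sum_pair_bool mulr_sumr -big_split; apply: sumr_ge0 => k _; exact: h.
  by rewrite lerD2r; exact: A_le.
have := ler_norm Ca; move: (lap f z) => L; rewrite /C0l => h1 h2.
rewrite (_ : _ - _ = (`|Ca| + kappa * L) / kappa); last by field; rewrite gt_eqF.
by apply: divr_ge0; [lra|exact: ltW].
Qed.

Lemma lap_uu z : Dd z -> lap u z = lap f z + 4 * delta * n%:R.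
Proof.
move=> Dz; have k1 : Ck 2 Dd (fun z => nsq (z - x0) + 0) := Ck_quad 2 x0 0 oD.
have -> : u = fun z => delta * (nsq (z - x0) + 0) + f z.
  by apply/funext => x; rewrite /uu addr0 addrC.
have E1 b : rderive (rderive (fun z => delta * (nsq (z - x0) + 0) + f z) (rb b)) (rb b) z =
    delta * (2 * dot (rb b) (rb b)) + rderive (rderive f (rb b)) (rb b) z.
  have e1 := rderive2_lin delta (rb b) (rb b) oD k1 kf2 Dz.
  by apply: (etrans e1); congr (_ * _ + _); exact: (rderive2_quad x0 0 (rb b) (rb b) oD Dz).
apply: (etrans (eq_bigr _ (fun b _ => E1 b))); rewrite big_split /= addrC; congr (_ + _).
have E b : dot (rb b) (rb b) = 1 :> R.
  rewrite -nsq_dot /nsq (bigD1 b) //= big1 ?addr0; first by rewrite crd_basis eqxx expr1n.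
  by move=> c cb; rewrite crd_basis (negbTE cb) expr0n.
under eq_bigr do rewrite E mulr1.
by rewrite sumr_const card_prod card_ord card_bool -[LHS]mulr_natr natrM; ring.
Qed.

Definition Yl : R := Int (zext (box x0 rho) (fun z => lap f z + C0l)).

Let sub32 : cbox x0 (3 / 2 * rho) `<=` Dd.
Proof. by apply: cbox_sub_box; rewrite ltr_pM2r // ltr_pdivrMr // -natrM ltr_nat. Qed.

Let sub1 : cbox x0 rho `<=` Dd.
Proof. by apply: cbox_sub_box; rewrite ltr_pMl // ltr1n. Qed.

Let mbox (a : Cn) (r : R) : measurable (box a r : set (BC R n)).
Proof. by apply: measurable_openC; exact: open_box. Qed.

Let lapc z : Dd z -> {for z, continuous (fun z => lap f z + C0l)}.
Proof. by move=> Dz; apply: continuousD; [exact: (lap_cont oD kf2 Dz)|exact: cst_continuous]. Qed.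

Let bY : bcs (zext (box x0 rho) (fun z => lap f z + C0l)).
Proof. exact: (bcs_zext_cont oD sub1 lapc (mbox x0 rho) (@box_sub_cbox _ _ x0 rho)). Qed.

Let lap_ge' z : Dd z -> 0 <= lap f z + C0l.
Proof.
move=> /lap_ge h; apply: le_trans h _; rewrite gerBl // !mulr_ge0 // ltW //.
Qed.

Definition CYl : R := (Cchi * C1 + C0l * Cchi * (4 * rho) ^+ (2 * n)) / cchi.

(** The nonnegative function [lap f + C0l] is tested against the cutoff; Green's formula moves the
    Laplacian onto the cutoff and leaves the L^1 norm of [f]. *)
Lemma Yl_le : Yl <= CYl.
Proof.
rewrite /CYl ler_pdivlMr // mulrC /Yl -(IntZ _ bY).
pose psi (z : Cn) := chi (z - x0).
pose K := cbox x0 (3 / 2 * rho).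
have cK : closed K by exact: closed_cbox.
have mK : measurable (K : set (BC R n)) by exact: measurable_closedC.
have kp : Ck 2 Dd psi.
  exact: (Ck_sub (@subsetT _ _) (Ck_shift x0 kchi)).
have p0 z : ~ K z -> psi z = 0.
  move=> Kz; apply: schi => h; apply: Kz => b; have := h b; by rewrite crd0 subr0 crdB.
have [bG IG] := Green oD cK sub32 (fun z h => h) kf2 kp (fun z _ => p0 z).
have bK : bcs (zext K (fun z => `|f z|)).
  apply: (bcs_zext_cont oD sub32 _ mK (fun z h => h)) => z Dz.
  by apply: (@continuous_comp _ _ _ f (fun x : R => `|x|)); [exact: (Ck_cont kf Dz)|exact: norm_continuous].
have b1 : bcs (zext Dd (fun=> 1 : R)) := bcs_vol (mbox x0 (2 * rho)) (@box_sub_cbox _ _ x0 (2 * rho)).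
have bcY := bcsZ cchi bY; rewrite -[leLHS]subr0 -{1}IG -(IntB bcY bG).
apply: (@le_trans _ _ (Int (fun z => Cchi * zext K (fun z => `|f z|) z + C0l * Cchi * zext Dd (fun=> 1) z))).
  apply: Int_le; [by apply: bcsB => //; exact: bcsZ|by apply: bcsD; exact: bcsZ|].
  move=> z; have [Dz|nD] := pselect (Dd z); last first.
    have nK : ~ K z by move=> /sub32.
    have nB : ~ box x0 rho z by move=> /box_sub_cbox /sub1.
    by rewrite !zextF // !mulr0 subr0 addr0.
  rewrite [zext Dd (fun z => _ - _) z]zextT // [zext Dd (fun=> 1) z]zextT // mulr1.
  have [h1 h2 h3] := chi_le (z - x0).
  have hl : lap psi z = lap chi (z - x0) := lap_shift chi x0 z.
  have L0 := lap_ge' Dz; have C00 := C0l_ge0.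
  have S1 : cchi * zext (box x0 rho) (fun z => lap f z + C0l) z <= psi z * (lap f z + C0l).
    have [Bz|nB] := pselect (box x0 rho z); last first.
      by rewrite (zextF (fun z => lap f z + C0l) nB) mulr0; exact: mulr_ge0.
    have hc : cchi <= chi (z - x0) by apply: chi_ge => b; have := Bz b; rewrite crd0 subr0 crdB.
    rewrite (zextT (fun z => lap f z + C0l) Bz); exact: (ler_wpM2r L0 hc).
  have S2 : f z * lap psi z <= Cchi * zext K (fun z => `|f z|) z.
    have [Kz|nK] := pselect (K z); last first.
      have oK : open (~` K) by exact: closed_openC.
      have l0 : lap psi z = 0.
        apply: big1 => b _.
        exact: (rderive_local0 (rb b) oK (fun x Kx => rderive_local0 (rb b) oK p0 Kx) nK).
      by rewrite (zextF (fun z => `|f z|) nK) l0 !mulr0.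
    rewrite (zextT (fun z => `|f z|) Kz) hl mulrC; apply: le_trans (ler_norm _) _.
    by rewrite normrM; exact: ler_wpM2r.
  have S3 : C0l * psi z <= C0l * Cchi by rewrite ler_wpM2l.
  exact: grad_num5 S1 S2 S3.
rewrite IntD ?IntZ //; try exact: bcsZ.
have Cc0 : 0 <= Cchi by have [h1 h2 _] := chi_le 0; exact: le_trans h2.
apply: lerD; first by rewrite ler_wpM2l.
have := @vol_box R n x0 (2 * rho); rewrite /vol => ->; last by rewrite mulr_gt0.
by rewrite (_ : 2 * (2 * rho) = 4 * rho) //; ring.
Qed.

Definition grad2 z : R := \sum_b rderive u (rb b) z ^+ 2.

Lemma grad2_cont z : Dd z -> {for z, continuous grad2}.
Proof.
move=> Dz; have k0 : Ck 0 Dd grad2.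
  rewrite /grad2; apply: Ck_sum; [exact: oD|move=> b _].
  have k1 : Ck 0 Dd (rderive u (rb b)) := Ck_le (isT : (0 <= 2)%N) (Ck_rderive (rb b) ku).
  exact: (CkM oD k1 k1).
exact: (Ck_cont k0 Dz).
Qed.

Lemma grad2_ge0 z : 0 <= grad2 z.
Proof. by apply: sumr_ge0 => b _; exact: sqr_ge0. Qed.

Lemma bcs_grad2 s : s <= delta * rho ^+ 2 -> bcs (zext (US s) grad2).
Proof.
move=> hs; apply: (bcs_zext_cont oD sub1 grad2_cont (measurable_US delta m kf _)).
by apply: (subset_trans (US_sub rho0 delta0 f_ge hs)); exact: box_sub_cbox.
Qed.

(* Integrate the Laplacian of [(m + b - u)_+^3] over the box. *)
Lemma grad_bound b : 0 < b -> b <= delta * rho ^+ 2 -> Int (zext (US (b / 2)) grad2) <= b * Yl.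
Proof.
move=> b0 hb; pose h (x : R) := tp 3 (m + b - x); pose g (x : R) := - 3 * tp 2 (m + b - x).
pose k (x : R) := 6 * tp 1 (m + b - x).
have sd (j : nat) (x : R) : is_derive x (1 : R) (fun y : R => tp j.+2 (m + b - y)) (- (j.+2%:R * tp j.+1 (m + b - x))).
  have h2 : is_derive x (1 : R) (fun y : R => m + b - y) (-1) by apply: is_derive_eq; rewrite /GRing.scale /=; ring.
  rewrite -mulrN1; exact: (@is_derive1_comp R _ _ x _ _ (is_derive_tp j (m + b - x)) h2).
have hd x : setT x -> is_derive x (1 : R) h (g x).
  by move=> _; have := sd 1%N x; rewrite /g mulNr.
have gd x : setT x -> is_derive x (1 : R) g (k x).
  move=> _; have D := sd 0%N x; rewrite /g /k; apply: is_derive_eq; rewrite /GRing.scale /=; ring.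
have Ch : Cr 2 setT h.
  apply: (@Cr_is_derive _ _ _ _ g openT hd); apply: (@Cr_is_derive _ _ _ _ k openT gd).
  split=> // x _; rewrite /k; apply: continuousM; first exact: cst_continuous.
  apply: (@continuous_comp _ _ _ (fun y : R => m + b - y) (@tp R 1)); last exact: continuous_tp1.
  by apply: continuousB; [exact: cst_continuous|].
have ku2 : Ck 2 Dd u := Ck_pred ku.
have kpsi : Ck 2 Dd (h \o u) := Ck_comp oD Ch (fun z _ => Logic.I) ku2.
have p0 z : Dd z -> ~ cbox x0 rho z -> (h \o u) z = 0.
  move=> Dz Kz; rewrite /h /= tpN // subr_le0; apply: le_trans (uu_out rho0 delta0 f_ge Dz _).
    by rewrite lerD2l.
  by move=> /box_sub_cbox.
have [bl Il] := Int_lap oD (@closed_cbox _ _ x0 rho) sub1 (fun z h => h) kpsi p0.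
have lapE z : Dd z -> lap (h \o u) z = k (u z) * grad2 z + g (u z) * lap u z.
  move=> Dz; rewrite /lap /grad2 !mulr_sumr -big_split; apply: eq_bigr => c _.
  have E := rderive2_comp (rb c) (rb c) oD ku2 Dz (fun x _ => Logic.I) hd gd.
  by rewrite expr2; exact: E.
have hb2 : b / 2 <= delta * rho ^+ 2 by apply: le_trans hb; lra.
have bG := bcs_grad2 hb2.
(* On [US (b / 2)] the second derivative [k (u z)] is at least [3 b]; throughout the box [- g (u z)]
   lies between 0 and [3 b^2], and it vanishes where [u >= m + b]. *)
have key : Int (fun z => (3 * b) * zext (US (b / 2)) grad2 z - (3 * b ^+ 2) * zext (box x0 rho) (fun z => lap f z + C0l) z) <= 0.
  have bZ1 := bcsZ (3 * b) bG; have bZ2 := bcsZ (3 * b ^+ 2) bY.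
  rewrite -Il; apply: Int_le; [exact: bcsB|exact: bl|].
  move=> z; have [Dz|nD] := pselect (Dd z); last first.
    rewrite !zextF ?mulr0 ?subrr //; [by move=> /box_sub_cbox /sub1|by case].
  have El := zextT (lap (h \o u)) Dz; rewrite El lapE // lap_uu //.
  have G0 := grad2_ge0 z; have L0 := lap_ge' Dz; have L1 := lap_ge Dz.
  have um : m <= u z by apply: le_trans (f_ge Dz) _; rewrite /uu lerDl mulr_ge0 ?nsq_ge0 // ltW.
  have S1 : 3 * b * zext (US (b / 2)) grad2 z <= k (u z) * grad2 z.
    have [Uz|nU] := pselect (US (b / 2) z); last first.
      by rewrite zextF // mulr0 mulr_ge0 // /k mulr_ge0 // tp_ge0.
    rewrite zextT // ler_wpM2r // /k; have [_ uz] := Uz.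
    by have [e1 e2] := grad_num1 uz b0; rewrite tpP ?expr1.
  have S2 : - g (u z) * (lap f z + 4 * delta * n%:R) <= 3 * b ^+ 2 * zext (box x0 rho) (fun z => lap f z + C0l) z.
    have t0 := tp_ge0 2 (m + b - u z).
    have [Bz|nB] := pselect (box x0 rho z); last first.
      rewrite zextF // mulr0 /g tpN ?mulr0 ?oppr0 ?mul0r // subr_le0.
      by apply: le_trans (uu_out rho0 delta0 f_ge Dz nB); rewrite lerD2l.
    rewrite zextT //; apply: (@le_trans _ _ (- g (u z) * (lap f z + C0l))).
      rewrite ler_wpM2l //; first by rewrite /g mulNr opprK mulr_ge0.
      by rewrite lerD2l /C0l lerDr divr_ge0 // ltW.
    rewrite ler_wpM2r // /g mulNr opprK ler_wpM2l // /tp lerXn2r ?nnegrE ?le_max ?lexx ?orbT ?(ltW b0) //.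
    by rewrite ge_max (ltW b0) andbT lerBlDr addrC lerD2l.
  exact: grad_num4 S1 S2.
move: key; rewrite (IntB (bcsZ _ bG) (bcsZ _ bY)) (IntZ _ bG) (IntZ _ bY) subr_le0 (_ : 3 * b ^+ 2 * _ = (3 * b) * (b * Yl)); last by rewrite /Yl; ring.
by rewrite ler_pM2l // mulr_gt0.
Qed.

(** [|x| <= 1 + x^2] trades the L^1 norm for the volume of the box and the integral of [grad2]. *)
Lemma grad_L1 b s : 0 < b -> b <= delta * rho ^+ 2 -> s <= b / 2 -> forall c,
  Int (zext (US s) (fun z => `|rderive u (rb c) z|)) <= (4 * rho) ^+ (2 * n) + b * Yl.
Proof.
move=> b0 hb sb c.
have hb2 : b / 2 <= delta * rho ^+ 2 by apply: le_trans hb; lra.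
have b1 : bcs (zext Dd (fun=> 1 : R)) := bcs_vol (mbox x0 (2 * rho)) (@box_sub_cbox _ _ x0 (2 * rho)).
have E1 : Int (zext Dd (fun=> 1 : R)) = (4 * rho) ^+ (2 * n).
  have := @vol_box R n x0 (2 * rho); rewrite /vol => ->; last by rewrite mulr_gt0.
  by rewrite (_ : 2 * (2 * rho) = 4 * rho) //; ring.
rewrite -E1; apply: le_trans (_ : _ <= Int (zext Dd (fun=> 1)) + Int (zext (US (b / 2)) grad2)) _; last first.
  by rewrite lerD2l; exact: grad_bound.
rewrite -IntD //; last exact: bcs_grad2.
have cr z : Dd z -> {for z, continuous (fun z => `|rderive u (rb c) z|)}.
  move=> Dz; apply: (@continuous_comp _ _ _ (rderive u (rb c)) (fun x : R => `|x|)); last exact: norm_continuous.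
  exact: (Ck_cont (Ck_rderive (rb c) ku) Dz).
apply: Int_le.
- apply: (bcs_zext_cont oD sub1 cr (measurable_US delta m kf _)).
  by apply: (subset_trans (US_sub rho0 delta0 f_ge (le_trans sb hb2))); exact: box_sub_cbox.
- by apply: bcsD => //; exact: bcs_grad2.
move=> z; have [Uz|nU] := pselect (US s z); last first.
  rewrite (zextF (fun z => `|rderive u (rb c) z|) nU) addr_ge0 //; apply: zext_ge0 => // x _; exact: grad2_ge0.
have Uz2 : US (b / 2) z by exact: US_mono sb _ Uz.
have [Dz _] := Uz.
rewrite (zextT (fun z => `|rderive u (rb c) z|) Uz) (zextT (fun=> 1) Dz) (zextT grad2 Uz2).
have : rderive u (rb c) z ^+ 2 <= grad2 z.
  by rewrite /grad2 (bigD1 c) //= lerDl sumr_ge0 // => d _; exact: sqr_ge0.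
rewrite -[_ ^+ 2]real_normK ?num_real //; exact: grad_num3.
Qed.

End GradientBound.

(** * Volume decay of sublevel sets of low density *)

Section Translation.
Variables (R : realType) (n : nat).
Local Notation Cn := 'rV[R[i]]_n.
Local Notation mu := (lebC R n).

Lemma Int_EFin (F : Cn -> R) : bcs F -> (\int[mu]_z (F z)%:E = (Int F)%:E)%E.
Proof.
move=> /bcs_integrable iF; rewrite /Int /Rintegral fineK //.
exact: integrable_fin_num.
Qed.

Lemma measurable_addC : measurable_fun setT (fun p : BC R n * BC R n => ((p.1 : Cn) + (p.2 : Cn) : BC R n)).
Proof.
apply: measurable_of_crd => b.
rewrite (_ : _ \o _ = (fun p => crd b (p.1 : Cn) + crd b (p.2 : Cn))); last first.
  by apply/funext => p /=; rewrite crdD.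
apply: measurable_funD; first exact: (measurableT_comp (@measurable_crd R n b) measurable_fst).
exact: (measurableT_comp (@measurable_crd R n b) measurable_snd).
Qed.

(** Double counting of [|G (z + y) - G z|] over [z] in [E] and [y] in [box 0 r]: integrated over [y]
    first, each [z] contributes at least half the volume of the box; integrated over [z] first, each
    [y] contributes at most [L]. *)
Lemma vol_translate (G : Cn -> R) (E : set Cn) (a : Cn) (rho r L : R) : 0 < r -> bcs G ->
  measurable (E : set (BC R n)) -> E `<=` cbox a rho ->
  (forall y, box 0 r y -> Int (fun z => `|G (z + y) - G z|) <= L) ->
  (forall z, E z -> 2^-1 * (2 * r) ^+ (2 * n) <= Int (zext (box 0 r) (fun y => `|G (z + y) - G z|))) ->
  vol E <= 2 * L.
Proof.
move=> r0 bG mE Ea hL hE.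
have mB : measurable (box 0 r : set (BC R n)) by apply: measurable_openC; exact: open_box.
pose H (p : BC R n * BC R n) : R := zext E (fun=> 1) p.1 * zext (box 0 r) (fun=> 1) p.2 * `|G ((p.1 : Cn) + p.2) - G p.1|.
have bE := bcs_vol mE Ea; have bB := bcs_vol mB (@box_sub_cbox _ _ 0 r).
have mH : measurable_fun setT (EFin \o H).
  apply/measurable_EFinP; apply: measurable_funM.
    apply: measurable_funM; (apply: measurableT_comp; first by [exact: bE.1|exact: bB.1]).
      exact: measurable_fst.
    exact: measurable_snd.
  apply: measurableT_comp => //; apply: measurable_funB.
    exact: (measurableT_comp bG.1 measurable_addC).
  exact: (measurableT_comp bG.1 measurable_fst).
have z0 (K : set Cn) x : 0 <= zext K (fun=> 1) x :> R by apply: zext_ge0.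
have H0 p : (0 <= (EFin \o H) p)%E by rewrite lee_fin !mulr_ge0.
have bd y : bcs (fun z => `|G (z + y) - G z|).
  by apply: bcs_abs; apply: bcsD; [exact: bcs_shift|exact: bcsN].
have bd2 z : bcs (zext (box 0 r) (fun y => `|G (z + y) - G z|)).
  have [M [M0 h1 h2]] := bcsP bG; apply: (@bcs_zext _ _ _ _ 0 r (M + M)) => //.
  - apply: measurable_funTS; apply: measurableT_comp => //; apply: measurable_funB => //.
    have := (bcs_shift z bG).1; congr (measurable_fun _ _); apply/funext => y; congr G; exact: addrC.
  - exact: box_sub_cbox.
  - by move=> y _; rewrite normr_id; apply: le_trans (ler_normB _ _) _; exact: lerD.
have mF := measurable_fun_fubini_tonelli_F (m2 := mu) _ mH H0.
have mG := measurable_fun_fubini_tonelli_G (m1 := mu) _ mH H0.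
have FE z : (\int[mu]_y (EFin \o H) (z, y) = (zext E (fun=> 1) z * Int (zext (box 0 r) (fun y => `|G (z + y) - G z|)))%:E)%E.
  rewrite -IntZ // -Int_EFin; last exact: bcsZ.
  apply: eq_integral => y _; rewrite /H /=; congr (_%:E); rewrite -mulrA; congr (_ * _).
  by rewrite /zext; case: asboolP => _; rewrite ?mul1r ?mul0r.
have GE y : (\int[mu]_z (EFin \o H) (z, y) <= (zext (box 0 r) (fun=> 1) y * L)%:E)%E.
  have [By|nB] := pselect (box 0 r y); last first.
    rewrite zextF // mul0r integral0_eq // => z _.
    by rewrite /H /= (zextF _ nB) mulr0 mul0r.
  rewrite (zextT _ By) mul1r; apply: le_trans (_ : _ <= (Int (fun z => `|G (z + y) - G z|))%:E)%E _; last first.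
    by rewrite lee_fin; exact: hL.
  rewrite -Int_EFin //; apply: ge0_le_integral => //.
  - exact: (measurableT_comp mH (measurable_pair2 _)).
  - by apply/measurable_EFinP; exact: (bd y).1.
  - move=> z _; rewrite lee_fin /H /= (zextT _ By) mulr1 ler_piMl //.
    by rewrite /zext; case: asboolP.
have L1 : ((2^-1 * (2 * r) ^+ (2 * n) * vol E)%:E <= \int[mu]_z \int[mu]_y (EFin \o H) (z, y))%E.
  rewrite /vol -IntZ // -Int_EFin; last exact: bcsZ.
  apply: ge0_le_integral => //.
  - by move=> z _; rewrite lee_fin !mulr_ge0 // ?invr_ge0 // exprn_ge0 // mulr_ge0 // ltW.
  - by apply/measurable_EFinP; exact: (bcsZ _ bE).1.
  - move=> z _; rewrite FE lee_fin; have [Ez|nE] := pselect (E z); last by rewrite zextF // mulr0 mul0r.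
    by rewrite zextT // mulr1 mul1r; exact: hE.
have L2 : (\int[mu]_y \int[mu]_z (EFin \o H) (z, y) <= (L * (2 * r) ^+ (2 * n))%:E)%E.
  rewrite -(vol_box 0 r0) /vol -IntZ // -Int_EFin; last exact: bcsZ.
  apply: ge0_le_integral => //.
  - by move=> y _; apply: integral_ge0.
  - by apply/measurable_EFinP; exact: (bcsZ _ bB).1.
  - by move=> y _; apply: le_trans (GE y) _; rewrite mulrC.
have : ((2^-1 * (2 * r) ^+ (2 * n) * vol E)%:E <= (L * (2 * r) ^+ (2 * n))%:E)%E.
  apply: le_trans L1 _; apply: le_trans L2.
  by rewrite (fubini_tonelli (m1 := mu) (m2 := mu) _ mH H0).
have p0 : 0 < (2 * r) ^+ (2 * n) by rewrite exprn_gt0 // mulr_gt0.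
rewrite lee_fin mulrAC ler_pM2r //; move: (vol E) => v h; lra.
Qed.

End Translation.

Lemma decay_num1 (R : realType) (m s t u : R) : u < m + s - 2 * t + t -> 0 < t -> u < m + s.
Proof. by move=> *; lra. Qed.

Lemma decay_num2 (R : realType) (s t : R) : 0 < t -> s - 2 * t <= s - t.
Proof. by move=> *; lra. Qed.

Lemma decay_num3 (R : realType) (x : R) : 3 <= x -> [/\ 0 <= x, 0 <= x - 1, 0 <= x - 2 & 0 <= x - 3].
Proof. by move=> *; split; lra. Qed.

Lemma decay_num4 (R : realType) (v P : R) : v <= 2^-1 * P -> 2^-1 * P <= P - v.
Proof. by move=> *; lra. Qed.

Lemma decay_num5 (R : realType) (m s t u : R) : u < m + (s - 2 * t) -> u - (m + s - 2 * t) <= 0.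
Proof. by move=> *; lra. Qed.

Section Decay.
Variables (R : realType) (n : nat) (rho delta m Cg : R).
Local Notation Cn := 'rV[R[i]]_n.
Local Notation "'rb' b" := (@real_basis R n b) (at level 10).
Variables (x0 : Cn) (f : Cn -> R).
Local Notation Dd := (box x0 (2 * rho)).
Hypotheses (rho0 : 0 < rho) (delta0 : 0 < delta).
Hypothesis kf : Ck 3 Dd f.
Hypothesis f_ge : forall z, Dd z -> m <= f z.
Local Notation u := (uu delta x0 f).
Local Notation US := (US rho delta m x0 f).
Let oD : open Dd. Proof. exact: open_box. Qed.
Local Opaque box.

Hypothesis grad_le : forall s c, s <= delta * rho ^+ 2 / 2 ->
  Int (zext (US s) (fun z => `|rderive u (rb c) z|)) <= Cg.

Section OneLevel.
Variables (s t r : R).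
Hypotheses (t0 : 0 < t) (r0 : 0 < r) (hs : s <= delta * rho ^+ 2 / 2).

(** The step [bsp 3 / 6] has width 3; rescaled to width [t] its slope is at most [3 / t]. *)
Let th (x : R) : R := 1 - 6^-1 * bsp 3 (3 / t * x).
Let th' (x : R) : R := - (3 / (2 * t)) * bsp 2 (3 / t * x).
Let c0 : R := m + s - 2 * t.
Let g (z : Cn) : R := th (u z - c0).
Let G : Cn -> R := zext Dd g.

Let d0 : 0 <= delta * rho ^+ 2. Proof. by rewrite mulr_ge0 ?ltW // exprn_gt0. Qed.

Let hs1 : s <= delta * rho ^+ 2.
Proof. by apply: le_trans hs _; rewrite ler_pdivrMr // ler_peMr // ler1n. Qed.

Let thd (x : R) : is_derive x (1 : R) th (th' x).
Proof.
have h2 : is_derive x (1 : R) (fun y : R => 3 / t * y) (3 / t).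
  by apply: is_derive_eq; rewrite /GRing.scale /= ?mulr1 ?mulr0 ?addr0 ?add0r.
have D := @is_derive1_comp R _ _ x _ _ (is_derive_bsp 1 (3 / t * x)) h2.
have D2 := @is_deriveZ R R R _ (6^-1) x 1 _ D.
have D3 := @is_deriveB R R R (cst 1) _ x 1 _ _ (is_derive_cst _ _ _) D2.
move: D3; rewrite /GRing.scale /=.
by congr (is_derive _ _ _ _); rewrite /th'; field; rewrite gt_eqF.
Qed.

Let th0 (x : R) : x <= 0 -> th x = 1.
Proof. by move=> x0'; rewrite /th bsp_le0 ?mulr0 ?subr0 // pmulr_rle0 // divr_gt0. Qed.

Let th1 (x : R) : t <= x -> th x = 0.
Proof.
move=> tx; rewrite /th bsp3_ge3; first by field.
by rewrite -mulrA ler_peMr // mulrC ler_pdivlMr // mul1r.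
Qed.

Let th'_le (x : R) : `|th' x| <= 3 / t.
Proof.
rewrite /th' mulNr normrN ger0_norm; last by rewrite mulr_ge0 ?bsp2_ge0 // divr_ge0 // mulr_ge0 // ltW.
apply: (@le_trans _ _ (3 / (2 * t) * 2)); first by rewrite ler_wpM2l ?bsp2_le // divr_ge0 // mulr_ge0 // ltW.
by rewrite le_eqVlt; apply/orP; left; apply/eqP; field; rewrite gt_eqF.
Qed.

Let Cth : Cr 1 setT th.
Proof.
apply: (@Cr_is_derive _ _ _ _ th' openT (fun x _ => thd x)).
Local Transparent Cr.
split=> // x _; rewrite /th'; apply: continuousM; first exact: cst_continuous.
apply: (@continuous_comp _ _ _ (fun y : R => 3 / t * y) (@bsp R 2)).
  by apply: continuousM; first exact: cst_continuous.
have [d _] := is_derive_bsp 0 (3 / t * x).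
exact/differentiable_continuous/derivable1_diffP.
Local Opaque Cr.
Qed.

Let ku : Ck 1 Dd u.
Proof. exact: (Ck_le (isT : (1 <= 3)%N) (Ck_uu delta kf)). Qed.

Let kuc : Ck 1 Dd (fun z => u z - c0).
Proof. exact: (CkB oD ku (Ck_cst 1 c0 oD)). Qed.

Let kg : Ck 1 Dd g.
Proof. exact: (Ck_comp oD Cth (fun z _ => Logic.I) kuc). Qed.

Let sub1 : cbox x0 rho `<=` Dd.
Proof. by apply: cbox_sub_box; rewrite ltr_pMl // ltr1n. Qed.

Let g0 z : Dd z -> ~ US (s - t) z -> g z = 0.
Proof.
move=> Dz nU; apply: th1; rewrite lerBrDl leNgt; apply/negP => h; apply: nU; split=> //.
by apply: lt_le_trans h _; rewrite /c0; lra.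
Qed.

Let US_K : US (s - t) `<=` cbox x0 rho.
Proof.
have h : s - t <= delta * rho ^+ 2 by apply: le_trans hs1; rewrite gerBl ltW.
by apply: (subset_trans (US_sub rho0 delta0 f_ge h)); exact: box_sub_cbox.
Qed.

Let g0K z : Dd z -> ~ cbox x0 rho z -> g z = 0.
Proof. by move=> Dz nK; apply: g0 => // /US_K. Qed.

Let kG : Ck 1 setT G := Ck_zext oD (@closed_cbox _ _ x0 rho) sub1 g0K kg.

Let sG : csupp (rho + \sum_b `|crd b x0|) G.
Proof.
move=> z nz; rewrite /G /zext; case: asboolP => // Dz; apply: g0K => // h; apply: nz; exact: cbox0_sub h.
Qed.

Let dG b z : `|rderive G (rb b) z| <= 3 / t * zext (US s) (fun z => `|rderive u (rb b) z|) z.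
Proof.
have t3 : 0 <= 3 / t by rewrite divr_ge0 // ltW.
have zz : 0 <= zext (US s) (fun z => `|rderive u (rb b) z|) z by apply: zext_ge0.
have [Dz|nD] := pselect (Dd z); last first.
  have oK : open (~` cbox x0 rho) by apply: closed_openC; exact: closed_cbox.
  have G0 x : (~` cbox x0 rho) x -> G x = 0.
    by move=> Kx; rewrite /G /zext; case: asboolP => // Dx; exact: g0K.
  have nK : (~` cbox x0 rho) z by move=> /sub1.
  by rewrite (rderive_local0 (rb b) oK G0 nK) normr0 mulr_ge0.
rewrite (rderive_zext oD Dz (Ck_der (rb b) kg Dz)).
have E : rderive g (rb b) z = th' (u z - c0) * rderive u (rb b) z.
  have [d1 e1] := rderiveD_def (Ck_der (rb b) ku Dz) (rderive_cst (- c0) (rb b) z).1.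
  have := rderive_comp (rb b) kuc Dz (thd (u z - c0)).
  by rewrite e1 (rderive_cst (- c0) (rb b) z).2 addr0.
rewrite E normrM; have [Uz|nU] := pselect (US s z).
  by rewrite (zextT (fun z => `|rderive u (rb b) z|) Uz); apply: ler_wpM2r => //; exact: th'_le.
suff E0 : th' (u z - c0) = 0 by rewrite E0 normr0 mul0r; exact: mulr_ge0.
have h : t <= u z - c0.
  rewrite lerBrDl leNgt; apply/negP => h; apply: nU; split=> //.
  exact: decay_num1 h t0.
have h3 : 3 <= 3 / t * (u z - c0).
  by rewrite -mulrA ler_peMr // mulrC ler_pdivlMr // mul1r.
have [h4 h5 h6 h7] := decay_num3 h3.
by rewrite /th' /bsp !tpP //; ring.
Qed.

Let bdu b : bcs (zext (US s) (fun z => `|rderive u (rb b) z|)).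
Proof.
have cr z : Dd z -> {for z, continuous (fun z => `|rderive u (rb b) z|)}.
  move=> Dz; apply: (@continuous_comp _ _ _ (rderive u (rb b)) (fun x : R => `|x|)); last exact: norm_continuous.
  exact: (Ck_cont (Ck_rderive (rb b) ku) Dz).
apply: (bcs_zext_cont oD sub1 cr (measurable_US delta m kf _)).
by apply: (subset_trans (US_sub rho0 delta0 f_ge hs1)); exact: box_sub_cbox.
Qed.

Let trans_le y : box 0 r y -> Int (fun z => `|G (z + y) - G z|) <= (2 * n)%:R * (r * (3 / t * Cg)).
Proof.
move=> hy; apply: le_trans (Int_translate_diff y kG sG) _.
have bG b : bcs (fun z => 3 / t * zext (US s) (fun z => `|rderive u (rb b) z|) z) := bcsZ _ (bdu b).
have -> : (2 * n)%:R * (r * (3 / t * Cg)) = \sum_(b : 'I_n * bool) r * (3 / t * Cg).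
  by rewrite sumr_const card_prod card_ord card_bool mulnC mulr_natl.
apply: (@le_trans _ _ (\sum_b Int (fun z => r * (3 / t * zext (US s) (fun z => `|rderive u (rb b) z|) z)))); last first.
  apply: ler_sum => b _; rewrite (IntZ _ (bG b)) (IntZ _ (bdu b)) ler_pM2l // ler_pM2l ?divr_gt0 //.
  exact: grad_le.
rewrite -Int_sum; last by move=> b _; exact: bcsZ.
apply: Int_le; [exact/bcs_abs/(bcs_rderive y kG sG)|by apply: bcs_sum => b _; exact: bcsZ|].
move=> z; rewrite (rderive_expand y openT kG Logic.I); apply: le_trans (ler_norm_sum _ _ _) _.
apply: ler_sum => b _; rewrite normrM; apply: ler_pM; [exact: normr_ge0|exact: normr_ge0| |].
  by have := hy b; rewrite crd0 subr0 => /ltW.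
by exact: dG.
Qed.

(* Apply [vol_translate] to a cutoff equal to 1 on [US (s - 2t)] and vanishing
   off [US (s - t)]: low density makes its translates by [y] in a box of radius [r]
   differ from it, on average by at least 1/2. *)
Lemma vol_US_decay : (forall z, US (s - 2 * t) z -> vol (US (s - t) `&` box z r) <= 2^-1 * (2 * r) ^+ (2 * n)) ->
  vol (US (s - 2 * t)) <= 2 * ((2 * n)%:R * (r * (3 / t * Cg))).
Proof.
move=> hd; have bG := bcs_Ck kG sG.
have UK2 : US (s - 2 * t) `<=` cbox x0 rho.
  by apply: subset_trans US_K; apply: US_mono; exact: decay_num2.
apply: (vol_translate r0 bG (measurable_US delta m kf _) UK2 trans_le) => z Uz.
have mE : measurable (US (s - t) `&` box z r : set (BC R n)).
  apply: measurableI; first exact: measurable_US.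
  by apply: measurable_openC; exact: open_box.
have mB : measurable (box 0 r : set (BC R n)) by apply: measurable_openC; exact: open_box.
have bE : bcs (zext (US (s - t) `&` box z r) (fun=> 1 : R)).
  by apply: (bcs_vol mE (a := z) (M := r)) => x [_ /box_sub_cbox].
have bB := bcs_vol mB (@box_sub_cbox _ _ 0 r).
have Ez : Int (fun y => zext (US (s - t) `&` box z r) (fun=> 1) (y + z)) = vol (US (s - t) `&` box z r).
  exact: Int_translate.
have := hd z Uz; rewrite -Ez => h1.
apply: (@le_trans _ _ (Int (fun y => zext (box 0 r) (fun=> 1) y - zext (US (s - t) `&` box z r) (fun=> 1) (y + z)))).
  rewrite (IntB bB (bcs_shift z bE)); have := vol_box (0 : Cn) r0; rewrite /vol => ->.
  exact: decay_num4 h1.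
apply: Int_le; first exact: bcsB bB (bcs_shift z bE).
  have [M [M0 k1 k2]] := bcsP bG; apply: (@bcs_zext _ _ _ _ 0 r (M + M)) => //.
  - apply: measurable_funTS; apply: measurableT_comp => //; apply: measurable_funB => //.
    have := (bcs_shift z bG).1; congr (measurable_fun _ _); apply/funext => y; congr G; exact: addrC.
  - exact: box_sub_cbox.
  - by move=> y _; rewrite normr_id; apply: le_trans (ler_normB _ _) _; exact: lerD.
move=> y; have [By|nB] := pselect (box 0 r y); last first.
  rewrite (zextF _ nB) (zextF _ nB) sub0r oppr_le0; exact: zext_ge0.
rewrite (zextT _ By) (zextT _ By); have [Dz Uz'] := Uz.
have Gz : G z = 1.
  rewrite /G (zextT _ Dz) /g th0 //; exact: decay_num5 Uz'.
rewrite Gz; have [Uy|nU] := pselect (US (s - t) (z + y)).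
  have Ey : (US (s - t) `&` box z r) (y + z).
    split; first by rewrite (addrC y z).
    by move=> b; rewrite crdD addrK; have := By b; rewrite crd0 subr0.
  by rewrite (zextT _ Ey) subrr.
have -> : G (z + y) = 0 by rewrite /G /zext; case: asboolP => // Dzy; exact: g0.
have nE : ~ (US (s - t) `&` box z r) (y + z) by case=> h _; apply: nU; rewrite (addrC z y).
by rewrite (zextF _ nE) subr0 sub0r normrN normr1.
Qed.

End OneLevel.
End Decay.

(** * De Giorgi iteration *)

Section DeGiorgi.
Variable R : realType.
Implicit Types (h : R -> R) (k K : nat).
Local Notation leb := (@lebesgue_measure R).

(** Integral test: [1 / h] is nonincreasing, so [1 / h (k + 1)] is at most its integral over
    [[k, k + 1]]; the partial sums are bounded and their tails small. *)
Lemma sum_inv_tail h : (forall t, 0 <= t -> 0 < h t) -> (forall s t, 0 <= s -> s <= t -> h s <= h t) ->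
  (exists2 a : R, 0 <= a & (\int[leb]_(t in `[a, +oo[) ((h t)^-1)%:E < +oo)%E) ->
  forall e : R, 0 < e -> exists k0, forall K, (k0 <= K)%N -> \sum_(k0 <= k < K) (h k%:R)^-1 <= e.
Proof.
move=> h0 hm [a a0 ha] e e0.
(* The conditions on [h] concern R^+ only; freezing the argument at 0 gives a function that is
   monotone on all of R, hence measurable. *)
pose g (t : R) : R := (h (Num.max t 0))^-1.
have hx0 (t : R) : 0 <= Num.max t 0 by rewrite le_max lexx orbT.
have g0 t : 0 <= g t by rewrite invr_ge0 ltW // h0.
have gm s t : s <= t -> g t <= g s.
  move=> st; rewrite /g lef_pV2 ?posrE ?h0 //; apply: hm => //.
  by rewrite ge_max !le_max st lexx !orbT.
have mg (D : set R) : measurable (D : set (measurableTypeR R)) ->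
    measurable_fun (D : set (measurableTypeR R)) (fun t => (g t)%:E).
  move=> mD; apply/measurable_EFinP; apply: nonincreasing_measurable => // s t st; exact: gm.
have ga t : 0 <= t -> (h t)^-1 = g t by move=> t0; rewrite /g max_l.
pose k1 := (Num.truncn a).+1.
have ak1 : a <= k1%:R by apply/ltW/truncnS_gt.
have [S hS] : exists S : R, forall K, \sum_(k1 <= k < K) (h k.+1%:R)^-1 <= S.
  exists (fine (\int[leb]_(t in `[a, +oo[) (g t)%:E)) => K.
  have fin : (\int[leb]_(t in `[a, +oo[) (g t)%:E)%E \is a fin_num.
    rewrite ge0_fin_numE; last by apply: integral_ge0 => t _; rewrite lee_fin.
    apply: le_lt_trans ha; rewrite le_eqVlt; apply/orP; left; apply/eqP/eq_integral => t.
    by rewrite inE /= in_itv /= andbT => at_; rewrite ga // (le_trans a0).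
  rewrite -lee_fin fineK //.
  have [kK|Kk] := leqP k1 K; last by rewrite big_geq 1?ltnW //; apply: integral_ge0 => t _; rewrite lee_fin.
  apply: (@le_trans _ _ (\int[leb]_(t in `[k1%:R, K%:R[) (g t)%:E)%E); last first.
    apply: ge0_subset_integral => //; first exact: mg.
      by move=> t _; rewrite lee_fin.
    by move=> t /=; rewrite !in_itv /= andbT => /andP[t1 _]; exact: le_trans t1.
  elim: K kK => [|K IH]; first by rewrite leqn0.
  rewrite leq_eqVlt => /predU1P[<-|].
    by rewrite big_geq //; apply: integral_ge0 => t _; rewrite lee_fin.
  rewrite ltnS => kK; rewrite big_nat_recr //= EFinD.
  have -> : [set` `[k1%:R, K.+1%:R[] = [set` `[k1%:R, K%:R[] `|` [set` `[K%:R, K.+1%:R[] :> set R.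
    rewrite -itv_bndbnd_setU // ?bnd_simp ?ler_nat //.
  rewrite ge0_integral_setU //; last 3 first.
  - by apply: mg; apply: measurableU.
  - by move=> t _; rewrite lee_fin.
  - apply/disj_setPS => t /=; rewrite !in_itv /= => -[/andP[_ t1] /andP[t2 _]].
    by have := lt_le_trans t1 t2; rewrite ltxx.
  apply: leeD; first exact: IH.
  have -> : ((h K.+1%:R)^-1)%:E = (\int[leb]_(t in `[K%:R, K.+1%:R[) ((h K.+1%:R)^-1)%:E)%E.
    have L1 : leb [set` `[K%:R, K.+1%:R[%R] = 1%:E.
      by rewrite lebesgue_measure_itv /= lte_fin ltr_nat ltnSn -EFinD -natrB // subSnn.
    transitivity (((h K.+1%:R)^-1)%:E * leb [set` `[K%:R, K.+1%:R[%R])%E; first by rewrite L1 mule1.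
    by rewrite integral_cst.
  apply: ge0_le_integral => //; first by move=> t _; rewrite lee_fin invr_ge0 ltW // h0.
    exact: mg.
  move=> t /=; rewrite in_itv /= => /andP[t1 t2]; rewrite lee_fin ga //; apply: gm; exact: ltW.
pose u K := \sum_(k1 <= k < K) (h k.+1%:R)^-1.
have und : nondecreasing_seq u.
  apply/nondecreasing_seqP => K; rewrite /u; have [kK|Kk] := leqP k1 K.
    by rewrite big_nat_recr //= lerDl invr_ge0 ltW // h0.
  by rewrite !big_geq // ltnW.
have bu : has_ubound (range u) by exists S => _ [K _ <-]; exact: hS.
have cu := nondecreasing_is_cvgn und bu.
have := nondecreasing_cvgn und bu; move=> /cvgrPdist_le /(_ e e0)[k2 _ hk2].
(* The shift by one is there because the sums bounded above run over [h (k + 1)]. *)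
exists (maxn k1 k2).+1 => -[|K] //; rewrite ltnS => hK.
rewrite big_add1 /=.
have le1 : (k1 <= maxn k1 k2)%N by exact: leq_maxl.
have -> : \sum_(maxn k1 k2 <= k < K) (h k.+1%:R)^-1 = u K - u (maxn k1 k2).
  by rewrite /u (big_cat_nat le1 hK) /= addrAC subrr add0r.
have hs : has_sup (range u) by split=> //; exists (u 0%N), 0%N.
have uK : u K <= sup (range u) by apply: (sup_upper_bound hs); exists K.
have := hk2 (maxn k1 k2) (leq_maxr _ _); rewrite ler_distl => /andP[_].
by move: uK; move: (sup _) (u _) (u _) => x y z; lra.
Qed.

Definition qk (k : nat) : R := expR (- k%:R).

Lemma qk_gt0 k : 0 < qk k. Proof. exact: expR_gt0. Qed.

Lemma qkS k : qk k.+1 = qk 1 * qk k.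
Proof. by rewrite /qk -expRD; congr expR; rewrite -natr1; ring. Qed.

Lemma qk1_le : qk 1 <= 2^-1.
Proof.
rewrite /qk expRN lef_pV2 ?posrE ?expR_gt0 //.
by apply: le_trans (expR_ge1Dx _); rewrite -[leLHS]/(1 + 1)%R.
Qed.

Lemma qk_sum k0 K : \sum_(k0 <= k < K) qk k <= 2.
Proof.
have key k : \sum_(0 <= k < k) qk k <= 2 - 2 * qk k.
  elim: k => [|k IH]; first by rewrite big_geq // /qk oppr0 expR0; lra.
  rewrite big_nat_recr //= qkS; have := qk1_le; have := qk_gt0 k; have := qk_gt0 1.
  move: IH; move: (\sum_(_ <= _ < _) _) (qk 1) (qk k) => x y z; nra.
have [h|h] := leqP k0 K; last by rewrite big_geq // ltnW.
have := key K; rewrite (big_cat_nat (leq0n k0) h) /=.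
have : 0 <= \sum_(0 <= k < k0) qk k by apply: sumr_ge0 => k _; exact/ltW/qk_gt0.
by have := qk_gt0 K; move=> h1 h2 h3; lra.
Qed.

Lemma qk_le k : qk k <= k.+1%:R^-1.
Proof.
rewrite /qk expRN lef_pV2 ?posrE ?expR_gt0 //.
by apply: le_trans (expR_ge1Dx _); rewrite -natr1 addrC.
Qed.

(** [exp x >= x] at [x = y / (N + 1)], raised to the power [N + 1]. *)
Lemma expRN_pow (N : nat) (y : R) : 0 < y -> expR (- y) <= (N.+1%:R / y) ^+ N.+1.
Proof.
move=> y0; have N0 : 0 < N.+1%:R :> R by rewrite ltr0n.
have -> : (N.+1%:R / y) ^+ N.+1 = ((y / N.+1%:R) ^+ N.+1)^-1 by rewrite -exprVn invf_div.
rewrite expRN lef_pV2 ?posrE ?expR_gt0 ?exprn_gt0 ?divr_gt0 //.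
have -> : expR y = expR (y / N.+1%:R) ^+ N.+1.
  by rewrite -expRM_natl; congr expR; rewrite mulrC divfK // gt_eqF.
rewrite lerXn2r ?nnegrE ?expR_ge0 ?divr_ge0 ?(ltW y0) ?(ltW N0) //.
by apply: le_trans (expR_ge1Dx _); rewrite lerDr.
Qed.

Lemma iteration_pow_id n (c A q N X : R) : 0 < A -> 0 < q -> 0 < X ->
  c / (A * q) * (N / (X / q)) ^+ (2 * n).+1 =
  c / A * N ^+ (2 * n).+1 / X * ((X ^+ n)^-1 * (X ^+ n)^-1) * q ^+ (2 * n).
Proof.
move=> A0 q0 X0; have Xn : X ^+ n != 0 by rewrite expf_eq0 gt_eqF // andbF.
rewrite invf_div exprMn expr_div_n (exprS X) (exprS q) mul2n -addnn !exprD.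
move: (N ^+ _) (X ^+ n) Xn (q ^+ n) => y z z0 w; field.
by rewrite z0 !gt_eqF.
Qed.

Lemma iteration_pow_id2 n (b X Q q : R) : 2^-1 * ((b * X^-1 * Q ^+ 2) * q ^+ 2) ^+ n =
  2^-1 * b ^+ n * q ^+ (2 * n) / X ^+ n * Q ^+ (2 * n).
Proof. rewrite !exprMn exprVn mul2n -addnn !exprD; ring. Qed.

Section Iteration.
Variables (n : nat) (a1 B0 B1 B2 C1 C3 C4 T0 : R) (h : R -> R).
Hypotheses (n0 : (0 < n)%N) (a10 : 0 < a1) (B00 : 0 < B0) (B10 : 0 <= B1) (B20 : 0 < B2).
Hypotheses (C10 : 0 <= C1) (C30 : 0 < C3) (C40 : 0 <= C4).
Hypotheses (h0 : forall t, 0 <= t -> 0 < h t) (hm : forall s t, 0 <= s -> s <= t -> h s <= h t).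
Hypothesis hint : exists2 a : R, 0 <= a & (\int[leb]_(t in `[a, +oo[) ((h t)^-1)%:E < +oo)%E.

(** The interface between the analysis and the iteration, [M] standing for the mass and [V] for the
    volume of sublevel sets. Levels are capped by [a1], up to which sublevel sets stay in the small
    box. *)
Definition decay_cond (M V : R -> R) := [/\ (forall s t, s <= t -> t <= a1 -> M s <= M t),
  (forall s t al, s <= a1 -> 0 < al -> B0 * al <= t -> M s <= al ^+ n ->
    V (s - 3 * t) <= B1 / t * expR (- (B2 * t / al))),
  (forall s T, s <= a1 -> T0 <= T -> 1 < T -> 1 <= ln T ->
    M s <= C3 * T * V s + C4 / (ln T * h (ln (ln T))) ^+ n) &
  (forall s, 0 < s -> s <= a1 -> 0 < M s)].

Let q : R := qk 1.
Let q0 : 0 < q. Proof. exact: qk_gt0. Qed.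
Let q1 : q <= 1. Proof. by apply: le_trans qk1_le _; rewrite invf_le1 // ler1n. Qed.

(** Chosen so that [C5 * B2 / (2 * al k) = (1 + 2 * C4) / al k.+1]: then [tk k >= C5 / h k] makes
    the Orlicz term at most half of [al k.+1 ^+ n]. *)
Let C5 : R := 2 * (1 + 2 * C4) / (B2 * q ^+ 2).
Let C50 : 0 < C5.
Proof. by rewrite /C5 divr_gt0 // mulr_gt0 // ?exprn_gt0 // ltr_pwDl // mulr_ge0. Qed.
(** The contributions [3 A qk] to the steps add up to at most [a1 / 4]; another quarter of [a1] is
    kept for the contributions [3 C5 / h k]. *)
Let A : R := a1 / 24.
Let A0 : 0 < A. Proof. by rewrite divr_gt0. Qed.
Let D0 : R := 2^-1 * (B2 * A / 2) ^+ n * q ^+ (2 * n).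
Let D00 : 0 < D0.
Proof. by rewrite /D0 !mulr_gt0 ?invr_gt0 ?exprn_gt0 // ?divr_gt0 ?mulr_gt0. Qed.
Let E0 : R := C3 * B1 / A * (2 * n).+1%:R ^+ (2 * n).+1.
Let E00 : 0 <= E0.
Proof. by rewrite /E0 mulr_ge0 ?exprn_ge0 // divr_ge0 ?mulr_ge0 // ltW. Qed.
(** Each summand meets one requirement: 1 gives [ln T >= 1], [E0 / D0] makes the volume term small,
    [B0 * B2] gives [B0 * al k <= tk k], and the last puts [T] above [T0]. *)
Let X : R := 1 + E0 / D0 + B0 * B2 + `|T0|.
Let X1 : 1 <= X.
Proof.
rewrite /X -!addrA lerDl; apply: addr_ge0; first by apply: divr_ge0 => //; exact: ltW.
by apply: addr_ge0 => //; apply: mulr_ge0; exact: ltW.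
Qed.
Let X0 : 0 < X. Proof. exact: lt_le_trans X1. Qed.
Let beta : R := B2 * A / (2 * X).
Let beta0 : 0 < beta. Proof. by rewrite divr_gt0 ?mulr_gt0. Qed.
Let al k : R := beta * qk k ^+ 2.
Let tk k : R := A * qk k + C5 / h k%:R.
Let al0 k : 0 < al k. Proof. by rewrite mulr_gt0 // exprn_gt0 // qk_gt0. Qed.
Let hk0 k : 0 < h k%:R. Proof. exact: h0. Qed.
Let tk_ge1 k : A * qk k <= tk k.
Proof. by rewrite lerDl divr_ge0 // ltW. Qed.
Let tk_ge2 k : C5 / h k%:R <= tk k.
Proof. by rewrite lerDr mulr_ge0 // ltW // qk_gt0. Qed.
Let tk0 k : 0 < tk k.
Proof. by apply: lt_le_trans (tk_ge1 k); rewrite mulr_gt0 // qk_gt0. Qed.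
(** Half of the exponent [B2 t_k / al_k] of the volume decay: with [ln T] equal to it,
    [T exp(- 2 yk) = exp(- yk)] is still small. *)
Let yk k : R := B2 * tk k / (2 * al k).
Let yk_ge k : X / qk k <= yk k.
Proof.
have Q := qk_gt0 k.
have -> : X / qk k = B2 * (A * qk k) / (2 * al k).
  by rewrite /al /beta; field; rewrite !gt_eqF.
rewrite /yk; apply: ler_wpM2r; first by rewrite invr_ge0 mulr_ge0 // ltW.
by apply: ler_wpM2l; [exact: ltW|exact: tk_ge1].
Qed.

Let B0al k : B0 * al k <= tk k.
Proof.
apply: le_trans (tk_ge1 k); have -> : B0 * al k = (B0 * beta * qk k) * qk k by rewrite /al; ring.
rewrite ler_pM2r ?qk_gt0 //.
have Q1 : qk k <= 1 by apply: le_trans (qk_le k) _; rewrite invf_le1 // ler1n.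
apply: (@le_trans _ _ (B0 * beta)); first by rewrite ler_piMr // mulr_ge0 // ltW.
have -> : B0 * beta = (B0 * B2) * A / (2 * X) by rewrite /beta; ring.
rewrite ler_pdivrMr ?mulr_gt0 // [leLHS]mulrC; apply: ler_wpM2l; first exact: ltW.
have : 0 <= E0 / D0 by rewrite divr_ge0 // ltW.
have := normr_ge0 T0; have := mulr_gt0 B00 B20.
by rewrite /X; move: (E0 / D0) (B0 * B2) `|T0| => x y z; lra.
Qed.

Lemma iteration_step (M V : R -> R) k s : decay_cond M V -> s <= a1 -> M s <= al k ^+ n ->
  M (s - 3 * tk k) <= al k.+1 ^+ n.
Proof.
move=> [hM hA hB _] sa Ms; have Q := qk_gt0 k; have y0 := yk_ge k.
have yX : X <= yk k.
  apply: le_trans y0; rewrite ler_pdivlMr // ler_piMr ?(ltW X0) //.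
  by apply: le_trans (qk_le k) _; rewrite invf_le1 // ler1n.
have yk0 : 0 < yk k := lt_le_trans X0 yX.
pose T := expR (yk k).
have lnT : ln T = yk k by rewrite /T expRK.
have TT : T0 <= T.
  apply: le_trans (expR_ge1Dx _); apply: le_trans (_ : X <= _); last by apply: le_trans yX _; rewrite lerDr.
  have : 0 <= E0 / D0 by rewrite divr_ge0 // ltW.
  have := ler_norm T0; have := mulr_gt0 B00 B20.
  by rewrite /X; move: (E0 / D0) (B0 * B2) `|T0| => x y z; lra.
have T1 : 1 < T by rewrite /T expR_gt1.
have sa' : s - 3 * tk k <= a1 by apply: le_trans sa; rewrite gerBl mulr_ge0 // ltW.
have := hB _ _ sa' TT T1; rewrite lnT => /(_ (le_trans X1 yX)) /le_trans; apply.
(* One half for each term of the Orlicz estimate. *)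
have -> : al k.+1 ^+ n = 2^-1 * al k.+1 ^+ n + 2^-1 * al k.+1 ^+ n by field.
have alS : al k.+1 = al k * q ^+ 2 by rewrite /al qkS -/q; ring.
apply: lerD.
  have := hA s (tk k) (al k) sa (al0 k) (B0al k) Ms => hV.
  apply: (@le_trans _ _ (C3 * T * (B1 / (A * qk k) * expR (- (B2 * tk k / al k))))).
    rewrite ler_wpM2l ?mulr_ge0 ?expR_ge0 ?(ltW C30) //; apply: le_trans hV _.
    rewrite ler_wpM2r ?expR_ge0 // ler_wpM2l // lef_pV2 ?posrE ?mulr_gt0 //.
  have -> : C3 * T * (B1 / (A * qk k) * expR (- (B2 * tk k / al k))) =
      C3 * B1 / (A * qk k) * expR (- yk k).
    have -> : B2 * tk k / al k = yk k + yk k by rewrite /yk; field; rewrite gt_eqF.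
    by rewrite opprD expRD /T expRN; field; rewrite !gt_eqF ?expR_gt0.
  (* The target [al k.+1 ^+ n] is of order [qk ^ (2 n)]; the power [2 n + 1] has one factor more,
     which cancels the [1 / qk] bounding [1 / tk]. *)
  apply: (@le_trans _ _ (C3 * B1 / (A * qk k) * ((2 * n).+1%:R / (X / qk k)) ^+ (2 * n).+1)).
    apply: ler_wpM2l; first by apply: divr_ge0; apply: mulr_ge0 => //; exact: ltW.
    apply: le_trans (expRN_pow _ _); last by rewrite divr_gt0.
    by rewrite ler_expR lerN2.
  have -> : C3 * B1 / (A * qk k) * ((2 * n).+1%:R / (X / qk k)) ^+ (2 * n).+1 =
     E0 / X * ((X ^+ n)^-1 * (X ^+ n)^-1) * qk k ^+ (2 * n).
    exact: iteration_pow_id.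
  have -> : 2^-1 * al k.+1 ^+ n = D0 * (X ^+ n)^-1 * qk k ^+ (2 * n).
    have -> : al k.+1 = ((B2 * A / 2) * X^-1 * qk k ^+ 2) * q ^+ 2.
      by rewrite alS /al /beta; field; rewrite gt_eqF.
    exact: iteration_pow_id2.
  rewrite ler_pM2r ?exprn_gt0 // mulrA ler_pM2r ?invr_gt0 ?exprn_gt0 //.
  apply: (@le_trans _ _ (E0 / X)).
    by rewrite ler_piMr ?divr_ge0 ?(ltW X0) // invf_le1 ?exprn_gt0 // exprn_ege1.
  rewrite ler_pdivrMr // mulrC -ler_pdivrMr // /X.
  have := normr_ge0 T0; have := mulr_gt0 B00 B20.
  by move: (E0 / D0) (B0 * B2) `|T0| => x y z; lra.
(* As [yk k >= exp k], the point [ln (ln T)] is at least [k], and monotonicity lets [h] be evaluated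
   at [k]. *)
have lnk : k%:R <= ln (yk k).
  rewrite -[leLHS]expRK ler_ln ?posrE ?expR_gt0 //; apply: le_trans y0.
  by rewrite /qk expRN invrK ler_peMl // expR_ge0.
have hh : h k%:R <= h (ln (yk k)) by apply: hm.
have yh : C5 * B2 / (2 * al k) <= yk k * h (ln (yk k)).
  apply: (@le_trans _ _ (yk k * h k%:R)); last by rewrite ler_pM2l.
  have -> : C5 * B2 / (2 * al k) = B2 * (C5 / h k%:R) / (2 * al k) * h k%:R.
    by field; rewrite !gt_eqF.
  apply: ler_wpM2r; first exact: ltW.
  rewrite /yk; apply: ler_wpM2r; first by rewrite invr_ge0 mulr_ge0 // ltW.
  by apply: ler_wpM2l; [exact: ltW|exact: tk_ge2].
have W0 : 0 < C5 * B2 / (2 * al k).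
  by apply: divr_gt0; [exact: (mulr_gt0 C50 B20)|exact: (mulr_gt0 (ltr0n R 2) (al0 k))].
apply: (@le_trans _ _ (C4 / (C5 * B2 / (2 * al k)) ^+ n)).
  have W1 := lt_le_trans W0 yh.
  by rewrite ler_wpM2l // lef_pV2 ?posrE ?exprn_gt0 // lerXn2r ?nnegrE // ltW.
have P1 : 1 <= 1 + 2 * C4 by rewrite lerDl mulr_ge0.
have -> : C5 * B2 / (2 * al k) = (1 + 2 * C4) / al k.+1.
  by rewrite alS /C5; field; rewrite !gt_eqF.
rewrite expr_div_n invf_div mulrA mulrAC ler_pM2r ?exprn_gt0 // ler_pdivrMr ?exprn_gt0 ?(lt_le_trans _ P1) //.
apply: (@le_trans _ _ (2^-1 * (1 + 2 * C4))); first by lra.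
by rewrite ler_pM2l ?invr_gt0 // ler_eXnr.
Qed.

(** If [M a1] were at most [al k0 ^+ n], the steps from [k0] on would lose at most [a1 / 2] in all,
    and [M (a1 / 2)] would be below every [al K ^+ n], against its positivity. The index [k0]
    depends on [h] and on the constants, not on [M] and [V]. *)
Lemma DeGiorgi_lower : exists2 cs : R, 0 < cs & forall M V : R -> R, decay_cond M V -> cs <= M a1.
Proof.
have e0 : 0 < a1 / (12 * C5) by rewrite divr_gt0 // mulr_gt0.
have [k0 hk] := sum_inv_tail h0 hm hint e0.
exists (al k0 ^+ n) => [|M V D]; first exact: exprn_gt0.
rewrite leNgt; apply/negP => /ltW Ms.
pose s K := a1 - \sum_(k0 <= k < K) 3 * tk k.
have sum0 K : 0 <= \sum_(k0 <= k < K) 3 * tk k by apply: sumr_ge0 => k _; rewrite mulr_ge0 // ltW.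
have it K : (k0 <= K)%N -> M (s K) <= al K ^+ n.
  elim: K => [|K IH]; first by rewrite leqn0 => /eqP E; rewrite /s -E big_geq // subr0.
  rewrite leq_eqVlt => /predU1P[<-|]; first by rewrite /s big_geq // subr0.
  rewrite ltnS => kK; have -> : s K.+1 = s K - 3 * tk K.
    by rewrite /s big_nat_recr //= opprD addrA.
  by apply: (iteration_step D); [rewrite gerBl|exact: IH].
have s2 K : (k0 <= K)%N -> a1 / 2 <= s K.
  move=> kK; have : \sum_(k0 <= k < K) 3 * tk k <= a1 / 2; last by rewrite /s; move: (\sum_(_ <= _ < _) _) => x; lra.
  have -> : \sum_(k0 <= k < K) 3 * tk k = 3 * A * (\sum_(k0 <= k < K) qk k) + 3 * C5 * \sum_(k0 <= k < K) (h k%:R)^-1.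
    rewrite !mulr_sumr -big_split; apply: eq_bigr => k _; rewrite /tk /=; ring.
  have S1 : 3 * A * (\sum_(k0 <= k < K) qk k) <= 3 * A * 2.
    by apply: ler_wpM2l; [apply: mulr_ge0 => //; exact: ltW|exact: qk_sum].
  have S2 : 3 * C5 * \sum_(k0 <= k < K) (h k%:R)^-1 <= 3 * C5 * (a1 / (12 * C5)).
    by apply: ler_wpM2l; [apply: mulr_ge0 => //; exact: ltW|exact: hk].
  apply: le_trans (lerD S1 S2) _; rewrite le_eqVlt; apply/orP; left; apply/eqP.
  by rewrite /A; field; rewrite gt_eqF.
have [hM _ _ hpos] := D.
have p0 : 0 < M (a1 / 2) by apply: hpos; [rewrite divr_gt0|rewrite ler_pdivrMr // ler_peMr ?(ltW a10) // ler1n].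
(* The second summand makes [beta ^+ n / (K + 1)], which bounds [al K ^+ n], smaller than
   [M (a1 / 2)]. *)
pose K := (k0 + Num.truncn (beta ^+ n / M (a1 / 2)))%N.
have kK : (k0 <= K)%N by exact: leq_addr.
have := it K kK; rewrite leNgt; move/negP; apply.
have : M (a1 / 2) <= M (s K) by apply: hM; [exact: s2|rewrite gerBl].
apply: lt_le_trans.
have Q1 : qk K <= 1 by apply: le_trans (qk_le K) _; rewrite invf_le1 // ler1n.
apply: (@le_lt_trans _ _ (beta ^+ n * K.+1%:R^-1)).
  rewrite /al exprMn ler_wpM2l ?exprn_ge0 ?(ltW beta0) //; apply: le_trans (qk_le K).
  by rewrite -exprM ler_iXnr ?muln_gt0 ?n0 ?(ltW (qk_gt0 K)).
rewrite ltr_pdivrMr // mulrC -ltr_pdivrMr //; apply: lt_le_trans (truncnS_gt _) _.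
by rewrite ler_nat ltnS leq_addl.
Qed.

(** A mass bounded below at level [a1] forces, through the Orlicz estimate at one fixed [T], a
    volume [V a1] bounded below, and the last condition then limits the depth of the minimum. *)
Lemma DeGiorgi_bound : exists C : R, forall (m : R) (M V : R -> R), decay_cond M V ->
  (0 < - m - a1 -> (- m - a1) * V a1 <= C1) -> - m <= C.
Proof.
have [cs cs0 hcs] := DeGiorgi_lower; have h1 := h0 (ler01 : 0 <= 1 :> R).
(* The summands ensure in turn that [ln Y >= 1], that [T >= T0], that [Y * h 1 >= 1], and that the
   second Orlicz term is at most [cs / 2]. *)
pose Y := expR 1 + `|T0| + (h 1)^-1 + 2 * C4 / (cs * h 1); pose T := expR Y.
have eY : expR 1 <= Y.
  rewrite /Y -!addrA lerDl; apply: addr_ge0 => //; apply: addr_ge0; first by rewrite invr_ge0 ltW.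
  by apply: divr_ge0; apply: mulr_ge0 => //; exact: ltW.
have Y0 : 0 < Y := lt_le_trans (expR_gt0 1) eY.
have Y1 : 1 <= Y by apply: le_trans eY; apply: le_trans (expR_ge1Dx _); rewrite lerDl.
have YT : T0 <= Y.
  apply: (le_trans (ler_norm _)); have := expR_gt0 (1 : R).
  have : 0 <= 2 * C4 / (cs * h 1) by apply: divr_ge0; apply: mulr_ge0 => //; exact: ltW.
  have : 0 <= (h 1)^-1 by rewrite invr_ge0 ltW.
  by rewrite /Y; move: (expR 1) `|T0| (h 1)^-1 (2 * C4 / _) => x y z w; lra.
have Yh : (h 1)^-1 <= Y /\ 2 * C4 / (cs * h 1) <= Y.
  have := expR_gt0 (1 : R); have := normr_ge0 T0.
  have : 0 <= 2 * C4 / (cs * h 1) by apply: divr_ge0; apply: mulr_ge0 => //; exact: ltW.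
  have : 0 <= (h 1)^-1 by rewrite invr_ge0 ltW.
  by rewrite /Y; move: (expR 1) `|T0| (h 1)^-1 (2 * C4 / _) => x y z w *; split; lra.
have lnT : ln T = Y by rewrite /T expRK.
have Tpos : 0 < T := expR_gt0 Y.
pose vs := cs / 2 / (C3 * T).
have vs0 : 0 < vs by rewrite !divr_gt0 // mulr_gt0.
exists (a1 + C1 / vs) => m M V D hV.
have [_ _ hB _] := D; have cM := hcs M V D.
(* The second Orlicz term takes at most half of [cs], so the volume term has to supply the other
   half. *)
have hv : vs <= V a1.
  have := hB a1 T (lexx _) _ _ _; rewrite lnT => /(_ _ _ Y1) B.
  have {}B := B (le_trans (le_trans YT (ltW (lt_le_trans (ltr_pwDl ltr01 (lexx Y)) (expR_ge1Dx Y)))) (lexx _)) _.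
  have {}B : M a1 <= C3 * T * V a1 + C4 / (Y * h (ln Y)) ^+ n.
    by apply: B; rewrite /T expR_gt1.
  have lY : 1 <= ln Y by rewrite -[leLHS](expRK 1) ler_ln ?posrE ?expR_gt0.
  have hY : h 1 <= h (ln Y) by apply: hm.
  have P : 1 <= Y * h (ln Y).
    apply: (@le_trans _ _ (Y * h 1)); last by rewrite ler_pM2l.
    by rewrite -ler_pdivrMr // mul1r; exact: Yh.1.
  have S : C4 / (Y * h (ln Y)) ^+ n <= cs / 2.
    apply: (@le_trans _ _ (C4 / (Y * h 1))).
      apply: ler_wpM2l => //; rewrite lef_pV2 ?posrE ?exprn_gt0 ?mulr_gt0 ?(lt_le_trans ltr01 P) //.
        apply: (@le_trans _ _ (Y * h (ln Y))); first by rewrite ler_pM2l.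
        by rewrite ler_eXnr.
      exact: (lt_le_trans h1).
    rewrite ler_pdivrMr ?mulr_gt0 //; have := Yh.2; rewrite ler_pdivrMr ?mulr_gt0 // => h2.
    move: h2; move: (h 1) => x h2; lra.
  rewrite /vs ler_pdivrMr ?mulr_gt0 // mulrC; move: B S cM.
  by rewrite [V a1 * _]mulrC; move: (C4 / _) (C3 * T * _) => x y B S cM; lra.
have [neg|pos] := leP (- m - a1) 0.
  have : 0 <= C1 / vs by apply: divr_ge0 => //; exact: ltW.
  by move: (C1 / vs) => x; lra.
have := hV pos; rewrite -lerBlDl ler_pdivlMr // => h2; apply: le_trans h2.
by rewrite ler_pM2l.
Qed.

End Iteration.
End DeGiorgi.

(** From [c1 <= 1] comes [c1 ^ n <= c1], and [c1 <= c 4^n / 2] is what density 1/2 requires of a box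
    of volume [(2 r)^(2 n)]. *)
Lemma decay_num (R : realType) (n : nat) (c c1 al r v : R) : 0 < c -> 0 < c1 -> c1 <= 1 ->
  c1 <= c * 4 ^+ n / 2 -> (0 < n)%N -> 0 < al -> 0 < r -> c * (al * (c1 * r ^+ 2)^-1) ^+ n * v <= al ^+ n ->
  v <= 2^-1 * (2 * r) ^+ (2 * n).
Proof.
move=> c0 c10 c11 c1c n0 al0 r0; have q0 : 0 < c1 * r ^+ 2 by rewrite mulr_gt0 // exprn_gt0.
rewrite (expr_div_n al (c1 * r ^+ 2) n).
have P0 : 0 < al ^+ n by rewrite exprn_gt0.
have Q0 : 0 < (c1 * r ^+ 2) ^+ n by rewrite exprn_gt0.
have hQ : (c1 * r ^+ 2) ^+ n <= c * (2^-1 * (2 * r) ^+ (2 * n)).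
  rewrite [leLHS]exprMn -exprM [(2 * r) ^+ _]exprMn (exprM 2) (_ : 2 ^+ 2 = 4 :> R); last by rewrite expr2 -natrM.
  have R0 : 0 < r ^+ (2 * n) by rewrite exprn_gt0.
  rewrite (_ : c * _ = (c * 4 ^+ n / 2) * r ^+ (2 * n)); last by ring.
  rewrite ler_pM2r //; apply: le_trans c1c; case: n n0 {P0 Q0 R0} => // n _.
  by rewrite exprS ler_piMr ?(ltW c10) // exprn_ile1 // ltW.
move=> hv; rewrite -(ler_pM2l c0); apply: le_trans hQ.
move: hv; rewrite (_ : c * _ * v = (c * v) * al ^+ n / (c1 * r ^+ 2) ^+ n); last by ring.
by rewrite ler_pdivrMr // [leRHS]mulrC ler_pM2r.
Qed.

(** * The bound in one chart *)

Section LocalBound.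
Variables (R : realType) (n : nat).
Local Notation Cn := 'rV[R[i]]_n.
Local Notation "'rb' b" := (@real_basis R n b) (at level 10).

(** Gathers what the estimate needs from one chart, with every constant explicit, so that a bound in
    terms of the constants alone is uniform in [m], [x0], [A] and [f]. *)
Record local_data (kappa rho delta Ca C1 C3 C4 T0 m : R) (h : R -> R) (x0 : Cn)
    (A : form2 R n) (f : Cn -> R) : Prop := LocalData {
  ld_J : forall z, box x0 (2 * rho) z -> Jform (A z);
  ld_A : forall v w, Ck 1 (box x0 (2 * rho)) (fun z => A z v w);
  ld_closed : closed_form_on (box x0 (2 * rho)) A;
  ld_Age : forall z, box x0 (2 * rho) z -> forall v, 4 * kappa * delta * nsq v <= A z v ('i *: v);
  ld_Ale : forall z, box x0 (2 * rho) z -> \sum_k A z (rb (k, false)) (rb (k, true)) <= Ca;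
  ld_f : Ck 3 (box x0 (2 * rho)) f;
  ld_fge : forall z, box x0 (2 * rho) z -> m <= f z;
  ld_fx0 : f x0 = m;
  ld_pos : forall z, box x0 (2 * rho) z -> forall v, 0 <= Om kappa A f z v ('i *: v);
  ld_L1 : Int (zext (cbox x0 (3 / 2 * rho)) (fun z => `|f z|)) <= C1;
  ld_orlicz : forall s T, s <= delta * rho ^+ 2 / 2 -> T0 <= T -> 1 < T -> 1 <= ln T ->
    MM kappa rho delta m x0 A f s <=
      C3 * T * vol (US rho delta m x0 f s) + C4 / (ln T * h (ln (ln T))) ^+ n }.

Lemma vol_le (E F : set Cn) (a : Cn) (r : R) : measurable (E : set (BC R n)) ->
  measurable (F : set (BC R n)) -> E `<=` F -> F `<=` cbox a r -> vol E <= vol F.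
Proof.
move=> mE mF EF Fa; apply: Int_le; [exact: (bcs_vol mE (subset_trans EF Fa))|exact: bcs_vol Fa|].
exact: zext_subset.
Qed.

Variables (kappa rho delta Ca C1 C3 C4 T0 : R) (h : R -> R).
Hypotheses (n0 : (0 < n)%N) (kappa0 : 0 < kappa) (rho0 : 0 < rho) (delta0 : 0 < delta) (cn0 : 0 < cn R n).
Hypotheses (C10 : 0 <= C1) (C30 : 0 < C3) (C40 : 0 <= C4).
Hypotheses (h0 : forall t, 0 <= t -> 0 < h t) (hm : forall s t, 0 <= s -> s <= t -> h s <= h t).
Hypothesis hint : exists2 a : R, 0 <= a & (\int[@lebesgue_measure R]_(t in `[a, +oo[) ((h t)^-1)%:E < +oo)%E.

Let a1 : R := delta * rho ^+ 2 / 2.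
Let dr0 : 0 < delta * rho ^+ 2. Proof. by rewrite mulr_gt0 // exprn_gt0. Qed.
Let a10 : 0 < a1. Proof. by rewrite divr_gt0. Qed.
Let c1 : R := Num.min 1 (cn R n * 4 ^+ n / 2).
Let c10 : 0 < c1. Proof. by rewrite lt_min ltr01 divr_gt0 // mulr_gt0 // exprn_gt0. Qed.
Let ck0 : 0 < ckap n kappa.
Proof. by rewrite divr_gt0 ?mulr_gt0 // exprn_gt0 // ltr_wpDl // mulr_ge0. Qed.
Let B2 : R := c1 * ckap n kappa.
Let B20 : 0 < B2. Proof. exact: mulr_gt0. Qed.
(** For [t >= B0 * al] the exponent [L = B2 * t / al] is at least [8 n + 2], whence the scale
    [Dc exp(- L)] does not exceed [rho]. *)
Let B0 : R := (8 * n%:R + 2) / B2.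
Let B00 : 0 < B0. Proof. by rewrite divr_gt0 // ltr_wpDl // mulr_ge0. Qed.

Local Opaque box ddc wedge_top.

Section Data.
Variables (m : R) (x0 : Cn) (A : form2 R n) (f : Cn -> R).
Hypothesis D : local_data kappa rho delta Ca C1 C3 C4 T0 m h x0 A f.
Local Notation US := (US rho delta m x0 f).
Local Notation MM := (MM kappa rho delta m x0 A f).

(** Three steps of length [t] are lost: one to the regularization, [3 eps = t]; one to the depth of
    the pole, [lam ln (Dc / r) = t]; one to the cutoff of [vol_US_decay]. *)
Lemma US_decay Cg s t al :
  (forall s c, s <= delta * rho ^+ 2 / 2 ->
    Int (zext (US s) (fun z => `|rderive (uu delta x0 f) (rb c) z|)) <= Cg) ->
  s <= a1 -> 0 < al -> B0 * al <= t -> MM s <= al ^+ n ->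
  vol (US (s - 3 * t)) <= (12 * n%:R * Dc n rho * Cg) / t * expR (- (B2 * t / al)).
Proof.
move=> grad_le sa al0 hB hM; have t0 : 0 < t by apply: lt_le_trans hB; rewrite mulr_gt0.
pose L := B2 * t / al; pose r := Dc n rho * expR (- L).
have Dc0 : 0 < Dc n rho by exact: Dc_gt0.
have L0 : 0 < L by rewrite divr_gt0 // mulr_gt0.
have r0 : 0 < r by rewrite mulr_gt0 // expR_gt0.
have LB : 8 * n%:R + 2 <= L.
  rewrite /L ler_pdivlMr //; have := ler_wpM2l (ltW B20) hB.
  by rewrite (_ : B2 * (B0 * al) = (8 * n%:R + 2) * al) // /B0; field; rewrite gt_eqF.
have rr : r <= rho.
  rewrite /r expRN ler_pdivrMr ?expR_gt0 // /Dc ler_pM2l //; apply: le_trans LB _.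
  by apply: le_trans (expR_ge1Dx _); rewrite lerDr.
have lnr : ln (Dc n rho / r) = L.
  by rewrite /r invfM mulrA divff ?gt_eqF // mul1r expRN invrK expRK.
have sd : s <= delta * rho ^+ 2 by apply: le_trans sa _; rewrite ler_pdivrMr // ler_peMr ?(ltW dr0) // ler1n.
have dens z : US (s - t - 2 * t) z -> vol (US (s - t - t) `&` box z r) <= 2^-1 * (2 * r) ^+ (2 * n).
  case=> Dz _; have lam0 : 0 < t / L by rewrite divr_gt0.
  have e0 : 0 < t / 3 by rewrite divr_gt0.
  have hs : s - t + 3 * (t / 3) <= delta * rho ^+ 2.
    by rewrite (_ : s - t + 3 * (t / 3) = s) //; field.
  have := comparison kappa0 rho0 delta0 cn0 (ld_J D) (ld_A D) (ld_closed D) (ld_Age D) (ld_f D)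
    (ld_fge D) (ld_pos D) Dz r0 rr lam0 e0 hs.
  rewrite lnr (_ : s - t + 3 * (t / 3) = s); last by field.
  rewrite (_ : t / L * L = t); last by rewrite divfK // gt_eqF.
  move: (vol _) => v /le_trans /(_ hM).
  have -> : t / L * ckap n kappa / r ^+ 2 = al * (c1 * r ^+ 2)^-1.
    by rewrite /L /B2; field; rewrite !gt_eqF // exprn_gt0.
  by apply: decay_num => //; rewrite ge_min lexx ?orbT.
have st : s - t <= delta * rho ^+ 2 / 2 by apply: le_trans sa; rewrite gerBl ltW.
have := vol_US_decay rho0 delta0 (ld_f D) (ld_fge D) grad_le t0 r0 st dens.
rewrite (_ : s - t - 2 * t = s - 3 * t); last by ring.
move=> /le_trans; apply; rewrite le_eqVlt; apply/orP; left; apply/eqP.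
by rewrite /r natrM /L; ring.
Qed.

Lemma MM_mono s t : s <= t -> t <= a1 -> MM s <= MM t.
Proof.
move=> st ta; have td : t <= delta * rho ^+ 2.
  by apply: le_trans ta _; rewrite ler_pdivrMr // ler_peMr ?(ltW dr0) // ler1n.
apply: Int_le.
- exact: (bcs_MM kappa rho0 delta0 (ld_A D) (ld_f D) (ld_fge D) (le_trans st td)).
- exact: (bcs_MM kappa rho0 delta0 (ld_A D) (ld_f D) (ld_fge D) td).
- apply: zext_subset; first exact: US_mono.
  by move=> z [Dz _]; exact: (wOm_ge0 cn0 (ld_J D) (ld_f D) (ld_pos D) Dz).
Qed.

Lemma US_sub_cbox s : s <= a1 -> US s `<=` cbox x0 rho.
Proof.
move=> sa; apply: (subset_trans (US_sub rho0 delta0 (ld_fge D) _)); last exact: box_sub_cbox.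
by apply: le_trans sa _; rewrite ler_pdivrMr // ler_peMr ?(ltW dr0) // ler1n.
Qed.

(** Comparison with a pole centred at [x0], at the fixed scale [rho]: the parameters lead to the
    level [s / 4], whose sublevel set contains a box around [x0] by continuity. *)
Lemma MM_gt0 s : 0 < s -> s <= a1 -> 0 < MM s.
Proof.
move=> s0 sa; have Dx : box x0 (2 * rho) x0 by apply: box_center; rewrite mulr_gt0.
have L0 : 0 < ln (Dc n rho / rho) by exact: ln_Dc_gt0.
have lam0 : 0 < s / 4 / ln (Dc n rho / rho) by rewrite !divr_gt0.
have e0 : 0 < s / 6 by rewrite divr_gt0.
have hs : s / 2 + 3 * (s / 6) <= delta * rho ^+ 2.
  rewrite (_ : s / 2 + 3 * (s / 6) = s); last by field.
  by apply: le_trans sa _; rewrite ler_pdivrMr // ler_peMr ?(ltW dr0) // ler1n.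
have := comparison kappa0 rho0 delta0 cn0 (ld_J D) (ld_A D) (ld_closed D) (ld_Age D) (ld_f D)
    (ld_fge D) (ld_pos D) Dx rho0 (lexx rho) lam0 e0 hs.
rewrite (_ : s / 2 + 3 * (s / 6) = s); last by field.
rewrite divfK ?gt_eqF // => /lt_le_trans; apply.
have s4 : s / 2 - s / 4 = s / 4 by field.
apply: mulr_gt0.
  by apply: (mulr_gt0 cn0); apply: exprn_gt0; apply: divr_gt0; [exact: mulr_gt0|exact: exprn_gt0].
rewrite s4; set E := _ `&` _.
have mE : measurable (E : set (BC R n)).
  apply: measurableI; first exact: (measurable_US _ _ (ld_f D)).
  by apply: measurable_openC; exact: open_box.
have oU : open (box x0 (2 * rho)) by exact: open_box.
have ux : {for x0, continuous (uu delta x0 f)} := Ck_cont (Ck_uu delta (ld_f D)) Dx.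
have uE : uu delta x0 f x0 = m.
  by rewrite /uu (ld_fx0 D) subrr /nsq big1 ?mulr0 ?addr0 // => b _; rewrite crd0 expr0n.
have [d1 d10 hd1] := (iffLR (continuous_boxP _ _) ux) (s / 4) (divr_gt0 s0 (ltr0n R 4)).
pose d := Num.min d1 rho; have dd0 : 0 < d by rewrite lt_min d10.
have sub : box x0 d `<=` E.
  move=> z hz; have z1 : box x0 d1 z by move=> b; apply: lt_le_trans (hz b) _; rewrite ge_min lexx.
  have z2 : box x0 rho z by move=> b; apply: lt_le_trans (hz b) _; rewrite ge_min lexx orbT.
  split=> //; split; first by move=> b; apply: lt_trans (z2 b) _; rewrite ltr_pMl // ltr1n.
  by apply: ltr_distlDr; rewrite -uE; exact: hd1.
have mb : measurable (box x0 d : set (BC R n)) by apply: measurable_openC; exact: open_box.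
apply: lt_le_trans (vol_le mb mE sub (a := x0) (r := rho) _); last by move=> z [_ /box_sub_cbox].
by rewrite vol_box // exprn_gt0 // mulr_gt0.
Qed.

(** On [US a1] one has [f <= uu < m + a1], hence [|f| >= - m - a1]. *)
Lemma US_chebyshev : 0 < - m - a1 -> (- m - a1) * vol (US a1) <= C1.
Proof.
move=> p; apply: le_trans (ld_L1 D).
have mU : measurable (US a1 : set (BC R n)) := measurable_US _ _ (ld_f D) a1.
have bU := bcs_vol mU (US_sub_cbox (lexx a1)).
have sub32 : cbox x0 (3 / 2 * rho) `<=` box x0 (2 * rho).
  by apply: cbox_sub_box; rewrite ltr_pM2r // ltr_pdivrMr // -natrM ltr_nat.
rewrite /vol -(IntZ _ bU); apply: Int_le; first exact: bcsZ.
  apply: (bcs_zext_cont (@open_box _ _ x0 (2 * rho)) sub32) => // [z Dz|].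
    by apply: (@continuous_comp _ _ _ f (fun x : R => `|x|)); [exact: (Ck_cont (ld_f D) Dz)|exact: norm_continuous].
  by apply: measurable_closedC; exact: closed_cbox.
move=> z; have [Uz|nU] := pselect (US a1 z); last first.
  by rewrite (zextF _ nU) mulr0; apply: zext_ge0.
have Kz : cbox x0 (3 / 2 * rho) z.
  move=> b; apply: le_trans (US_sub_cbox (lexx a1) Uz b) _.
  by rewrite ler_peMl ?(ltW rho0) // ler_pdivlMr // mul1r ler_nat.
rewrite (zextT (fun=> 1) Uz) (zextT (fun z => `|f z|) Kz) mulr1.
have [Dz uz] := Uz; have : f z <= uu delta x0 f z by rewrite lerDl mulr_ge0 ?nsq_ge0 // ltW.
have := ler_norm (- f z); rewrite normrN; move: uz; move: (uu _ _ _ _) (f z) => x y; move: a1 m => a m'.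
by move=> *; lra.
Qed.

End Data.

Lemma local_bound : exists C : R, forall m x0 A f,
  local_data kappa rho delta Ca C1 C3 C4 T0 m h x0 A f -> - m <= C.
Proof.
have [chi [cchi [Cchi [cc0 kchi schi chi1 chi2]]]] := cutoff n rho0.
(* The bound of [grad_L1] at the level [b = delta * rho ^+ 2], with [CYl] in place of [Yl]. *)
pose Cg := (4 * rho) ^+ (2 * n) + delta * rho ^+ 2 * CYl n kappa rho delta Ca C1 cchi Cchi.
have Cchi0 : 0 <= Cchi by have [h1 h2 _] := chi2 0; exact: le_trans h2.
have CY0 : 0 <= CYl n kappa rho delta Ca C1 cchi Cchi.
  apply: divr_ge0; last exact: ltW; apply: addr_ge0; first exact: mulr_ge0.
  apply: mulr_ge0; last by rewrite exprn_ge0 // mulr_ge0 // ltW.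
  by apply: mulr_ge0 => //; exact: C0l_ge0.
have Cg0 : 0 <= Cg.
  apply: addr_ge0; first by apply: exprn_ge0; apply: mulr_ge0 => //; exact: ltW.
  by apply: mulr_ge0 => //; exact: ltW.
have B10 : 0 <= 12 * n%:R * Dc n rho * Cg.
  by apply: mulr_ge0 => //; apply: mulr_ge0; [exact: mulr_ge0|exact/ltW/Dc_gt0].
have [C hC] := DeGiorgi_bound T0 n0 a10 B00 B10 B20 C10 C30 C40 h0 hm hint.
exists C => m x0 A f D.
have gl s c : s <= delta * rho ^+ 2 / 2 ->
    Int (zext (US rho delta m x0 f s) (fun z => `|rderive (uu delta x0 f) (rb c) z|)) <= Cg.
  move=> sa; apply: le_trans (grad_L1 kappa0 rho0 delta0 (ld_f D) (ld_fge D) (ld_pos D) (ld_Ale D) dr0 (lexx _) sa c) _.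
  rewrite lerD2l ler_pM2l //.
  exact: (Yl_le kappa0 rho0 delta0 (ld_f D) (ld_pos D) (ld_Ale D) (ld_L1 D) cc0 kchi schi chi1 chi2).
apply: (hC m (MM kappa rho delta m x0 A f) (fun s => vol (US rho delta m x0 f s))).
- split.
  + exact: (MM_mono D).
  + by move=> s t al; exact: (US_decay D gl).
  + exact: (ld_orlicz D).
  + exact: (MM_gt0 D).
- exact: (US_chebyshev D).
Qed.

End LocalBound.

(** * Invariance of dd^c under changes of charts *)

Section AffineMaps.
Variables (R : realType) (m n : nat).
Local Notation Cm := 'rV[R[i]]_m.
Local Notation Cn := 'rV[R[i]]_n.
Variables (E L : Cm -> Cn).
Hypothesis EL : forall (z v : Cm) (t : R), E (z + t%:C *: v) = E z + t%:C *: L v.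

Lemma rderive_affine (f : Cn -> R) (v z : Cm) : rderive (f \o E) v z = rderive f (L v) (E z).
Proof.
Local Transparent rderive.
rewrite /rderive; congr (derive1 _ 0); apply/funext => t; by rewrite /= EL.
Local Opaque rderive.
Qed.

Lemma rderive2_affine (f : Cn -> R) (v w z : Cm) :
  rderive (rderive (f \o E) v) w z = rderive (rderive f (L v)) (L w) (E z).
Proof.
rewrite (_ : rderive (f \o E) v = rderive f (L v) \o E); first exact: rderive_affine.
by apply/funext => x; exact: rderive_affine.
Qed.

Lemma dir_derivable_affine (f : Cn -> R) (v z : Cm) :
  dir_derivable f (L v) (E z) -> dir_derivable (f \o E) v z.
Proof.
rewrite /dir_derivable (_ : (fun t : R => (f \o E) (z + t%:C *: v)) = fun t : R => f (E z + t%:C *: L v)) //.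
by apply/funext => t; rewrite /= EL.
Qed.

Hypothesis cE : continuous E.

Lemma Ck_affine k (D : set Cn) (f : Cn -> R) : Ck k D f -> Ck k (E @^-1` D) (f \o E).
Proof.
Local Transparent Ck.
have hc (g : Cn -> R) : (forall z, D z -> {for z, continuous g}) ->
    forall z, (E @^-1` D) z -> {for z, continuous (g \o E)}.
  by move=> cg z Dz; apply: continuous_comp; [exact: cE|exact: cg].
elim: k f => [|k IH] f [c d]; first by split=> //; exact: hc.
split=> [|v]; first exact: hc.
split=> [z Dz|]; first by apply: dir_derivable_affine; exact: (d (L v)).1.
rewrite (_ : rderive (f \o E) v = rderive f (L v) \o E); first exact: IH (d (L v)).2.
by apply/funext => z; exact: rderive_affine.
Local Opaque Ck.
Qed.

End AffineMaps.

Lemma continuous_vec (R : realType) (T : topologicalType) (n : nat) (E : T -> 'rV[R[i]]_n) (z : T) :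
  (forall b, {for z, continuous (fun x => crd b (E x))}) -> {for z, continuous E}.
Proof.
move=> cE A /nbhs_boxP[e e0 hA].
have : \forall w \near z, forall b : 'I_n * bool, `|crd b (E w) - crd b (E z)| < e.
  apply: filter_forall => b; have /cvgrPdist_lt/(_ e e0) := cE b.
  by apply: filterS => w; rewrite distrC.
by apply: filterS => w hw; apply: hA.
Qed.

Section AffineExamples.
Variables (R : realType) (n : nat).
Local Notation Cn := 'rV[R[i]]_n.

Lemma homothety_EL (y : Cn) (r : R) (z v : Cn) (t : R) :
  y + r%:C *: (z + t%:C *: v) = y + r%:C *: z + t%:C *: (r%:C *: v).
Proof. by rewrite scalerDr addrA !scalerA mulrC. Qed.

Lemma homothety_cont (y : Cn) (r : R) : continuous (fun z : Cn => y + r%:C *: z).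
Proof.
move=> z; apply: continuous_vec => b.
rewrite (_ : (fun x : Cn => crd b (y + r%:C *: x)) = fun x => crd b y + r * crd b x).
  apply: continuousD; first exact: cst_continuous.
  by apply: continuousM; [exact: cst_continuous|exact: continuous_crd].
by apply/funext => x; rewrite crdD crdZ.
Qed.

Lemma line_EL (y e : Cn) (z v : 'rV[R[i]]_1) (t : R) :
  y + (z + t%:C *: v) 0 0 *: e = y + z 0 0 *: e + t%:C *: (v 0 0 *: e).
Proof. by rewrite !mxE scalerDl addrA scalerA. Qed.

Lemma line_cont (y e : Cn) : continuous (fun z : 'rV[R[i]]_1 => y + z 0 0 *: e).
Proof.
move=> z; apply: continuous_vec => -[k b].
rewrite (_ : (fun x : 'rV[R[i]]_1 => crd (k, b) (y + x 0 0 *: e)) = fun x => crd (k, b) y +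
    (crd (0, false) x * crd (k, b) e + crd (0, true) x * (if b then crd (k, false) e else - crd (k, true) e))).
  apply: continuousD; first exact: cst_continuous.
  by apply: continuousD; (apply: continuousM; [exact: continuous_crd|exact: cst_continuous]).
apply/funext => x; rewrite crdD; congr (_ + _); rewrite /crd /= !mxE.
by case: b; case: (x 0 0) (e 0 k) => [a1 a2] [c1 c2] /=; ring.
Qed.

Lemma nsq_scale (x : R[i]) (e : Cn) : nsq (x *: e) = (complex.Re x ^+ 2 + complex.Im x ^+ 2) * nsq e.
Proof.
rewrite /nsq !sum_pair_bool mulr_sumr; apply: eq_bigr => k _; rewrite /crd /= !mxE.
by case: x (e 0 k) => [a b] [c d] /=; ring.
Qed.

Lemma nsq_line (z : 'rV[R[i]]_1) (e : Cn) : nsq (z 0 0 *: e) = nsq z * nsq e.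
Proof. by rewrite nsq_scale /nsq !sum_pair_bool big_ord1 /crd. Qed.

Lemma nsq_le_box (z : Cn) (d : R) : box 0 d z -> nsq z <= (2 * n)%:R * d ^+ 2.
Proof.
move=> hz; rewrite /nsq (_ : (2 * n)%:R * d ^+ 2 = \sum_(b : 'I_n * bool) d ^+ 2).
  apply: ler_sum => b _; have := hz b; rewrite crd0 subr0 => h.
  by rewrite -[leLHS]real_normK ?num_real // lerXn2r ?nnegrE ?(ltW h) // (le_trans _ (ltW h)).
by rewrite sumr_const card_prod card_ord card_bool mulr_natl mulnC.
Qed.

End AffineExamples.

Section WeakHarmonic.
Variables (R : realType) (n : nat).
Local Notation Cn := 'rV[R[i]]_n.
Implicit Types (D : set Cn) (A chi : Cn -> R) (v : Cn).
Local Opaque box.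

(** [A] has bounded derivatives that may be discontinuous, so the product with [chi] is not known to
    be C^1 and the integration by parts rests on [Int_rderive_bnd]. *)
Lemma Int_rderive_prod D (s : R) A chi v C : open D -> cbox 0 s `<=` D ->
  (forall z, D z -> {for z, continuous A}) -> (forall z, D z -> dir_derivable A v z) ->
  (forall z, D z -> `|rderive A v z| <= C) -> Ck 1 setT chi -> csupp s chi ->
  bcs (zext D (fun z => rderive A v z * chi z + A z * rderive chi v z)) /\
  Int (zext D (fun z => rderive A v z * chi z + A z * rderive chi v z)) = 0.
Proof.
move=> oD KD cA dA bA kc sc.
have oK : open (~` cbox (0 : Cn) s) by apply: closed_openC; exact: closed_cbox.
pose F := zext D (fun z => A z * chi z).
have F0 z : ~ cbox 0 s z -> F z = 0.
  by move=> nz; rewrite /F /zext; case: asboolP => // _; rewrite sc // mulr0.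
have kF z : {for z, continuous F} /\ (dir_derivable F v z /\
    rderive F v z = zext D (fun z => rderive A v z * chi z + A z * rderive chi v z) z).
  have [Dz|nD] := pselect (D z); last first.
    have nK : ~ cbox 0 s z by move/KD.
    split; first by apply: (@continuous_ext _ _ _ (fun=> 0) F z oK) => // [x|]; [rewrite inE => /F0 ->|exact: cst_continuous].
    rewrite (zextF _ nD).
    have [|d e] := rderive_ext (f := fun=> 0) (g := F) (v := v) oK _ nK (rderive_cst 0 v z).1.
      by move=> x; rewrite inE => /F0 ->.
    by split=> //; rewrite e; exact: (rderive_cst 0 v z).2.
  have FE : {in D, (fun z => A z * chi z) =1 F} by move=> x; rewrite inE => Dx; rewrite /F zextT.
  split.
    apply: (continuous_ext oD FE Dz); apply: continuousM; [exact: cA|exact: (Ck_cont kc)].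
  have [d e] := rderiveM_def (dA _ Dz) (Ck_der v kc (I : setT z)).
  have [d' e'] := rderive_ext oD FE Dz d.
  split=> //; rewrite e' e zextT // addrC.
  by [].
have bF : bcs F by apply: bcs_cont => [z|z /F0]; [exact: (kF z).1|].
have FE : rderive F v = zext D (fun z => rderive A v z * chi z + A z * rderive chi v z).
  by apply/funext => z; exact: (kF z).2.2.
have [C1 C10 hA] := bounded_cbox (fun z h => cA z (KD z h)).
have [C2 [_ h2 _]] := bcsP (bcs_Ck kc sc); have [C3 [_ h3 _]] := bcsP (bcs_rderive v kc sc).
rewrite -FE; apply: Int_rderive_bnd => // [z|]; first exact: (kF z).2.1.
exists (`|C| * C2 + C1 * C3) => z; rewrite FE.
have C20 : 0 <= C2 := le_trans (normr_ge0 _) (h2 z).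
have C30 : 0 <= C3 := le_trans (normr_ge0 _) (h3 z).
have P0 : 0 <= `|C| * C2 + C1 * C3.
  by apply: addr_ge0; apply: mulr_ge0 => //; exact: ltW.
have [Dz|nD] := pselect (D z); last by rewrite (zextF _ nD) normr0.
rewrite (zextT (fun z => rderive A v z * chi z + A z * rderive chi v z) Dz).
have [Kz|nK] := pselect (cbox 0 s z); last first.
  by rewrite sc // mulr0 (csupp_rderive v sc nK) mulr0 addr0 normr0.
apply: le_trans (ler_normD _ _) _; rewrite !normrM; apply: lerD; apply: ler_pM => //.
- by apply: le_trans (bA _ Dz) (ler_norm _).
- exact: hA.
Qed.

End WeakHarmonic.

Lemma CR_num (R : realType) (A B k1 k2 L p q a1 a2 b1 b2 x y : R) :
  L = p + q -> a2 = - b1 -> b2 = a1 -> x = y ->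
  A * L = a1 * k1 + A * p + (a2 * k2 + A * q) + (b1 * k2 + B * y - (b2 * k1 + B * x)).
Proof. by move=> -> -> -> ->; ring. Qed.

Lemma lap_homothety (R : realType) (n : nat) (D : set 'rV[R[i]]_n) (f : 'rV[R[i]]_n -> R) (y z : 'rV[R[i]]_n) (r : R) :
  open D -> Ck 2 D f -> D (y + r%:C *: z) ->
  lap (f \o (fun x => y + r%:C *: x)) z = r ^+ 2 * lap f (y + r%:C *: z).
Proof.
move=> oD kf Dz; rewrite /lap mulr_sumr; apply: eq_bigr => b _.
rewrite (rderive2_affine (homothety_EL y r)).
rewrite (rderive2_expand _ _ oD kf Dz) (rderive2_expand (real_basis R b) _ oD kf Dz).
rewrite mulr_sumr; apply: eq_bigr => b' _; rewrite mulr_sumr; apply: eq_bigr => c _.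
rewrite !crdZ; move: (rderive _ _ _) (crd _ _) (crd _ _) => H p q; ring.
Qed.

Lemma lap0_num (R : realType) (t c C r e I1 I2 : R) : 0 < t -> 0 < c -> 0 <= C -> 0 < r ->
  e * (64 * C + 1) = t * c -> t / 2 * I1 <= I2 -> c * (2 * r) ^+ 2 <= I1 -> I2 <= e * (8 * r ^+ 2) * (C / r ^+ 2) * (4 * r) ^+ 2 -> False.
Proof.
move=> t0 c0 C0 r0 eE h1 h2; have P0 : 0 < r ^+ 2 by rewrite exprn_gt0.
rewrite (_ : e * (8 * r ^+ 2) * (C / r ^+ 2) * (4 * r) ^+ 2 = 2 * (e * (64 * C)) * r ^+ 2); last by field; rewrite gt_eqF.
move=> h3; have e0 : 0 < e.
  by rewrite -(pmulr_lgt0 _ (_ : 0 < 64 * C + 1)) ?eE ?mulr_gt0 // ltr_wpDl // mulr_ge0.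
have h4 : t / 2 * (c * (2 * r) ^+ 2) <= 2 * (e * (64 * C)) * r ^+ 2.
  by apply: le_trans h3; apply: le_trans h1; rewrite ler_pM2l // divr_gt0.
move: h4; rewrite (_ : t / 2 * (c * (2 * r) ^+ 2) = 2 * (t * c) * r ^+ 2); last by field.
by rewrite ler_pM2r // -eE; nra.
Qed.

Lemma lap0_num2 (R : realType) (e C r : R) : 0 <= e -> 0 <= C -> 0 <= e * (8 * r ^+ 2) * (C / r ^+ 2).
Proof. move=> e0 C0; have r2 := sqr_ge0 r.
by apply: mulr_ge0; [apply: mulr_ge0 => //; exact: mulr_ge0|exact: divr_ge0]. Qed.

Lemma lap0_num3 (R : realType) (r : R) : (2 * 1)%:R * (2 * r) ^+ 2 = 8 * r ^+ 2.
Proof. by rewrite muln1; ring. Qed.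

Section IntEstimates.
Variables (R : realType) (n : nat).
Local Notation Cn := 'rV[R[i]]_n.
Implicit Types (F G : Cn -> R).
Local Opaque box.

Lemma Int_norm_le F G : bcs F -> bcs G -> (forall z, `|F z| <= G z) -> `|Int F| <= Int G.
Proof.
move=> bF bG h; rewrite ler_norml -(IntN bG); apply/andP; split.
  by apply: Int_le => // [|z]; [exact: bcsN|have := h z; rewrite ler_norml => /andP[]].
by apply: Int_le => // z; have := h z; rewrite ler_norml => /andP[].
Qed.

Lemma Int_abs_box G (M r : R) : bcs G -> (forall z, ~ box 0 r z -> G z = 0) -> 0 < r -> 0 <= M ->
  (forall z, box 0 r z -> `|G z| <= M) -> `|Int G| <= M * (2 * r) ^+ (2 * n).
Proof.
move=> bG G0 r0 M0 GM; have b2 := bcs_indic_box (0 : Cn) r.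
rewrite -(Int_indic_box (0 : Cn) r0) -(IntZ _ b2); apply: Int_norm_le => // [|z]; first exact: bcsZ.
rewrite indicE; have [bz|nb] := pselect (box 0 r z); first by rewrite mem_set // mulr1; exact: GM.
by rewrite memNset // mulr0 (G0 z nb) normr0.
Qed.

Lemma Int_ge_box F (c r : R) : bcs F -> 0 < r -> (forall z, ~ box 0 r z -> 0 <= F z) ->
  (forall z, box 0 r z -> c <= F z) -> c * (2 * r) ^+ (2 * n) <= Int F.
Proof.
move=> bF r0 F0 Fc; have b2 := bcs_indic_box (0 : Cn) r.
rewrite -(Int_indic_box (0 : Cn) r0) -(IntZ _ b2); apply: Int_le => // [|z]; first exact: bcsZ.
rewrite indicE; have [bz|nb] := pselect (box 0 r z); first by rewrite mem_set // mulr1; exact: Fc.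
by rewrite memNset // mulr0; exact: F0.
Qed.

Lemma Int_dist_box F G (t : R) : bcs F -> bcs G -> (forall z, 0 <= G z) ->
  (forall z, `|F z - t * G z| <= `|t| / 2 * G z) -> `|t| / 2 * Int G <= `|Int F|.
Proof.
move=> bF bG G0 h; have bt := bcsZ t bG; have b2 := bcsZ (`|t| / 2) bG.
have : `|Int F - t * Int G| <= `|t| / 2 * Int G.
  by rewrite -(IntZ t bG) -(IntZ _ bG) -(IntB bF bt); apply: Int_norm_le => //; exact: bcsB.
have := ler_distD (Int F) (t * Int G) 0; rewrite !subr0 normrM (ger0_norm (Int_ge0 G0)) distrC.
by move: (`|Int F|) (`|t|) (Int G) (`|Int F - _|) => x y w q; nra.
Qed.

End IntEstimates.

Section CauchyRiemann.
Variables (R : realType).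
Local Notation C1 := 'rV[R[i]]_1.
Local Notation e1 := (@real_basis R 1 (0, false)).
Local Notation e2 := (@real_basis R 1 (0, true)).
Implicit Types (D : set C1) (A B chi u : C1 -> R).
Local Opaque box.

Lemma lap1 u z : lap u z = rderive (rderive u e1) e1 z + rderive (rderive u e2) e2 z.
Proof. by rewrite /lap sum_pair_bool big_ord1. Qed.

Lemma Int4 (F1 F2 F3 F4 : C1 -> R) : bcs F1 -> bcs F2 -> bcs F3 -> bcs F4 ->
  Int F1 = 0 -> Int F2 = 0 -> Int F3 = 0 -> Int F4 = 0 ->
  bcs (fun z => (F1 z + F2 z) + (F3 z - F4 z)) /\ Int (fun z => (F1 z + F2 z) + (F3 z - F4 z)) = 0.
Proof.
move=> p1 p2 p3 p4 q1 q2 q3 q4; split; first by apply: bcsD; [exact: bcsD|exact: bcsB].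
rewrite IntD; [|exact: bcsD|exact: bcsB].
by rewrite (IntD p1 p2) (IntB p3 p4) q1 q2 q3 q4 subrr !addr0.
Qed.

Lemma Int3 (F F1 F2 : C1 -> R) : bcs F -> bcs F1 -> bcs F2 -> Int F1 = 0 -> Int F2 = 0 ->
  Int (fun z => F z - (F1 z + F2 z)) = Int F.
Proof.
move=> p p1 p2 q1 q2; rewrite IntB //; last exact: bcsD.
by rewrite (IntD p1 p2) q1 q2 addr0 subr0.
Qed.

(** One integration by parts moves a derivative to [A]; the Cauchy-Riemann equations turn it into a
    derivative of [B], and a second integration by parts leaves [B] against two mixed second
    derivatives of [chi], which cancel. *)
Lemma CR_weak_harmonic D (s : R) A B chi C : open D -> cbox 0 s `<=` D ->
  (forall z, D z -> {for z, continuous A}) -> (forall z, D z -> {for z, continuous B}) ->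
  (forall v z, D z -> dir_derivable A v z) -> (forall v z, D z -> dir_derivable B v z) ->
  (forall z, D z -> `|rderive A e1 z| <= C) -> (forall z, D z -> `|rderive A e2 z| <= C) ->
  (forall z, D z -> rderive A e2 z = - rderive B e1 z) ->
  (forall z, D z -> rderive B e2 z = rderive A e1 z) ->
  Ck 2 setT chi -> csupp s chi ->
  bcs (zext D (fun z => A z * lap chi z)) /\ Int (zext D (fun z => A z * lap chi z)) = 0.
Proof.
move=> oD KD cA cB dA dB bA1 bA2 cr1 cr2 kc sc.
have bB1 z : D z -> `|rderive B e1 z| <= C by move=> Dz; have := bA2 z Dz; rewrite cr1 // normrN.
have bB2 z : D z -> `|rderive B e2 z| <= C by move=> Dz; have := bA1 z Dz; rewrite cr2.
have k1 := Ck_rderive e1 kc; have k2 := Ck_rderive e2 kc.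
have s1 := csupp_rderive e1 sc; have s2 := csupp_rderive e2 sc.
have [p1 q1] := Int_rderive_prod oD KD cA (dA e1) bA1 k1 s1.
have [p2 q2] := Int_rderive_prod oD KD cA (dA e2) bA2 k2 s2.
have [p3 q3] := Int_rderive_prod oD KD cB (dB e2) bB2 k1 s1.
have [p4 q4] := Int_rderive_prod oD KD cB (dB e1) bB1 k2 s2.
have E : zext D (fun z => A z * lap chi z) = fun z =>
   (zext D (fun z => rderive A e1 z * rderive chi e1 z + A z * rderive (rderive chi e1) e1 z) z +
    zext D (fun z => rderive A e2 z * rderive chi e2 z + A z * rderive (rderive chi e2) e2 z) z) +
   (zext D (fun z => rderive B e1 z * rderive chi e2 z + B z * rderive (rderive chi e2) e1 z) z -
    zext D (fun z => rderive B e2 z * rderive chi e1 z + B z * rderive (rderive chi e1) e2 z) z).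
  apply/funext => z; rewrite /zext; case: asboolP => [Dz|_]; last by rewrite subrr !addr0.
  exact: (CR_num _ _ _ _ (lap1 chi z) (cr1 z Dz) (cr2 z Dz) (rderive2_sym e1 e2 openT kc (I : setT z))).
by rewrite E; exact: (Int4 p1 p2 p4 p3 q1 q2 q4 q3).
Qed.

(* Only pointwise complex differentiability of the transition maps is assumed, so
   that they cannot be differentiated twice.  A real part [A] with bounded first
   derivatives is weakly harmonic; if a C^2 function [u] agrees with it to second
   order at 0, testing against cutoffs shrinking to 0 gives [lap u 0 = 0]. *)
Lemma CR_lap0 D A B u C : open D -> D 0 -> Ck 2 D u ->
  (forall z, D z -> {for z, continuous A}) -> (forall z, D z -> {for z, continuous B}) ->
  (forall v z, D z -> dir_derivable A v z) -> (forall v z, D z -> dir_derivable B v z) ->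
  (forall z, D z -> `|rderive A e1 z| <= C) -> (forall z, D z -> `|rderive A e2 z| <= C) ->
  (forall z, D z -> rderive A e2 z = - rderive B e1 z) ->
  (forall z, D z -> rderive B e2 z = rderive A e1 z) ->
  (forall e : R, 0 < e -> exists2 d : R, 0 < d & forall z, box 0 d z -> `|u z - A z| <= e * nsq z) ->
  lap u 0 = 0.
Proof.
move=> oD D0 ku cA cB dA dB bA1 bA2 cr1 cr2 hu; apply/eqP/negPn/negP => t0.
have {t0}t0 : 0 < `|lap u 0| by rewrite normr_gt0.
have [chi [c [C' [c0 kc sc chi1 chi2]]]] := @cutoff R 1 1 ltr01.
have C'0 : 0 <= C' by have [h1 h2 _] := chi2 0; exact: le_trans h2.
have Q0 : 0 < 64 * C' + 1 by rewrite ltr_wpDl // mulr_ge0.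
(* Main term and error both scale like [r^2]; this [e] makes the error the smaller one at every
   scale. *)
pose e := `|lap u 0| * c / (64 * C' + 1); have e0 : 0 < e by rewrite divr_gt0 // mulr_gt0.
have eE : e * (64 * C' + 1) = `|lap u 0| * c by rewrite /e divfK // gt_eqF.
have [d1 d10 hd1] := open_box_sub oD D0.
have [d2 d20 hd2] := hu e e0.
have [d3 d30 hd3] := (iffLR (continuous_boxP _ _) (lap_cont oD ku D0)) (`|lap u 0| / 2) (divr_gt0 t0 (ltr0n R 2)).
pose d := Num.min d1 (Num.min d2 d3); have d0 : 0 < d by rewrite !lt_min d10 d20.
pose r := d / 2; have r0 : 0 < r by rewrite divr_gt0.
have box2 x (z : C1) : d <= x -> box 0 (2 * r) z -> box 0 x z.
  by move=> dx h b; apply: lt_le_trans (h b) _; rewrite /r mulrC divfK.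
pose E (z : C1) : C1 := 0 + (r^-1)%:C *: z; pose chir := chi \o E.
have kr : Ck 2 setT chir by exact: (Ck_affine (homothety_EL 0 r^-1) (@homothety_cont _ _ 0 r^-1) kc).
have crdE b z : crd b (E z) = crd b z / r by rewrite /E add0r crdZ mulrC.
have sr : csupp (3 / 2 * r) chir.
  move=> z nz; apply: sc => hz; apply: nz => b; have := hz b.
  by rewrite crdE !crd0 !subr0 normrM normfV (gtr0_norm r0) ler_pdivrMr // mulr1.
have chir1 z : box 0 r z -> c <= chir z.
  move=> hz; apply: chi1 => b; have := hz b.
  by rewrite crdE !crd0 !subr0 normrM normfV (gtr0_norm r0) ltr_pdivrMr // mul1r.
have chir2 z : `|lap chir z| <= C' / r ^+ 2.
  rewrite (lap_homothety openT kc I) normrM ger0_norm ?sqr_ge0 // exprVn mulrC ler_pM2r ?invr_gt0 ?exprn_gt0 //.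
  by have [] := chi2 (E z).
have chir0 z : 0 <= chir z by have [] := chi2 (E z).
have K2 : cbox (0 : C1) (3 / 2 * r) `<=` box 0 (2 * r).
  by apply: cbox_sub_box; rewrite ltr_pM2r // ltr_pdivrMr // -natrM ltr_nat.
have K1 : cbox (0 : C1) (3 / 2 * r) `<=` D.
  by move=> z /K2 h; apply: hd1; apply: box2 h; rewrite ge_min lexx.
have [g1 g2] := Green oD (@closed_cbox _ _ 0 (3 / 2 * r)) K1 (@subset_refl _ _) ku (Ck_sub (@subsetT _ D) kr) (fun z _ => sr z).
have [w1 w2] := CR_weak_harmonic oD K1 cA cB dA dB bA1 bA2 cr1 cr2 kr sr.
have sl z : ~ cbox 0 (3 / 2 * r) z -> lap chir z = 0.
  by move=> nz; apply: big1 => b _; exact: (csupp_rderive _ (csupp_rderive _ sr)).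
have bchi : bcs chir := bcs_Ck kr sr.
pose F := zext D (fun z => chir z * lap u z).
pose G := zext D (fun z => (u z - A z) * lap chir z).
have bG2 : bcs (fun z => (zext D (fun z => chir z * lap u z - u z * lap chir z) z + zext D (fun z => A z * lap chir z) z)).
  exact: bcsD.
have bF : bcs F.
  have oK : open (~` cbox (0 : C1) (3 / 2 * r)) by apply: closed_openC; exact: closed_cbox.
  have F0 : forall z, ~ cbox 0 (3 / 2 * r) z -> F z = 0.
    by move=> z nz; rewrite /F /zext; case: asboolP => // _; rewrite sr // mul0r.
  apply: (bcs_cont _ F0) => z; have [Dz|nD] := pselect (D z).
    apply: (continuous_ext (f := fun z => chir z * lap u z) oD _ Dz).
      by move=> x; rewrite inE => Dx; rewrite /F zextT.
    by apply: continuousM; [exact: (Ck_cont kr)|exact: lap_cont ku Dz].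
  have nK : ~ cbox 0 (3 / 2 * r) z by move/K1.
  by apply: (@continuous_ext _ _ _ (fun=> 0) F z oK) => // [x|]; [rewrite inE => /F0 ->|exact: cst_continuous].
(* Green's formula for [u] and the weak harmonicity of [A] alter [F] by functions of zero integral
   only; what remains contains [u - A], which is small to second order. *)
have GE : G = fun z => F z - (zext D (fun z => chir z * lap u z - u z * lap chir z) z + zext D (fun z => A z * lap chir z) z).
  apply/funext => z; rewrite /G /F /zext; case: asboolP => _; last by rewrite addr0 subr0.
  by move: (lap _ _) (lap _ _) (u z) (A z) (chir z) => *; ring.
have bG : bcs G by rewrite GE; exact: (bcsB bF bG2).
have IG : Int G = Int F by rewrite GE; exact: Int3.
have hI2 : `|Int F| <= e * (8 * r ^+ 2) * (C' / r ^+ 2) * (4 * r) ^+ 2.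
  rewrite -IG (_ : 4 * r = 2 * (2 * r)); last by ring.
  apply: (Int_abs_box bG _ (mulr_gt0 (ltr0n R 2) r0) (lap0_num2 _ (ltW e0) C'0)) => z Bz.
    rewrite /G /zext; case: asboolP => [_|_]; last by [].
    by rewrite (sl z (fun h => Bz (K2 _ h))) mulr0.
  rewrite /G /zext; case: asboolP => [Dz|_]; last by rewrite normr0; exact: (lap0_num2 _ (ltW e0) C'0).
  rewrite normrM; apply: (ler_pM (normr_ge0 _) (normr_ge0 _) _ (chir2 z)); apply: (le_trans (hd2 z _)).
    by apply: box2 Bz; rewrite !ge_min lexx orbT.
  by apply: ler_wpM2l; [exact: ltW|rewrite -lap0_num3; exact: (nsq_le_box Bz)].
have hI1 : c * (2 * r) ^+ 2 <= Int chir by exact: (Int_ge_box bchi r0 (fun z _ => chir0 z) chir1).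
have hI3 : `|lap u 0| / 2 * Int chir <= `|Int F|.
  apply: (Int_dist_box bF bchi chir0) => z; have [Kz|nK] := pselect (cbox 0 (3 / 2 * r) z); last first.
    rewrite (sr z nK) /F /zext; case: asboolP => [_|_]; last by rewrite !mulr0 subrr normr0.
    by rewrite (sr z nK) mul0r !mulr0 subrr normr0.
  rewrite /F (zextT (fun z => chir z * lap u z) (K1 _ Kz)) [chir z * _]mulrC -mulrBl normrM (ger0_norm (chir0 z)).
  apply: (ler_wpM2r (chir0 z)); apply/ltW/hd3; apply: box2 (K2 _ Kz).
  by rewrite !ge_min lexx !orbT.
exact: (lap0_num t0 c0 C'0 r0 eE hI3 hI1 hI2).
Qed.

End CauchyRiemann.

Section NormComparison.
Variables (R : realType) (m n : nat).
Local Notation Cm := 'rV[R[i]]_m.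
Local Notation Cn := 'rV[R[i]]_n.

Lemma normc_sqr (x : R[i]) : `|x| ^+ 2 = (complex.Re x ^+ 2 + complex.Im x ^+ 2)%:C.
Proof. by case: x => a b; rewrite normc_def -rmorphXn /= sqr_sqrtr // addr_ge0 // sqr_ge0. Qed.

Lemma nsq_sum k (x : 'rV[R[i]]_k) : nsq x = \sum_j (complex.Re (x 0 j) ^+ 2 + complex.Im (x 0 j) ^+ 2).
Proof. by rewrite /nsq sum_pair_bool. Qed.

(** The norm of a row vector is the maximum of the moduli of its entries, whence the factor [n]. *)
Lemma nsq_norm_le (x : Cm) (y : Cn) (e : R) : 0 <= e -> `|y| <= e%:C * `|x| -> nsq y <= n%:R * e ^+ 2 * nsq x.
Proof.
move=> e0 h; rewrite (nsq_sum y) -mulrA mulr_natl -[X in _ *+ X](card_ord n) -sumr_const; apply: ler_sum => k _.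
have yk : `|y 0 k| <= `|y|.
  by rewrite -[leLHS]nngE [leRHS]mx_normE num_le; exact: (le_bigmax _ (fun ij => `|y ij.1 ij.2|%:nng) (0, k)).
have [x0|x0] := eqVneq `|x| 0.
  have y0 : y 0 k = 0 by apply/eqP; rewrite -normr_eq0 eq_le normr_ge0 andbT (le_trans yk) // (le_trans h) // x0 mulr0.
  by rewrite y0 /= !expr0n addr0 mulr_ge0 ?sqr_ge0 // nsq_ge0.
have [[i j] xij] := mx_norm_neq0 x0.
have hk : `|y 0 k| <= e%:C * `|x i j| by apply: le_trans yk _; apply: le_trans h _; rewrite [`|x|]xij.
rewrite -lecR -normc_sqr rmorphM rmorphXn /=.
apply: (@le_trans _ _ ((e%:C * `|x i j|) ^+ 2)); first by rewrite lerXn2r ?nnegrE ?normr_ge0 // mulr_ge0 // lecR.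
rewrite exprMn ler_wpM2l ?exprn_ge0 ?lecR // normc_sqr lecR (ord1 i) nsq_sum (bigD1 j) //= lerDl sumr_ge0 // => l _.
by rewrite addr_ge0 // sqr_ge0.
Qed.

End NormComparison.

Section ComplexDerivative.
Variables (R : realType) (m n : nat).
Local Notation Cm := 'rV[R[i]]_m.
Local Notation Cn := 'rV[R[i]]_n.

Lemma diff_nsq (F : Cm -> Cn) (z : Cm) : differentiable F z -> forall e : R, 0 < e ->
  exists2 d : R, 0 < d & forall h, box 0 d h -> nsq (F (z + h) - F z - 'd F z h) <= e * nsq h.
Proof.
move=> dF e e0; pose q : R := Num.sqrt (e / n.+1%:R).
have q0 : 0 < q by rewrite sqrtr_gt0 divr_gt0.
have qe : n%:R * q ^+ 2 <= e.
  by rewrite sqr_sqrtr ?divr_ge0 ?(ltW e0) // mulrCA ler_piMr ?(ltW e0) // ler_pdivrMr // mul1r ler_nat.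
have /eqaddoP/(_ q%:C) := diff_locally dF; rewrite ltcR => /(_ q0) /nbhs_boxP[d d0 hd].
exists d => // h hh; have := hd h hh; rewrite /= !fctE /= => le1.
apply: le_trans (ler_wpM2r (nsq_ge0 h) qe); apply: nsq_norm_le; first exact: ltW.
by apply: le_trans le1; rewrite opprD addrA [h + z]addrC.
Qed.

Lemma dot_comb (c : Cn) (a b : Cn) (t : R) : dot c (a - t%:C *: b) = dot c a - t * dot c b.
Proof. by rewrite /dot mulr_sumr -sumrB; apply: eq_bigr => x _; rewrite crdB crdZ; ring. Qed.

Lemma dot_derive (P : Cm -> Cn) (T : Cm -> Cn) (c : Cn) (v z : Cm) :
  (forall t : R, T (t%:C *: v) = t%:C *: T v) ->
  (forall e : R, 0 < e -> exists2 d : R, 0 < d & forall h, box 0 d h -> nsq (P (z + h) - P z - T h) <= e * nsq h) ->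
  dir_derivable (fun z => dot c (P z)) v z /\ rderive (fun z => dot c (P z)) v z = dot c (T v).
Proof.
move=> TZ hP; apply: is_derive_dir; apply/is_derive0P => e e0.
pose q : R := e ^+ 2 / (1 + nsq c) / (1 + nsq v).
have c0 := nsq_ge0 c; have v0 := nsq_ge0 v.
have pc : 0 < 1 + nsq c by rewrite ltr_pwDl.
have pv : 0 < 1 + nsq v by rewrite ltr_pwDl.
have q0 : 0 < q by rewrite !divr_gt0 // exprn_gt0.
have [d d0 hd] := hP q q0.
have [d' d'0 hd'] := box_ray2 (0 : Cm) v 0 d0.
exists d' => // t td; rewrite ray0.
have bt : box 0 d (t%:C *: v).
  by have := hd' t 0 td; rewrite normr0 => /(_ d'0); rewrite add0r ray0.
have := hd _ bt; rewrite TZ; set y := P _ - P z => hy.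
have -> : dot c (P (z + t%:C *: v)) - dot c (P z) - t * dot c (T v) = dot c (y - t%:C *: T v).
  rewrite dot_comb; congr (_ - _); rewrite /y /dot -sumrB; apply: eq_bigr => b _.
  by rewrite crdB mulrBr.
rewrite -(ler_pXn2r (ltn0Sn 1)) ?nnegrE ?mulr_ge0 ?(ltW e0) // real_normK ?num_real //.
apply: (@le_trans _ _ (nsq c * nsq (y - t%:C *: T v))).
  have CS := dot_CS c (erefl ('i *: (y - t%:C *: T v))).
  by apply: le_trans CS; rewrite lerDl sqr_ge0.
rewrite exprMn real_normK ?num_real //.
have qE : q * ((1 + nsq c) * (1 + nsq v)) = e ^+ 2.
  by rewrite /q; field; rewrite !gt_eqF.
apply: (@le_trans _ _ (nsq c * (q * (t ^+ 2 * nsq v)))); first by rewrite ler_wpM2l // -nsqZ.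
rewrite -qE; have t0 := sqr_ge0 t.
rewrite (_ : _ * (q * _) = q * (nsq c * nsq v) * t ^+ 2); last by ring.
rewrite ler_wpM2r // ler_pM2l // ler_pM //; by rewrite lerDr.
Qed.

Lemma dot_cont (P : Cm -> Cn) (c : Cn) z : {for z, continuous P} -> {for z, continuous (fun z => dot c (P z))}.
Proof.
move=> cP; have cd : continuous (fun x : Cn => dot c x).
  have k : Ck 0 setT (fun x : Cn => dot c x).
    by apply: Ck_sum; [exact: openT|move=> b _; exact: (CkZ _ openT (Ck_crd 0 b openT))].
  by move=> x; exact: (Ck_cont k).
by apply: (continuous_comp cP); exact: cd.
Qed.

End ComplexDerivative.

Lemma pullback_num (R : realType) (g0 gX gW lX lW lD qX qW a b e k h s z : R) :
  `|gX - g0 - lX - qX / 2| <= e * a -> `|gW - g0 - lW - qW / 2| <= e * b ->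
  lX - lW = lD -> `|qX - qW| <= e * h -> a <= k * z -> b <= k * z -> h <= k * z ->
  0 <= e -> s = e * (3 * k) -> `|gX - gW - lD| <= s * z.
Proof.
move=> h1 h2 <- h3 ha hb hh e0 ->.
have {h1} h1 : `|gX - g0 - lX - qX / 2| <= e * (k * z) by apply: le_trans h1 _; exact: ler_wpM2l.
have {h2} h2 : `|gW - g0 - lW - qW / 2| <= e * (k * z) by apply: le_trans h2 _; exact: ler_wpM2l.
have {h3} h3 : `|qX - qW| <= e * (k * z) by apply: le_trans h3 _; exact: ler_wpM2l.
rewrite (_ : e * (3 * k) * z = 3 * (e * (k * z))); last by ring.
move: (e * (k * z)) h1 h2 h3 => E; rewrite !ler_norml => /andP[? ?] /andP[? ?] /andP[? ?].
by apply/andP; split; lra.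
Qed.

Lemma pullback_num2 (R : realType) (k u p q a b c d : R) : u = p + q -> p = -1 * a + b ->
  q = -1 * c + d -> u = 0 -> k * (b + d) = k * (a + c).
Proof. by move=> -> -> -> h; congr (_ * _); lra. Qed.

Lemma prod_diff_num (R : realType) (xb xc wb wc e : R) : 0 < e ->
  `|xb * xc - wb * wc| <= ((xb - wb) ^+ 2 + (xc - wc) ^+ 2) / e + e * (xc ^+ 2 + wb ^+ 2).
Proof.
move=> e0; have am (p q : R) : `|p * q| <= p ^+ 2 / e + e * q ^+ 2.
  rewrite -(ler_pM2l e0) mulrDr [e * (_ / e)]mulrC divfK ?gt_eqF //.
  have := sqr_ge0 (p - e * q); have := sqr_ge0 (p + e * q).
  have := sqr_ge0 p; have := sqr_ge0 (e * q).
  by rewrite -(gtr0_norm e0) -normrM ler_norml (gtr0_norm e0) !expr2 => *; apply/andP; split; nra.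
rewrite (_ : xb * xc - wb * wc = (xb - wb) * xc + (xc - wc) * wb); last by ring.
apply: le_trans (ler_normD _ _) _; apply: le_trans (lerD (am _ _) (am _ _)) _.
by rewrite mulrDl mulrDr; lra.
Qed.

Section Pullback.
Variables (R : realType) (n : nat).
Local Notation Cn := 'rV[R[i]]_n.
Local Notation C1 := 'rV[R[i]]_1.
Local Notation e1 := (@real_basis R 1 (0, false)).
Local Notation e2 := (@real_basis R 1 (0, true)).
Implicit Types (D U : set Cn) (f g : Cn -> R).
Local Opaque box.

Lemma dot_iN (c x : Cn) : dot ('i *: c) x = - dot c ('i *: x).
Proof.
rewrite /dot !sum_pair_bool -sumrN; apply: eq_bigr => k _; rewrite !crd_iF !crd_iT; ring.
Qed.

Lemma e1_00 : (e1 : C1) 0 0 = 1. Proof. by rewrite /real_basis /= mxE !eqxx. Qed.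
Lemma e2_00 : (e2 : C1) 0 0 = 'i. Proof. by rewrite /real_basis /= !mxE !eqxx mulr1. Qed.

(** In the application [X - W] is of smaller order than [X] and [W]; the free parameter [e] balances
    the two terms. *)
Lemma rderive2_quad_diff U g y : open U -> Ck 2 U g -> U y -> exists2 H : R, 0 < H &
  forall (X W : Cn) (e : R), 0 < e ->
    `|rderive (rderive g X) X y - rderive (rderive g W) W y| <=
      H * (nsq (X - W) / e + e * (nsq X + nsq W)).
Proof.
move=> oU kg Uy; pose h b c := rderive (rderive g (@real_basis R n b)) (@real_basis R n c) y.
exists (1 + \sum_b \sum_c 2 * `|h b c|) => [|X W e e0].
  by rewrite ltr_pwDl // sumr_ge0 // => b _; apply: sumr_ge0 => c _; exact: mulr_ge0.
rewrite (rderive2_expand _ _ oU kg Uy) (rderive2_expand W _ oU kg Uy) -sumrB.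
rewrite (eq_bigr (fun b => \sum_c (crd b X * crd c X - crd b W * crd c W) * h b c)); last first.
  by move=> b _; rewrite -sumrB; apply: eq_bigr => c _; rewrite mulrBl.
set N := nsq (X - W) / e + _; have N0 : 0 <= N.
  by rewrite addr_ge0 ?divr_ge0 ?mulr_ge0 ?addr_ge0 ?nsq_ge0 // ltW.
rewrite mulrDl mul1r; apply: (@le_trans _ _ ((\sum_b \sum_c 2 * `|h b c|) * N)); last by rewrite lerDr.
rewrite mulr_suml; apply: le_trans (ler_norm_sum _ _ _) _; apply: ler_sum => b _.
rewrite mulr_suml; apply: le_trans (ler_norm_sum _ _ _) _; apply: ler_sum => c _.
rewrite normrM mulrC [2 * _]mulrC -mulrA; apply: ler_wpM2l => //.
apply: le_trans (prod_diff_num _ _ _ _ e0) _; rewrite -!crdB.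
have p1 := crd_nsq b (X - W); have p2 := crd_nsq c (X - W); have p3 := crd_nsq c X; have p4 := crd_nsq b W.
have q1 := nsq_ge0 X; have q2 := nsq_ge0 W.
rewrite /N [leRHS]mulrDr; apply: lerD.
  by rewrite mulrA; apply: ler_wpM2r; [rewrite invr_ge0 ltW|rewrite mulr2n mulrDl !mul1r; exact: lerD].
rewrite mulrCA; apply: ler_wpM2l; first exact: ltW.
by apply: le_trans (lerD p3 p4) _; rewrite mulr2n mulrDl !mul1r lerDl addr_ge0.
Qed.

Lemma nsq_addle (X W : Cn) : nsq (X + W) <= 2 * nsq X + 2 * nsq W.
Proof.
rewrite /nsq !mulr_sumr -big_split; apply: ler_sum => b _ /=; rewrite crdD.
by have := sqr_ge0 (crd b X - crd b W); move: (crd b X) (crd b W) => p q; nra.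
Qed.

Lemma dotB (c X W : Cn) : dot c (X - W) = dot c X - dot c W.
Proof. by rewrite /dot -sumrB; apply: eq_bigr => b _; rewrite crdB mulrBr. Qed.

(* Along the complex line through [z] directed by [e], the second order Taylor
   expansions of [f] and of [g] at [F z] differ by the composition of a linear form
   with the holomorphic map [F], to which [CR_lap0] applies. *)
Lemma ddc_pullback (kappa : R) D U f g (F : Cn -> Cn) (z e ie : Cn) (C : R) :
  ie = 'i *: e -> open D -> D z -> open U -> Ck 2 D f -> Ck 2 U g ->
  (forall x, D x -> U (F x)) -> (forall x, D x -> differentiable F x) ->
  (forall x, D x -> f x = g (F x)) -> (forall x, D x -> nsq ('d F x e - 'd F z e) <= C) ->
  ddc kappa f z e ie = ddc kappa g (F z) ('d F z e) ('i *: 'd F z e).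
Proof.
move=> Eie oD Dz oU kf kg FU dF fg dFC; set y := F z; set w := 'd F z e; have Uy : U y := FU z Dz.
pose l1 (x : C1) := z + x 0 0 *: e; pose l2 (x : C1) := y + x 0 0 *: w.
have c1 : continuous l1 := @line_cont _ _ z e; have c2 : continuous l2 := @line_cont _ _ y w.
pose V : set C1 := l1 @^-1` D `&` l2 @^-1` U.
have oV : open V.
  by apply: openI; apply: open_comp.
have l10 : l1 0 = z by rewrite /l1 mxE scale0r addr0.
have l20 : l2 0 = y by rewrite /l2 mxE scale0r addr0.
have V0 : V 0 by rewrite /V /= l10 l20.
have k1 : Ck 2 V (f \o l1) by apply: Ck_sub (Ck_affine (line_EL z e) c1 kf) => x [].
have k2 : Ck 2 V (g \o l2) by apply: Ck_sub (Ck_affine (line_EL y w) c2 kg) => x [].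
(* The gradient of [g] at [y], so that [dot c] is the differential of [g] there. *)
pose c : Cn := vec_of_crd (fun b => rderive g (real_basis R b) y).
have lc x : rderive g x y = dot c x.
  rewrite (rderive_expand x oU (Ck_pred kg) Uy); apply: eq_bigr => b _.
  by rewrite crd_vec_of_crd mulrC.
(* The deviation of [F] from its tangent line, with complex derivative [T], zero at the origin. The
   functions [dot c (P x)] and [dot ('i *: c) (P x)] satisfy the Cauchy-Riemann equations. *)
pose P (x : C1) : Cn := F (l1 x) - l2 x.
pose T (x : C1) : Cn := 'd F (l1 x) e - w.
have l1D x h : l1 (x + h) = l1 x + h 0 0 *: e by rewrite /l1 mxE scalerDl addrA.
have l2D x h : l2 (x + h) = l2 x + h 0 0 *: w by rewrite /l2 mxE scalerDl addrA.
have FrP x : V x -> forall q : R, 0 < q -> exists2 d : R, 0 < d & forall h, box 0 d h ->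
    nsq (P (x + h) - P x - h 0 0 *: T x) <= q * nsq h.
  move=> [Dx _] q q0; have q'0 : 0 < q / (1 + nsq e) by rewrite divr_gt0 // ltr_pwDl // nsq_ge0.
  have [d d0 hd] := diff_nsq (dF _ Dx) q'0.
  have cl : {for 0, continuous (fun h : C1 => (0 : Cn) + h 0 0 *: e)} by exact: line_cont.
  have : nbhs (0 : C1) ((fun h : C1 => (0 : Cn) + h 0 0 *: e) @^-1` box 0 d).
    by apply: cl; rewrite mxE scale0r addr0; apply/nbhs_boxP; exists d.
  move=> /nbhs_boxP[d' d'0 hd']; exists d' => // h /hd' /=; rewrite add0r => /hd.
  rewrite linearZ /= nsq_line.
  have -> : P (x + h) - P x - h 0 0 *: T x = F (l1 x + h 0 0 *: e) - F (l1 x) - h 0 0 *: 'd F (l1 x) e.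
    rewrite /P /T l1D l2D; move: (F _) (F _) ('d F _ _) (l2 x) => a1 a2 a3 a4.
    by apply/rowP => j; rewrite !mxE; ring.
  move=> /le_trans; apply; have he := nsq_ge0 h; have ee := nsq_ge0 e.
  rewrite (_ : _ * _ = q * nsq h * (nsq e / (1 + nsq e))); last by ring.
  by rewrite ler_piMr ?mulr_ge0 ?(ltW q0) // ler_pdivrMr ?ltr_pwDl // mul1r lerDr.
have cF x : D x -> {for x, continuous F} by move=> /dF; exact: differentiable_continuous.
have cFl x : V x -> {for x, continuous (F \o l1)}.
  by move=> [Dx _]; apply: continuous_comp; [exact: c1|exact: cF].
have cP x : V x -> {for x, continuous P}.
  by move=> Vx; apply: continuousB; [exact: cFl|exact: c2].
have TE x b (v : C1) : V x -> dir_derivable (fun x => dot b (P x)) v x /\ rderive (fun x => dot b (P x)) v x = dot b (v 0 0 *: T x).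
  by move=> Vx; apply: dot_derive (FrP x Vx) => t; rewrite mxE scalerA.
have DA x (v : C1) : V x -> rderive (fun x => dot c (P x)) v x = dot c (v 0 0 *: T x) by move=> Vx; exact: (TE x c v Vx).2.
have DB x (v : C1) : V x -> rderive (fun x => dot ('i *: c) (P x)) v x = dot ('i *: c) (v 0 0 *: T x) by move=> Vx; exact: (TE x _ v Vx).2.
have TC x : V x -> nsq (T x) <= C by move=> [Dx _]; exact: dFC.
have dotC (x : Cn) : nsq x <= C -> `|dot c x| <= 1 + nsq c * C.
  move=> xC; have CS := dot_CS c (erefl ('i *: x)).
  have h2 : dot c x ^+ 2 <= nsq c * C.
    apply: le_trans (_ : nsq c * nsq x <= _); first by apply: le_trans CS; rewrite lerDl sqr_ge0.
    by rewrite ler_wpM2l // nsq_ge0.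
  by rewrite -real_normK ?num_real // in h2; move: (`|dot c x|) h2 => p h2; have := sqr_ge0 (p - 1); nra.
pose u (x : C1) := -1 * (g \o l2) x + (f \o l1) x.
have ku : Ck 2 V u := Ck_lin (-1) oV k2 k1.
have P0 : P 0 = 0 by rewrite /P l10 l20 subrr.
have T0 : T 0 = 0 by rewrite /T l10 subrr.
have u0 : lap u 0 = 0.
  apply: (@CR_lap0 R V (fun x => dot c (P x)) (fun x => dot ('i *: c) (P x)) u (1 + nsq c * C) oV V0 ku).
  - by move=> x Vx; apply: dot_cont; exact: cP.
  - by move=> x Vx; apply: dot_cont; exact: cP.
  - by move=> v x Vx; exact: (TE x c v Vx).1.
  - by move=> v x Vx; exact: (TE x _ v Vx).1.
  - by move=> x Vx; rewrite DA // e1_00 scale1r; apply: dotC; exact: TC.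
  - by move=> x Vx; rewrite DA // e2_00; apply: dotC; rewrite nsq_i; exact: TC.
  - move=> x Vx; rewrite (DA _ _ Vx) (DB _ _ Vx) e1_00 e2_00 scale1r.
    by apply/esym; rewrite (dot_iN c (T x)) opprK.
  - move=> x Vx; rewrite (DA _ _ Vx) (DB _ _ Vx) e1_00 e2_00 scale1r.
    rewrite (dot_iN c ('i *: T x)) iiv /dot -sumrN.
    by apply: eq_bigr => b _; rewrite crdN mulrN opprK.
  move=> eps eps0; have [H H0 hH] := rderive2_quad_diff oU kg Uy.
  (* Three errors, each at most [eta * k * nsq x]: the two Taylor remainders of [g] and the
     variation of its quadratic term between [X] and [W]. *)
  pose k := (1 + H) * (3 + 3 * nsq w); have w0 := nsq_ge0 w.
  have k0 : 0 < k by rewrite mulr_gt0 // ?ltr_pwDl ?ltr_wpDr ?mulr_ge0 // ltW.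
  pose eta := Num.min 1 (eps / (3 * k)).
  have k30 : 0 < 3 * k by exact: (mulr_gt0 (ltr0n R 3) k0).
  have eta0 : 0 < eta by rewrite lt_min ltr01; exact: (divr_gt0 eps0 k30).
  have eta1 : eta <= 1 by rewrite ge_min lexx.
  have etae : eta * (3 * k) <= eps by rewrite -(ler_pdivlMr _ _ k30) ge_min lexx orbT.
  have [d1 d10 hd1] := Taylor2 oU kg Uy eta0.
  have [d2 d20 hd2] := FrP 0 V0 (eta ^+ 2) (exprn_gt0 2 eta0).
  have n1 : nbhs (0 : C1) ((F \o l1) @^-1` box y d1).
    by apply: (cFl _ V0); rewrite /= l10; apply/nbhs_boxP; exists d1.
  have n2 : nbhs (0 : C1) (l2 @^-1` box y d1).
    by apply: c2; rewrite l20; apply/nbhs_boxP; exists d1.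
  have n3 : nbhs (0 : C1) (box 0 d2) by apply/nbhs_boxP; exists d2.
  have n4 : nbhs (0 : C1) V by exact: open_nbhs_nbhs.
  have n5 : nbhs (0 : C1) (((F \o l1) @^-1` box y d1 `&` l2 @^-1` box y d1) `&` (box 0 d2 `&` V)).
    by apply: filterI; exact: filterI.
  have [d d0 hd] := iffLR (nbhs_boxP (0 : C1) _) n5.
  exists d => // x /hd[[h1 h2] [h3 [Dx _]]].
  set W := x 0 0 *: w; set X := F (l1 x) - y.
  have XW : X - W = P x by rewrite /X /W /P /l2 opprD addrA.
  have bX : box 0 d1 X by move=> b; rewrite crd0 subr0 crdB; exact: h1.
  have bW : box 0 d1 W.
    by move=> b; rewrite crd0 subr0 (_ : W = l2 x - y) ?crdB; [exact: h2|rewrite /l2 addrAC subrr add0r].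
  have nP : nsq (P x) <= eta ^+ 2 * nsq x.
    by have := hd2 _ h3; rewrite add0r P0 T0 scaler0 !subr0.
  have x0 := nsq_ge0 x.
  have nP' : nsq (P x) <= nsq x by apply: le_trans nP _; rewrite ler_piMl // exprn_ile1 // ltW.
  have nW : nsq W = nsq x * nsq w by exact: nsq_line.
  have nX : nsq X <= (2 + 2 * nsq w) * nsq x.
    have : nsq X <= 2 * nsq (P x) + 2 * nsq W by rewrite -[X](subrK W) XW; exact: nsq_addle.
    by move=> /le_trans; apply; rewrite nW; move: nP'; move: (nsq x) (nsq w) (nsq _) => *; lra.
  have := pullback_num (z := nsq x) (k := k) (h := H * (nsq (P x) / eta ^+ 2 + (nsq X + nsq W))) (hd1 X bX) (hd1 W bW) (erefl _).
  have -> : y + X = F (l1 x) by rewrite /X addrC subrK.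
  rewrite !lc (_ : dot c X - dot c W = dot c (P x)); last first.
    by rewrite -(dotB c X W) XW.
  rewrite (_ : g (F (l1 x)) - g (y + W) = u x); last by rewrite /u /= fg // mulN1r addrC.
  have E2 : 0 < eta ^+ 2 by rewrite exprn_gt0.
  have hk : H <= k /\ (2 + 2 * nsq w) <= k /\ H * (3 + 3 * nsq w) <= k /\ nsq w <= k.
    by rewrite /k; clear -w0 H0; move: (nsq w) w0 => q q0; split; [|split; [|split]]; nra.
  move=> hp; apply: le_trans (ler_wpM2r x0 etae); apply: (hp _ _ _ _ _ _ (erefl _)).
  - have := hH X W eta eta0; rewrite XW; move=> /le_trans; apply.
    by rewrite le_eqVlt; apply/orP; left; apply/eqP; field; rewrite gt_eqF.
  - by apply: le_trans nX _; apply: (ler_wpM2r x0); exact: hk.2.1.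
  - by rewrite nW mulrC; apply: (ler_wpM2r x0); exact: hk.2.2.2.
  - have nP2 : nsq (P x) / eta ^+ 2 <= nsq x by rewrite ler_pdivrMr // mulrC.
    apply: (@le_trans _ _ (H * (3 + 3 * nsq w) * nsq x)); last by apply: (ler_wpM2r x0); exact: hk.2.2.1.
    rewrite -mulrA ler_pM2l // nW; move: nX nP2.
    by move: (nsq x) (nsq w) (nsq X) (nsq (P x) / _) => *; lra.
  - exact: ltW.
have E1 := rderive2_lin (-1) e1 e1 oV k2 k1 V0; have E2 := rderive2_lin (-1) e2 e2 oV k2 k1 V0.
have A1 := rderive2_affine (line_EL z e) f e1 e1 0; have A2 := rderive2_affine (line_EL z e) f e2 e2 0.
have A3 := rderive2_affine (line_EL y w) g e1 e1 0; have A4 := rderive2_affine (line_EL y w) g e2 e2 0.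
rewrite (ddc_diag kappa oD kf Dz Eie) (ddc_diag kappa oU kg Uy erefl) Eie.
move: A1 A2 A3 A4; rewrite !e1_00 !e2_00 !scale1r -/(l1 0) -/(l2 0) l10 l20 => <- <- <- <-.
exact: (pullback_num2 _ (lap1 u 0) E1 E2 u0).
Qed.

End Pullback.

Lemma taylor_num (R : realType) (p q a b H h c C : R) : p - q = h * a -> a - b = c * H -> `|H| <= C ->
  0 < c -> c < h -> q + h * b - C * h ^+ 2 <= p.
Proof.
move=> E1 E2 hH c0 ch; have -> : p = q + h * (b + c * H) by rewrite -E2; move/eqP: E1; rewrite subr_eq => /eqP ->; ring.
rewrite mulrDr addrA lerD2l -[- _]mulN1r; have := hH; rewrite ler_norml => /andP[h1 h2].
have C0 : 0 <= C by apply: le_trans hH.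
have : c * - C <= c * H by rewrite ler_pM2l.
have : h * - C <= c * - C by rewrite ler_wnM2r ?oppr_le0 // ltW.
move=> h3 h4; have : h * (h * - C) <= h * (c * H) by rewrite ler_pM2l; [exact: le_trans h4|exact: lt_trans ch].
by rewrite expr2; lra.
Qed.

(** * Submean inequality *)

Section Homothety.
Variables (R : realType) (n : nat).
Local Notation Cn := 'rV[R[i]]_n.

Lemma homothety_cbox (y : Cn) (s r : R) (z : Cn) : 0 <= r -> r <= s -> cbox 0 1 z -> cbox y s (y + r%:C *: z).
Proof.
move=> r0 rs hz b; rewrite crdD crdZ addrAC subrr add0r normrM (ger0_norm r0).
have := hz b; rewrite crd0 subr0 => h1; apply: le_trans rs.
by rewrite ler_piMr.
Qed.

Lemma bcs_aff (r : R) (v : Cn) (F : Cn -> R) : 0 < r -> bcs F -> bcs (fun z => F (r%:C *: z + v)).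
Proof.
move=> r0 bF; have [M [M0 hM1 hM2]] := bcsP bF.
apply: (@bcs_le _ _ _ ((M + \sum_b `|crd b v|) / r) M).
- exact: (measurableT_comp bF.1 (measurable_affC r v)).
- by move=> z; exact: hM1.
move=> z nz; apply: hM2 => hz; apply: nz => b; have := hz b.
rewrite !crd0 !subr0 crdD crdZ ltr_pdivlMr // => h.
rewrite mulrC -[X in X * _](gtr0_norm r0) -normrM -[r * _](addrK (crd b v)).
apply: le_lt_trans (ler_normB _ _) _; apply: ltr_leD => //.
by rewrite (bigD1 b) //= lerDl sumr_ge0.
Qed.

End Homothety.

Lemma Phi_num (R : realType) (k p q h a c : R) : 0 <= k -> q + h * a - c <= p ->
  k * q + h * (k * a) - c * k <= k * p.
Proof.
move=> k0 hp; rewrite (_ : _ - _ = k * (q + h * a - c)); last by ring.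
exact: ler_wpM2l.
Qed.

Section SubMean.
Variables (R : realType) (n : nat).
Local Notation Cn := 'rV[R[i]]_n.
Local Notation "'rb' b" := (@real_basis R n b) (at level 10).
Implicit Types (D : set Cn) (f : Cn -> R) (v z : Cn).
Local Opaque box.

Definition bump z : R := tp 3 (1 - nsq z).
Definition mkern z : R := 6 * tp 2 (1 - nsq z).

Lemma mkern_ge0 z : 0 <= mkern z.
Proof. by rewrite mulr_ge0 // tp_ge0. Qed.

Lemma nsq_out_cbox1 z : ~ cbox 0 1 z -> 1 - nsq z <= 0.
Proof.
move=> /existsNP[b /negP]; rewrite -ltNge crd0 subr0 => hb.
rewrite subr_le0; apply: le_trans (crd_nsq b z).
by rewrite -[leRHS]real_normK ?num_real // exprn_ege1 // ltW.
Qed.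

Lemma mkern_csupp : csupp 1 mkern.
Proof. by move=> z /nsq_out_cbox1 h; rewrite /mkern tpN // mulr0. Qed.

Lemma bump_csupp : csupp 1 bump.
Proof. by move=> z /nsq_out_cbox1 h; rewrite /bump tpN. Qed.

Let kq : Ck 2 setT (fun z : Cn => 1 - nsq z).
Proof.
have k1 := CkB (@openT Cn) (Ck_cst 2 (1 : R) openT) (Ck_quad 2 (0 : Cn) (0 : R) openT).
by apply: (Ck_ext openT _ k1) => z _; rewrite subr0 addr0.
Qed.

Lemma Ck_bump : Ck 2 setT bump.
Proof.
have := Ck_comp openT (Cr_tp 2 1) (fun z _ => Logic.I) kq.
by apply: (Ck_ext openT) => z _ /=; rewrite mul1r.
Qed.

Lemma mkern_cont z : {for z, continuous mkern}.
Proof.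
have := Ck_comp openT (Cr_tp 1 6) (fun z _ => Logic.I) (Ck_pred kq).
by move=> k; exact: (Ck_cont k).
Qed.

Lemma rderive_bump b z : rderive bump (rb b) z = - (mkern z * crd b z).
Proof.
have E : rderive (fun z : Cn => 1 - nsq z) (rb b) z = - (2 * crd b z).
  have [d e] := rderive_quad (0 : Cn) (0 : R) (rb b) z.
  have [d1 e1] := rderiveN_def d; have [d2 e2] := rderiveD_def (rderive_cst (1 : R) (rb b) z).1 d1.
  have -> : (fun z : Cn => 1 - nsq z) = (fun x => 1 - (nsq (x - 0) + 0)).
    by apply/funext => x; rewrite subr0 addr0.
  rewrite e2 e1 e (rderive_cst (1 : R) (rb b) z).2 add0r subr0; congr (- (2 * _)).
  rewrite /dot (bigD1 b) //= crd_basis eqxx mulr1 big1 ?addr0 // => c cb.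
  by rewrite crd_basis (negbTE cb) mulr0.
have := rderive_comp (rb b) (h := tp 3) (g := fun x => 3 * tp 2 x) (Ck_pred kq) (Logic.I : setT z) (is_derive_tp 1 _).
rewrite E => ->; rewrite /mkern; move: (tp 2 _) (crd b z) => p q; ring.
Qed.

Definition Ikern : R := Int mkern.
Definition Ibump : R := Int bump.

Lemma bcs_mkern : bcs mkern.
Proof. by apply: (bcs_cont mkern_cont) => z; exact: mkern_csupp. Qed.

Lemma bcs_bump : bcs bump.
Proof. exact: bcs_Ck Ck_bump bump_csupp. Qed.

Section Scale.
Variables (D : set Cn) (f : Cn -> R) (y : Cn) (s C0 : R).
Hypotheses (oD : open D) (kf : Ck 2 D f) (s0 : 0 < s) (sD : cbox y s `<=` D).
Hypothesis lap_f : forall z, cbox y s z -> - C0 <= lap f z.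
Hypothesis C00 : 0 <= C0.

(* [Phi r] is the mean of [f] at scale [r] around [y]; [bump] is chosen such that
   [grad bump = - mkern * z], whence [Phi' r = r Int (bump * lap f)]. *)
Definition Phi r : R := Int (zext (cbox 0 1) (fun z => mkern z * f (y + r%:C *: z))).

Let Dr r : set Cn := (fun z : Cn => y + r%:C *: z) @^-1` D.

Let oDr r : open (Dr r).
Proof. by apply: open_comp => // z _; exact: homothety_cont. Qed.

Let subDr r : 0 <= r -> r <= s -> cbox 0 1 `<=` Dr r.
Proof. by move=> r0 rs z hz; apply: sD; exact: homothety_cbox. Qed.

Let bcsK r (g : Cn -> R) : 0 <= r -> r <= s -> (forall z, Dr r z -> {for z, continuous g}) ->
  bcs (zext (cbox 0 1) (fun z => mkern z * g z)).
Proof.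
move=> r0 rs cg; apply: (bcs_zext_cont (@oDr r) (subDr r0 rs)) => //.
  by move=> z Dz; apply: continuousM; [exact: mkern_cont|exact: cg].
by apply: measurable_closedC; exact: closed_cbox.
Qed.

Let cfr r z : Dr r z -> {for z, continuous (fun z => f (y + r%:C *: z))}.
Proof.
move=> Dz; apply: (@continuous_comp _ _ _ (fun z : Cn => y + r%:C *: z) f); first exact: homothety_cont.
exact: (Ck_cont kf).
Qed.

Lemma Phi0 : Phi 0 = f y * Ikern.
Proof.
rewrite /Phi /Ikern -(IntZ _ bcs_mkern); congr Int; apply/funext => z.
rewrite /zext; case: asboolP => [_|nz]; first by rewrite ray0 mulrC.
by rewrite (mkern_csupp nz) mulr0.
Qed.

Definition rad r z : R := rderive f z (y + r%:C *: z).

Lemma rad_sum r z : Dr r z -> rad r z = \sum_b crd b z * rderive f (rb b) (y + r%:C *: z).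
Proof. by move=> Dz; rewrite /rad (rderive_expand z oD (Ck_pred kf) Dz). Qed.

(** Divergence theorem for [bump] times the gradient of [f] at [y + r z]: since
    [grad bump = - mkern z], the radial integral equals [r] times the integral of [bump] against
    [lap f]. *)
Lemma Int_rad r : 0 <= r -> r <= s ->
  bcs (zext (cbox 0 1) (fun z => mkern z * rad r z)) /\
  - (r * (C0 * Ibump)) <= Int (zext (cbox 0 1) (fun z => mkern z * rad r z)).
Proof.
move=> r0 rs; pose E z := y + r%:C *: z.
pose G b := rderive f (rb b) \o E.
have kG b : Ck 1 (Dr r) (G b) := Ck_affine (homothety_EL y r) (@homothety_cont _ _ y r) (Ck_rderive (rb b) kf).
pose H b := zext (Dr r) (fun z => bump z * G b z).
have kp : Ck 1 (Dr r) bump := Ck_pred (Ck_sub (@subsetT _ _) Ck_bump).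
have h0 b z : Dr r z -> ~ cbox 0 1 z -> bump z * G b z = 0.
  by move=> _ nz; rewrite (bump_csupp nz) mul0r.
have kH b : Ck 1 setT (H b) := Ck_zext (@oDr r) (@closed_cbox _ _ 0 1) (subDr r0 rs) (h0 b) (CkM (@oDr r) kp (kG b)).
have sH b : csupp 1 (H b).
  by move=> z nz; rewrite /H /zext; case: asboolP => // Dz; exact: h0.
have dH b z : rderive (H b) (rb b) z =
    zext (cbox 0 1) (fun z => - (mkern z * crd b z) * G b z + bump z * (r * rderive (rderive f (rb b)) (rb b) (E z))) z.
  have [Kz|nK] := pselect (cbox 0 1 z); last first.
    by rewrite (csupp_rderive (rb b) (sH b) nK) (zextF _ nK).
  have Dz := subDr r0 rs Kz.
  rewrite (zextT (fun z => - (mkern z * crd b z) * G b z + bump z * (r * rderive (rderive f (rb b)) (rb b) (E z))) Kz).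
  have kk := CkM (@oDr r) kp (kG b).
  rewrite (rderive_zext (@oDr r) Dz (Ck_der (rb b) kk Dz)).
  have [_ ->] := rderiveM_def (Ck_der (rb b) kp Dz) (Ck_der (rb b) (kG b) Dz).
  have EG : rderive (G b) (rb b) z = r * rderive (rderive f (rb b)) (rb b) (E z).
    have -> := rderive_affine (homothety_EL y r) (rderive f (rb b)) (rb b) z.
    by have [_ ->] := rderiveZ_dir r (Ck_der (rb b) (Ck_rderive (rb b) kf) Dz).
  by rewrite EG rderive_bump addrC.
have bH b := bcs_rderive (rb b) (kH b) (sH b).
have IH : Int (fun z => \sum_b rderive (H b) (rb b) z) = 0.
  by rewrite Int_sum // big1 // => b _; exact: (Int_rderive (rb b) (kH b) (sH b)).
have bS : bcs (fun z => \sum_b rderive (H b) (rb b) z) by apply: bcs_sum => b _; exact: bH.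
have SE z : \sum_b rderive (H b) (rb b) z =
    zext (cbox 0 1) (fun z => r * (bump z * lap f (E z))) z - zext (cbox 0 1) (fun z => mkern z * rad r z) z.
  have [Kz|nK] := pselect (cbox 0 1 z); last first.
    rewrite (zextF _ nK) (zextF _ nK) subrr; apply: big1 => b _.
    exact: (csupp_rderive (rb b) (sH b) nK).
  rewrite (zextT (fun z => r * (bump z * lap f (E z))) Kz) (zextT (fun z => mkern z * rad r z) Kz).
  rewrite (rad_sum (subDr r0 rs Kz)) /lap !mulr_sumr -sumrB; apply: eq_bigr => b _.
  rewrite (dH b z) (zextT (fun z => - (mkern z * crd b z) * G b z + bump z * (r * rderive (rderive f (rb b)) (rb b) (E z))) Kz).
  rewrite /G /=; move: (rderive _ _ _) (rderive _ _ _) (mkern z) (bump z) (crd b z) => *; ring.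
have bM : bcs (zext (cbox 0 1) (fun z => mkern z * rad r z)).
  apply: (bcsK r0 rs) => z Dz.
  have k1 : Ck 1 (Dr r) (fun z => \sum_b crd b z * G b z).
    by apply: Ck_sum => // b _; exact: (CkM (@oDr r) (Ck_crd 1 b (@oDr r)) (kG b)).
  apply: (continuous_ext (@oDr r) _ Dz (Ck_cont k1 Dz)) => x; rewrite inE => Dx.
  by rewrite (rad_sum Dx).
split=> //; rewrite -(IntZ _ bcs_bump) -(IntZ _ (bcsZ C0 bcs_bump)) -(IntN (bcsZ _ (bcsZ C0 bcs_bump))).
rewrite -[leRHS]addr0 -IH -(IntD bM bS); apply: Int_le; [exact: bcsN (bcsZ _ (bcsZ C0 bcs_bump))|exact: bcsD|move=> z].
rewrite SE addrC subrK; have [Kz|nK] := pselect (cbox 0 1 z); last first.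
  by rewrite (zextF _ nK) (bump_csupp nK) !mulr0 oppr0.
rewrite (zextT (fun z => r * (bump z * lap f (E z))) Kz) -mulrN; apply: (ler_wpM2l r0).
rewrite mulrC -mulrN; apply: ler_wpM2l; first exact: tp_ge0.
by apply: lap_f; apply: homothety_cbox Kz.
Qed.

Lemma hess_bound : exists2 C1 : R, 0 <= C1 & forall z p, cbox 0 1 z -> cbox y s p ->
  `|rderive (rderive f z) z p| <= C1.
Proof.
(* Squares keep [g] continuous, and [|x| <= 1 + x^2] makes it dominate the absolute values. *)
pose g (p : Cn) := \sum_b \sum_c (1 + rderive (rderive f (rb b)) (rb c) p * rderive (rderive f (rb b)) (rb c) p).
have kg : Ck 0 D g.
  apply: Ck_sum => // b _; apply: Ck_sum => // c _; apply: (CkD oD (Ck_cst 0 1 oD)).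
  have k0 := Ck_rderive (rb c) (Ck_rderive (rb b) kf); exact: (CkM oD k0 k0).
have [C C0' hC] := bounded_cbox (fun z h => Ck_cont kg (sD h)).
exists C => [|z p hz hp]; first exact: ltW.
apply: le_trans (hC p hp); apply: le_trans (ler_norm _).
rewrite (rderive2_expand _ _ oD kf (sD hp)) /g; apply: le_trans (ler_norm_sum _ _ _) _; apply: ler_sum => b _.
apply: le_trans (ler_norm_sum _ _ _) _; apply: ler_sum => c _.
have h1 : `|crd b z * crd c z| <= 1.
  have := hz b; have := hz c; rewrite !crd0 !subr0 normrM => h1 h2.
  by rewrite -[leRHS]mulr1; apply: ler_pM.
rewrite normrM; move: (rderive _ _ _) => q; apply: (@le_trans _ _ (1 * `|q|)); first exact: ler_wpM2r.
by rewrite mul1r -expr2 -(real_normK (num_real q)); have := sqr_ge0 (`|q| - 1); have := sqr_ge0 `|q|; move: `|q| => x; nra.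
Qed.

Lemma taylor_lower C1 z r h : cbox 0 1 z -> 0 <= r -> 0 < h -> r + h <= s ->
  (forall p, cbox y s p -> `|rderive (rderive f z) z p| <= C1) ->
  f (y + r%:C *: z) + h * rad r z - C1 * h ^+ 2 <= f (y + (r + h)%:C *: z).
Proof.
move=> hz r0 h0 rh hC.
have seg t : 0 <= t -> t <= h -> cbox y s (y + r%:C *: z + t%:C *: z).
  move=> t0 th; rewrite -addrA -scalerDl -rmorphD; apply: homothety_cbox => //; first exact: addr_ge0.
  by apply: le_trans rh; rewrite lerD2l.
have -> : y + (r + h)%:C *: z = y + r%:C *: z + h%:C *: z by rewrite rmorphD scalerDl addrA.
have [|c /andP[c0 ch] E1] := @ray_MVT _ _ f z (y + r%:C *: z) h h0.
  by move=> t t0 th; exact: (Ck_der z kf (sD (seg t t0 th))).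
have [|c' /andP[c'0 c'c] E2] := @ray_MVT _ _ (rderive f z) z (y + r%:C *: z) c c0.
  by move=> t t0 tc; exact: (Ck_der z (Ck_rderive z kf) (sD (seg t t0 (le_trans tc (ltW ch))))).
have hb := hC _ (seg c' (ltW c'0) (le_trans (ltW c'c) (ltW ch))).
exact: (taylor_num E1 E2 hb c0 ch).
Qed.

(** A one-sided Taylor inequality with quadratic error, integrated against [mkern], replaces
    differentiation under the integral sign. *)
Lemma Phi_step C1 r h : 0 <= r -> 0 < h -> r + h <= s -> 0 <= C1 ->
  (forall z p, cbox 0 1 z -> cbox y s p -> `|rderive (rderive f z) z p| <= C1) ->
  Phi r - h * (s * (C0 * Ibump)) - C1 * h ^+ 2 * Ikern <= Phi (r + h).
Proof.
move=> r0 h0 rh C10 hC; have rs : r <= s by apply: le_trans rh; rewrite lerDl ltW.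
have rh0 : 0 <= r + h by rewrite addr_ge0 // ltW.
have [bR iR] := Int_rad r0 rs.
have b0 : bcs (zext (cbox 0 1) (fun z => mkern z * f (y + r%:C *: z))) by apply: (bcsK r0 rs) => z; exact: cfr.
have b1 : bcs (zext (cbox 0 1) (fun z => mkern z * f (y + (r + h)%:C *: z))) by apply: (bcsK rh0 rh) => z; exact: cfr.
have bk := bcsZ (C1 * h ^+ 2) bcs_mkern; have bh := bcsZ h bR.
apply: (@le_trans _ _ (Phi r + h * Int (zext (cbox 0 1) (fun z => mkern z * rad r z)) - C1 * h ^+ 2 * Ikern)).
  rewrite lerD2r lerD2l -mulrN; apply: (ler_wpM2l (ltW h0)); apply: le_trans iR; rewrite lerN2.
  by apply: ler_wpM2r => //; apply: mulr_ge0 => //; apply: Int_ge0 => z; exact: tp_ge0.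
rewrite /Phi /Ikern -(IntZ h bR) -(IntZ _ bcs_mkern) -(IntD b0 bh) -(IntB (bcsD b0 bh) bk).
apply: Int_le; [exact: bcsB (bcsD b0 bh) bk|exact: b1|move=> z].
have [Kz|nK] := pselect (cbox 0 1 z); last first.
  by rewrite !(zextF _ nK) (mkern_csupp nK) !mulr0 addr0 subr0.
rewrite (zextT (fun z => mkern z * f (y + r%:C *: z)) Kz) (zextT (fun z => mkern z * f (y + (r + h)%:C *: z)) Kz).
rewrite (zextT (fun z => mkern z * rad r z) Kz).
exact: (Phi_num (mkern_ge0 z) (taylor_lower Kz r0 h0 rh (fun p => hC z p Kz))).
Qed.

(** [N + 1] steps of length [s / (N + 1)]: the quadratic errors add up to [O(1 / N)]. *)
Lemma submean : f y * Ikern - s ^+ 2 * (C0 * Ibump) <= Phi s.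
Proof.
have [C1 C10 hC] := hess_bound.
have step (N k : nat) : (k <= N.+1)%N ->
    Phi 0 - k%:R * (s / N.+1%:R * (s * (C0 * Ibump)) + C1 * (s / N.+1%:R) ^+ 2 * Ikern) <= Phi (k%:R * (s / N.+1%:R)).
  elim: k => [|k IH] kN; first by rewrite !mul0r subr0.
  have h0 : 0 < s / N.+1%:R by rewrite divr_gt0.
  have E : k.+1%:R * (s / N.+1%:R) = k%:R * (s / N.+1%:R) + s / N.+1%:R by rewrite -natr1 mulrDl mul1r.
  have le : k%:R * (s / N.+1%:R) + s / N.+1%:R <= s.
    by rewrite -E mulrC -mulrA ler_piMr ?(ltW s0) // ler_pdivrMl // mulr1 ler_nat.
  have := Phi_step (mulr_ge0 (ler0n R k) (ltW h0)) h0 le C10 hC; rewrite -E.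
  apply: le_trans; rewrite -addrA -opprD; apply: le_trans (lerD (IH (ltnW kN)) (lexx _)).
  rewrite -[k.+1%:R]natr1; move: (_ + C1 * _ * Ikern) => X.
  by rewrite le_eqVlt; apply/orP; left; apply/eqP; ring.
apply/ler_addgt0Pl => e e0; have K0 : 0 <= Ikern by apply: Int_ge0 => z; exact: mkern_ge0.
pose q := C1 * s ^+ 2 * Ikern; have q0 : 0 <= q by rewrite mulr_ge0 // mulr_ge0 // sqr_ge0.
have [N hN] : exists N : nat, q / e <= N.+1%:R.
  exists (Num.truncn (q / e)); apply: ltW; exact: truncnS_gt.
have := step N N.+1 (leqnn _); rewrite [_ * (s / _)]mulrC divfK ?pnatr_eq0 // Phi0 => h.
have NE : N.+1%:R * (s / N.+1%:R * (s * (C0 * Ibump)) + C1 * (s / N.+1%:R) ^+ 2 * Ikern) =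
    s ^+ 2 * (C0 * Ibump) + q / N.+1%:R.
  have N0 : N.+1%:R != 0 :> R by rewrite pnatr_eq0.
  by rewrite /q; move: (N.+1%:R) N0 => x x0; field.
move: h; rewrite NE opprD addrA lerBlDr => /le_trans; apply; rewrite [e + _]addrC lerD2l.
by rewrite ler_pdivrMr // mulrC -ler_pdivrMr.
Qed.

End Scale.

(** As [f <= 0], the mean at scale [s] may be restricted to the small box. The factor [5 * n.+1] is
    such that the points of [cbox x0 (3 / 2 * rho)], rescaled around [y], satisfy [nsq <= 1 / 2],
    where [mkern >= 3 / 2]. *)
Lemma L1_bound (D : set Cn) (f : Cn -> R) (x0 y : Cn) (rho C0 : R) : open D -> Ck 2 D f -> 0 < rho -> 0 <= C0 ->
  cbox x0 (rho + 5 * n.+1%:R * rho) `<=` D ->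
  (forall z, cbox x0 (rho + 5 * n.+1%:R * rho) z -> - C0 <= lap f z) ->
  (forall z, cbox x0 (rho + 5 * n.+1%:R * rho) z -> f z <= 0) -> cbox x0 rho y ->
  Int (zext (cbox x0 (3 / 2 * rho)) (fun z => `|f z|)) <=
    (5 * n.+1%:R * rho) ^+ (2 * n) * (- f y * Ikern + (5 * n.+1%:R * rho) ^+ 2 * (C0 * Ibump)).
Proof.
set s := 5 * n.+1%:R * rho => oD kf rho0 C00 sub0 hl hf hy.
have s0 : 0 < s by rewrite /s !mulr_gt0.
have sy : cbox y s `<=` cbox x0 (rho + s).
  move=> z hz b; rewrite (_ : crd b z - crd b x0 = (crd b y - crd b x0) + (crd b z - crd b y)); last by ring.
  by apply: le_trans (ler_normD _ _) _; apply: lerD; [exact: hy|exact: hz].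
have sE : cbox x0 (3 / 2 * rho) `<=` cbox x0 (rho + s).
  move=> z hz b; apply: le_trans (hz b) _; rewrite (_ : 3 / 2 * rho = rho + 2^-1 * rho); last by field.
  rewrite lerD2l /s ler_pM2r //; apply: (@le_trans _ _ (5 * 1)); first by lra.
  by rewrite ler_pM2l // ler1n.
have sm := submean oD kf s0 (subset_trans sy sub0) (fun z h => hl z (sy z h)) C00.
pose G := zext (cbox x0 (3 / 2 * rho)) (fun z => `|f z|).
have bG : bcs G.
  apply: (bcs_zext_cont oD (subset_trans sE sub0)) => // [z Dz|]; last by apply: measurable_closedC; exact: closed_cbox.
  by apply: (@continuous_comp _ _ _ f (fun x : R => `|x|)); [exact: (Ck_cont kf Dz)|exact: norm_continuous].
have := Int_aff y s0 bG; move=> E.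
have sp : 0 < s ^+ (2 * n) by rewrite exprn_gt0.
rewrite -/G -(ler_pdivrMl _ _ sp) -E.
apply: (@le_trans _ _ (- Phi f y s)); last by rewrite mulNr; move: sm; move: (Phi _ _ _) (f y * _) (s ^+ 2 * _) => *; lra.
have sD z : cbox 0 1 z -> cbox x0 (rho + s) (y + s%:C *: z).
  by move=> hz; apply: sy; apply: homothety_cbox hz; [exact: ltW|exact: lexx].
pose D' : set Cn := (fun z : Cn => y + s%:C *: z) @^-1` D.
have oD' : open D' by apply: open_comp => // z _; exact: homothety_cont.
have bP : bcs (zext (cbox 0 1) (fun z => mkern z * f (y + s%:C *: z))).
  apply: (bcs_zext_cont oD' (fun z h => sub0 _ (sD z h))) => [z Dz|//|//].
    apply: continuousM; first exact: mkern_cont.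
    apply: (@continuous_comp _ _ _ (fun z : Cn => y + s%:C *: z) f); first exact: homothety_cont.
    exact: (Ck_cont kf).
  by apply: measurable_closedC; exact: closed_cbox.
have bG' : bcs (fun z => G (s%:C *: z + y)) := bcs_aff y s0 bG.
rewrite -(IntN bP); apply: Int_le; [exact: bG'|exact: bcsN|move=> z].
rewrite addrC /G; have [Ez|nE] := pselect (cbox x0 (3 / 2 * rho) (y + s%:C *: z)); last first.
  rewrite (zextF _ nE); have [Kz|nK] := pselect (cbox 0 1 z); last by rewrite (zextF _ nK) oppr0.
  rewrite (zextT (fun z => mkern z * f (y + s%:C *: z)) Kz) -mulrN; apply: mulr_ge0; first exact: mkern_ge0.
  by rewrite oppr_ge0; exact: hf (sD z Kz).
have cz b : `|crd b z| <= (2 * n.+1%:R)^-1.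
  have := Ez b; have := hy b; rewrite crdD crdZ => h1 h2.
  have : `|s * crd b z| <= 5 / 2 * rho.
    rewrite (_ : s * crd b z = (crd b y + s * crd b z - crd b x0) - (crd b y - crd b x0)); last by ring.
    by apply: le_trans (ler_normB _ _) _; apply: le_trans (lerD h2 h1) _; rewrite le_eqVlt; apply/orP; left; apply/eqP; field.
  rewrite normrM (gtr0_norm s0) mulrC -ler_pdivlMr // => /le_trans; apply.
  have N0 : n.+1%:R != 0 :> R by rewrite pnatr_eq0.
  have r0' : rho != 0 by rewrite gt_eqF.
  rewrite le_eqVlt; apply/orP; left; apply/eqP; rewrite /s; move: (n.+1%:R) N0 => x x0'; field.
  by rewrite x0' r0'.
have Kz : cbox 0 1 z.
  move=> b; rewrite crd0 subr0; apply: le_trans (cz b) _; rewrite invf_le1 ?mulr_gt0 //.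
  by rewrite -natrM ler1n.
have nz : nsq z <= 2^-1.
  have q0 : 0 < (2 * n.+1%:R)^-1 :> R by rewrite invr_gt0 mulr_gt0.
  apply: (@le_trans _ _ (\sum_(b : 'I_n * bool) (2 * n.+1%:R)^-1 ^+ 2)).
    apply: ler_sum => b _; rewrite -[leLHS]real_normK ?num_real //.
    by rewrite lerXn2r ?nnegrE // ltW.
  rewrite sumr_const card_prod card_ord card_bool -[leLHS]mulr_natl exprVn.
  have P0 : 0 < (2 * n.+1%:R) ^+ 2 :> R by rewrite exprn_gt0 // mulr_gt0.
  rewrite (ler_pdivrMr _ _ P0) natrM -[n.+1%:R]natr1; have := ler0n R n.
  by move: (n%:R) => x x0'; nra.
rewrite (zextT (fun z => `|f z|) Ez) (zextT (fun z => mkern z * f (y + s%:C *: z)) Kz) -mulrN.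
have f0 := hf _ (sD z Kz); rewrite ler0_norm // ler_peMl ?oppr_ge0 // /mkern tpP; last by lra.
by move: (nsq z) nz => q hq; nra.
Qed.

End SubMean.

(** [mu] is at most the sum of its restrictions to [D] and to the complement, and the latter does
    not charge [D]. *)
Lemma ge0_integral_mrestr d (T : measurableType d) (R : realType) (mu : {measure set T -> \bar R})
    (D : set T) (mD : measurable D) (f : T -> \bar R) :
  (forall x, 0 <= f x)%E -> measurable_fun setT f ->
  (\int[mu]_(x in D) f x <= \int[mrestr mu mD]_x f x)%E.
Proof.
move=> f0 mf; have mC := measurableC mD.
have mfD : measurable_fun D f by exact: measurable_funS mf.
apply: (@le_trans _ _ (\int[measure_add (mrestr mu mD) (mrestr mu mC)]_(x in D) f x)%E).
  apply: ge0_le_measure_integral => // S mS.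
  apply: (@le_trans _ _ (mrestr mu mD S + mrestr mu mC S)%E).
    by rewrite /mrestr -setDE addeC -(measureDI _ mS mD).
  by have h := measure_addE (mrestr mu mD) (mrestr mu mC) S; rewrite -h; exact: lexx.
rewrite ge0_integral_measure_add // (_ : (\int[mrestr mu mC]_(x in D) f x)%E = 0%E) ?adde0.
  by apply: ge0_subset_integral.
by apply: null_set_integral => //; rewrite /= /mrestr setICr measure0.
Qed.

Lemma measurable_openX (X : ptopologicalType) (O : set X) : open O -> measurable (O : set (g_sigma_algebraType (@open X))).
Proof. by move=> oO; apply: sub_sigma_algebra. Qed.

Lemma measurable_contX (R : realType) (X : ptopologicalType) (f : X -> R) : continuous f -> measurable_fun setT (f : g_sigma_algebraType (@open X) -> R).
Proof.
move=> cf; apply: (measurability _ (measurable_realfun.RGenOInfty.measurableE R)) => _ [_ [x ->] <-].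
rewrite setTI; apply: measurable_openX.
by move/continuousP : cf; apply; exact: rray_open.
Qed.

(** * From the manifold to charts *)

Section Charts.
Variables (R : realType) (n : nat) (X : ptopologicalType) (M : complex_manifold R n X).
Local Notation Cn := 'rV[R[i]]_n.
Local Notation BX := (g_sigma_algebraType (@open X)).
Implicit Types (i : idx M) (B : set Cn).

Lemma imgK i z : img i z -> Defs.dom i (psi i z) /\ phi i (psi i z) = z.
Proof. by move=> [x Dx <-]; rewrite phiK. Qed.

Lemma open_img i : open (img i). Proof. exact: img_open. Qed.

Lemma psi_cont i z : img i z -> {for z, continuous (psi (c := M) i)}.
Proof. exact: psi_continuous. Qed.

Lemma psi_image i B : B `<=` img i -> psi i @` B = Defs.dom i `&` phi i @^-1` B.
Proof.
move=> Bi; apply/seteqP; split => [x [z Bz <-]|x [Dx Bx]].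
  by have [h1 h2] := imgK (Bi _ Bz); split=> //=; rewrite h2.
by exists (phi i x) => //; exact: phiK.
Qed.

Lemma open_psi_image i B : open B -> B `<=` img i -> open (psi i @` B).
Proof.
move=> oB Bi; rewrite (psi_image Bi) openE => x [Dx Bx].
apply: filterI; first exact: (open_nbhs_nbhs (conj (dom_open i) Dx)).
by apply: (phi_continuous Dx); exact: open_nbhs_nbhs.
Qed.

Lemma smooth_cont (f : X -> R) : smooth M f -> continuous f.
Proof.
move=> sf x; have [i Dx] := dom_cover M x; have Iz : img i (phi i x) by exists x.
have c1 : {for x, continuous ((f \o psi i) \o phi i)}.
  apply: continuous_comp; first exact: phi_continuous.
  by have [] := sf i [::] _ Iz.
have : \forall y \near x, ((f \o psi i) \o phi i) y = f y.
  apply: filterS (open_nbhs_nbhs (conj (dom_open i) Dx)) => y Dy /=.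
  by rewrite phiK.
move=> h; rewrite /continuous_at -(nbhs_singleton h); apply: cvg_trans c1.
by apply: near_eq_cvg; apply: filterS h => y ->.
Qed.

End Charts.

Section Transfer.
Variables (R : realType) (n : nat) (X : ptopologicalType) (M : complex_manifold R n X).
Local Notation Cn := 'rV[R[i]]_n.
Local Notation BX := (g_sigma_algebraType (@open X)).
Variables (dV : smooth_probability M) (i : idx M) (B : set Cn) (c : R).
Hypotheses (oB : open B) (Bi : B `<=` img i) (c0 : 0 <= c).
Hypothesis cB : forall z, B z -> c <= svm_coef dV i z.
Let mB : measurable (B : set (BC R n)) := measurable_openC oB.

(** Made total by an arbitrary value off [B], which is harmless because the measure pushed forward
    is restricted to [B]. *)
Let psiB (z : BC R n) : BX := if `[< B z >] then psi i z else point.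

Let measurable_psiB : measurable_fun setT psiB.
Proof.
apply: (@measurability _ _ _ BX _ _ (@open X) erefl) => // _ [U oU <-].
have m1 : measurable (B `&` psi i @^-1` U : set (BC R n)).
  apply: measurable_openC; rewrite openE => z [Bz Uz].
  apply: filterI; first exact: open_nbhs_nbhs.
  by apply: (psi_cont (Bi Bz)); exact: open_nbhs_nbhs.
have [Up|nUp] := pselect (U point).
  rewrite (_ : _ `&` _ = (B `&` psi i @^-1` U) `|` ~` B).
    by apply: measurableU => //; exact: measurableC.
  rewrite setTI; apply/seteqP; split => z; rewrite /= /psiB; case: asboolP => h.
  - by left.
  - by right.
  - by case=> [[]|].
  - by [].
rewrite (_ : _ `&` _ = (B `&` psi i @^-1` U)) //.
rewrite setTI; apply/seteqP; split => z; rewrite /= /psiB; case: asboolP => h //.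
  by case.
by move=> [/h].
Qed.

(** On subsets of the chart [svm_density] shows that [dV] dominates [c] times the image of Lebesgue
    measure on [B]; the inequality of measures passes to integrals. *)
Lemma transfer (g : X -> \bar R) : (forall x, 0 <= g x)%E -> measurable_fun setT (g : BX -> \bar R) ->
  (c%:E * \int[lebC R n]_(z in B) g (psi i z) <= \int[dV]_x g x)%E.
Proof.
move=> g0 mg; pose k : {nonneg R} := NngNum c0.
pose nu : {measure set BX -> \bar R} := measure_function_pushforward__canonical__measure_function_Measure
  (mrestr (lebC R n) mB) measurable_psiB.
have h1 : (\int[mscale k nu]_x g x <= \int[dV]_x g x)%E.
  apply: ge0_le_measure_integral => // S mS.
  have oI := open_psi_image oB Bi; have mI := measurable_openX oI.
  have mSI : measurable (S `&` psi i @` B : set BX) by exact: measurableI.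
  apply: (@le_trans _ _ (dV (S `&` psi i @` B))); last first.
    by apply: le_measure; rewrite ?inE //; exact: subIsetl.
  have sub : S `&` psi i @` B `<=` Defs.dom i by move=> x [_]; rewrite (psi_image Bi) => -[].
  rewrite (svm_density dV mSI sub).
  pose Z : set (BC R n) := psiB @^-1` S `&` B.
  have mZ : measurable Z by apply: measurableI => //; rewrite -[X in measurable X]setTI; exact: measurable_psiB.
  have ZE : phi i @` (S `&` psi i @` B) = Z.
    apply/seteqP; split => [z [x [Sx [w Bw wx]] <-]|z []].
      by rewrite -wx (imgK (Bi Bw)).2; split=> //; rewrite /= /psiB asboolT // wx.
    rewrite /= /psiB => Sz Bz; move: Sz; rewrite asboolT // => Sz.
    by exists (psi i z); [split=> //; exists z|exact: (imgK (Bi Bz)).2].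
  have E : (fun z : Cn => (\1_Z z * svm_coef dV i z)%:E) = EFin \o zext Z (svm_coef dV i).
    apply/funext => z /=; rewrite /zext indicE; case: asboolP => h; first by rewrite mem_set // mul1r.
    by rewrite memNset // mul0r.
  have sc : Ck 0 (img i) (svm_coef dV i) := smooth_on_Ck 0 (@svm_smooth _ _ _ _ dV i).
  have mE : measurable_fun setT (zext Z (svm_coef dV i) : BC R n -> R).
    apply: measurable_zext => //.
    have := measurable_cont_on (@open_img R n X M i) (Ck_cont sc).
    by apply: measurable_funS; [exact: measurable_openC (@open_img R n X M i)|move=> z [_ /Bi]].
  have E0 z : 0 <= zext Z (svm_coef dV i) z by apply: zext_ge0 => w [_ /Bi /svm_gt0 /ltW].
  rewrite ZE E Cn_integralE; last 2 first.
  - exact/measurable_EFinP.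
  - by move=> z; rewrite lee_fin.
  rewrite /mscale /= /pushforward /mrestr -/Z -[leLHS]/(c%:E * lebC R n Z)%E.
  have mI1 : measurable_fun setT (fun z : BC R n => (\1_Z z)%:E : \bar R).
    by apply/measurable_EFinP; exact: measurable_indic.
  have <- : (\int[lebC R n]_z (c%:E * (\1_Z z)%:E) = c%:E * lebC R n Z)%E.
    by rewrite ge0_integralZl // integral_indic // setIT.
  apply: ge0_le_integral => //.
  - by move=> z _; rewrite -EFinM lee_fin mulr_ge0.
  - by apply: measurable_funeM.
  - exact/measurable_EFinP.
  move=> z _; rewrite -EFinM lee_fin indicE /zext; case: asboolP => h.
    by rewrite mem_set // mulr1; apply: cB; case: h.
  by rewrite memNset // mulr0.
apply: le_trans h1; rewrite ge0_integral_mscale //; apply: lee_wpmul2l; first by rewrite lee_fin.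
rewrite /nu ge0_integral_pushforward // preimage_setT.
have mgp : measurable_fun setT (g \o psiB) by exact: measurableT_comp.
apply: le_trans (ge0_integral_mrestr (lebC R n) mB (fun z => g0 (psiB z)) mgp).
rewrite le_eqVlt; apply/orP; left; apply/eqP; apply: eq_integral => z; rewrite inE => Bz.
by rewrite /= /psiB asboolT.
Qed.

End Transfer.

(** * Orlicz estimate of the mass of sublevel sets *)

Lemma weight_tail (R : realType) (n : nat) (w h : R -> R) :
  (forall t, 0 <= t -> 0 < h t) -> (forall s t, 0 <= s -> s <= t -> h s <= h t) ->
  w t / (t * ln t ^+ n * h (ln (ln t)) ^+ n) @[t --> +oo] --> (1 : R) ->
  exists T0 : R, forall T x, T0 <= T -> 1 < T -> 1 <= ln T -> T < x ->
    x <= 2 * w x / (ln T * h (ln (ln T))) ^+ n.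
Proof.
move=> h0 hm /cvgrPdist_lt/(_ 2^-1); rewrite invr_gt0 ltr0n => /(_ isT)[T0 [_ hT0]].
exists T0 => T x T0T T1 lT Tx; have x1 : 1 < x := lt_trans T1 Tx.
have x0 : 0 < x := lt_trans ltr01 x1; have T00 : 0 < T := lt_trans ltr01 T1.
have lx : ln T <= ln x by rewrite ler_ln ?posrE // ltW.
have lT0 : 0 < ln T := lt_le_trans ltr01 lT; have lx0 : 0 < ln x := lt_le_trans lT0 lx.
have llT : 0 <= ln (ln T) by exact: ln_ge0.
have llx : ln (ln T) <= ln (ln x) by rewrite ler_ln ?posrE.
have hT : 0 < h (ln (ln T)) := h0 _ llT; have hx : 0 < h (ln (ln x)) := h0 _ (le_trans llT llx).
have Q : (ln T * h (ln (ln T))) ^+ n <= ln x ^+ n * h (ln (ln x)) ^+ n.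
  rewrite -exprMn; apply: lerXn2r; rewrite ?nnegrE; [exact: ltW (mulr_gt0 _ _)|exact: ltW (mulr_gt0 _ _)|].
  by apply: ler_pM => //; [exact: ltW|exact: ltW|exact: hm].
have Q0 : 0 < (ln T * h (ln (ln T))) ^+ n by rewrite exprn_gt0 // mulr_gt0.
have := hT0 x (le_lt_trans T0T Tx); rewrite /= distrC ltr_norml => /andP[h1 _].
have P0 : 0 < x * ln x ^+ n * h (ln (ln x)) ^+ n by rewrite !mulr_gt0 // exprn_gt0.
have {}h1 : 2^-1 * (x * ln x ^+ n * h (ln (ln x)) ^+ n) <= w x.
  rewrite -ler_pdivlMr //; move: h1; move: (w x / _) => y; lra.
rewrite ler_pdivlMr //; apply: (@le_trans _ _ (x * (ln x ^+ n * h (ln (ln x)) ^+ n))); first by rewrite ler_pM2l.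
by move: h1; rewrite -mulrA; move: (x * _) => y; lra.
Qed.

Section Orlicz.
Variables (R : realType) (n : nat) (X : ptopologicalType) (M : complex_manifold R n X).
Local Notation Cn := 'rV[R[i]]_n.
Local Notation BX := (g_sigma_algebraType (@open X)).
Variables (dV : smooth_probability M).

(** The infimum need not be attained; one unit of room provides an admissible [r]. *)
Lemma luxembourg_lt (w f : _ -> R) (K : R) : (luxembourg_norm dV w f <= K%:E)%E ->
  exists r : R, [/\ 0 < r, r < K + 1 & (\int[dV]_x (w (`|f x| / r))%:E < (w 1)%:E)%E].
Proof.
move=> hK; have : (luxembourg_norm dV w f < (K + 1)%:E)%E.
  by apply: (le_lt_trans hK); rewrite lte_fin ltrDl.
move=> /ereal_inf_lt[_ [r [r0 hr] <-]]; rewrite lte_fin => rK.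
by exists r; split.
Qed.

Variables (i : idx M) (z0 : Cn) (rho c C : R) (w h : R -> R) (f : X -> R) (r : R).
Hypotheses (rho0 : 0 < rho) (sub : cbox z0 rho `<=` img i) (c0 : 0 < c).
Hypothesis cB : forall z, cbox z0 rho z -> c <= svm_coef dV i z.
Hypothesis BC' : forall z, cbox z0 rho z -> svm_coef dV i z <= C.
Hypotheses (w0 : forall t, 0 <= t -> 0 <= w t) (wm : forall s t, 0 <= s -> s <= t -> w s <= w t).
Hypotheses (f0 : forall x, 0 < f x) (sf : smooth M f) (r0 : 0 < r).
Hypothesis fw : (\int[dV]_x (w (`|f x| / r))%:E < (w 1)%:E)%E.

Lemma orlicz_box (g : Cn -> R) : g = zext (box z0 rho) (fun z => w (`|f (psi i z)| / r)) ->
  bcs g /\ Int g <= w 1 / c.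
Proof.
(* Truncating the argument at 0 extends [w] from R^+ to a monotone, hence measurable, function on
   R. *)
move=> ->; pose w1 t := w (Num.max t 0).
have w1E t : 0 <= t -> w1 t = w t by move=> t0; rewrite /w1 max_l.
have w10 t : 0 <= w1 t by apply: w0; rewrite le_max lexx orbT.
have mw1 : measurable_fun setT w1.
  apply: nondecreasing_measurable => // s t st; apply: wm; first by rewrite le_max lexx orbT.
  by rewrite ge_max !le_max st lexx orbT.
have a0 x : 0 <= `|f x| / r by rewrite divr_ge0 // ltW.
have subB : box z0 rho `<=` img i := subset_trans (@box_sub_cbox _ _ z0 rho) sub.
have mB : measurable (box z0 rho : set (BC R n)) by apply: measurable_openC; exact: open_box.
have kfp : forall z, img i z -> {for z, continuous (f \o psi i)} by move=> z Iz; have [] := @sf i [::] z Iz.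
have bW : bcs (zext (box z0 rho) (fun z => w (`|f (psi i z)| / r))).
  have [Cf _ hCf] := bounded_cbox (fun z hz => kfp z (sub hz)).
  apply: (bcs_zext (a := z0) (M := rho) (C := w (Cf / r)) mB).
  - have mf : measurable_fun (box z0 rho : set (BC R n)) (f \o psi i : BC R n -> R).
      by apply: measurable_cont_on; [exact: open_box|move=> z /subB; exact: kfp].
    have -> : (fun z => w (`|f (psi i z)| / r)) = w1 \o (fun z => `|(f \o psi i) z| / r) :> (Cn -> R).
      by apply/funext => z /=; rewrite w1E.
    apply: measurableT_comp => //; apply: measurable_funM => //.
    by apply: measurableT_comp.
  - exact: box_sub_cbox.
  - move=> z /box_sub_cbox hz; rewrite ger0_norm; last exact: w0.
    by apply: wm => //; apply: ler_wpM2r; [rewrite invr_ge0 ltW|exact: hCf].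
split=> //.
have mg : measurable_fun setT (fun x : BX => (w (`|f x| / r))%:E).
  apply/measurable_EFinP.
  have -> : (fun x => w (`|f x| / r)) = w1 \o (fun x => `|f x| / r) :> (X -> R).
    by apply/funext => x /=; rewrite w1E.
  apply: measurableT_comp => //; apply: measurable_funM => //.
  by apply: measurableT_comp => //; exact: measurable_contX (smooth_cont sf).
have g0 x : (0 <= (w (`|f x| / r))%:E)%E by rewrite lee_fin; exact: w0.
have := transfer (open_box (a := z0) (r := rho)) subB (ltW c0) (fun z hz => cB (box_sub_cbox hz)) g0 mg.
have -> : (\int[lebC R n]_(z in box z0 rho) (w (`|f (psi i z)| / r))%:E)%E =
    (Int (zext (box z0 rho) (fun z => w (`|f (psi i z)| / r))))%:E.
  rewrite -(Int_EFin bW) integral_mkcond; apply: eq_integral => z _.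
  rewrite /patch /zext; have [bz|nb] := pselect (box z0 rho z).
    by rewrite mem_set // asboolT.
  by rewrite memNset // asboolF.
rewrite -EFinM => /le_lt_trans/(_ fw); rewrite lte_fin => hlt.
by rewrite ler_pdivlMr // mulrC ltW.
Qed.

Lemma orlicz_local (V T Q : R) (U : set Cn) (F : Cn -> R) : measurable (U : set (BC R n)) ->
  U `<=` box z0 rho -> 0 <= V -> 0 < T -> 0 <= Q ->
  (forall z, U z -> F z = V * (f (psi i z) * svm_coef dV i z)) -> bcs (zext U F) ->
  (forall x, T < x -> x <= Q * w x) ->
  Int (zext U F) <= V * C * r * (T * vol U + Q * (w 1 / c)).
Proof.
move=> mU UB V0 T0 Q0 FE bF hx.
have [bW iW] := orlicz_box erefl; set W := zext _ _ in bW iW.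
have bU : bcs (zext U (fun=> 1)) := bcs_vol mU (subset_trans UB (@box_sub_cbox _ _ z0 rho)).
have C0 : 0 <= C.
  have hc : cbox z0 rho z0 by move=> b; rewrite subrr normr0 ltW.
  by apply: le_trans (BC' hc); apply: le_trans (cB hc); exact: ltW.
have P0 : 0 <= V * C * r by rewrite !mulr_ge0 // ltW.
have b1 := bcsD (bcsZ T bU) (bcsZ Q bW); have b2 := bcsZ (V * C * r) b1.
apply: (@le_trans _ _ (V * C * r * (T * vol U + Q * Int W))); last first.
  by apply: ler_wpM2l => //; rewrite lerD2l; exact: ler_wpM2l.
rewrite /vol -(IntZ T bU) -(IntZ Q bW) -(IntD (bcsZ T bU) (bcsZ Q bW)) -(IntZ _ b1).
apply: Int_le => // z; have [Uz|nU] := pselect (U z); last first.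
  rewrite !(zextF _ nU) mulr0 add0r; apply: mulr_ge0 => //; apply: mulr_ge0 => //.
  by apply: zext_ge0 => x _; apply: w0; rewrite divr_ge0 // ltW.
have Bz := UB _ Uz; rewrite (zextT F Uz) (zextT (fun=> 1) Uz) /W (zextT (fun z => w (`|f (psi i z)| / r)) Bz) FE // mulr1.
have fz := f0 (psi i z); rewrite (gtr0_norm fz).
rewrite -!mulrA; apply: (ler_wpM2l V0).
apply: (@le_trans _ _ (f (psi i z) * C)).
  by apply: ler_wpM2l; [exact: ltW|exact: BC' (box_sub_cbox Bz)].
rewrite mulrC; apply: (ler_wpM2l C0).
have wz : 0 <= w (f (psi i z) / r) by apply: w0; rewrite divr_ge0 // ltW.
rewrite -[leLHS](divfK (lt0r_neq0 r0)) mulrC; apply: (ler_wpM2l (ltW r0)).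
have [le|lt] := leP (f (psi i z) / r) T; first by apply: le_trans le _; rewrite lerDl mulr_ge0.
by apply: le_trans (hx _ lt) _; rewrite lerDr ltW.
Qed.

End Orlicz.

(** * Positivity of omega + dd^c u *)

Lemma locally_constant_connected (X : ptopologicalType) (P : X -> Prop) : connected [set: X] ->
  (forall x, \forall y \near x, P y <-> P x) -> forall x0, P x0 -> forall x, P x.
Proof.
move=> cX lc x0 Px0 x; have oP : open [set x | P x].
  by rewrite openE => y Py; apply: filterS (lc y) => z [_]; exact.
have cP : closed [set x | P x].
  rewrite -openC openE => y nPy; apply: filterS (lc y) => z h; rewrite /= => /h; exact: nPy.
have : [set x | P x] = [set: X].
  apply: cX; first by exists x0.
  - by exists [set x | P x] => //; rewrite setTI.
  - by exists [set x | P x] => //; rewrite setTI.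
by move=> /seteqP[_ h]; exact: h.
Qed.

Lemma osc_le (R : realType) (X : ptopologicalType) (u : X -> R) (a b : R) :
  (forall x, u x <= a) -> (forall x, b <= u x) -> osc u <= a - b.
Proof.
move=> ua ub; have ne : range u !=set0 by exists (u point); exists point.
apply: lerB; first by apply: ge_sup => // _ [x _ <-].
by apply: lb_le_inf => // _ [x _ <-].
Qed.

Lemma hess_num (R : realType) (q e t f0 f1 f2 l H : R) : 0 <= q -> 0 < e -> 0 < t ->
  `|f1 - f0 - t * l - t ^+ 2 * H / 2| <= e / (2 * (1 + q)) * (t ^+ 2 * q) ->
  `|f2 - f0 - - t * l - t ^+ 2 * H / 2| <= e / (2 * (1 + q)) * (t ^+ 2 * q) ->
  f0 <= f1 -> f0 <= f2 -> 0 <= e + H.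
Proof.
move=> q0 e0 t0 h1 h2 m1 m2; have t2 : 0 < t ^+ 2 by rewrite exprn_gt0.
have E : e / (2 * (1 + q)) * (t ^+ 2 * q) <= e / 2 * t ^+ 2.
  rewrite (_ : _ * _ = e / 2 * t ^+ 2 * (q / (1 + q))); last by field; rewrite gt_eqF // ltr_pwDl.
  have P0 : 0 <= e / 2 * t ^+ 2 by apply: mulr_ge0; [rewrite divr_ge0 // ltW|exact: ltW].
  rewrite -[leRHS]mulr1; apply: (ler_wpM2l P0).
  by rewrite ler_pdivrMr ?ltr_pwDl // mul1r lerDr.
have : 0 <= t ^+ 2 * (e + H).
  by move: h1 h2; rewrite !ler_norml => /andP[? ?] /andP[? ?]; lra.
by rewrite pmulr_rge0.
Qed.

Lemma hess_num2 (R : realType) (q e t f0 f1 f2 l H l1 l2 H1 H2 q1 q2 : R) : 0 <= q -> 0 < e -> 0 < t ->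
  l1 = t * l -> l2 = - t * l -> H1 = t ^+ 2 * H -> H2 = (- t) ^+ 2 * H -> q1 = t ^+ 2 * q -> q2 = (- t) ^+ 2 * q ->
  `|f1 - f0 - l1 - H1 / 2| <= e / (2 * (1 + q)) * q1 ->
  `|f2 - f0 - l2 - H2 / 2| <= e / (2 * (1 + q)) * q2 ->
  f0 <= f1 -> f0 <= f2 -> 0 <= e + H.
Proof. by move=> q0 e0 t0 -> -> -> -> -> ->; rewrite sqrrN; exact: hess_num. Qed.

Lemma dist_lt0 (R : realDomainType) (x y : R) : `|x - y| < - y -> x < 0.
Proof. by move=> /ltr_distlDr; rewrite subrr. Qed.

Section Positivity.
Variables (R : realType) (n : nat).
Local Notation Cn := 'rV[R[i]]_n.
Local Notation "'rb' b" := (@real_basis R n b) (at level 10).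
Implicit Types (D : set Cn) (a : Cn -> Cn -> R) (A : form2 R n) (f : Cn -> R).

Lemma Jform_suml a (ja : Jform a) I (r : seq I) (F : I -> Cn) (c : I -> R) w :
  a (\sum_(b <- r) (c b)%:C *: F b) w = \sum_(b <- r) c b * a (F b) w.
Proof.
elim: r => [|b r IH]; first by rewrite !big_nil Jform0.
by rewrite !big_cons -IH; case: ja => h _ _; exact: h.
Qed.

Lemma Jform_expand a (v w : Cn) : Jform a ->
  a v w = \sum_b \sum_c crd b v * crd c w * a (rb b) (rb c).
Proof.
move=> ja; have [_ as_ _] := ja.
rewrite {1}(crd_expand v) (Jform_suml ja); apply: eq_bigr => b _.
rewrite as_ {1}(crd_expand w) (Jform_suml ja) -sumrN mulr_sumr; apply: eq_bigr => c _.
by rewrite [a (rb c) _]as_; ring.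
Qed.

Lemma nsqN (v : Cn) : nsq (- v) = nsq v.
Proof. by apply: eq_bigr => b _; rewrite crdN sqrrN. Qed.

Lemma coercive_pos (a : Cn -> Cn -> R) (c : R) : 0 < c -> (forall v, c * nsq v <= a v ('i *: v)) ->
  forall v, v != 0 -> 0 < a v ('i *: v).
Proof. by move=> c0 h v v0; apply: lt_le_trans (h v); rewrite mulr_gt0 // nsq_gt0. Qed.

(** Near [z0] the coefficients in the real basis vary by less than [c / 2 / N], which costs half of
    the coercivity at [z0]. *)
Lemma PD_near D A z0 : open D -> D z0 -> (forall z, D z -> Jform (A z)) ->
  (forall v w, Ck 0 D (fun z => A z v w)) -> (forall v, v != 0 -> 0 < A z0 v ('i *: v)) ->
  exists2 c : R, 0 < c & \forall z \near z0, D z /\ forall v, c * nsq v <= A z v ('i *: v).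
Proof.
move=> oD Dz0 jA kA pA; have [c c0 hc] := Jform_coercive (jA _ Dz0) pA.
pose I := (('I_n * bool) * ('I_n * bool))%type.
pose F (p : I) (z : Cn) := A z (rb p.1) (rb p.2).
pose N : R := 1 + \sum_(p : I) 1; have N0 : 0 < N by rewrite ltr_pwDl // sumr_ge0.
have e0 : 0 < c / 2 / N by rewrite !divr_gt0.
have [d d0 hd] := uniform_continuousD oD Dz0 (fun p => kA (rb p.1) (rb p.2) : Ck 0 D (F p)) e0.
exists (c / 2); first by rewrite divr_gt0.
apply/nbhs_boxP; exists d => // z /hd[Dz hz]; split=> // v.
have bd : `|A z v ('i *: v) - A z0 v ('i *: v)| <= c / 2 * nsq v.
  rewrite (Jform_expand v ('i *: v) (jA _ Dz)) (Jform_expand v ('i *: v) (jA _ Dz0)) -sumrB.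
  rewrite (eq_bigr (fun b => \sum_b' crd b v * crd b' ('i *: v) * (F (b, b') z - F (b, b') z0))); last first.
    by move=> b _; rewrite -sumrB; apply: eq_bigr => b' _; rewrite mulrBr.
  rewrite pair_big /=; apply: le_trans (ler_norm_sum _ _ _) _.
  apply: (@le_trans _ _ (\sum_(p : I) nsq v * (c / 2 / N))).
    apply: ler_sum => p _; rewrite normrM; apply: ler_pM => //; last exact/ltW/(hz p).
    have h1 := crd_nsq p.1 v; have h2 := crd_nsq p.2 ('i *: v); rewrite nsq_i in h2.
    move: h1 h2; move: (crd _ _) (crd _ _) (nsq v) => x y q h1 h2.
    have := sqr_ge0 (x - y); have := sqr_ge0 (x + y); rewrite ler_norml => *; apply/andP; split; nra.
  rewrite (eq_bigr (fun p : I => nsq v * (c / 2 / N) * 1)) => [|p _]; last by rewrite mulr1.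
  have gen (q c' N' s : R) : q * (c' / 2 / N') * s = c' / 2 * q * (s / N') by ring.
  rewrite -mulr_sumr gen.
  have P0 : 0 <= c / 2 * nsq v by apply: mulr_ge0; [rewrite divr_ge0 // ltW|exact: nsq_ge0].
  by rewrite -[leRHS]mulr1; apply: (ler_wpM2l P0); rewrite ler_pdivrMr // mul1r /N lerDr.
have := hc v; move: bd; rewrite ler_norml => /andP[h1 _].
by move: h1; move: (nsq v) (A z _ _) (A z0 _ _) => q x y; lra.
Qed.

(** In the sum of the Taylor expansions at [t v] and [- t v] the first order terms cancel. *)
Lemma rderive2_min_ge0 D f z v : open D -> Ck 2 D f -> D z -> (forall w, D w -> f z <= f w) ->
  0 <= rderive (rderive f v) v z.
Proof.
move=> oD kf Dz fm; apply/ler_addgt0Pl => e e0; set H := rderive _ _ _.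
have e'0 : 0 < e / (2 * (1 + nsq v)) by rewrite divr_gt0 // mulr_gt0 // ltr_pwDl // nsq_ge0.
have [d d0 hd] := Taylor2 oD kf Dz e'0; have [d1 d10 hd1] := open_box_sub oD Dz.
pose d2 := Num.min d d1; have d20 : 0 < d2 by rewrite lt_min d0.
have [t0 t00 ht] := box_ray2 (0 : Cn) v 0 d20.
pose t := t0 / 2; have tp0 : 0 < t by rewrite divr_gt0.
have tt0 : t < t0 by rewrite ltr_pdivrMr // ltr_pMr // ltr1n.
have bx (s : R) : `|s| = t -> box 0 d (s%:C *: v) /\ box z d1 (z + s%:C *: v).
  move=> st; have := ht s 0; rewrite st normr0 => /(_ tt0 t00); rewrite add0r ray0 => h.
  split; first by move=> b; apply: lt_le_trans (h b) _; rewrite ge_min lexx.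
  move=> b; have := h b; rewrite crdD crd0 subr0 [crd b z + _]addrC addrK => /lt_le_trans; apply.
  by rewrite ge_min lexx orbT.
have [b1 b2] := bx t (gtr0_norm tp0).
have tN : `|- t| = t by rewrite normrN gtr0_norm.
have [b3 b4] := bx (- t) tN.
have T1 := hd _ b1; have T2 := hd _ b3.
have m1 := fm _ (hd1 _ b2); have m2 := fm _ (hd1 _ b4).
have Z (s : R) : rderive f (s%:C *: v) z = s * rderive f v z by exact: (rderiveZ_dir s (Ck_der v (Ck_pred kf) Dz)).2.
have ZZ (s : R) : rderive (rderive f (s%:C *: v)) (s%:C *: v) z = s ^+ 2 * H.
  rewrite (rderive2_expand _ _ oD kf Dz) /H (rderive2_expand v _ oD kf Dz) mulr_sumr; apply: eq_bigr => b _.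
  by rewrite mulr_sumr; apply: eq_bigr => c _; rewrite !crdZ; move: (rderive _ _ _) (crd _ _) (crd _ _) => *; ring.
exact: (hess_num2 (nsq_ge0 v) e0 tp0 (Z t) (Z (- t)) (ZZ t) (ZZ (- t)) (nsqZ t v) (nsqZ (- t) v) T1 T2 m1 m2).
Qed.

End Positivity.

Section Global.
Variables (R : realType) (n : nat) (X : ptopologicalType) (M : complex_manifold R n X).
Local Notation Cn := 'rV[R[i]]_n.
Local Notation "'rb' b" := (@real_basis R n b) (at level 10).
Variables (kappa : R) (omega : kahler_form M) (u : X -> R).
Hypotheses (kappa0 : 0 < kappa) (su : smooth M u) (hX : compact [set: X]).

Implicit Types (i j : idx M) (z : Cn).

Definition Omega i : form2 R n := Om kappa (kf omega i) (u \o psi i).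

Definition psd_form := forall i z, img i z -> forall v, 0 <= Omega i z v ('i *: v).

Lemma kf_Jform i z : img i z -> Jform (kf omega i z).
Proof. by move=> Iz; split; [exact: kf_linear|exact: kf_antisym|exact: kf_J]. Qed.

Lemma Ck_kf k i v w : Ck k (img i) (fun z => kf omega i z v w).
Proof. exact: smooth_on_Ck (@kf_smooth _ _ _ _ omega i v w). Qed.

Lemma Ck_chart k i : Ck k (img i) (u \o psi i).
Proof. exact: smooth_on_Ck (su (i := i)). Qed.

Lemma Omega_Jform i z : img i z -> Jform (Omega i z).
Proof.
by move=> Iz; exact: (JformD (kf_Jform Iz) (ddc_Jform kappa (@open_img R n X M i) (Ck_chart 2 i) Iz)).
Qed.

Lemma Ck_Omega i v w : Ck 0 (img i) (fun z => Omega i z v w).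
Proof. exact: (CkD (@open_img R n X M i) (Ck_kf 0 i v w) (Ck_ddc kappa v w (@open_img R n X M i) (Ck_chart 2 i))). Qed.

Let PD i z := forall v, v != 0 -> 0 < Omega i z v ('i *: v).

(** By [ddc_pullback] definiteness passes from one chart to another. The bound that lemma requires
    on the differential of the transition map comes from the Kähler form: its transformation law
    compares [kf omega j], coercive near [F z], with [kf omega i], bounded near [z]. *)
Lemma PD_chart i j z : img i z -> Defs.dom j (psi i z) -> PD j (phi j (psi i z)) -> PD i z.
Proof.
move=> Iz Jz pd e e0; pose F : Cn -> Cn := phi j \o psi i.
pose D0 : set Cn := phi i @` (Defs.dom i `&` Defs.dom j).
have D0E : D0 = img i `&` psi i @^-1` Defs.dom j.
  apply/seteqP; split => [w [x [Dx Dj] <-]|w [[x Dx <-] Dj]].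
    by split; [exists x|rewrite /= phiK].
  by exists x => //; split=> //; rewrite /= phiK in Dj.
have oD0 : open D0.
  rewrite D0E openE => w [Iw Jw]; apply: filterI; first exact: (open_nbhs_nbhs (conj (@open_img R n X M i) Iw)).
  by apply: (psi_cont Iw); exact: (open_nbhs_nbhs (conj (dom_open j) Jw)).
have D0z : D0 z by rewrite D0E.
have FI w : D0 w -> img j (F w) by rewrite D0E => -[Iw Jw]; exists (psi i w).
have dF w : D0 w -> differentiable F w by exact: transition_holomorphic.
have cF w : D0 w -> {for w, continuous F} by move=> /dF; exact: differentiable_continuous.
have KT w : D0 w -> kf omega i w e ('i *: e) = kf omega j (F w) ('d F w e) ('i *: 'd F w e).
  by move=> Dw; have := kf_transition omega Dw e ('i *: e); rewrite /= linearZ.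
have [c c0 hc] := PD_near (@open_img R n X M j) (FI _ D0z) (@kf_Jform j) (Ck_kf 0 j) (kf_pos omega (FI _ D0z)).
have nF : \forall w \near z, img j (F w) /\ forall v, c * nsq v <= kf omega j (F w) v ('i *: v).
  exact: (cF _ D0z _ hc).
have nk : \forall w \near z, kf omega i w e ('i *: e) < kf omega i z e ('i *: e) + 1.
  have ck := Ck_cont (Ck_kf 0 i e ('i *: e)) Iz.
  have [d d0 hd] := (iffLR (continuous_boxP _ _) ck) 1 ltr01.
  by apply/nbhs_boxP; exists d => // w /hd /ltr_distlDr.
have n3 : nbhs z D0 by exact: open_nbhs_nbhs.
have n4 : nbhs z (D0 `&` [set w | (img j (F w) /\ forall v, c * nsq v <= kf omega j (F w) v ('i *: v)) /\
    kf omega i w e ('i *: e) < kf omega i z e ('i *: e) + 1]).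
  by apply: filterI => //; exact: filterI.
have [d d0 hd] := iffLR (nbhs_boxP z _) n4.
pose C := (kf omega i z e ('i *: e) + 1) / c.
have bd w : box z d w -> nsq ('d F w e) <= C.
  move=> /hd[Dw [[_ h1] h2]]; rewrite /C ler_pdivlMr // mulrC; apply: le_trans (h1 _) _.
  by rewrite -(KT _ Dw); exact: ltW.
have sD : box z d `<=` D0 by move=> w /hd[].
have bz : box z d z by exact: box_center.
have EQ : ddc kappa (u \o psi i) z e ('i *: e) = ddc kappa (u \o psi j) (F z) ('d F z e) ('i *: 'd F z e).
  apply: (@ddc_pullback R n kappa (box z d) (img j) _ _ F z e ('i *: e) (2 * C + 2 * C) erefl) => //.
  - exact: open_box.
  - exact: open_img.
  - by apply: Ck_sub (Ck_chart 2 i) => w /sD; rewrite D0E => -[].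
  - exact: Ck_chart.
  - by move=> w /sD; exact: FI.
  - by move=> w /sD; exact: dF.
  - by move=> w /sD; rewrite D0E => -[_ Jw]; rewrite /= /F /= phiK.
  move=> w bw; apply: le_trans (nsq_addle _ _) _; rewrite nsqN.
  by apply: lerD; rewrite ler_pM2l //; exact: bd.
have KQ : kf omega i z e ('i *: e) = kf omega j (F z) ('d F z e) ('i *: 'd F z e).
  exact: KT.
(* The differential does not kill [e], since otherwise the transformation law would contradict the
   positivity of [kf omega i] on [e]. *)
have w0 : 'd F z e != 0.
  apply/eqP => w0; have := kf_pos omega Iz e0; rewrite KQ w0 (Jform0 (kf_Jform (FI _ D0z))).
  by rewrite ltxx.
by have := pd _ w0; rewrite /Omega /Om EQ KQ.
Qed.

Lemma kahler_volume_ge0 : 0 <= kahler_volume omega.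
Proof. by rewrite /kahler_volume; apply: fine_ge0; case: xgetP => // y -> [m _ ->]. Qed.

Variables (dV : smooth_probability M) (f : X -> R).
Hypotheses (f0 : forall x, 0 < f x) (ma : monge_ampere kappa omega dV f u).
Local Notation V := (kahler_volume omega).

Lemma MA_rhs_gt0 i z : img i z -> 0 < f (psi i z) * svm_coef dV i z.
Proof. by move=> Iz; apply: mulr_gt0 => //; exact: svm_gt0. Qed.

(** The volume is defined through default values, so its positivity cannot be read off there. The
    equation excludes 0: the inverse of 0 is 0, while the right-hand side is positive. *)
Lemma volume_gt0 : 0 < V.
Proof.
rewrite lt_neqAle kahler_volume_ge0 andbT eq_sym; apply/eqP => V0.
have [i Dx] := dom_cover M point; have Iz : img i (phi i point) by exists point.
by have := MA_rhs_gt0 Iz; rewrite -(ma Iz) V0 invr0 mul0r ltxx.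
Qed.

Lemma MA_wedge i z : img i z -> wedge_top (Omega i z) = V * (f (psi i z) * svm_coef dV i z).
Proof. by move=> Iz; rewrite -(ma Iz) mulVKf // gt_eqF // volume_gt0. Qed.

Lemma wedge_gt0 i z : img i z -> 0 < wedge_top (Omega i z).
Proof. by move=> Iz; rewrite MA_wedge // mulr_gt0 ?volume_gt0 // MA_rhs_gt0. Qed.

Lemma exists_min : exists x, forall y, u x <= u y.
Proof.
have [| |c _ hc] := @compact_EVT_min X R u [set: X] _ hX.
- by exists point.
- by apply: continuous_subspaceT; exact: smooth_cont su.
by exists c => y; apply: hc; rewrite inE.
Qed.

(** At a minimum the second derivatives along both [v] and ['i *: v] are nonnegative, so dd^c of [u]
    only adds to the Kähler form. *)
Lemma PD_min x i : (forall y, u x <= u y) -> Defs.dom i x -> PD i (phi i x).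
Proof.
move=> mx Dx v v0; have Iz : img i (phi i x) by exists x.
have k2 := Ck_chart 2 i; have oI := @open_img R n X M i.
have um w : img i w -> (u \o psi i) (phi i x) <= (u \o psi i) w by move=> _; rewrite /= phiK.
rewrite /Omega /Om (ddc_diag kappa oI k2 Iz erefl); apply: ltr_wpDr; last exact: kf_pos.
by apply: mulr_ge0; [exact: ltW|apply: addr_ge0; exact: (rderive2_min_ge0 _ oI k2 Iz um)].
Qed.

Lemma cn_gt0_MA : 0 < cn R n.
Proof.
have [x mx] := exists_min; have [i Dx] := dom_cover M x; have Iz : img i (phi i x) by exists x.
apply: (cn_gt0 (Omega_Jform Iz) _ (wedge_gt0 Iz)) => v.
have [->|v0] := eqVneq v 0; first by rewrite (Jform0 (Omega_Jform Iz)).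
exact/ltW/PD_min.
Qed.

Lemma MA_psd : psd_form.
Proof.
pose P x := exists2 i, Defs.dom i x & PD i (phi i x).
have PE i x : Defs.dom i x -> P x -> PD i (phi i x).
  move=> Dx [j Dj pd]; have Iz : img i (phi i x) by exists x.
  by apply: (PD_chart (j := j) Iz); rewrite phiK.
have near_chart i x (A : set Cn) : Defs.dom i x -> nbhs (phi i x) A -> \forall y \near x, Defs.dom i y /\ A (phi i y).
  move=> Dx nA; apply: filterI; first exact: (open_nbhs_nbhs (conj (dom_open i) Dx)).
  by apply: (phi_continuous Dx); exact: nA.
have lc x : \forall y \near x, P y <-> P x.
  have [i Dx] := dom_cover M x; have Iz : img i (phi i x) by exists x.
  have [pd|npd] := pselect (PD i (phi i x)).
    have [c c0 hc] := PD_near (@open_img R n X M i) Iz (@Omega_Jform i) (Ck_Omega i) pd.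
    apply: filterS (near_chart _ _ _ Dx hc) => y [Dy [_ hy]]; split=> _; first by exists i.
    by exists i; [exact: Dy|exact: (coercive_pos c0 hy)].
  (* Where definiteness fails, the nonvanishing top power yields a direction of strict negativity,
     and this persists nearby; so the failure is an open condition too. *)
  have [v hv] : exists v, Omega i (phi i x) v ('i *: v) < 0.
    apply: contrapT => nv; apply: npd.
    have [v|] := Jform_nondeg (Omega_Jform Iz) _ (lt0r_neq0 (wedge_gt0 Iz)).
      by rewrite leNgt; apply/negP => hv; apply: nv; exists v.
    by move=> c c0 hc; exact: (coercive_pos c0 hc).
  have ng : \forall w \near phi i x, Omega i w v ('i *: v) < 0.
    have ck := Ck_cont (Ck_Omega i v ('i *: v)) Iz.
    have hv' : 0 < - Omega i (phi i x) v ('i *: v) by rewrite oppr_gt0.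
    have [d d0 hd] := (iffLR (continuous_boxP _ _) ck) _ hv'.
    by apply/nbhs_boxP; exists d; [exact: d0|move=> w /hd; exact: dist_lt0].
  apply: filterS (near_chart _ _ _ Dx ng) => y [Dy hy]; split=> Py; exfalso.
    have v0 : v != 0.
      apply/eqP => v0; move: hy; rewrite v0 (Jform0 (Omega_Jform _)) ?ltxx //; by exists y.
    by have := PE _ _ Dy Py v v0; rewrite ltNge (ltW hy).
  exact: npd (PE _ _ Dx Py).
have [x0 mx0] := exists_min; have [i0 Dx0] := dom_cover M x0.
have Px0 : P x0 by exists i0 => //; exact: PD_min.
move=> i z Iz v; have [Dz zE] := imgK Iz.
have [->|v0] := eqVneq v 0; first by rewrite (Jform0 (Omega_Jform Iz)).
have := PE _ _ Dz (locally_constant_connected (mfd_connected M) lc Px0 (psi i z)).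
by rewrite zE => /(_ v v0)/ltW.
Qed.

End Global.

(** Compactness applied to bounds: since a local bound may be increased freely, the finitely many
    local ones have a common value. *)
Lemma near_covering_pinfty (R : realType) (T : topologicalType) (A : set T) (P : R -> T -> Prop) : compact A ->
  (forall a b x, a <= b -> P a x -> P b x) ->
  (forall x, A x -> exists a, \forall y \near x, P a y) -> exists a, forall x, A x -> P a x.
Proof.
move=> cA hm hP; have [|a [_ ha]] := (iffLR (compact_near_coveringP A) cA) R (pinfty_nbhs R) P _.
  move=> x Ax; have [a ha] := hP x Ax.
  exists ([set y | P a y], [set b | a < b]); first by split=> //; exists a; split=> //; rewrite num_real.
  by move=> [y b] [/= Py ab]; apply: hm Py; exact: ltW.
by exists (a + 1) => x Ax; apply: (ha (a + 1)) => //; rewrite ltrDl.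
Qed.

Lemma lap_ge_psd (R : realType) (n : nat) (kappa Ca : R) (D : set 'rV[R[i]]_n) (A : form2 R n) (f : 'rV[R[i]]_n -> R) z :
  0 < kappa -> open D -> Ck 2 D f -> D z -> (forall v, 0 <= Om kappa A f z v ('i *: v)) ->
  \sum_k A z (real_basis R (k, false)) (real_basis R (k, true)) <= Ca -> - (Ca / kappa) <= lap f z.
Proof.
move=> kappa0 oD kf Dz psd hCa; rewrite -(ler_pM2l kappa0) mulrN mulrC divfK ?gt_eqF //.
rewrite lerNl -subr_ge0 opprK; apply: le_trans (_ : 0 <= \sum_k A z (real_basis R (k, false)) (real_basis R (k, true)) + kappa * lap f z) _.
  rewrite /lap sum_pair_bool mulr_sumr -big_split; apply: sumr_ge0 => k _.
  have := psd (real_basis R (k, false)); rewrite /Om.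
  by rewrite (ddc_diag kappa oD kf Dz (erefl : real_basis R (k, true) = 'i *: real_basis R (k, false))).
by rewrite lerD2r.
Qed.

(** * Uniform L^1 bound in all charts *)

Section Chain.
Variables (R : realType) (n : nat) (X : ptopologicalType) (M : complex_manifold R n X).
Local Notation Cn := 'rV[R[i]]_n.
Variables (kappa : R) (omega : kahler_form M).
Hypotheses (kappa0 : 0 < kappa) (hX : compact [set: X]).
Implicit Types (i : idx M) (x y : X) (u : X -> R).
Local Opaque box.

Definition qpsh u := [/\ smooth M u, forall x, u x <= 0 & psd_form kappa omega u].

(** The margin [5 * n.+1 * cb_rho] is the radius over which [L1_bound] takes its mean around a point
    of the small box. *)
Record chart_box x := ChartBox {
  cb_i : idx M;
  cb_rho : R;
  cb_dom : Defs.dom cb_i x;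
  cb_rho0 : 0 < cb_rho;
  cb_sub : cbox (phi cb_i x) (cb_rho + 5 * n.+1%:R * cb_rho) `<=` img cb_i }.

Lemma chart_box_exists x : inhabited (chart_box x).
Proof.
have [i Dx] := dom_cover M x; have Iz : img i (phi i x) by exists x.
have [d d0 hd] := open_box_sub (@open_img R n X M i) Iz.
have N0 : 0 < 1 + 5 * n.+1%:R + 1 :> R by rewrite !addr_gt0 // mulr_gt0.
have r0 : 0 < d / (1 + 5 * n.+1%:R + 1) by rewrite divr_gt0.
constructor; apply: (@ChartBox x i (d / (1 + 5 * n.+1%:R + 1)) Dx r0) => z hz; apply: hd.
apply: (cbox_sub_box _ hz); rewrite -[X in X + _]mul1r -mulrDl mulrC mulrAC ltr_pdivrMr //.
by rewrite ltr_pM2l // ltrDl.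
Qed.

Variable cb : forall x, chart_box x.
Local Notation ci x := (cb_i (cb x)).
Local Notation rh x := (cb_rho (cb x)).
Local Notation pt x := (phi (ci x) x).

Lemma sub_img x (r : R) : r <= 6 * rh x -> cbox (pt x) r `<=` img (ci x).
Proof.
move=> hr z hz; apply: (cb_sub (c := cb x)) => b; apply: le_trans (hz b) _; apply: le_trans hr _.
have r0 := cb_rho0 (cb x); rewrite -[X in _ <= X + _]mul1r -mulrDl ler_pM2r // (_ : 6 = 1 + 5 * 1); last by ring.
by rewrite lerD2l ler_pM2l // ler1n.
Qed.

Definition nbx x : set X := psi (ci x) @` box (pt x) (rh x).

Lemma box_img x : box (pt x) (rh x) `<=` img (ci x).
Proof.
move=> z /box_sub_cbox; apply: sub_img; have r0 := cb_rho0 (cb x).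
by rewrite ler_peMl ?(ltW r0) // ler1n.
Qed.

Lemma open_nbx x : open (nbx x).
Proof. by apply: open_psi_image; [exact: open_box|exact: box_img]. Qed.

Lemma nbx_self x : nbx x x.
Proof. by exists (pt x); [apply: box_center; exact: cb_rho0|apply: phiK; exact: cb_dom]. Qed.

Lemma nbxP x y : nbx x y -> Defs.dom (ci x) y /\ box (pt x) (rh x) (phi (ci x) y).
Proof. by move=> [z Bz <-]; have [h1 h2] := imgK (box_img Bz); rewrite h2. Qed.

(** [L1_bound] centred at [y]: the trace of [omega] bounds the Laplacian from below in the same way
    for all [u]. *)
Lemma L1_point x : exists2 C : R, 0 <= C & forall u, qpsh u -> forall y, nbx x y ->
  Int (zext (cbox (pt x) (3 / 2 * rh x)) (fun z => `|u (psi (ci x) z)|)) <= C * (1 - u y).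
Proof.
set i := ci x; set z0 := pt x; set rho := rh x; have r0 : 0 < rho := cb_rho0 (cb x).
pose g (z : Cn) := \sum_k kf omega i z (real_basis R (k, false)) (real_basis R (k, true)).
have kg : Ck 0 (img i) g.
  by apply: Ck_sum => [|k _]; [exact: open_img|exact: Ck_kf].
have [Ca Ca0 hCa] := bounded_cbox (fun z h => Ck_cont kg (cb_sub h)).
pose s := 5 * n.+1%:R * rho; pose C0 := Ca / kappa.
have C00 : 0 <= C0 by rewrite divr_ge0 // ltW.
have K0 : 0 <= Ikern R n by apply: Int_ge0 => z; exact: mkern_ge0.
have B0 : 0 <= Ibump R n by apply: Int_ge0 => z; exact: tp_ge0.
have s0 : 0 < s by rewrite /s !mulr_gt0.
have sp : 0 <= s ^+ (2 * n) by rewrite exprn_ge0 // ltW.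
exists (s ^+ (2 * n) * (Ikern R n + s ^+ 2 * (C0 * Ibump R n))).
  by apply: mulr_ge0 => //; apply: addr_ge0 => //; apply: mulr_ge0; [exact: sqr_ge0|exact: mulr_ge0].
move=> u [su u0 pu] y /nbxP[Dy By].
have ku := Ck_chart su 2 i.
have := L1_bound (@open_img R n X M i) ku r0 C00 (cb_sub (c := cb x)) _ _ (box_sub_cbox By).
rewrite -/s /= phiK // => h; apply: le_trans (h _ _) _.
- move=> z hz; apply: (lap_ge_psd kappa0 (@open_img R n X M i) ku (cb_sub hz) (pu i z (cb_sub hz))).
  by apply: le_trans (hCa z hz); exact: ler_norm.
- by move=> z _; exact: u0.
rewrite -mulrA; apply: (ler_wpM2l sp).
have uy : 0 <= - u y by rewrite oppr_ge0.
have P0 : 0 <= s ^+ 2 * (C0 * Ibump R n) by apply: mulr_ge0; [exact: sqr_ge0|exact: mulr_ge0].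
move: (s ^+ 2 * _) P0 K0 uy => P P0; move: (Ikern R n) (- u y) => K v K0 v0.
by have := mulr_ge0 P0 v0; lra.
Qed.

Definition good u x (a : R) := exists2 y, nbx x y & - a <= u y.

(* The bound [c] is uniform over all quasi-plurisubharmonic [u], so that the chain
   of charts joining two points may be chosen independently of [u]. *)
Definition linked x y := exists c : R -> R, forall u, qpsh u -> forall a, good u x a -> good u y (c a).

Lemma linked_trans x y z : linked x y -> linked y z -> linked x z.
Proof.
by move=> [c hc] [d hd]; exists (d \o c) => u hu a /(hc u hu)/(hd u hu).
Qed.

(** Were [u] very negative on the whole of [nbx y], it would be so on a fixed box around [p] inside
    both neighbourhoods, against the L^1 bound seen from [x]. *)
Lemma linked_overlap x y p : nbx x p -> nbx y p -> linked x y.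
Proof.
move=> xp yp; have [C C0 hC] := L1_point x.
set i := ci x; have [Dp Bp] := nbxP xp; have Ip : img i (phi i p) by exists p.
have n1 : nbhs (phi i p) (psi i @^-1` nbx y).
  by apply: (psi_cont Ip); rewrite phiK //; exact: (open_nbhs_nbhs (conj (open_nbx y) yp)).
have n2 : nbhs (phi i p) (box (pt x) (rh x)) by exact: (open_nbhs_nbhs (conj (@open_box _ _ _ _) Bp)).
have n3 : nbhs (phi i p) (psi i @^-1` nbx y `&` box (pt x) (rh x)) by exact: filterI.
have [d d0 hd] := iffLR (nbhs_boxP _ _) n3.
have v0 : 0 < (2 * d) ^+ (2 * n) by rewrite exprn_gt0 // mulr_gt0.
(* One more than the mean of [|u|] over [box (phi i p) d] that the L^1 bound allows. *)
exists (fun a => C * (1 + a) / (2 * d) ^+ (2 * n) + 1) => u hu a [q xq qa].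
apply: contrapT => ng; have [su u0 pu] := hu.
have big z : box (phi i p) d z -> C * (1 + a) / (2 * d) ^+ (2 * n) + 1 <= `|u (psi i z)|.
  move=> /hd[yz _]; rewrite ler0_norm // lerNr; rewrite leNgt; apply/negP => h.
  by apply: ng; exists (psi i z) => //; exact: ltW.
have r0 := cb_rho0 (cb x).
have subK : box (phi i p) d `<=` cbox (pt x) (3 / 2 * rh x).
  move=> z /hd[_ Bz] b; apply: le_trans (box_sub_cbox Bz b) _.
  by rewrite ler_peMl ?(ltW r0) // ler_pdivlMr // mul1r ler_nat.
have cu z : img i z -> {for z, continuous (fun z => `|u (psi i z)|)}.
  move=> Iz; apply: (@continuous_comp _ _ _ (u \o psi i) (fun x : R => `|x|)); last exact: norm_continuous.
  exact: (Ck_cont (Ck_chart su 0 i)).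
have sI : cbox (pt x) (3 / 2 * rh x) `<=` img i.
  by apply: sub_img; rewrite ler_pM2r // ler_pdivrMr // -natrM ler_nat.
have bI : bcs (zext (cbox (pt x) (3 / 2 * rh x)) (fun z => `|u (psi i z)|)).
  apply: (bcs_zext_cont (@open_img R n X M i) sI cu) => //.
  by apply: measurable_closedC; exact: closed_cbox.
have h1 := hC u hu q xq.
have h2 : (C * (1 + a) / (2 * d) ^+ (2 * n) + 1) * (2 * d) ^+ (2 * n) <=
    Int (zext (cbox (pt x) (3 / 2 * rh x)) (fun z => `|u (psi i z)|)).
  have bb := bcs_indic_box (phi i p) d; move: big; set c0 := _ / _ + 1 => big.
  rewrite -(Int_indic_box (phi i p) d0) -(IntZ _ bb); apply: Int_le => // [|z]; first exact: bcsZ.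
  rewrite indicE; have [bz|nb] := pselect (box (phi i p) d z).
    by rewrite mem_set // mulr1 (zextT (fun z => `|u (psi i z)|) (subK _ bz)); exact: big.
  by rewrite memNset // mulr0; exact: zext_ge0.
have h3 : C * (1 - u q) <= C * (1 + a) by apply: ler_wpM2l => //; rewrite lerD2l lerNl.
have := le_trans h2 (le_trans h1 h3); rewrite mulrDl mul1r divfK ?gt_eqF //.
by rewrite gerDl leNgt v0.
Qed.

Lemma linked_all x y : linked x y.
Proof.
apply: (locally_constant_connected (mfd_connected M) (P := linked x) _ (x0 := x)).
  move=> z; apply: filterS (open_nbhs_nbhs (conj (open_nbx z) (nbx_self z))) => p zp.
  have l1 := linked_overlap zp (nbx_self p); have l2 := linked_overlap (nbx_self p) zp.
  by split=> h; [exact: linked_trans h l2|exact: linked_trans h l1].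
by exists id.
Qed.

(** The zero of [u] can be anywhere: each possible position is linked to [x], and compactness makes
    the resulting bound independent of it. *)
Lemma good_uniform x : exists A : R, forall u, qpsh u -> (exists y, u y = 0) -> good u x A.
Proof.
have [||A hA] := @near_covering_pinfty R X [set: X] (fun A y => forall u, qpsh u -> u y = 0 -> good u x A) hX.
- by move=> a b y ab h u hu uy; have [q xq qa] := h u hu uy; exists q => //; apply: le_trans qa; rewrite lerN2.
- move=> y _; have [c hc] := linked_all y x; exists (c 0).
  apply: filterS (open_nbhs_nbhs (conj (open_nbx y) (nbx_self y))) => z yz u hu uz.
  by apply: (hc u hu); exists z => //; rewrite uz oppr0.
by exists A => u hu [y uy]; exact: hA uy.
Qed.

Lemma L1_uniform x : exists2 C1 : R, 0 <= C1 & forall u, qpsh u -> (exists y, u y = 0) ->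
  Int (zext (cbox (pt x) (3 / 2 * rh x)) (fun z => `|u (psi (ci x) z)|)) <= C1.
Proof.
have [C C0 hC] := L1_point x; have [A hA] := good_uniform x.
exists (C * (1 + `|A|)) => [|u hu zu]; first by rewrite mulr_ge0 // addr_ge0.
have [q xq qa] := hA u hu zu; apply: le_trans (hC u hu q xq) _.
apply: ler_wpM2l => //; rewrite lerD2l lerNl; apply: le_trans qa.
by rewrite lerN2 ler_norm.
Qed.

End Chain.

Lemma third_num (R : realFieldType) (q : R) : 0 < q ->
  2 * (q / 3) + q <= 2 * q /\ 3 / 2 * (q / 3) + q <= 3 / 2 * q /\ q / 3 + q < 2 * q.
Proof. by move=> q0; split; [|split]; lra. Qed.

Section SubConstant.
Variables (R : realType) (n : nat).
Local Notation Cn := 'rV[R[i]]_n.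
Implicit Types (f : Cn -> R) (v z : Cn) (c : R).

Lemma rderive_subc f c v : rderive (fun x => f x - c) v = rderive f v.
Proof.
Local Transparent rderive.
apply/funext => z; rewrite /rderive /derive1.
suff -> : (fun h : R => h^-1 *: (f (z + (h + 0)%:C *: v) - c - (f (z + (0 : R)%:C *: v) - c))) =
  (fun h : R => h^-1 *: (f (z + (h + 0)%:C *: v) - f (z + (0 : R)%:C *: v))) by [].
by apply/funext => h; congr (_ *: _); ring.
Local Opaque rderive.
Qed.

Lemma smooth_on_subc D f c : smooth_on D f -> smooth_on D (fun x => f x - c).
Proof.
move=> sf vs z Dz; have E : foldr (fun v h => rderive h v) (fun x => f x - c) vs =
    if vs is [::] then (fun x => f x - c) else foldr (fun v h => rderive h v) f vs.
  elim: vs => // v vs IH; rewrite [LHS]/= IH; case: vs {IH} => [|v' vs] //=.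
  exact: rderive_subc.
rewrite E; case: vs E => [_|v vs _]; last exact: sf (v :: vs) z Dz.
have [h1 h2] := sf [::] z Dz; split.
  by apply: continuousB; [exact: h1|exact: cst_continuous].
by move=> v; apply: derivableB; [exact: h2|exact: derivable_cst].
Qed.

Lemma ddc_subc kappa f c : ddc kappa (fun x => f x - c) = ddc kappa f.
Proof. by rewrite /ddc /dc; apply/funext => z; apply/funext => v; apply/funext => w; rewrite !rderive_subc. Qed.

End SubConstant.

(** * From charts to the oscillation *)

Section Final.
Variables (R : realType) (n : nat) (X : ptopologicalType) (M : complex_manifold R n X).
Local Notation Cn := 'rV[R[i]]_n.
Variables (kappa : R) (omega : kahler_form M) (dV : smooth_probability M).
Hypotheses (kappa0 : 0 < kappa) (hX : compact [set: X]).
Local Opaque box cbox ddc wedge_top.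

(** Local coercivity constants become uniform by compactness. They are used in inverted form, as
    bounds that may be increased; the absolute value keeps this monotone without recourse to
    positivity. *)
Lemma kf_coercive_cbox (i : idx M) (z0 : Cn) (r : R) : cbox z0 r `<=` img i ->
  exists2 delta : R, 0 < delta & forall z, cbox z0 r z -> forall v, 4 * kappa * delta * nsq v <= kf omega i z v ('i *: v).
Proof.
move=> sI; have [||a ha] := @near_covering_pinfty R Cn (cbox z0 r)
    (fun a z => forall v, nsq v <= a * `|kf omega i z v ('i *: v)|) (@compact_cbox _ _ z0 r).
- by move=> a b z ab h v; apply: le_trans (h v) _; apply: ler_wpM2r.
- move=> z hz; have Iz := sI _ hz.
  have [c c0 hc] := PD_near (@open_img R n X M i) Iz (@kf_Jform R n X M omega i) (@Ck_kf R n X M omega 0 i) (kf_pos omega Iz).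
  exists c^-1; apply: filterS hc => y [Iy hy] v.
  by rewrite mulrC ler_pdivlMr // mulrC; apply: le_trans (hy v) (ler_norm _).
pose a1 := `|a| + 1; have a10 : 0 < a1 by rewrite ltr_wpDl.
have k4 : 0 < 4 * kappa by rewrite mulr_gt0.
exists ((4 * kappa)^-1 / a1); first by rewrite divr_gt0 // invr_gt0.
move=> z hz v; rewrite mulrA mulfV ?gt_eqF // mul1r mulrC ler_pdivrMr // mulrC.
have Iz := sI _ hz; have k0 : 0 <= kf omega i z v ('i *: v).
  have [->|v0] := eqVneq v 0; first by rewrite (Jform0 (kf_Jform omega Iz)).
  exact/ltW/kf_pos.
apply: le_trans (ha z hz v) _; rewrite (ger0_norm k0); apply: ler_wpM2r => //.
by apply: le_trans (ler_norm a) _; rewrite lerDl.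
Qed.

Lemma svm_coef_bounds (i : idx M) (z0 : Cn) (r : R) : cbox z0 r `<=` img i ->
  exists c C : R, [/\ 0 < c, 0 < C, forall z, cbox z0 r z -> c <= svm_coef dV i z &
    forall z, cbox z0 r z -> svm_coef dV i z <= C].
Proof.
move=> sI; have sc : Ck 0 (img i) (svm_coef dV i) := smooth_on_Ck 0 (@svm_smooth _ _ _ _ dV i).
have t0 z : cbox z0 r z -> 0 < svm_coef dV i z by move=> /sI; exact: svm_gt0.
have [C C0 hC] := bounded_cbox (fun z hz => Ck_cont sc (sI z hz)).
have [D D0 hD] := @bounded_cbox R n (fun z => (svm_coef dV i z)^-1) z0 r
  (fun z hz => continuousV (lt0r_neq0 (t0 z hz)) (Ck_cont sc (sI z hz))).
exists D^-1, C; split=> //; first by rewrite invr_gt0.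
  move=> z hz; have tz := t0 z hz; have := hD z hz; rewrite gtr0_norm ?invr_gt0 // => h.
  by rewrite -[leRHS]invrK lef_pV2 ?posrE ?invr_gt0.
by move=> z hz; apply: le_trans (ler_norm _) (hC z hz).
Qed.

Variable cb : forall x, chart_box M x.
Variables (w h : R -> R) (K : R).
Hypotheses (n0 : (0 < n)%N) (K0 : 0 < K).
Hypotheses (w0 : forall t, 0 <= t -> 0 <= w t) (wm : forall s t, 0 <= s -> s <= t -> w s <= w t).
Hypotheses (h0 : forall t, 0 <= t -> 0 < h t) (hm : forall s t, 0 <= s -> s <= t -> h s <= h t).
Hypothesis hw : w t / (t * ln t ^+ n * h (ln (ln t)) ^+ n) @[t --> +oo] --> (1 : R).
Hypothesis hint : exists2 a : R, 0 <= a & (\int[@lebesgue_measure R]_(t in `[a, +oo[) ((h t)^-1)%:E < +oo)%E.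

Lemma min_bound x : exists C : R, forall f u, (forall y, 0 < f y) -> smooth M f ->
  (luxembourg_norm dV w f <= K%:E)%E -> qpsh kappa omega u -> (exists y, u y = 0) ->
  monge_ampere kappa omega dV f u -> forall y, nbx cb x y -> (forall p, u y <= u p) -> - u y <= C.
Proof.
(* If [cn] were not positive there would be no solution, and any constant would do. *)
have [cn0|ncn] := pselect (0 < cn R n); last first.
  by exists 0 => f u f0 _ _ [su _ _] _ ma; case: ncn; exact: (cn_gt0_MA kappa0 su hX f0 ma).
set i := cb_i (cb x); set z0 := phi i x; set rr := cb_rho (cb x).
have r0 : 0 < rr := cb_rho0 (cb x).
have s2 : cbox z0 (2 * rr) `<=` img i by apply: sub_img; rewrite ler_pM2r // ler_nat.
have [delta delta0 hdelta] := kf_coercive_cbox s2.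
have [c [Ct [c0 Ct0 hc hCt]]] := svm_coef_bounds s2.
pose g (z : Cn) := \sum_k kf omega i z (real_basis R (k, false)) (real_basis R (k, true)).
have kg : Ck 0 (img i) g by apply: Ck_sum => [|k _]; [exact: open_img|exact: Ck_kf].
have [Ca Ca0 hCa] := bounded_cbox (fun z h => Ck_cont kg (s2 z h)).
have [C1 C10 hC1] := L1_uniform omega kappa0 hX cb x.
have [T0 hT0] := weight_tail h0 hm hw.
have V0 := kahler_volume_ge0 omega; set V := kahler_volume omega in V0.
have w10 : 0 <= w 1 by exact: w0.
have wc : 0 <= w 1 / c by apply: divr_ge0 => //; exact: ltW.
have VC : 0 <= V * Ct * (K + 1).
  by apply: mulr_ge0; [apply: mulr_ge0 => //; exact: ltW|rewrite addr_ge0 // ltW].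
(* The constants are fixed before any solution is given, when only [V >= 0] is known; adding 1 keeps
   this one positive. *)
have C30 : 0 < V * Ct * (K + 1) + 1 by rewrite ltr_wpDl.
have C40 : 0 <= V * Ct * (K + 1) * (2 * (w 1 / c)) by apply: mulr_ge0 => //; exact: mulr_ge0.
(* A third of the radius, so that the boxes needed around any point of [nbx cb x] stay inside those
   around [z0]. *)
have rho0 : 0 < rr / 3 by rewrite divr_gt0.
have [C hC] := local_bound Ca T0 n0 kappa0 rho0 delta0 cn0 C10 C30 C40 h0 hm hint.
exists C => f u f0 sf lux hu zu ma y /nbxP[Dy By] my; have [su u0 pu] := hu.
apply: (hC (u y) (phi i y) (kf omega i) (u \o psi i)).
have sub2 : box (phi i y) (2 * (rr / 3)) `<=` cbox z0 (2 * rr).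
  move=> z hz b; have := hz b; have := By b; rewrite -/i -/z0 -/rr => h1 h2.
  rewrite (_ : crd b z - crd b z0 = (crd b z - crd b (phi i y)) + (crd b (phi i y) - crd b z0)); last by ring.
  apply: le_trans (ler_normD _ _) _; apply: le_trans (lerD (ltW h2) (ltW h1)) _.
  exact: (third_num r0).1.
have subI : box (phi i y) (2 * (rr / 3)) `<=` img i := subset_trans sub2 s2.
have fy : u (psi i (phi i y)) = u y by rewrite phiK.
have ku k : Ck k (box (phi i y) (2 * (rr / 3))) (u \o psi i) := Ck_sub subI (Ck_chart su k i).
have kA v w' : Ck 1 (box (phi i y) (2 * (rr / 3))) (fun z => kf omega i z v w') := Ck_sub subI (Ck_kf omega 1 i v w').
have fge z : box (phi i y) (2 * (rr / 3)) z -> u y <= (u \o psi i) z by move=> _; exact: my.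
split=> //.
- by move=> z /subI; exact: kf_Jform.
- by move=> z /subI; exact: kf_closed.
- by move=> z /sub2 hz v; exact: hdelta.
- by move=> z /sub2 hz; apply: le_trans (ler_norm _) (hCa z hz).
- by move=> z /subI Iz v; exact: pu.
- apply: le_trans (hC1 u hu zu).
  have m32 (a : Cn) (r : R) : measurable (cbox a r : set (BC R n)) by apply: measurable_closedC; exact: closed_cbox.
  have s32 : cbox z0 (3 / 2 * rr) `<=` img i.
    by move=> z hz; apply: s2 => b; apply: le_trans (hz b) _; rewrite ler_pM2r // ler_pdivrMr // -natrM ler_nat.
  have sub3 : cbox (phi i y) (3 / 2 * (rr / 3)) `<=` cbox z0 (3 / 2 * rr).
    move=> z hz b; have := hz b; have := By b; rewrite -/i -/z0 -/rr => h1 h2.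
    rewrite (_ : crd b z - crd b z0 = (crd b z - crd b (phi i y)) + (crd b (phi i y) - crd b z0)); last by ring.
    apply: le_trans (ler_normD _ _) _; apply: le_trans (lerD h2 (ltW h1)) _.
    exact: (third_num r0).2.1.
  have cu z : img i z -> {for z, continuous (fun z => `|(u \o psi i) z|)}.
    move=> Iz; apply: (@continuous_comp _ _ _ (u \o psi i) (fun x : R => `|x|)); last exact: norm_continuous.
    exact: (Ck_cont (Ck_chart su 0 i)).
  apply: Int_le.
  + by apply: (bcs_zext_cont (@open_img R n X M i) (subset_trans sub3 s32) cu).
  + by apply: (bcs_zext_cont (@open_img R n X M i) s32 cu).
  + by apply: zext_subset.
move=> s T sd T0T T1 lT.
have [r [rp rK fw]] := luxembourg_lt lux.
have sd' : s <= delta * (rr / 3) ^+ 2.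
  apply: le_trans sd _; rewrite ler_pdivrMr // ler_peMr ?ler1n //.
  by apply: mulr_ge0; [exact: ltW|exact: sqr_ge0].
have mU := measurable_US delta (u y) (ku 3) s.
have UB : US (rr / 3) delta (u y) (phi i y) (u \o psi i) s `<=` box z0 (2 * rr).
  move=> z /(US_sub rho0 delta0 fge sd') hz b; have := hz b; have := By b; rewrite -/i -/z0 -/rr => h1 h2.
  rewrite (_ : crd b z - crd b z0 = (crd b z - crd b (phi i y)) + (crd b (phi i y) - crd b z0)); last by ring.
  apply: le_lt_trans (ler_normD _ _) _; apply: lt_trans (ltrD h2 h1) _.
  exact: (third_num r0).2.2.
have bM := bcs_MM kappa rho0 delta0 kA (ku 3) fge sd'.
have lT0 : 0 < ln T := lt_le_trans ltr01 lT.
have hT : 0 < h (ln (ln T)) by apply: h0; exact: ln_ge0.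
set Q := (ln T * h (ln (ln T))) ^+ n in hT0 *.
have Q0 : 0 < Q by apply: exprn_gt0; exact: mulr_gt0.
have Q20 : 0 <= 2 / Q by apply: divr_ge0 => //; exact: ltW.
have hx p : T < p -> p <= 2 / Q * w p.
  by move=> Tp; apply: le_trans (hT0 T p T0T T1 lT Tp) _; rewrite mulrAC.
have r20 : 0 < 2 * rr by exact: mulr_gt0.
have FE z : US (rr / 3) delta (u y) (phi i y) (u \o psi i) s z ->
    wedge_top (Om kappa (kf omega i) (u \o psi i) z) = V * (f (psi i z) * svm_coef dV i z).
  by move=> /UB/box_sub_cbox/s2 Iz; exact: (MA_wedge f0 ma Iz).
apply: le_trans (orlicz_local r20 s2 c0 hc hCt w0 wm f0 sf rp fw mU UB V0 (lt_trans ltr01 T1) Q20 FE bM hx) _.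
have vU : 0 <= vol (US (rr / 3) delta (u y) (phi i y) (u \o psi i) s) by apply: Int_ge0; exact: zext_ge0.
have TU := mulr_ge0 (ltW (lt_trans ltr01 T1)) vU.
have QW := mulr_ge0 Q20 wc.
apply: (@le_trans _ _ (V * Ct * (K + 1) * (T * vol (US (rr / 3) delta (u y) (phi i y) (u \o psi i) s) + 2 / Q * (w 1 / c)))).
  apply: ler_wpM2r; first exact: addr_ge0.
  by apply: ler_wpM2l; [apply: mulr_ge0 => //; exact: ltW|exact: ltW].
rewrite mulrDr; apply: lerD.
  by rewrite [leRHS]mulrAC -[leRHS]mulrA -mulrA [X in _ <= X](_ : _ = (V * Ct * (K + 1) + 1) * (T * vol (US (rr / 3) delta (u y) (phi i y) (u \o psi i) s))); [rewrite mulrA; apply: ler_wpM2r => //; rewrite lerDl|ring].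
by rewrite le_eqVlt; apply/orP; left; apply/eqP; ring.
Qed.

End Final.

Theorem theoremA (R : realType) (kappa : R) (hkappa : 0 < kappa)
  (n : nat) (X : ptopologicalType) (hX : compact [set: X])
  (M : complex_manifold R n X) (omega : kahler_form M)
  (dV : smooth_probability M) (p : R) (hp : n%:R < p)
  (Lp_bound : forall K : R, 0 < K -> exists C : R,
    forall f u : X -> R, smooth_positive_density dV f ->
      ('N[dV]_(p%:E)[EFin \o f] <= K%:E)%E ->
      smooth M u -> monge_ampere kappa omega dV f u ->
      osc u <= C) :
  forall w : R -> R, conditionK n w ->
  forall K : R, 0 < K -> exists C' : R,
    forall f u : X -> R, smooth_positive_density dV f ->
      (luxembourg_norm dV w f <= K%:E)%E ->
      smooth M u -> monge_ampere kappa omega dV f u ->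
      osc u <= C'.
Proof.
move=> w [w0 _ wm [h [h0 hm hw hint]]] K K0.
(* In dimension 0 the charts take values in a point, so [u] is locally constant, hence constant. *)
have [n0|n0] := posnP n.
  exists 0 => f u _ _ _ _.
  have uc x : u x = u point.
    apply: (locally_constant_connected (mfd_connected M) (P := fun y => u y = u point) _ (erefl _)).
    move=> y; have [i Dy] := dom_cover M y.
    apply: filterS (open_nbhs_nbhs (conj (dom_open i) Dy)) => z Dz.
    rewrite -(phiK Dy) -(phiK Dz) (_ : phi i z = phi i y) //.
    by apply: crd_ext => -[[k kn] c]; exfalso; move: kn; rewrite n0.
  by rewrite -(subrr (u point)); apply: osc_le => x; rewrite uc.
have cb x : chart_box M x by exact: (projT1 (cid (let: inhabits c := chart_box_exists M x in ex_intro (fun=> True) c I))).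
(* The position of the minimum point is not known in advance; compactness makes the bounds of
   [min_bound] independent of it. *)
have [||C hC] := @near_covering_pinfty R X [set: X] (fun a y => forall f u, (forall y, 0 < f y) -> smooth M f ->
  (luxembourg_norm dV w f <= K%:E)%E -> qpsh kappa omega u -> (exists y, u y = 0) ->
  monge_ampere kappa omega dV f u -> (forall p, u y <= u p) -> - u y <= a) hX.
- by move=> a b y ab H f u h1 h2 h3 h4 h5 h6 h7; apply: le_trans ab; exact: (H f u).
- move=> x _; have [C hC] := min_bound omega dV hkappa hX cb n0 K0 w0 wm h0 hm hw hint x.
  exists C; apply: filterS (open_nbhs_nbhs (conj (open_nbx cb x) (nbx_self cb x))) => y xy f u h1 h2 h3 h4 h5 h6 h7.
  exact: (hC f u).
exists C => f u [sf f0 _] lux su ma.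
have [| |q _ hq] := @compact_EVT_max X R u [set: X] _ hX.
- by exists point.
- by apply: continuous_subspaceT; exact: smooth_cont su.
have uq x : u x <= u q by apply: hq; rewrite inE.
pose v x := u x - u q.
have sv : smooth M v by move=> i; exact: smooth_on_subc (su i).
have mav : monge_ampere kappa omega dV f v.
  by move=> i z Iz; rewrite -(ma i z Iz) -(ddc_subc kappa (u \o psi i) (u q)).
have qv : qpsh kappa omega v.
  split=> // [x|]; first by rewrite subr_le0.
  exact: (MA_psd hkappa sv hX f0 mav).
have [x mx] := exists_min sv hX.
have zv : exists y, v y = 0 by exists q; rewrite /v subrr.
have := hC x I f v f0 sf lux qv zv mav mx; rewrite /v opprB; apply: le_trans.
apply: osc_le => // y.
by have := mx y; rewrite lerD2r.
Qed.
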